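(* Let $0<r<R<\infty$, $\mathbb A=A(r,R)$, $r_\ast>0$, and let $\mathcal A^\ast\subset\mathbb C$ be a doubly connected domain whose inner boundary is the circle $\{|w|=r_\ast\}$ (i.e. the bounded component of $\mathbb C\setminus\mathcal A^\ast$ is the closed disk $\{|w|\le r_\ast\}$; the outer boundary is arbitrary). Let $h:\mathbb A\to\mathcal A^\ast$ be a sense-preserving harmonic homeomorphism onto $\mathcal A^\ast$ preserving the order of the boundary components, so in particular $|h(z)|\to r_\ast$ as $|z|\searrow r$. Then for every $r<\sigma<R$, $$\left[\frac{1}{2\pi\sigma}\int_{|z|=\sigma}|h(z)|^2\,|dz|\right]^{1/2}\geqslant\frac12\left(\frac\sigma r+\frac r\sigma\right)r_\ast .$$ If equality occurs for some $\sigma\in(r,R)$, then it occurs for every $\sigma\in(r,R)$ and $h(z)=\frac12\left(\frac zr+\frac r{\bar z}\right)r_\ast e^{i\alpha}$ for some $0\leqslant\alpha<2\pi$. *)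

(* Defs.v *)
From Stdlib Require Import Reals Lra.
Open Scope R_scope.

Definition pt := (R * R)%type.

Definition cnorm (p : pt) : R := sqrt (fst p ^ 2 + snd p ^ 2).
Definition cdist (p q : pt) : R := cnorm (fst p - fst q, snd p - snd q).

Definition open_set (S : pt -> Prop) : Prop :=
  forall p, S p -> exists e, 0 < e /\ forall q, cdist q p < e -> S q.

Definition connected (S : pt -> Prop) : Prop :=
  forall U V : pt -> Prop, open_set U -> open_set V ->
    (forall p, S p -> U p \/ V p) ->
    (exists p, S p /\ U p) -> (exists p, S p /\ V p) ->
    exists p, S p /\ U p /\ V p.

Definition component (S K : pt -> Prop) : Prop :=
  (forall p, K p -> S p) /\ (exists p, K p) /\ connected K /\
  forall C : pt -> Prop, (forall p, C p -> S p) -> connected C ->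
    (exists p, C p /\ K p) -> forall p, C p -> K p.

Definition bounded (K : pt -> Prop) : Prop :=
  exists M, forall p, K p -> cnorm p <= M.

Definition domain (D : pt -> Prop) : Prop :=
  open_set D /\ connected D /\ exists p, D p.

(* A* is a doubly connected domain whose inner boundary is the circle |w| = rs:
   C \ A* has exactly one bounded component (equivalently the complement of A*
   in the Riemann sphere has exactly two components), and that bounded
   component is the closed disk |w| <= rs. *)
Definition doubly_connected_inner_circle (A : pt -> Prop) (rs : R) : Prop :=
  domain A /\
  component (fun p => ~ A p) (fun p => cnorm p <= rs) /\
  forall K, component (fun p => ~ A p) K -> bounded K ->
    forall p, K p <-> cnorm p <= rs.

Definition annulus (r R0 : R) (p : pt) : Prop := r < cnorm p /\ cnorm p < R0.

Definition cont_on (U : pt -> Prop) (f : pt -> R) : Prop :=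
  forall p, U p -> forall eps, 0 < eps ->
    exists d, 0 < d /\ forall q, U q -> cdist q p < d -> Rabs (f q - f p) < eps.

Definition has_partials (U : pt -> Prop) (f fx fy : pt -> R) : Prop :=
  forall p, U p ->
    derivable_pt_lim (fun t => f (t, snd p)) (fst p) (fx p) /\
    derivable_pt_lim (fun t => f (fst p, t)) (snd p) (fy p).

Definition harmonic_on (U : pt -> Prop) (f fx fy : pt -> R) : Prop :=
  cont_on U f /\ has_partials U f fx fy /\ cont_on U fx /\ cont_on U fy /\
  exists fxx fxy fyx fyy : pt -> R,
    has_partials U fx fxx fxy /\ has_partials U fy fyx fyy /\
    cont_on U fxx /\ cont_on U fxy /\ cont_on U fyx /\ cont_on U fyy /\
    forall p, U p -> fxx p + fyy p = 0.

Definition homeo_onto (U V : pt -> Prop) (h : pt -> pt) : Prop :=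
  (forall z, U z -> V (h z)) /\
  (forall z, U z -> forall eps, 0 < eps -> exists d, 0 < d /\
     forall z', U z' -> cdist z' z < d -> cdist (h z') (h z) < eps) /\
  exists g : pt -> pt,
    (forall z, U z -> g (h z) = z) /\
    (forall w, V w -> U (g w) /\ h (g w) = w) /\
    (forall w, V w -> forall eps, 0 < eps -> exists d, 0 < d /\
       forall w', V w' -> cdist w' w < d -> cdist (g w') (g w) < eps).

(* the extremal map  z |-> (1/2)(z/r + r/conj z) rs e^{i alpha},
   written in real coordinates: r/conj z = r z/|z|^2, so the map is the real
   factor (1/2)(1/r + r/|z|^2) rs times z rotated by alpha. *)
Definition extremal_map (r rs alpha : R) (z : pt) : pt :=
  let c := / 2 * (/ r + r / (fst z ^ 2 + snd z ^ 2)) * rs in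
  (c * (fst z * cos alpha - snd z * sin alpha),
   c * (fst z * sin alpha + snd z * cos alpha)).

(* |h(z)|^2 on the circle |z| = sigma, parametrized by arclength density:
   integrand of  \int_{|z|=sigma} |h|^2 |dz| = \int_0^{2pi} |h(sigma e^{it})|^2 sigma dt *)
Definition circ_integrand (h : pt -> pt) (sigma : R) (t : R) : R :=
  (cnorm (h (sigma * cos t, sigma * sin t))) ^ 2 * sigma.

(* Main.v *)
(* In the coordinates z = r e^{t + i q} the map h / rs = u + i v becomes a harmonic, 2 PI-periodic map of a strip
   0 < t < ln (R0 / r), with |h| > 1 and |h| -> 1 as t -> 0, and the claim is U(t) >= cosh^2 t for U(t) = mean of |h(t, .)|^2.
   Degree theory (integrals of d arg h weighted by functions of |h|^2) shows that h winds at least once around 0 and that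
   the mean A of Im (conj h h_q) is at least 1.

   For t <= 1 one integrates from 0 to t a combination Z of U, U' - 2 tanh U and A - U whose derivative is at
   least a nonnegative multiple of the mean of |h_t - tanh h|^2 + |h_q - i h|^2.

   For t >= 1 one compares with a circle t = t0 close to 0. Since h(t0, .) has nonzero winding, its harmonic extension to
   the disk has a zero, say at a. With P the Poisson kernel of a, completing squares in each Fourier mode against the
   multiplier P h(t0, .) bounds U(t) from below by quadratic expressions in h(t0, .); there mean (P |h|^2) and mean (P^2 |h|^2)
   are known up to o(1), the t-derivative enters only through mean (P (|h|^2)_t) >= - o(1), and the remaining Dirichlet-type
   form is bounded below because h(t0, .) annihilates the Poisson kernel. Letting t0 -> 0 gives the claim.

   In the equality case both arguments kill all modes but e^{+-iq}, leaving cosh t (C cos q + D sin q); |h| -> 1 and the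
   sign of the Jacobian then force a rotation. *)
Require Import Defs.
From Stdlib Require Import Reals Ranalysis5 Lra Lia Psatz.
From Coquelicot Require Import Coquelicot.
Open Scope R_scope.

(** * Continuous periodic functions and their means *)

(** Nothing is known about the derivatives of h at the inner circle, so boundary data enter only
    one-sidedly: |h|^2 - 1 is nonnegative and tends to 0, hence a weighted mean of it that is convex
    up to a small error cannot have a markedly negative slope. Two regimes are needed because the
    coefficient [2 * P x - Q x * ks x] of the defect tends, as x -> 0, to a positive multiple of (1
    - t)(1 - e^{-2t}): the first argument stops exactly at t = 1. The comparison across circles
    needs e^{-T} <= 3/8 with T = t - t0; T >= 999/1000 suffices and leaves room for t0 <= 1/1000.
    The multiplier is P h rather than h because P h has mean 0, the mean being the value of the
    extension at its zero a; so the constant mode of h(t0, .) takes no part in the squares. The zero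
    must stay away from the unit circle uniformly in t0 ([zero_loc]), since the errors carry the
    factor mean P^2 = (1 + a^2)/(1 - a^2). A zero a > 0 leaves the surplus (mean P^2 - 1)/2 in the
    bound, and in the equality case this drives a to 0. *)

Definition cts (f : R -> R) : Prop := forall x, continuous f x.

Lemma cts_const c : cts (fun _ => c).
Proof. intro x; apply continuous_const. Qed.
Lemma cts_id : cts (fun x => x).
Proof. intro x; apply continuous_id. Qed.
Lemma cts_plus f g : cts f -> cts g -> cts (fun x => f x + g x).
Proof. intros F G x; exact (continuous_plus f g x (F x) (G x)). Qed.
Lemma cts_minus f g : cts f -> cts g -> cts (fun x => f x - g x).
Proof. intros F G x; exact (continuous_minus f g x (F x) (G x)). Qed.
Lemma cts_opp f : cts f -> cts (fun x => - f x).
Proof. intros F x; exact (continuous_opp f x (F x)). Qed.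
Lemma cts_mult f g : cts f -> cts g -> cts (fun x => f x * g x).
Proof. intros F G x; exact (continuous_mult f g x (F x) (G x)). Qed.
Lemma cts_comp f g : cts f -> cts g -> cts (fun x => g (f x)).
Proof. intros F G x; exact (continuous_comp f g x (F x) (G (f x))). Qed.
Lemma cts_cos f : cts f -> cts (fun x => cos (f x)).
Proof. intro F; apply (cts_comp f cos F); intro x; apply continuous_cos. Qed.
Lemma cts_sin f : cts f -> cts (fun x => sin (f x)).
Proof. intro F; apply (cts_comp f sin F); intro x; apply continuous_sin. Qed.
Lemma cts_pow f n : cts f -> cts (fun x => f x ^ n).
Proof.
  intro F; induction n as [|n IH]; simpl; [apply cts_const | now apply cts_mult].
Qed.
Lemma cts_abs f : cts f -> cts (fun x => Rabs (f x)).
Proof. intros F; apply (cts_comp f Rabs F); intro x; apply continuous_Rabs. Qed.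
Lemma cts_inv f : cts f -> (forall x, f x <> 0) -> cts (fun x => / f x).
Proof. intros F N x; apply (continuous_Rinv_comp f x (F x) (N x)). Qed.
Lemma cts_div f g : cts f -> cts g -> (forall x, g x <> 0) -> cts (fun x => f x / g x).
Proof. intros F G N; apply cts_mult; [exact F | now apply cts_inv]. Qed.

Create HintDb cts.
#[export] Hint Resolve cts_const cts_id cts_plus cts_minus cts_opp cts_mult
  cts_cos cts_sin cts_pow cts_abs : cts.

Lemma cts_ext f g : (forall x, f x = g x) -> cts f -> cts g.
Proof. intros E F x; apply (continuous_ext f g x E (F x)). Qed.

Lemma cts_ex_RInt f a b : cts f -> ex_RInt f a b.
Proof. intro F; apply (ex_RInt_continuous (V:=R_CompleteNormedModule)); intros z _; apply F. Qed.
#[export] Hint Resolve cts_ex_RInt : cts.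

Definition mean (f : R -> R) : R := RInt f 0 (2 * PI) / (2 * PI).

Lemma PI2_pos : 0 < 2 * PI.
Proof. pose proof PI_RGT_0; lra. Qed.

Lemma mean_ext f g : (forall x, f x = g x) -> mean f = mean g.
Proof. intro E; unfold mean; f_equal; apply RInt_ext; intros x _; apply E. Qed.

Lemma mean_plus f g : cts f -> cts g -> mean (fun x => f x + g x) = mean f + mean g.
Proof.
  intros F G; unfold mean.
  rewrite (RInt_plus f g) by auto 20 with cts.
  unfold plus; simpl; field; pose proof PI2_pos; lra.
Qed.
Lemma mean_minus f g : cts f -> cts g -> mean (fun x => f x - g x) = mean f - mean g.
Proof.
  intros F G; unfold mean.
  rewrite (RInt_minus f g) by auto 20 with cts.
  unfold minus, plus, opp; simpl; field; pose proof PI2_pos; lra.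
Qed.
Lemma mean_scal c f : cts f -> mean (fun x => c * f x) = c * mean f.
Proof.
  intros F; unfold mean.
  rewrite (RInt_scal f) by auto 20 with cts.
  unfold scal; simpl; unfold mult; simpl; field; pose proof PI2_pos; lra.
Qed.
Lemma mean_opp f : cts f -> mean (fun x => - f x) = - mean f.
Proof.
  intros F; rewrite (mean_ext _ (fun x => (-1) * f x)) by (intro; ring).
  rewrite mean_scal by auto; ring.
Qed.
Lemma mean_const c : mean (fun _ => c) = c.
Proof.
  unfold mean; rewrite RInt_const; unfold scal; simpl; unfold mult; simpl; field.
  pose proof PI_RGT_0; lra.
Qed.

Lemma mean_le f g : cts f -> cts g -> (forall x, f x <= g x) -> mean f <= mean g.
Proof.
  intros F G L; unfold mean; apply Rmult_le_compat_r.
  - pose proof PI2_pos; left; now apply Rinv_0_lt_compat.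
  - apply RInt_le; auto 20 with cts. pose proof PI2_pos; lra.
Qed.
Lemma mean_ge0 f : cts f -> (forall x, 0 <= f x) -> 0 <= mean f.
Proof.
  intros F L; rewrite <- (mean_const 0); apply mean_le; auto 20 with cts.
Qed.
Lemma mean_bound f M : cts f -> (forall x, Rabs (f x) <= M) -> Rabs (mean f) <= M.
Proof.
  intros F L. apply Rabs_le; split.
  - rewrite <- (mean_const (- M)); apply mean_le; auto 20 with cts.
    intro x; specialize (L x); apply Rabs_le_between in L; lra.
  - rewrite <- (mean_const M); apply mean_le; auto 20 with cts.
    intro x; specialize (L x); apply Rabs_le_between in L; lra.
Qed.
Lemma mean_zero_fun f : cts f -> (forall x, 0 <= f x) -> mean f = 0 ->
  forall x, 0 < x < 2 * PI -> f x = 0.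
Proof.
  intros F L Z x Hx.
  destruct (Rle_lt_or_eq_dec _ _ (L x)) as [P|P]; [exfalso|now symmetry].
  pose proof (F x) as Cx.
  assert (Hl : locally x (fun y => f x / 2 < f y)).
  { apply (Cx (fun z => f x / 2 < z)). apply (open_gt (f x / 2)). lra. }
  destruct Hl as [d Hd].
  set (e := Rmin (d / 2) (Rmin (x / 2) ((2 * PI - x) / 2))).
  assert (He : 0 < e).
  { unfold e; repeat apply Rmin_pos; try lra. destruct d as [d0 Hd0]; simpl; lra. }
  assert (He1 : e <= d / 2) by apply Rmin_l.
  assert (He2 : e <= x / 2) by (unfold e; eapply Rle_trans; [apply Rmin_r|apply Rmin_l]).
  assert (He3 : e <= (2 * PI - x) / 2) by (unfold e; eapply Rle_trans; [apply Rmin_r|apply Rmin_r]).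
  assert (E : forall a b, ex_RInt f a b) by (intros; auto 20 with cts).
  assert (S : RInt f 0 (2 * PI) = RInt f 0 (x - e) + RInt f (x - e) (x + e) + RInt f (x + e) (2 * PI)).
  { pose proof (RInt_Chasles f 0 (x - e) (x + e) (E _ _) (E _ _)) as C1.
    pose proof (RInt_Chasles f 0 (x + e) (2 * PI) (E _ _) (E _ _)) as C2.
    unfold plus in C1, C2; simpl in C1, C2; lra. }
  assert (P1 : 0 <= RInt f 0 (x - e)) by (apply RInt_ge_0; auto; lra).
  assert (P3 : 0 <= RInt f (x + e) (2 * PI)) by (apply RInt_ge_0; auto; lra).
  assert (P2 : 0 < RInt f (x - e) (x + e)).
  { apply RInt_gt_0; try lra; [|intros; apply F].
    intros y Hy. assert (f x / 2 < f y); [|lra]. apply Hd.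
    unfold ball; simpl; unfold AbsRing_ball, abs, minus, plus, opp; simpl.
    apply Rabs_def1; destruct d as [d0 Hd0]; simpl in *; lra. }
  unfold mean in Z. pose proof PI2_pos.
  apply Rmult_integral in Z; destruct Z as [Z|Z]; [lra|].
  pose proof (Rinv_0_lt_compat _ H); lra.
Qed.

Definition per (f : R -> R) : Prop := forall x, f (x + 2 * PI) = f x.

Lemma der_ext (f g : R -> R) (x l : R) :
  (forall y : R, f y = g y) -> is_derive f x l -> is_derive g x l.
Proof. intros E; apply is_derive_ext; exact E. Qed.

Lemma der_eq (f : R -> R) (x l l' : R) : is_derive f x l -> l = l' -> is_derive f x l'.
Proof. now intros D <-. Qed.

Lemma mean_derive0 F f : (forall x, is_derive F x (f x)) -> cts f -> per F -> mean f = 0.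
Proof.
  intros D C P; unfold mean.
  rewrite (is_RInt_unique f 0 (2 * PI) (minus (F (2 * PI)) (F 0))).
  - unfold minus, plus, opp; simpl. rewrite <- (P 0), Rplus_0_l. unfold Rdiv; ring.
  - apply (is_RInt_derive F f); intros; auto.
Qed.

Lemma mean_parts f g df dg : (forall x, is_derive f x (df x)) -> (forall x, is_derive g x (dg x)) ->
  cts df -> cts dg -> per f -> per g ->
  mean (fun x => f x * dg x) = - mean (fun x => df x * g x).
Proof.
  intros F G DF DG PF PG.
  assert (cf : cts f) by (intro x; apply (ex_derive_continuous f x); eexists; apply F).
  assert (cg : cts g) by (intro x; apply (ex_derive_continuous g x); eexists; apply G).
  assert (E : mean (fun x => df x * g x + f x * dg x) = 0).
  { apply (mean_derive0 (fun x => f x * g x)).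
    - intro x. apply (is_derive_mult f g x (df x) (dg x)); auto. intros n0 m0; apply Rmult_comm.
    - auto 20 with cts.
    - intro x; cbv beta; now rewrite PF, PG. }
  rewrite mean_plus in E by auto 20 with cts. lra.
Qed.

Lemma mean_shift f b : cts f -> per f -> mean (fun x => f (x + b)) = mean f.
Proof.
  intros C P; unfold mean; f_equal.
  assert (E : forall a b, ex_RInt f a b) by (intros; auto 20 with cts).
  assert (S : forall a c d, RInt (fun x => f (x + d)) a c = RInt f (a + d) (c + d)).
  { intros a c d. pose proof (RInt_comp_lin f 1 d a c (E _ _)) as L.
    rewrite !Rmult_1_l in L. rewrite <- L. apply RInt_ext; intros x _.
    unfold scal; simpl; unfold mult; simpl. rewrite !Rmult_1_l; reflexivity. }
  rewrite S.
  assert (S2 : RInt f 0 (0 + b) = RInt f (2 * PI) (2 * PI + b)).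
  { pose proof (S 0 b (2 * PI)) as S3. rewrite Rplus_0_l in S3.
    replace (2 * PI + b) with (b + 2 * PI) by ring. rewrite <- S3, Rplus_0_l.
    apply RInt_ext; intros x _; now rewrite P. }
  pose proof (RInt_Chasles f 0 (0 + b) (2 * PI + b) (E _ _) (E _ _)) as C1.
  pose proof (RInt_Chasles f 0 (2 * PI) (2 * PI + b) (E _ _) (E _ _)) as C2.
  unfold plus in C1, C2; simpl in C1, C2. lra.
Qed.

Lemma c2_slice f t q : continuity_2d_pt f t q -> continuous (f t) q.
Proof.
  intros C. apply continuity_pt_filterlim. intros e He.
  destruct (C (mkposreal e He)) as [d Hd]. exists d; split; [apply cond_pos|].
  intros x [_ Hx]. simpl in *. unfold R_dist in *. apply Hd; auto.
  unfold Rminus; rewrite Rplus_opp_r, Rabs_R0; apply cond_pos.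
Qed.
Lemma c2_slice1 f t q : continuity_2d_pt f t q -> continuous (fun s => f s q) t.
Proof.
  intros C. apply continuity_pt_filterlim. intros e He.
  destruct (C (mkposreal e He)) as [d Hd]. exists d; split; [apply cond_pos|].
  intros x [_ Hx]. simpl in *. unfold R_dist in *. apply Hd; auto.
  unfold Rminus; rewrite Rplus_opp_r, Rabs_R0; apply cond_pos.
Qed.

Lemma loc_in a b t : a < t < b -> locally t (fun s => a < s < b).
Proof.
  intros H. apply (open_and (fun s => a < s) (fun s => s < b)); auto.
  - apply open_gt. - apply open_lt.
Qed.

Lemma mean_derive f ft a b :
  (forall t q, a < t < b -> is_derive (fun s => f s q) t (ft t q)) ->
  (forall t q, a < t < b -> continuity_2d_pt ft t q) ->
  (forall t, a < t < b -> cts (f t)) ->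
  forall t, a < t < b -> is_derive (fun s => mean (f s)) t (mean (ft t)).
Proof.
  intros D C F t Ht. unfold mean.
  apply (is_derive_ext (fun s => / (2 * PI) * RInt (f s) 0 (2 * PI))).
  { intro s; apply Rmult_comm. }
  replace (RInt (ft t) 0 (2 * PI) / (2 * PI)) with (/ (2 * PI) * RInt (ft t) 0 (2 * PI)) by apply Rmult_comm.
  apply is_derive_scal.
  assert (E : RInt (ft t) 0 (2 * PI) = RInt (fun q => Derive (fun s => f s q) t) 0 (2 * PI)).
  { apply RInt_ext; intros q _. symmetry; apply is_derive_unique, D, Ht. }
  rewrite E. apply (is_derive_RInt_param f 0 (2 * PI) t).
  - generalize (loc_in a b t Ht); apply filter_imp. intros s Hs q _. eexists; apply D, Hs.
  - intros q _. apply (continuity_2d_pt_ext_loc ft).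
    + destruct (loc_in a b t Ht) as [d Hd]. exists d. intros s p Hs _.
      symmetry; apply is_derive_unique, D, Hd, Hs.
    + apply C, Ht.
  - generalize (loc_in a b t Ht); apply filter_imp. intros s Hs. apply cts_ex_RInt, F, Hs.
Qed.

(** * Harmonic functions in logarithmic polar coordinates *)

Lemma d_plus f g (x df dg : R) : is_derive f x df -> is_derive g x dg -> is_derive (fun y => f y + g y) x (df + dg).
Proof. intros F G; exact (is_derive_plus f g x df dg F G). Qed.
Lemma d_minus f g (x df dg : R) : is_derive f x df -> is_derive g x dg -> is_derive (fun y => f y - g y) x (df - dg).
Proof. intros F G; exact (is_derive_minus f g x df dg F G). Qed.
Lemma d_mult f g (x df dg : R) : is_derive f x df -> is_derive g x dg -> is_derive (fun y => f y * g y) x (df * g x + f x * dg).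
Proof. intros F G; apply (is_derive_mult f g x df dg F G). intros; apply Rmult_comm. Qed.
Lemma d_opp f (x df : R) : is_derive f x df -> is_derive (fun y => - f y) x (- df).
Proof. intros F; exact (is_derive_opp f x df F). Qed.
Lemma d_const (c x : R) : is_derive (fun _ => c) x 0.
Proof. apply (is_derive_const c x). Qed.
Lemma d_id (x : R) : is_derive (fun y => y) x 1.
Proof. apply (is_derive_id x). Qed.
Lemma d_scal f (c x df : R) : is_derive f x df -> is_derive (fun y => c * f y) x (c * df).
Proof. intro F; exact (is_derive_scal f x c df F). Qed.
Lemma d_comp f g (x df dg : R) : is_derive g (f x) dg -> is_derive f x df -> is_derive (fun y => g (f y)) x (df * dg).
Proof. intros G F; exact (is_derive_comp g f x dg df G F). Qed.
Lemma d_cosh x : is_derive cosh x (sinh x).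
Proof. apply is_derive_Reals, derivable_pt_lim_cosh. Qed.
Lemma d_sinh x : is_derive sinh x (cosh x).
Proof. apply is_derive_Reals, derivable_pt_lim_sinh. Qed.

(** Despite the name this is joint continuity in the two variables on the open strip, not a
    differentiability class. *)
Definition C2 (a b : R) (f : R -> R -> R) : Prop := forall t q, a < t < b -> continuity_2d_pt f t q.
Definition Dt (a b : R) (f ft : R -> R -> R) : Prop := forall t q, a < t < b -> is_derive (fun s => f s q) t (ft t q).
Definition Dq (a b : R) (f fq : R -> R -> R) : Prop := forall t q, a < t < b -> is_derive (f t) q (fq t q).
Definition Per (f : R -> R -> R) : Prop := forall t q, f t (q + 2 * PI) = f t q.

Section Calc.
Variables a b : R.

Lemma C2_const c : C2 a b (fun _ _ => c).
Proof. intros t q _; apply continuity_2d_pt_const. Qed.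
Lemma C2_plus f g : C2 a b f -> C2 a b g -> C2 a b (fun t q => f t q + g t q).
Proof. intros F G t q H; apply continuity_2d_pt_plus; auto. Qed.
Lemma C2_minus f g : C2 a b f -> C2 a b g -> C2 a b (fun t q => f t q - g t q).
Proof. intros F G t q H; apply continuity_2d_pt_minus; auto. Qed.
Lemma C2_opp f : C2 a b f -> C2 a b (fun t q => - f t q).
Proof. intros F t q H; apply continuity_2d_pt_opp; auto. Qed.
Lemma C2_mult f g : C2 a b f -> C2 a b g -> C2 a b (fun t q => f t q * g t q).
Proof. intros F G t q H; apply continuity_2d_pt_mult; auto. Qed.
Lemma C2_inv f : C2 a b f -> (forall t q, a < t < b -> f t q <> 0) -> C2 a b (fun t q => / f t q).
Proof. intros F N t q H; apply continuity_2d_pt_inv; auto. Qed.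
Lemma C2_pow f n : C2 a b f -> C2 a b (fun t q => f t q ^ n).
Proof. intro F; induction n as [|n IH]; simpl; [apply C2_const|now apply C2_mult]. Qed.
Lemma C2_comp f (g : R -> R) : C2 a b f -> cts g -> C2 a b (fun t q => g (f t q)).
Proof.
  intros F G t q H. apply (continuity_1d_2d_pt_comp g f t q); [|auto].
  apply continuity_pt_filterlim, G.
Qed.
Lemma C2_fst (g : R -> R) : cts g -> C2 a b (fun t q => g t).
Proof. intros G. apply (C2_comp (fun t q => t) g); auto. intros t q _; apply continuity_2d_pt_id1. Qed.
Lemma C2_snd (g : R -> R) : cts g -> C2 a b (fun t q => g q).
Proof. intros G. apply (C2_comp (fun t q => q) g); auto. intros t q _; apply continuity_2d_pt_id2. Qed.
Lemma C2_slice f t : C2 a b f -> a < t < b -> cts (f t).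
Proof. intros F H q; apply c2_slice; auto. Qed.
Lemma C2_shift f p : C2 a b f -> C2 a b (fun t q => f t (q + p)).
Proof.
  intros F t q H e. destruct (F t (q + p) H e) as [d Hd]. exists d. intros x y Hx Hy. apply Hd; auto.
  replace (y + p - (q + p)) with (y - q) by ring; auto.
Qed.

Lemma Dt_plus f g ft gt : Dt a b f ft -> Dt a b g gt -> Dt a b (fun t q => f t q + g t q) (fun t q => ft t q + gt t q).
Proof. intros F G t q H; apply (d_plus (fun s => f s q)); auto. Qed.
Lemma Dt_minus f g ft gt : Dt a b f ft -> Dt a b g gt -> Dt a b (fun t q => f t q - g t q) (fun t q => ft t q - gt t q).
Proof. intros F G t q H; apply (d_minus (fun s => f s q)); auto. Qed.
Lemma Dt_mult f g ft gt : Dt a b f ft -> Dt a b g gt -> Dt a b (fun t q => f t q * g t q) (fun t q => ft t q * g t q + f t q * gt t q).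
Proof. intros F G t q H; apply (d_mult (fun s => f s q) (fun s => g s q)); auto. Qed.
Lemma Dt_const c : Dt a b (fun _ _ => c) (fun _ _ => 0).
Proof. intros t q _; apply d_const. Qed.
Lemma Dt_snd (g : R -> R) : Dt a b (fun _ q => g q) (fun _ _ => 0).
Proof. intros t q _; apply d_const. Qed.
Lemma Dt_comp f ft (g g' : R -> R) : (forall x, is_derive g x (g' x)) -> Dt a b f ft ->
  Dt a b (fun t q => g (f t q)) (fun t q => ft t q * g' (f t q)).
Proof. intros G F t q H; apply (d_comp (fun s => f s q) g); auto. Qed.
Lemma Dt_inv f ft : Dt a b f ft -> (forall t q, a < t < b -> f t q <> 0) ->
  Dt a b (fun t q => / f t q) (fun t q => - ft t q / f t q ^ 2).
Proof. intros F N t q H; apply (is_derive_inv (fun s => f s q)); auto. Qed.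
Lemma Dt_eq f ft ft' : Dt a b f ft -> (forall t q, a < t < b -> ft t q = ft' t q) -> Dt a b f ft'.
Proof. intros F E t q H; eapply der_eq; [apply F|]; auto. Qed.

Lemma Dq_plus f g ft gt : Dq a b f ft -> Dq a b g gt -> Dq a b (fun t q => f t q + g t q) (fun t q => ft t q + gt t q).
Proof. intros F G t q H; apply (d_plus (f t)); auto. Qed.
Lemma Dq_minus f g ft gt : Dq a b f ft -> Dq a b g gt -> Dq a b (fun t q => f t q - g t q) (fun t q => ft t q - gt t q).
Proof. intros F G t q H; apply (d_minus (f t)); auto. Qed.
Lemma Dq_mult f g ft gt : Dq a b f ft -> Dq a b g gt -> Dq a b (fun t q => f t q * g t q) (fun t q => ft t q * g t q + f t q * gt t q).
Proof. intros F G t q H; apply (d_mult (f t) (g t)); auto. Qed.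
Lemma Dq_const c : Dq a b (fun _ _ => c) (fun _ _ => 0).
Proof. intros t q _; apply d_const. Qed.
Lemma Dq_comp f ft (g g' : R -> R) : (forall x, is_derive g x (g' x)) -> Dq a b f ft ->
  Dq a b (fun t q => g (f t q)) (fun t q => ft t q * g' (f t q)).
Proof. intros G F t q H; apply (d_comp (f t) g); auto. Qed.
Lemma Dq_inv f ft : Dq a b f ft -> (forall t q, a < t < b -> f t q <> 0) ->
  Dq a b (fun t q => / f t q) (fun t q => - ft t q / f t q ^ 2).
Proof. intros F N t q H; apply (is_derive_inv (f t)); auto. Qed.
Lemma Dq_eq f ft ft' : Dq a b f ft -> (forall t q, a < t < b -> ft t q = ft' t q) -> Dq a b f ft'.
Proof. intros F E t q H; eapply der_eq; [apply F|]; auto. Qed.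

Lemma mean_Dt f ft : Dt a b f ft -> C2 a b f -> C2 a b ft ->
  forall t, a < t < b -> is_derive (fun s => mean (f s)) t (mean (ft t)).
Proof. intros F C C'. apply mean_derive; auto. intros; apply C2_slice; auto. Qed.
Lemma mean_Dq f fq : Dq a b f fq -> Per f -> C2 a b fq -> forall t, a < t < b -> mean (fq t) = 0.
Proof. intros F P C t H. apply (mean_derive0 (f t)); auto. - intro; auto. - apply C2_slice; auto. - intro; apply P. Qed.
End Calc.

Create HintDb dt.
#[export] Hint Resolve Dt_plus Dt_minus Dt_mult Dt_const Dq_plus Dq_minus Dq_mult Dq_const : dt.

Record jet := Jet { j0 : R -> R -> R; jt : R -> R -> R; jq : R -> R -> R;
  jtt : R -> R -> R; jtq : R -> R -> R; jqq : R -> R -> R }.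

(** Derivatives are carried as data together with their joint continuity, so that means over q can
    be differentiated in t and integrated by parts in q. The one field [jtq] serves as both mixed
    derivatives; their equality is established once, in [mixed_eq]. *)
Record harm (a b : R) (j : jet) : Prop := {
  h_t : Dt a b (j0 j) (jt j);
  h_q : Dq a b (j0 j) (jq j);
  h_tt : Dt a b (jt j) (jtt j);
  h_tq : Dq a b (jt j) (jtq j);
  h_qt : Dt a b (jq j) (jtq j);
  h_qq : Dq a b (jq j) (jqq j);
  h_lap : forall t q, a < t < b -> jtt j t q + jqq j t q = 0;
  h_c : C2 a b (j0 j);
  h_ct : C2 a b (jt j);
  h_cq : C2 a b (jq j);
  h_ctt : C2 a b (jtt j);
  h_ctq : C2 a b (jtq j);
  h_cqq : C2 a b (jqq j);
  h_p : Per (j0 j);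
  h_pt : Per (jt j);
  h_pq : Per (jq j) }.
#[export] Hint Resolve h_t h_q h_tt h_tq h_qt h_qq : dt.

(** Rotation of the angular variable; it later moves the zero of the extension onto the positive
    real axis, so that the Poisson kernel is even. *)
Definition shf (p : R) (f : R -> R -> R) : R -> R -> R := fun t q => f t (q + p).
Definition shift (p : R) (j : jet) : jet :=
  Jet (shf p (j0 j)) (shf p (jt j)) (shf p (jq j)) (shf p (jtt j)) (shf p (jtq j)) (shf p (jqq j)).

Lemma Dt_shf a b p f ft : Dt a b f ft -> Dt a b (shf p f) (shf p ft).
Proof. intros F t q H; apply F, H. Qed.
Lemma Dq_shf a b p f fq : Dq a b f fq -> Dq a b (shf p f) (shf p fq).
Proof.
  intros F t q H. unfold shf. eapply der_eq; [apply (d_comp (fun q => q + p) (f t)); [apply F, H|]|].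
  - apply d_plus; [apply d_id|apply d_const].
  - ring.
Qed.
Lemma Per_shf p f : Per f -> Per (shf p f).
Proof. intros P t q. unfold shf. replace (q + 2 * PI + p) with (q + p + 2 * PI) by ring. apply P. Qed.
Lemma harm_shift a b p j : harm a b j -> harm a b (shift p j).
Proof.
  intros []; constructor; unfold shift; simpl;
  first [now apply Dt_shf | now apply Dq_shf | now apply C2_shift | now apply Per_shf | intros; unfold shf; auto].
Qed.
Lemma harm_sub a b a' b' j : a <= a' -> b' <= b -> harm a b j -> harm a' b' j.
Proof.
  intros A B []; constructor; auto; intros t q H; match goal with H0 : context [_ t q] |- _ => idtac | _ => idtac end;
  first [apply h_t0 | apply h_q0 | apply h_tt0 | apply h_tq0 | apply h_qt0 | apply h_qq0 | apply h_lap0 | apply h_c0 | apply h_ct0 | apply h_cq0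
    | apply h_ctt0 | apply h_ctq0 | apply h_cqq0]; lra.
Qed.

Ltac c2t := repeat first [eassumption | apply C2_const | apply C2_minus | apply C2_plus | apply C2_opp | apply C2_mult | apply C2_pow
  | (eapply h_c; eassumption) | (eapply h_ct; eassumption) | (eapply h_cq; eassumption)
  | (eapply h_ctt; eassumption) | (eapply h_ctq; eassumption) | (eapply h_cqq; eassumption)].

(** * Winding integrals *)

Lemma mvt_open (f df : R -> R) a b t1 t2 : (forall t, a < t < b -> is_derive f t (df t)) ->
  a < t1 -> t1 < t2 -> t2 < b -> exists c, t1 < c < t2 /\ f t2 - f t1 = df c * (t2 - t1).
Proof.
  intros D A L B. destruct (MVT_cor2 f df t1 t2 L) as [c [E H]].
  - intros c H. apply is_derive_Reals, D. lra.
  - exists c; auto.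
Qed.

Lemma der_mono (f df : R -> R) a b : (forall t, a < t < b -> is_derive f t (df t)) ->
  (forall t, a < t < b -> 0 <= df t) -> forall t1 t2, a < t1 -> t1 <= t2 -> t2 < b -> f t1 <= f t2.
Proof.
  intros D P t1 t2 A L B. destruct L as [L|<-]; [|lra].
  destruct (mvt_open f df a b t1 t2 D A L B) as (c & Hc & E). pose proof (P c ltac:(lra)). nra.
Qed.

Lemma der_const (f : R -> R) a b : (forall t, a < t < b -> is_derive f t 0) ->
  forall t1 t2, a < t1 < b -> a < t2 < b -> f t1 = f t2.
Proof.
  intros D t1 t2 H1 H2.
  assert (M : forall x y, a < x -> x <= y -> y < b -> f x = f y).
  { intros x y A L B. apply Rle_antisym.
    - apply (der_mono f (fun _ => 0) a b); auto. intros; lra.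
    - assert (- f x <= - f y); [|lra]. apply (der_mono (fun t => - f t) (fun _ => 0) a b); auto; [|intros; lra].
      intros t Ht. eapply der_eq; [apply (is_derive_opp f t 0), D, Ht|]. unfold opp; simpl; ring. }
  destruct (Rle_dec t1 t2); [apply M; lra|symmetry; apply M; lra].
Qed.

(** If f'(t) = -K t - g with g > 0, then f'' >= -K keeps f' <= -g on all of (0, t], so f(s) >= f(t)
    + g (t - s) stays away from 0 as s -> 0, against the limit. This is how the boundary values of
    |h| yield a sign for a derivative. *)
Lemma slope_lower (f f' f'' : R -> R) b K : 0 <= K ->
  (forall t, 0 < t < b -> is_derive f t (f' t)) -> (forall t, 0 < t < b -> is_derive f' t (f'' t)) ->
  (forall t, 0 < t < b -> - K <= f'' t) -> (forall t, 0 < t < b -> 0 <= f t) ->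
  (forall e, 0 < e -> exists d, 0 < d /\ forall t, 0 < t < d -> t < b -> f t < e) ->
  forall t, 0 < t < b -> - K * t <= f' t.
Proof.
  intros HK D1 D2 L P Lim t Ht. destruct (Rle_lt_dec (- K * t) (f' t)) as [|N]; auto. exfalso.
  set (g := - K * t - f' t). assert (g0 : 0 < g) by (unfold g; lra).
  destruct (Lim (g * (t / 2)) ltac:(nra)) as (d & Hd & Ld).
  set (s := Rmin (d / 2) (t / 2)).
  assert (Hs : 0 < s) by (unfold s; apply Rmin_pos; lra).
  assert (s <= d / 2) by apply Rmin_l. assert (s <= t / 2) by apply Rmin_r.
  specialize (Ld s ltac:(lra) ltac:(lra)).
  destruct (mvt_open f f' 0 b s t D1) as (c & Hc & E); try lra.
  destruct (mvt_open f' f'' 0 b c t D2) as (c' & Hc' & E'); try lra.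
  pose proof (L c' ltac:(lra)). pose proof (P t Ht).
  assert (f' c <= f' t + K * t) by nra. assert (f' c <= - g) by (unfold g; lra). nra.
Qed.

Lemma per_nat f n x : per f -> f (x + INR n * (2 * PI)) = f x.
Proof.
  intro P; induction n as [|n IH]; [simpl; f_equal; ring|].
  rewrite <- IH, S_INR, <- (P (x + INR n * (2 * PI))). f_equal; ring.
Qed.

Lemma per_reduce f x : per f -> exists y, 0 <= y <= 2 * PI /\ f x = f y.
Proof.
  intro P. pose proof PI2_pos as P0.
  assert (Pos : forall x, 0 <= x -> exists y, 0 <= y <= 2 * PI /\ f x = f y).
  { intros z Hz. destruct (nfloor_ex (z / (2 * PI))) as [n [L U]].
    - apply Rmult_le_pos; auto. left; now apply Rinv_0_lt_compat.
    - exists (z - INR n * (2 * PI)).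
      assert (E : z = z / (2 * PI) * (2 * PI)) by (field; lra).
      split; [split; rewrite E; nra|]. rewrite <- (per_nat f n (z - _)) by auto. f_equal; ring. }
  destruct (nfloor_ex (Rabs x / (2 * PI))) as [n [L U]].
  { apply Rmult_le_pos; [apply Rabs_pos|]. left; now apply Rinv_0_lt_compat. }
  destruct (Pos (x + INR (S n) * (2 * PI))) as (y & Hy & E).
  - rewrite S_INR. assert (Rabs x = Rabs x / (2 * PI) * (2 * PI)) by (field; lra).
    pose proof (Rle_abs (- x)). rewrite Rabs_Ropp in H0. nra.
  - exists y; split; auto. rewrite <- E. symmetry; now apply per_nat.
Qed.

Lemma per_min f : cts f -> per f -> exists m, (forall x, f m <= f x).
Proof.
  intros C P. pose proof PI2_pos.
  destruct (continuity_ab_min f 0 (2 * PI)) as [m [M _]]; [lra| |].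
  - intros c _. apply continuity_pt_filterlim, C.
  - exists m. intro x. destruct (per_reduce f x P) as (y & Hy & ->). auto.
Qed.
Lemma per_max f : cts f -> per f -> exists M, 0 <= M /\ forall x, Rabs (f x) <= M.
Proof.
  intros C P. destruct (per_min (fun x => - Rabs (f x))) as [m M].
  - auto with cts.
  - intro x; now rewrite P.
  - exists (Rabs (f m)). split; [apply Rabs_pos|]. intro x. specialize (M x). cbv beta in M. lra.
Qed.

Definition nsq (U V : jet) (t q : R) : R := j0 U t q * j0 U t q + j0 V t q * j0 V t q.
(** Im (conj h h_q), that is |h|^2 times the q-derivative of arg h. *)
Definition ang (U V : jet) (t q : R) : R := j0 U t q * jq V t q - j0 V t q * jq U t q.
Definition jac (U V : jet) (t q : R) : R := jt U t q * jq V t q - jq U t q * jt V t q.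

Section Winding.
Variables (a b : R) (U V : jet).
Hypothesis HU : harm a b U.
Hypothesis HV : harm a b V.

Lemma C2_nsq : C2 a b (nsq U V).
Proof. unfold nsq; c2t. Qed.
Lemma C2_ang : C2 a b (ang U V).
Proof. unfold ang; c2t. Qed.
Lemma C2_jac : C2 a b (jac U V).
Proof. unfold jac; c2t. Qed.
Lemma Per_nsq : Per (nsq U V).
Proof. intros t q; unfold nsq; now rewrite (h_p _ _ _ HU), (h_p _ _ _ HV). Qed.
Lemma Dt_nsq : Dt a b (nsq U V) (fun t q => 2 * (j0 U t q * jt U t q + j0 V t q * jt V t q)).
Proof. eapply Dt_eq; [unfold nsq; eauto 20 with dt|]. intros; cbv beta; ring. Qed.
Lemma Dq_nsq : Dq a b (nsq U V) (fun t q => 2 * (j0 U t q * jq U t q + j0 V t q * jq V t q)).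
Proof. eapply Dq_eq; [unfold nsq; eauto 20 with dt|]. intros; cbv beta; ring. Qed.

Hypothesis Hpos : forall t q, a < t < b -> 0 < nsq U V t q.
Variables (chi chi' : R -> R).
Hypothesis Dchi : forall y, is_derive chi y (chi' y).
Hypothesis Cchi : cts chi'.

Definition wnd (t : R) : R := mean (fun q => chi (nsq U V t q) * / nsq U V t q * ang U V t q).

Lemma chi_cts : cts chi.
Proof. intro y; apply (ex_derive_continuous chi y); eexists; apply Dchi. Qed.

Lemma C2_is2 : C2 a b (fun t q => / nsq U V t q).
Proof. apply C2_inv; [apply C2_nsq|]. intros t q H. apply Rgt_not_eq, Hpos, H. Qed.
Lemma C2_chis2 g : cts g -> C2 a b (fun t q => g (nsq U V t q)).
Proof. apply C2_comp, C2_nsq. Qed.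

Lemma wnd_cts t : a < t < b -> cts (fun q => chi (nsq U V t q) * / nsq U V t q * ang U V t q).
Proof.
  intro H. apply (C2_slice a b (fun t q => chi (nsq U V t q) * / nsq U V t q * ang U V t q) t); auto.
  pose proof C2_is2. pose proof (C2_chis2 chi chi_cts). pose proof C2_ang. c2t.
Qed.

(** Stokes on a thin ring: the form chi(|h|^2) d arg h has exterior derivative 2 chi'(|h|^2) J dt
    dq, because d arg h is closed where h does not vanish. *)
Lemma wnd_derive t : a < t < b -> is_derive wnd t (mean (fun q => 2 * chi' (nsq U V t q) * jac U V t q)).
Proof.
  intro Ht. set (S := nsq U V).
  set (w := fun t q => chi (S t q) * / S t q).
  set (p := fun t q => chi' (S t q) * / S t q - chi (S t q) * / S t q ^ 2).
  set (cr := fun t q => j0 U t q * jt V t q - j0 V t q * jt U t q).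
  assert (NS : forall t q, a < t < b -> S t q <> 0) by (intros; apply Rgt_not_eq, Hpos; auto).
  assert (Dw : Dt a b w (fun t q => 2 * p t q * (j0 U t q * jt U t q + j0 V t q * jt V t q))).
  { eapply Dt_eq; [exact (Dt_mult a b _ _ _ _ (Dt_comp a b S _ chi chi' Dchi Dt_nsq) (Dt_inv a b S _ Dt_nsq NS))|].
    intros s q H; unfold p. fold S. field. auto. }
  assert (Dwq : Dq a b w (fun t q => 2 * p t q * (j0 U t q * jq U t q + j0 V t q * jq V t q))).
  { eapply Dq_eq; [exact (Dq_mult a b _ _ _ _ (Dq_comp a b S _ chi chi' Dchi Dq_nsq) (Dq_inv a b S _ Dq_nsq NS))|].
    intros s q H; unfold p. fold S. field. auto. }
  assert (Ci := C2_is2). assert (C1 := C2_chis2 chi chi_cts). assert (C1' := C2_chis2 chi' Cchi). fold S in Ci, C1, C1'.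
  assert (Ca := C2_ang). assert (Cj := C2_jac). assert (Cs := C2_nsq). fold S in Cs.
  assert (Cw : C2 a b w) by (unfold w; c2t).
  assert (Cp : C2 a b p).
  { unfold p. apply C2_minus; [c2t|]. apply C2_mult; auto. apply C2_inv; c2t.
    intros s q H. apply pow_nonzero; auto. }
  set (ft := fun t q => 2 * p t q * (j0 U t q * jt U t q + j0 V t q * jt V t q) * ang U V t q
       + w t q * (jac U V t q + (j0 U t q * jtq V t q - j0 V t q * jtq U t q))).
  (* The q-derivative of the t-component of the form; its mean over a period is 0, and subtracting
     it from [ft] cancels all second derivatives. *)
  set (fq := fun t q => 2 * p t q * (j0 U t q * jq U t q + j0 V t q * jq V t q) * cr t q
       + w t q * ((j0 U t q * jtq V t q - j0 V t q * jtq U t q) - jac U V t q)).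
  assert (D1 : Dt a b (fun t q => w t q * ang U V t q) ft).
  { eapply Dt_eq; [eapply Dt_mult; [exact Dw|unfold ang; eauto 20 with dt]|].
    intros s q H; unfold ft, ang, jac; ring. }
  assert (D2 : Dq a b (fun t q => w t q * cr t q) fq).
  { eapply Dq_eq; [eapply Dq_mult; [exact Dwq|unfold cr; eauto 20 with dt]|].
    intros s q H; unfold fq, cr, jac; ring. }
  assert (Ccr : C2 a b cr) by (unfold cr; c2t).
  assert (Cft : C2 a b ft) by (unfold ft; c2t).
  assert (Cfq : C2 a b fq) by (unfold fq; c2t).
  assert (Z : mean (fq t) = 0).
  { apply (mean_Dq a b (fun t q => w t q * cr t q)); auto. intros s q. unfold w, cr.
    unfold S. rewrite Per_nsq, (h_p _ _ _ HU), (h_p _ _ _ HV), (h_pt _ _ _ HU), (h_pt _ _ _ HV). reflexivity. }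
  eapply der_eq.
  - apply (mean_Dt a b (fun t q => w t q * ang U V t q) ft D1); auto. c2t.
  - transitivity (mean (ft t) - mean (fq t)); [lra|]. rewrite <- mean_minus by (eapply C2_slice; eauto).
    apply mean_ext; intro q. unfold ft, fq, p, w. fold S.
    transitivity (2 * (w t q + S t q * p t q) * jac U V t q).
    + unfold w, p, cr, ang, jac, S, nsq. ring.
    + unfold w, p. field. auto.
Qed.
End Winding.

(** The map divided by the inner radius, in logarithmic polar coordinates. The limit [r_lim] is
    uniform in q and is the only boundary information. *)
Record rmap (b : R) (U V : jet) : Prop := {
  r_U : harm 0 b U;
  r_V : harm 0 b V;
  r_gt : forall t q, 0 < t < b -> 1 < nsq U V t q;
  r_lim : forall e, 0 < e -> exists d, 0 < d /\ forall t q, 0 < t < d -> t < b -> nsq U V t q < 1 + e;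
  r_jac : forall t q, 0 < t < b -> 0 < jac U V t q }.

Lemma rmap_shift b U V p : rmap b U V -> rmap b (shift p U) (shift p V).
Proof.
  intros []; constructor; auto using harm_shift.
  - intros t q H. apply r_gt0, H.
  - intros e He. destruct (r_lim0 e He) as (d & Hd & L). exists d; split; auto. intros t q H1 H2. apply L; auto.
  - intros t q H. apply r_jac0, H.
Qed.

(* An integral multiple of [2 PI] is recognised by [cos x = 1]; only the positive case matters. *)
Lemma cos1_ge x : 0 < x -> cos x = 1 -> 2 * PI <= x.
Proof.
  intros H C. destruct (Rle_lt_dec (2 * PI) x) as [|L]; auto. exfalso.
  assert (S : 0 < sin (x / 2)) by (apply sin_gt_0; lra).
  replace x with (2 * (x / 2)) in C by field. rewrite cos_2a_sin in C. nra.
Qed.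

(** The derivative of Re (h e^{-i phi}) / |h| when phi' is the angular speed of h = f + i g, with c
    = cos phi, s = sin phi, r = |h|; [frame_alg2] is the imaginary part. *)
Lemma frame_alg1 f g f' g' c s r : r <> 0 -> r * r = f * f + g * g ->
  (f' * c + f * ((f * g' - g * f') / (r * r) * - s) + (g' * s + g * ((f * g' - g * f') / (r * r) * c))) * / r
  + (f * c + g * s) * (- (2 * (f * f' + g * g') * / (2 * r)) / r ^ 2) = 0.
Proof.
  intros N E.
  transitivity (((f' * c + g' * s) * (r * r) + (g * c - f * s) * (f * g' - g * f') - (f * c + g * s) * (f * f' + g * g')) / r ^ 3); [field; auto|].
  rewrite E. unfold Rdiv. ring.
Qed.
Lemma frame_alg2 f g f' g' c s r : r <> 0 -> r * r = f * f + g * g ->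
  (g' * c + g * ((f * g' - g * f') / (r * r) * - s) - (f' * s + f * ((f * g' - g * f') / (r * r) * c))) * / r
  + (g * c - f * s) * (- (2 * (f * f' + g * g') * / (2 * r)) / r ^ 2) = 0.
Proof.
  intros N E.
  transitivity (((g' * c - f' * s) * (r * r) - (g * s + f * c) * (f * g' - g * f') - (g * c - f * s) * (f * f' + g * g')) / r ^ 3); [field; auto|].
  rewrite E. unfold Rdiv. ring.
Qed.

(** A winding number is an integer: h / |h| is a constant times e^{i phi}, so periodicity forces
    e^{i phi(2 PI)} = 1, and a positive multiple of 2 PI is at least 2 PI. *)
Lemma index_ge1 (f g f' g' : R -> R) : (forall x, is_derive f x (f' x)) -> (forall x, is_derive g x (g' x)) ->
  cts f' -> cts g' -> per f -> per g -> (forall x, 0 < f x * f x + g x * g x) ->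
  0 < mean (fun x => (f x * g' x - g x * f' x) / (f x * f x + g x * g x)) ->
  1 <= mean (fun x => (f x * g' x - g x * f' x) / (f x * f x + g x * g x)).
Proof.
  intros Df Dg Cf' Cg' Pf Pg Pos M0.
  assert (Cf : cts f) by (intro x; apply (ex_derive_continuous f x); eexists; apply Df).
  assert (Cg : cts g) by (intro x; apply (ex_derive_continuous g x); eexists; apply Dg).
  set (w := fun x => (f x * g' x - g x * f' x) / (f x * f x + g x * g x)) in *.
  assert (Cw : cts w) by (apply cts_div; auto with cts; intro x; apply Rgt_not_eq, Pos).
  set (phi := (fun x => RInt w 0 x) : R -> R).
  assert (Dphi : forall x, is_derive phi x (w x)).
  { intro x. apply (is_derive_RInt w phi 0 x); [|apply Cw].
    apply filter_forall. intro y. apply (RInt_correct w 0 y). auto with cts. }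
  set (S := fun x => f x * f x + g x * g x).
  assert (DS : forall x, is_derive S x (2 * (f x * f' x + g x * g' x))).
  { intro x. eapply der_eq; [apply d_plus; apply d_mult; auto|]. ring. }
  (* (f + i g) e^{-i phi} / |f + i g| is constant *)
  set (F := fun x => (f x * cos (phi x) + g x * sin (phi x)) * / sqrt (S x)).
  assert (DF : forall x, is_derive F x 0).
  { intro x. pose proof (Pos x) as Px. fold (S x) in Px.
    assert (sq : 0 < sqrt (S x)) by now apply sqrt_lt_R0.
    eapply der_eq.
    - apply d_mult.
      + apply d_plus; apply d_mult; auto.
        * apply (d_comp phi cos); [apply is_derive_cos|apply Dphi].
        * apply (d_comp phi sin); [apply is_derive_sin|apply Dphi].
      + apply (is_derive_inv (fun y => sqrt (S y))); [|lra].
        apply (d_comp S sqrt); [apply is_derive_Reals, derivable_pt_lim_sqrt; exact Px|apply DS].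
    - assert (q2 : sqrt (S x) * sqrt (S x) = S x) by (apply sqrt_sqrt; lra).
      assert (w x = (f x * g' x - g x * f' x) / (sqrt (S x) * sqrt (S x))) as -> by (rewrite q2; unfold w; fold (S x); reflexivity).
      apply frame_alg1; [lra|exact q2]. }
  assert (G : forall x, is_derive (fun x => (g x * cos (phi x) - f x * sin (phi x)) * / sqrt (S x)) x 0).
  { intro x. pose proof (Pos x) as Px. fold (S x) in Px.
    assert (sq : 0 < sqrt (S x)) by now apply sqrt_lt_R0.
    eapply der_eq.
    - apply d_mult.
      + apply d_minus; apply d_mult; auto.
        * apply (d_comp phi cos); [apply is_derive_cos|apply Dphi].
        * apply (d_comp phi sin); [apply is_derive_sin|apply Dphi].
      + apply (is_derive_inv (fun y => sqrt (S y))); [|lra].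
        apply (d_comp S sqrt); [apply is_derive_Reals, derivable_pt_lim_sqrt; exact Px|apply DS].
    - assert (q2 : sqrt (S x) * sqrt (S x) = S x) by (apply sqrt_sqrt; lra).
      assert (w x = (f x * g' x - g x * f' x) / (sqrt (S x) * sqrt (S x))) as -> by (rewrite q2; unfold w; fold (S x); reflexivity).
      apply frame_alg2; [lra|exact q2]. }
  pose proof PI2_pos as P2.
  assert (E1 : F 0 = F (2 * PI)) by (apply (der_const F (-1) (2 * PI + 1)); auto; lra).
  assert (E2 : (g 0 * cos (phi 0) - f 0 * sin (phi 0)) * / sqrt (S 0) = (g (2 * PI) * cos (phi (2 * PI)) - f (2 * PI) * sin (phi (2 * PI))) * / sqrt (S (2 * PI))).
  { apply (der_const (fun x => (g x * cos (phi x) - f x * sin (phi x)) * / sqrt (S x)) (-1) (2 * PI + 1)); auto; lra. }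
  assert (f2 : f (2 * PI) = f 0) by (rewrite <- (Pf 0); f_equal; ring).
  assert (g2 : g (2 * PI) = g 0) by (rewrite <- (Pg 0); f_equal; ring).
  assert (p0 : phi 0 = 0) by (apply (RInt_point 0 w)).
  unfold F in E1. unfold S in E1, E2. rewrite f2, g2, p0, cos_0, sin_0 in *.
  pose proof (Pos 0) as Px. pose proof (sqrt_lt_R0 _ Px) as sq.
  apply Rmult_eq_reg_r in E1; [|apply Rgt_not_eq, Rinv_0_lt_compat, sq].
  apply Rmult_eq_reg_r in E2; [|apply Rgt_not_eq, Rinv_0_lt_compat, sq].
  assert (C : cos (phi (2 * PI)) = 1).
  { set (c := cos _) in *. set (s := sin _) in *.
    assert ((f 0 * f 0 + g 0 * g 0) * (c - 1) = 0).
    { transitivity (f 0 * (f 0 * c + g 0 * s - (f 0 * 1 + g 0 * 0)) + g 0 * (g 0 * c - f 0 * s - (g 0 * 1 - f 0 * 0))); [ring|].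
      rewrite <- E1, <- E2. ring. }
    apply Rmult_integral in H; destruct H; lra. }
  unfold mean in M0 |- *. fold (phi (2 * PI)) in M0 |- *.
  assert (0 < phi (2 * PI)).
  { apply (Rmult_lt_reg_r (/ (2 * PI))); [now apply Rinv_0_lt_compat|]. rewrite Rmult_0_l. exact M0. }
  pose proof (cos1_ge _ H C).
  apply (Rmult_le_reg_r (2 * PI)); auto. unfold Rdiv. rewrite Rmult_assoc, Rinv_l by lra. lra.
Qed.

(* The square of the positive part is C^1, which makes [bump] a C^1 cut-off. *)
Definition pp (x : R) : R := Rmax 0 x.
Lemma pp_cts : cts pp.
Proof.
  apply (cts_ext (fun x => (x + Rabs x) / 2)); [|unfold Rdiv; auto with cts].
  intro x; unfold pp, Rmax. destruct (Rle_dec 0 x); [rewrite Rabs_pos_eq|rewrite Rabs_left]; lra.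
Qed.
Lemma pp_ge0 x : 0 <= pp x.
Proof. apply Rmax_l. Qed.
Lemma pp_pos x : 0 <= x -> pp x = x.
Proof. apply Rmax_right. Qed.
Lemma pp_neg x : x <= 0 -> pp x = 0.
Proof. apply Rmax_left. Qed.
Definition qq (x : R) : R := pp x * pp x.
Lemma qq_derive x : is_derive qq x (2 * pp x).
Proof.
  apply is_derive_Reals. intros e He. exists (mkposreal e He). intros h Hh Hd. simpl in Hd.
  assert (B : Rabs (qq (x + h) - qq x - 2 * pp x * h) <= h * h).
  { unfold qq. destruct (Rle_lt_dec 0 (x + h)), (Rle_lt_dec 0 x); rewrite ?(pp_pos (x + h)), ?(pp_neg (x + h)), ?(pp_pos x), ?(pp_neg x) by lra; apply Rabs_le; split; nra. }
  replace ((qq (x + h) - qq x) / h - 2 * pp x) with ((qq (x + h) - qq x - 2 * pp x * h) * / h) by (field; auto).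
  rewrite Rabs_mult, Rabs_inv.
  pose proof (Rabs_pos_lt h Hh) as Ph.
  apply (Rmult_lt_reg_r (Rabs h)); auto. rewrite Rmult_assoc, Rinv_l, Rmult_1_r by lra.
  assert (h * h = Rabs h * Rabs h) by (rewrite <- Rabs_mult, Rabs_pos_eq; nra). nra.
Qed.

Definition bump (m1 m2 y : R) : R := qq (y - m1) / (qq (y - m1) + qq (m2 - y)).
Definition bump' (m1 m2 y : R) : R :=
  2 * (pp (y - m1) * qq (m2 - y) + qq (y - m1) * pp (m2 - y)) / (qq (y - m1) + qq (m2 - y)) ^ 2.
Lemma bump_den m1 m2 y : m1 < m2 -> 0 < qq (y - m1) + qq (m2 - y).
Proof.
  intro H. unfold qq. destruct (Rle_lt_dec y m1).
  - rewrite (pp_neg (y - m1)), (pp_pos (m2 - y)) by lra. nra.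
  - rewrite (pp_pos (y - m1)) by lra. pose proof (pp_ge0 (m2 - y)). nra.
Qed.
Lemma qq_cts : cts qq.
Proof. unfold qq. pose proof pp_cts. auto with cts. Qed.
Lemma cts_at (f g : R -> R) : cts f -> cts g -> cts (fun x => g (f x)).
Proof. apply cts_comp. Qed.
Lemma bump_derive m1 m2 y : m1 < m2 -> is_derive (bump m1 m2) y (bump' m1 m2 y).
Proof.
  intro H. pose proof (bump_den m1 m2 y H) as D.
  assert (D1 : is_derive (fun y => qq (y - m1)) y (1 * (2 * pp (y - m1)))).
  { apply (d_comp (fun y => y - m1) qq); [apply qq_derive|]. eapply der_eq; [apply d_minus; [apply d_id|apply d_const]|ring]. }
  assert (D2 : is_derive (fun y => qq (m2 - y)) y (-1 * (2 * pp (m2 - y)))).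
  { apply (d_comp (fun y => m2 - y) qq); [apply qq_derive|]. eapply der_eq; [apply d_minus; [apply d_const|apply d_id]|ring]. }
  eapply der_eq.
  - apply (d_mult (fun y => qq (y - m1)) (fun y => / (qq (y - m1) + qq (m2 - y)))); [exact D1|].
    apply (is_derive_inv (fun y => qq (y - m1) + qq (m2 - y))); [apply d_plus; [exact D1|exact D2]|lra].
  - unfold bump'. field. lra.
Qed.
Lemma bump'_cts m1 m2 : m1 < m2 -> cts (bump' m1 m2).
Proof.
  intro H. unfold bump'. pose proof qq_cts as Q. pose proof pp_cts as P.
  assert (cts (fun y => qq (y - m1))) by (apply (cts_at (fun y => y - m1) qq); auto with cts).
  assert (cts (fun y => qq (m2 - y))) by (apply (cts_at (fun y => m2 - y) qq); auto with cts).
  assert (cts (fun y => pp (y - m1))) by (apply (cts_at (fun y => y - m1) pp); auto with cts).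
  assert (cts (fun y => pp (m2 - y))) by (apply (cts_at (fun y => m2 - y) pp); auto with cts).
  apply cts_div; auto 20 with cts. intro y. apply pow_nonzero, Rgt_not_eq, bump_den, H.
Qed.
Lemma bump'_ge0 m1 m2 y : m1 < m2 -> 0 <= bump' m1 m2 y.
Proof.
  intro H. unfold bump'. pose proof (bump_den m1 m2 y H) as D.
  apply Rmult_le_pos; [|left; apply Rinv_0_lt_compat, pow_lt, D].
  pose proof (pp_ge0 (y - m1)). pose proof (pp_ge0 (m2 - y)). unfold qq.
  assert (0 <= pp (y - m1) * pp (m2 - y)) by (apply Rmult_le_pos; auto). nra.
Qed.
Lemma bump'_gt0 m1 m2 y : m1 < y < m2 -> 0 < bump' m1 m2 y.
Proof.
  intro H. unfold bump', qq. rewrite !pp_pos by lra. apply Rdiv_lt_0_compat.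
  - assert (0 < (y - m1) * (m2 - y)) by nra. nra.
  - apply pow_lt. nra.
Qed.

Lemma bump_lo m1 m2 y : m1 < m2 -> y <= m1 -> bump m1 m2 y = 0.
Proof. intros H L. unfold bump, qq. rewrite (pp_neg (y - m1)) by lra. unfold Rdiv; ring. Qed.
Lemma bump_hi m1 m2 y : m1 < m2 -> m2 <= y -> bump m1 m2 y = 1.
Proof. intros H L. unfold bump, qq. rewrite (pp_neg (m2 - y)), (pp_pos (y - m1)) by lra. field. lra. Qed.
Lemma bump_01 m1 m2 y : m1 < m2 -> 0 <= bump m1 m2 y <= 1.
Proof.
  intros H. pose proof (bump_den m1 m2 y H) as D. unfold bump.
  assert (0 <= qq (y - m1)) by apply Rle_0_sqr. assert (0 <= qq (m2 - y)) by apply Rle_0_sqr.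
  split.
  - apply Rmult_le_pos; auto. left; now apply Rinv_0_lt_compat.
  - apply (Rmult_le_reg_r (qq (y - m1) + qq (m2 - y))); auto. unfold Rdiv. rewrite Rmult_assoc, Rinv_l by lra. lra.
Qed.

Section Rmap.
Variables (b : R) (U V : jet).
Hypothesis HR : rmap b U V.
Let HU := r_U _ _ _ HR.
Let HV := r_V _ _ _ HR.
Let S := nsq U V.

Lemma nsq_pos t q : 0 < t < b -> 0 < nsq U V t q.
Proof. intro H. pose proof (r_gt _ _ _ HR t q H). lra. Qed.

(** The sign of the Jacobian enters here. Only the values of [chi'] on [1, oo) matter, since |h| >
    1. *)
Lemma wnd_mono (chi chi' : R -> R) : (forall y, is_derive chi y (chi' y)) -> cts chi' -> (forall y, 1 <= y -> 0 <= chi' y) ->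
  forall t1 t2, 0 < t1 -> t1 <= t2 -> t2 < b -> wnd U V chi t1 <= wnd U V chi t2.
Proof.
  intros D C P. apply (der_mono _ (fun t => mean (fun q => 2 * chi' (S t q) * jac U V t q))).
  - intros t Ht. apply (wnd_derive 0 b U V HU HV nsq_pos chi chi'); auto.
  - intros t Ht. apply mean_ge0.
    + apply (C2_slice 0 b (fun t q => 2 * chi' (S t q) * jac U V t q)); auto.
      assert (C2 0 b (fun t q => chi' (S t q))) by (apply C2_comp; auto; apply C2_nsq; auto).
      pose proof (C2_jac 0 b U V HU HV). c2t.
    + intro q. pose proof (r_jac _ _ _ HR t q Ht). pose proof (r_gt _ _ _ HR t q Ht).
      assert (0 <= chi' (S t q)) by (apply P; unfold S; lra). nra.
Qed.

Lemma wnd_zero (chi : R -> R) m : 1 < m -> (forall y, y <= m -> chi y = 0) ->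
  exists d, 0 < d /\ forall t, 0 < t < d -> t < b -> wnd U V chi t = 0.
Proof.
  intros H Z. destruct (r_lim _ _ _ HR (m - 1)) as (d & Hd & L); [lra|].
  exists d; split; auto. intros t Ht Hb. unfold wnd.
  rewrite (mean_ext _ (fun _ => 0)); [apply mean_const|]. intro q.
  rewrite Z; [ring|]. pose proof (L t q Ht Hb). lra.
Qed.

Lemma wnd_ge0 (chi chi' : R -> R) m : (forall y, is_derive chi y (chi' y)) -> cts chi' -> (forall y, 1 <= y -> 0 <= chi' y) ->
  1 < m -> (forall y, y <= m -> chi y = 0) -> forall t, 0 < t < b -> 0 <= wnd U V chi t.
Proof.
  intros D C P H Z t Ht. destruct (wnd_zero chi m H Z) as (d & Hd & L).
  rewrite <- (L (Rmin (d / 2) (t / 2))).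
  - apply (wnd_mono chi chi'); auto; try lra. + apply Rmin_pos; lra. + eapply Rle_trans; [apply Rmin_r|lra].
  - split; [apply Rmin_pos; lra|]. eapply Rle_lt_trans; [apply Rmin_l|lra].
  - eapply Rle_lt_trans; [apply Rmin_r|lra].
Qed.

Definition winding (t : R) : R := mean (fun q => ang U V t q / S t q).

(** With a cut-off that is 1 on the circle t and 0 near the inner circle, the weighted winding
    starts at 0, never decreases and ends as the true winding. Were it 0 at t, its derivative would
    vanish throughout, so |h|^2 could not cross the zone where the cut-off increases, although it
    must. *)
Lemma winding_gt0 t : 0 < t < b -> 0 < winding t.
Proof.
  intro Ht. pose proof PI2_pos as P2.
  assert (CS : C2 0 b S) by (apply C2_nsq; auto).
  destruct (per_min (S t)) as [q0 Hq0]; [eapply C2_slice; eauto|intro x; now apply (Per_nsq 0 b U V HU HV)|].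
  set (m2 := S t q0) in *. assert (M2 : 1 < m2) by (apply (r_gt _ _ _ HR); auto).
  (* Strictly between 1, the limit of |h|^2 at the inner circle, and the minimum [m2] of |h|^2 on
     the circle t. *)
  set (m1 := (1 + m2) / 2). assert (M1 : 1 < m1 < m2) by (unfold m1; lra).
  set (chi := bump m1 m2).
  assert (D : forall y, is_derive chi y (bump' m1 m2 y)) by (intro; apply bump_derive; lra).
  assert (C : cts (bump' m1 m2)) by (apply bump'_cts; lra).
  assert (Z : forall y, y <= m1 -> chi y = 0) by (intros; apply bump_lo; lra).
  assert (E : wnd U V chi t = winding t).
  { unfold wnd, winding. apply mean_ext; intro q. fold S. unfold chi. rewrite bump_hi; [unfold Rdiv; ring|lra|apply Hq0]. }
  rewrite <- E.
  assert (G : forall s, 0 < s < b -> 0 <= wnd U V chi s).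
  { apply (wnd_ge0 chi (bump' m1 m2) m1); auto; try lra. intros; apply bump'_ge0; lra. }
  destruct (Rle_lt_or_eq_dec _ _ (G t Ht)) as [|E0]; auto. exfalso.
  assert (Zs : forall s, 0 < s < t -> wnd U V chi s = 0).
  { intros s Hs. apply Rle_antisym; [|apply G; lra]. rewrite E0.
    apply (wnd_mono chi (bump' m1 m2)); auto; try lra. intros; apply bump'_ge0; lra. }
  assert (Zd : forall s, 0 < s < t -> bump' m1 m2 (S s 1) = 0).
  { intros s Hs. pose proof (wnd_derive 0 b U V HU HV nsq_pos chi (bump' m1 m2) D C s ltac:(lra)) as W.
    assert (W0 : is_derive (wnd U V chi) s 0).
    { apply (is_derive_ext_loc (fun _ => 0)); [|apply d_const].
      generalize (loc_in 0 t s Hs); apply filter_imp. intros x Hx. symmetry; now apply Zs. }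
    apply is_derive_unique in W. apply is_derive_unique in W0. rewrite W0 in W. symmetry in W.
    assert (Cj : C2 0 b (fun t q => 2 * bump' m1 m2 (S t q) * jac U V t q)).
    { assert (C2 0 b (fun t q => bump' m1 m2 (S t q))) by (apply C2_comp; auto).
      pose proof (C2_jac 0 b U V HU HV). c2t. }
    assert (Hsb : 0 < s < b) by lra.
    pose proof (mean_zero_fun _ (C2_slice 0 b _ s Cj Hsb)) as Q. cbv beta in Q.
    assert (Q1 : 2 * bump' m1 m2 (S s 1) * jac U V s 1 = 0).
    { apply Q; [|exact W|pose proof PI2_1; lra]. intro q. pose proof (bump'_ge0 m1 m2 (S s q) ltac:(lra)).
      pose proof (r_jac _ _ _ HR s q Hsb). nra. }
    pose proof (r_jac _ _ _ HR s 1 Hsb). nra. }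
  destruct (r_lim _ _ _ HR (m1 - 1)) as (d & Hd & L); [lra|].
  set (s0 := Rmin (d / 2) (t / 2)).
  assert (0 < s0) by (apply Rmin_pos; lra). assert (s0 <= d / 2) by apply Rmin_l. assert (s0 <= t / 2) by apply Rmin_r.
  specialize (L s0 1 ltac:(lra) ltac:(lra)). fold S in L.
  (* Along the ray of angle 1, any point inside (0, 2 PI) being as good, |h|^2 passes the midpoint
     of [m1, m2], where [bump'] is positive. *)
  destruct (IVT_interv (fun s => S s 1 - (m1 + m2) / 2) s0 t) as (z & Hz & Ez).
  - intros x Hx. apply continuity_pt_filterlim.
    apply (continuous_minus (fun s => S s 1) (fun _ => (m1 + m2) / 2)); [|apply continuous_const].
    apply c2_slice1, CS. lra.
  - lra.
  - lra.
  - specialize (Hq0 1). lra.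
  - assert (z <> t). { intros ->. specialize (Hq0 1). lra. }
    specialize (Zd z ltac:(lra)). pose proof (bump'_gt0 m1 m2 (S z 1) ltac:(lra)). lra.
Qed.

Lemma winding_ge1 t : 0 < t < b -> 1 <= winding t.
Proof.
  intro Ht. pose proof (winding_gt0 t Ht) as W. unfold winding, ang, S, nsq in *.
  apply (index_ge1 (j0 U t) (j0 V t) (jq U t) (jq V t)); auto.
  - intro; apply (h_q _ _ _ HU); auto. - intro; apply (h_q _ _ _ HV); auto.
  - eapply C2_slice; [apply (h_cq _ _ _ HU)|auto]. - eapply C2_slice; [apply (h_cq _ _ _ HV)|auto].
  - intro; apply (h_p _ _ _ HU). - intro; apply (h_p _ _ _ HV).
  - intro q. pose proof (nsq_pos t q Ht) as Q. exact Q.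
Qed.

(** The weight chi(y) = y - 1 turns the weighted winding into area minus winding. Cut off near y =
    1, this weight vanishes close to the inner circle, so the weighted winding is nonnegative; the
    cut-off costs at most a multiple of e. Hence area >= winding >= 1. *)
Lemma area_ge1 t : 0 < t < b -> 1 <= mean (ang U V t).
Proof.
  intro Ht. pose proof (winding_ge1 t Ht) as W.
  assert (CS : C2 0 b S) by (apply C2_nsq; auto). assert (CA : C2 0 b (ang U V)) by (apply C2_ang; auto).
  assert (CI : C2 0 b (fun t q => / S t q)) by (apply (C2_is2 0 b U V HU HV nsq_pos)).
  assert (cA : cts (ang U V t)) by (eapply C2_slice; eauto).
  assert (cS : cts (S t)) by (eapply C2_slice; eauto).
  assert (cI : cts (fun q => / S t q)) by (apply (C2_slice 0 b (fun t q => / S t q)); auto).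
  set (M := mean (fun q => Rabs (ang U V t q))).
  assert (M0 : 0 <= M) by (apply mean_ge0; [auto with cts|intro; apply Rabs_pos]).
  assert (K : forall e, 0 < e -> - (2 * e * M) <= mean (ang U V t) - winding t).
  { intros e He.
    (* It differs from y - 1 only for y < 1 + 2 e, hence by at most 2 e on the range of |h|^2. *)
    set (chi := fun y => (y - 1) * bump (1 + e) (1 + 2 * e) y).
    set (chi' := fun y => bump (1 + e) (1 + 2 * e) y + (y - 1) * bump' (1 + e) (1 + 2 * e) y).
    assert (H12 : 1 + e < 1 + 2 * e) by lra.
    assert (D : forall y, is_derive chi y (chi' y)).
    { intro y. eapply der_eq; [apply d_mult; [apply d_minus; [apply d_id|apply d_const]|apply bump_derive; lra]|]. unfold chi'; ring. }
    assert (C : cts chi').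
    { unfold chi'. assert (cts (bump (1 + e) (1 + 2 * e))) by (intro y; apply (ex_derive_continuous (bump (1 + e) (1 + 2 * e)) y); eexists; apply bump_derive; lra).
      pose proof (bump'_cts _ _ H12). auto with cts. }
    assert (G : 0 <= wnd U V chi t).
    { apply (wnd_ge0 chi chi' (1 + e)); auto; try lra.
      - intros y Hy. unfold chi'. pose proof (bump_01 _ _ y H12). pose proof (bump'_ge0 _ _ y H12). nra.
      - intros y Hy. unfold chi. rewrite bump_lo by lra. ring. }
    assert (cc : cts (fun q => chi (S t q) * / S t q * ang U V t q)) by (apply (wnd_cts 0 b U V HU HV nsq_pos chi chi' D t Ht)).
    assert (Le : wnd U V chi t <= mean (ang U V t) - winding t + 2 * e * M).
    { unfold wnd, winding, M. rewrite <- mean_scal by auto with cts. rewrite <- mean_minus, <- mean_plus by (unfold Rdiv; auto 20 with cts).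
      apply mean_le; auto; [unfold Rdiv; auto 20 with cts|]. intro q. fold S.
      pose proof (r_gt _ _ _ HR t q Ht) as G1. fold S in G1.
      assert (Q : 0 <= (S t q - 1) - chi (S t q) <= 2 * e).
      { unfold chi. pose proof (bump_01 _ _ (S t q) H12). destruct (Rle_lt_dec (1 + 2 * e) (S t q)).
        - rewrite bump_hi by lra. lra. - nra. }
      set (y := S t q) in *. set (w := ang U V t q).
      assert (E : w - w / y - chi y * / y * w = ((y - 1) - chi y) * / y * w) by (field; lra).
      assert (B : Rabs (((y - 1) - chi y) * / y * w) <= 2 * e * Rabs w).
      { rewrite Rabs_mult. apply Rmult_le_compat_r; [apply Rabs_pos|].
        assert (I : 0 < / y <= 1) by (split; [apply Rinv_0_lt_compat; lra|rewrite <- Rinv_1; apply Rinv_le_contravar; lra]).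
        rewrite Rabs_pos_eq by nra. nra. }
      rewrite <- E in B. apply Rabs_le_between in B. lra. }
    lra. }
  apply Rnot_lt_le. intro N.
  set (g := winding t - mean (ang U V t)). assert (g0 : 0 < g) by (unfold g; lra).
  (* This choice makes the error 2 e M at most half of the supposed gap. *)
  specialize (K (g / (4 * (M + 1)))). assert (P : 0 < g / (4 * (M + 1))) by (apply Rdiv_lt_0_compat; lra).
  specialize (K P). assert (E : 2 * (g / (4 * (M + 1))) * M <= g / 2).
  { apply (Rmult_le_reg_r (4 * (M + 1))); [lra|]. replace (2 * (g / (4 * (M + 1))) * M * (4 * (M + 1))) with (2 * g * M) by (field; lra). nra. }
  unfold g in *. lra.
Qed.
End Rmap.

(** * A quadratic form inequality *)

Fixpoint sm (n : nat) (f : nat -> R) : R :=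
  match n with O => 0 | S m => sm m f + f m end.

Lemma sm_ext n f g : (forall i, (i < n)%nat -> f i = g i) -> sm n f = sm n g.
Proof.
  induction n as [|n IH]; intro E; simpl; [reflexivity|].
  rewrite IH, E; auto.
Qed.
Lemma sm_plus n f g : sm n (fun i => f i + g i) = sm n f + sm n g.
Proof. induction n as [|n IH]; simpl; [ring|rewrite IH; ring]. Qed.
Lemma sm_minus n f g : sm n (fun i => f i - g i) = sm n f - sm n g.
Proof. induction n as [|n IH]; simpl; [ring|rewrite IH; ring]. Qed.
Lemma sm_scal n c f : sm n (fun i => c * f i) = c * sm n f.
Proof. induction n as [|n IH]; simpl; [ring|rewrite IH; ring]. Qed.
Lemma sm_le n f g : (forall i, (i < n)%nat -> f i <= g i) -> sm n f <= sm n g.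
Proof.
  induction n as [|n IH]; intro E; simpl; [lra|].
  apply Rplus_le_compat; [apply IH; auto | apply E; auto].
Qed.
Lemma sm_ge0 n f : (forall i, (i < n)%nat -> 0 <= f i) -> 0 <= sm n f.
Proof.
  intro H. replace 0 with (sm n (fun _ => 0)).
  - now apply sm_le.
  - clear; induction n; simpl; lra.
Qed.
Lemma sm_term n f i : (forall i, (i < n)%nat -> 0 <= f i) -> (i < n)%nat -> f i <= sm n f.
Proof.
  induction n as [|n IH]; intros H Hi; [lia|]. simpl.
  destruct (Nat.eq_dec i n) as [->|N].
  - pose proof (sm_ge0 n f (fun i h => H i (Nat.lt_lt_succ_r _ _ h))). lra.
  - pose proof (IH (fun i h => H i (Nat.lt_lt_succ_r _ _ h))) as K.
    specialize (K ltac:(lia)). pose proof (H n (Nat.lt_succ_diag_r n)). lra.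
Qed.
Lemma sm_shift n f : sm (S n) f = f O + sm n (fun i => f (S i)).
Proof. induction n as [|n IH]; [simpl; ring|]. simpl sm in *. rewrite IH. ring. Qed.
Lemma sm_swap n m f : sm n (fun i => sm m (fun j => f i j)) = sm m (fun j => sm n (fun i => f i j)).
Proof.
  induction n as [|n IH]; simpl.
  - induction m as [|m IHm]; simpl; lra.
  - rewrite IH, <- sm_plus. reflexivity.
Qed.

(** One of the two truncated differences is 0, so this is |n - m|. *)
Definition dst (n m : nat) : nat := (n - m) + (m - n).
Definition qf (N : nat) (K : nat -> nat -> R) (F : nat -> R) : R :=
  sm N (fun n => F n * sm N (fun m => F m * K n m)).

(* Synthetic division by [X - a]: [F_0 = -a U_0] is the condition that [a] is a root. *)
Definition syn (a : R) (N : nat) (F : nat -> R) (i : nat) : R :=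
  sm (N - i) (fun k => F (S i + k)%nat * a ^ k).

Lemma syn_rec a N F i : (i < N)%nat ->
  syn a N F i = F (S i) + a * syn a N F (S i).
Proof.
  intro H. unfold syn. replace (N - i)%nat with (S (N - S i)) by lia.
  rewrite sm_shift. replace (S i + 0)%nat with (S i) by lia. simpl pow at 1.
  rewrite Rmult_1_r. f_equal. rewrite <- sm_scal. apply sm_ext; intros k _.
  replace (S i + S k)%nat with (S (S i) + k)%nat by lia. simpl pow. ring.
Qed.

(** Summation by parts for F = (X - a) U: the coefficient F_n equals U_{n-1} - a U_n, with U_{-1} =
    0. *)
Lemma syn_sum a N F f : sm (S N) (fun n => F n * a ^ n) = 0 ->
  sm (S N) (fun n => F n * f n) = sm N (fun i => syn a N F i * (f (S i) - a * f i)).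
Proof.
  intro H0.
  (* The boundary term disappears at k = N, where [syn a N F N] is an empty sum. *)
  assert (G : forall k, (k <= N)%nat -> sm (S k) (fun n => F n * f n) =
    sm k (fun i => syn a N F i * (f (S i) - a * f i)) - a * syn a N F k * f k).
  { induction k as [|k IH]; intro Hk.
    - simpl. rewrite Rplus_0_l. rewrite sm_shift in H0. simpl in H0.
      unfold syn. rewrite Nat.sub_0_r, Rmult_1_r in *.
      assert (E : sm N (fun i => F (S i) * (a * a ^ i)) = a * sm N (fun k => F (1 + k)%nat * a ^ k)).
      { rewrite <- sm_scal. apply sm_ext; intros; simpl; ring. }
      rewrite E in H0. replace (F O) with (- (a * sm N (fun k => F (1 + k)%nat * a ^ k))) by lra. ring.
    - change (sm (S (S k)) (fun n => F n * f n)) with (sm (S k) (fun n => F n * f n) + F (S k) * f (S k)).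
      rewrite IH by lia. simpl sm. rewrite (syn_rec a N F k) by lia. ring. }
  rewrite (G N (le_n N)). unfold syn at 2. rewrite Nat.sub_diag. simpl sm at 2. ring.
Qed.

(** The root condition is removed by passing to the quotient U, on which there is no constraint; the
    kernel is differenced in both indices. *)
Lemma qf_syn a N F K : sm (S N) (fun n => F n * a ^ n) = 0 ->
  qf (S N) K F = qf N (fun i j => K (S i) (S j) - a * K (S i) j - a * K i (S j) + a ^ 2 * K i j) (syn a N F).
Proof.
  intro H0. unfold qf.
  rewrite (sm_ext (S N) _ (fun n => F n * sm N (fun j => syn a N F j * (K n (S j) - a * K n j)))).
  2:{ intros n _. f_equal. apply (syn_sum a N F (K n) H0). }
  rewrite (syn_sum a N F _ H0). apply sm_ext; intros i _. f_equal.
  rewrite <- sm_scal, <- sm_minus. apply sm_ext; intros j _. ring.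
Qed.

(** Induction on the size: the new index N meets each older i in 2 U_N U_i a^{N-i} <= U_N^2 +
    a^{2(N-i)} U_i^2. So index i collects weight i from the smaller indices, 1 from the diagonal and
    a geometric sum from the larger ones. *)
Lemma geo_form a N U : 0 <= a < 1 ->
  qf N (fun i j => a ^ dst i j) U <=
  sm N (fun i => (INR i + (1 - a ^ (2 * (N - i))) / (1 - a ^ 2)) * U i ^ 2).
Proof.
  intros Ha. assert (D : 0 < 1 - a ^ 2) by nra.
  induction N as [|N IH]; [unfold qf; simpl; lra|].
  assert (E : qf (S N) (fun i j => a ^ dst i j) U =
    qf N (fun i j => a ^ dst i j) U + U N ^ 2 + 2 * U N * sm N (fun i => U i * a ^ (N - i))).
  { unfold qf. simpl sm.
    rewrite (sm_ext N _ (fun n => U n * sm N (fun m => U m * a ^ dst n m) + U N * (U n * a ^ (N - n)))).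
    2:{ intros i Hi. unfold dst at 2. replace (i - N + (N - i))%nat with (N - i)%nat by lia. ring. }
    rewrite sm_plus, sm_scal.
    rewrite (sm_ext N (fun m => U m * a ^ dst N m) (fun i => U i * a ^ (N - i))).
    2:{ intros i Hi. unfold dst. replace (N - i + (i - N))%nat with (N - i)%nat by lia. reflexivity. }
    unfold dst. rewrite Nat.sub_diag. simpl. ring. }
  rewrite E.
  assert (B : 2 * U N * sm N (fun i => U i * a ^ (N - i)) <=
     INR N * U N ^ 2 + sm N (fun i => a ^ (2 * (N - i)) * U i ^ 2)).
  { replace (INR N * U N ^ 2) with (sm N (fun _ => U N ^ 2)).
    2:{ clear. induction N as [|N IH] in U |- *; [simpl; ring|].
        change (sm (S N) (fun _ => U (S N) ^ 2)) with (sm N (fun _ => U (S N) ^ 2) + U (S N) ^ 2).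
        rewrite (IH (fun _ => U (S N))). rewrite S_INR. ring. }
    rewrite <- sm_plus, <- sm_scal. apply sm_le; intros i Hi.
    rewrite Nat.mul_comm, pow_mult. set (p := a ^ (N - i)).
    pose proof (Rle_0_sqr (U N - p * U i)). unfold Rsqr in H. simpl. nra. }
  change (sm (S N) (fun i => (INR i + (1 - a ^ (2 * (S N - i))) / (1 - a ^ 2)) * U i ^ 2))
   with (sm N (fun i => (INR i + (1 - a ^ (2 * (S N - i))) / (1 - a ^ 2)) * U i ^ 2)
        + (INR N + (1 - a ^ (2 * (S N - N))) / (1 - a ^ 2)) * U N ^ 2).
  replace (S N - N)%nat with 1%nat by lia. replace (a ^ (2 * 1)) with (a ^ 2) by (f_equal; lia).
  replace ((1 - a ^ 2) / (1 - a ^ 2)) with 1 by (field; lra).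
  assert (E2 : sm N (fun i => (INR i + (1 - a ^ (2 * (S N - i))) / (1 - a ^ 2)) * U i ^ 2) =
    sm N (fun i => (INR i + (1 - a ^ (2 * (N - i))) / (1 - a ^ 2)) * U i ^ 2)
    + sm N (fun i => a ^ (2 * (N - i)) * U i ^ 2)).
  { rewrite <- sm_plus. apply sm_ext; intros i Hi.
    replace (2 * (S N - i))%nat with (2 + 2 * (N - i))%nat by lia.
    rewrite pow_add. field. lra. }
  rewrite E2. lra.
Qed.

Lemma geo_form' a N U : 0 <= a < 1 ->
  qf N (fun i j => a ^ dst i j) U <= sm N (fun i => (INR i + / (1 - a ^ 2)) * U i ^ 2).
Proof.
  intros Ha. eapply Rle_trans; [apply geo_form, Ha|]. apply sm_le; intros i _.
  apply Rmult_le_compat_r; [apply pow2_ge_0|]. apply Rplus_le_compat_l.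
  assert (0 < 1 - a ^ 2) by nra. unfold Rdiv. rewrite <- (Rmult_1_l (/ (1 - a ^ 2))) at 2.
  apply Rmult_le_compat_r; [left; now apply Rinv_0_lt_compat|].
  assert (0 <= a ^ (2 * (N - i))) by (apply pow_le; lra). lra.
Qed.

(** The mean of the squared Poisson kernel, see [mean_poisson2] at k = 0. *)
Definition vv (a : R) : R := (1 + a ^ 2) / (1 - a ^ 2).

(** The kernel is made for synthetic division: differencing it twice leaves (1 - a^2) times the
    diagonal with entries i + 1/(1 - a^2) minus a^|i-j|, which is nonnegative by [geo_form'].
    Without the root condition the form has no sign: its (0, 0) entry is - [vv a]. *)
Lemma weighted_form a N F : 0 <= a < 1 -> sm (S N) (fun n => F n * a ^ n) = 0 ->
  0 <= qf (S N) (fun n m => a ^ dst n m * ((INR n + INR m) / 2 - 3 / 2 * INR (dst n m) - vv a)) F.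
Proof.
  intros Ha H0. rewrite (qf_syn a N F _ H0).
  assert (D : 0 < 1 - a ^ 2) by nra.
  pose proof (geo_form' a N (syn a N F) Ha) as G. set (U := syn a N F) in *.
  assert (E : qf N (fun i j => (1 - a ^ 2) * ((if Nat.eqb i j then INR i + / (1 - a ^ 2) else 0) - a ^ dst i j)) U
    = (1 - a ^ 2) * (sm N (fun i => (INR i + / (1 - a ^ 2)) * U i ^ 2) - qf N (fun i j => a ^ dst i j) U)).
  { unfold qf. rewrite <- sm_minus, <- sm_scal. apply sm_ext; intros i Hi.
    rewrite (sm_ext N _ (fun m => (1 - a ^ 2) * ((if Nat.eqb i m then (INR i + / (1 - a ^ 2)) * U i else 0) - U m * a ^ dst i m))).
    2:{ intros j Hj. destruct (Nat.eqb_spec i j) as [->|]; ring. }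
    rewrite sm_scal, sm_minus.
    assert (Dl : forall c, sm N (fun m => if Nat.eqb i m then c else 0) = c).
    { intro c. assert (Q : forall M, sm M (fun m => if Nat.eqb i m then c else 0) = if Nat.ltb i M then c else 0).
      { induction M as [|M IH]; [reflexivity|]. simpl sm. rewrite IH.
        destruct (Nat.ltb_spec i M), (Nat.eqb_spec i M), (Nat.ltb_spec i (S M)); try lia; ring. }
      rewrite Q. destruct (Nat.ltb_spec i N); [reflexivity|lia]. }
    rewrite Dl. ring. }
  replace (qf N _ U) with (qf N (fun i j => (1 - a ^ 2) * ((if Nat.eqb i j then INR i + / (1 - a ^ 2) else 0) - a ^ dst i j)) U).
  { rewrite E. apply Rmult_le_pos; lra. }
  unfold qf. apply sm_ext; intros i _. f_equal. apply sm_ext; intros j _. f_equal.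
  unfold vv. destruct (Nat.eqb_spec i j) as [->|Nij].
  - replace (dst (S j) (S j)) with O by (unfold dst; lia). replace (dst j j) with O by (unfold dst; lia).
    replace (dst (S j) j) with 1%nat by (unfold dst; lia). replace (dst j (S j)) with 1%nat by (unfold dst; lia).
    rewrite S_INR. simpl. field. nra.
  - destruct (Nat.lt_total i j) as [L|[L|L]]; [|lia|].
    + replace (dst (S i) (S j)) with (S (j - S i)) by (unfold dst; lia).
      replace (dst i j) with (S (j - S i)) by (unfold dst; lia).
      replace (dst (S i) j) with (j - S i)%nat by (unfold dst; lia).
      replace (dst i (S j)) with (S (S (j - S i))) by (unfold dst; lia).
      remember (j - S i)%nat as k. replace j with (S i + k)%nat by lia.
      rewrite !S_INR, plus_INR, !S_INR. simpl pow. field. nra.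
    + replace (dst (S i) (S j)) with (S (i - S j)) by (unfold dst; lia).
      replace (dst i j) with (S (i - S j)) by (unfold dst; lia).
      replace (dst (S i) j) with (S (S (i - S j))) by (unfold dst; lia).
      replace (dst i (S j)) with (i - S j)%nat by (unfold dst; lia).
      remember (i - S j)%nat as k. replace i with (S j + k)%nat by lia.
      rewrite !S_INR, plus_INR, !S_INR. simpl pow. field. nra.
Qed.

(** * Hyperbolic inequalities for the modes *)

Lemma cosh_sinh_sq x : cosh x ^ 2 = 1 + sinh x ^ 2.
Proof.
  unfold cosh, sinh. assert (exp x * exp (- x) = 1) by (rewrite <- exp_plus, Rplus_opp_r; apply exp_0).
  nra.
Qed.
Lemma sinh_plus x y : sinh (x + y) = sinh x * cosh y + cosh x * sinh y.
Proof. unfold sinh, cosh. rewrite Ropp_plus_distr, !exp_plus. field. Qed.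
Lemma cosh_plus x y : cosh (x + y) = cosh x * cosh y + sinh x * sinh y.
Proof. unfold sinh, cosh. rewrite Ropp_plus_distr, !exp_plus. field. Qed.
Lemma cosh_ge1 x : 1 <= cosh x.
Proof.
  unfold cosh. assert (exp x * exp (- x) = 1) by (rewrite <- exp_plus, Rplus_opp_r; apply exp_0).
  pose proof (exp_pos x); pose proof (exp_pos (-x)).
  destruct (Rle_lt_dec 2 (exp x + exp (- x))); [lra|exfalso].
  assert (exp x * (exp x + exp (- x) - 2) = (exp x - 1) ^ 2) by (simpl; nra).
  pose proof (pow2_ge_0 (exp x - 1)). nra.
Qed.
Lemma sinh_pos x : 0 < x -> 0 < sinh x.
Proof. intro H. unfold sinh. assert (exp (-x) < exp x) by (apply exp_increasing; lra). lra. Qed.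
Lemma cosh_m_sinh x : cosh x - sinh x = exp (- x).
Proof. unfold cosh, sinh; field. Qed.

(** The solution of x'' = n^2 x with x(0) = 0, x'(0) = 1, at time T. *)
Definition Sn (T : R) (n : nat) : R := sinh (INR n * T) / INR n.
(** This is n coth(n T) - n, the excess of the Dirichlet-to-Neumann multiplier over its limit n. *)
Definition rho (T : R) (n : nat) : R := INR n * exp (- (INR n * T)) / sinh (INR n * T).

Section Mode.
Variable T : R.
Hypothesis HT : 0 < T.
Hypothesis HE : exp (- T) <= 3 / 8.
Let E := exp (- T).
Let s := sinh T.
Let c := cosh T.

(** 55/48 and 73/48 are the values of sinh and cosh at e^T = 8/3. *)
Lemma mode_facts : 0 < E <= 3/8 /\ s * E = (1 - E ^ 2) / 2 /\ c * E = (1 + E ^ 2) / 2 /\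
  55 / 48 <= s /\ c ^ 2 = 1 + s ^ 2 /\ 0 < c /\ 73/48 <= c.
Proof.
  assert (P : exp T * E = 1) by (unfold E; rewrite <- exp_plus, Rplus_opp_r; apply exp_0).
  assert (E0 : 0 < E) by apply exp_pos. assert (E1 : E <= 3/8) by exact HE.
  assert (X : 8/3 <= exp T) by nra.
  assert (s = (exp T - E) / 2) by reflexivity. assert (c = (exp T + E) / 2) by reflexivity.
  pose proof (cosh_sinh_sq T). fold c s in H1. repeat split; nra.
Qed.

(** For n = 3, sinh(3T) = s (3 + 4 s^2), and s >= 55/48 just gives 3 + 4 s^2 >= 33/4. From n to n +
    1 the left side grows by (n + 1)/n <= 4/3 and the right side by at least cosh T > 4/3. *)
Lemma sn_ratio n : (3 <= n)%nat -> 11 * s * INR n <= 4 * sinh (INR n * T).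
Proof.
  destruct mode_facts as (E0 & sE & cE & s1 & cs & c0 & c1).
  intro H. induction H as [|n Hn IH].
  - replace (INR 3 * T) with (T + T + T) by (simpl; ring).
    rewrite !sinh_plus, cosh_plus. fold s c. replace (INR 3) with 3 by (simpl; ring). nra.
  - rewrite S_INR. replace ((INR n + 1) * T) with (INR n * T + T) by ring.
    rewrite sinh_plus. fold s c.
    assert (3 <= INR n) by (apply (le_INR 3) in Hn; simpl in Hn; lra).
    pose proof (cosh_ge1 (INR n * T)). assert (0 < sinh (INR n * T)) by (apply sinh_pos; nra).
    assert (4 / 3 * (11 * s * INR n) <= c * (4 * sinh (INR n * T))) by nra.
    assert (11 * s * (INR n + 1) <= 4 / 3 * (11 * s * INR n)) by nra.
    nra.
Qed.

Lemma rho1 : rho T 1 = E / s.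
Proof. unfold rho. simpl INR. rewrite !Rmult_1_l. reflexivity. Qed.

(** Modes n >= 2 are treated as if they were the first. This leaves a gain of order c^2 z^2, of
    which z^2/20 is kept for the equality case; the term (z - y)^2/2 given away is paid for through
    mean (P - 1)^2 |h|^2 in [key_lemma]. *)
Lemma mode_ineq n z y : (2 <= n)%nat ->
  2 * (s * c) * rho T 1 * (z * y) - c ^ 2 * z ^ 2 + z ^ 2 / 20 - (z - y) ^ 2 / 2 <=
  2 * (s * c) * rho T n * (z * y) - (s * c) ^ 2 * (z / Sn T n) ^ 2.
Proof.
  intro Hn. rewrite rho1.
  destruct mode_facts as (E0 & sE & cE & s1 & cs & c0 & c1).
  (* Writing z y = z^2 - z (z - y), the difference of the two sides is X z^2 + 2 M z (z - y) -
     z^2/20 + (z - y)^2/2. The square (2 M z + (z - y))^2 / 2 absorbs the mixed term at the price 2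
     M^2 z^2. *)
  assert (Fin : forall M X, M = s * c * (E / s) - s * c * rho T n -> X * z ^ 2 = (c ^ 2 - 2 * M) * z ^ 2 - (s * c) ^ 2 * (z / Sn T n) ^ 2 ->
     1/20 < X -> 2 * M ^ 2 <= X - 1 / 20 ->
     2 * (s * c) * (E / s) * (z * y) - c ^ 2 * z ^ 2 + z ^ 2 / 20 - (z - y) ^ 2 / 2 <=
     2 * (s * c) * rho T n * (z * y) - (s * c) ^ 2 * (z / Sn T n) ^ 2).
  { intros M X HM HX X0 HMX.
    assert (Q : 0 <= X * z ^ 2 + 2 * M * z * (z - y) - z ^ 2 / 20 + (z - y) ^ 2 / 2).
    { set (e := z - y). pose proof (pow2_ge_0 (2 * M * z + e)). pose proof (pow2_ge_0 z). nra. }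
    assert (2 * (s * c) * (E / s) * (z * y) = 2 * M * (z * y) + 2 * (s * c) * rho T n * (z * y)) by (rewrite HM; ring).
    nra. }
  destruct (Nat.eq_dec n 2) as [->|N2].
  (* Here Sn T 2 = s c, so the last quotient is just z, and s c (rho 1 - rho 2) = E (c - E) = s
     E. *)
  - assert (S2 : sinh (INR 2 * T) = 2 * s * c).
    { replace (INR 2 * T) with (T + T) by (simpl; ring). rewrite sinh_plus. fold s c. ring. }
    assert (X2 : exp (- (INR 2 * T)) = E ^ 2).
    { replace (- (INR 2 * T)) with (- T + - T) by (simpl; ring). rewrite exp_plus. unfold E. ring. }
    apply (Fin (s * E) (s ^ 2 - 1 + E ^ 2)).
    + unfold rho. rewrite S2, X2. replace (INR 2) with 2 by (simpl; ring).
      assert (Hc : c = s + E) by (pose proof (cosh_m_sinh T); unfold c, s, E; lra).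
      rewrite Hc in *. field. split; lra.
    + unfold Sn. rewrite S2. replace (INR 2) with 2 by (simpl; ring).
      rewrite sE, cs. field. split; lra.
    + nra.
    (* Dividing s E = (1 - E^2)/2 by E <= 3/8 bounds s below by 4/3 (1 - E^2); the claim becomes
       quadratic in w = 1 - E^2 >= 55/64. *)
    + rewrite sE. assert (4/3 * (1 - E ^ 2) <= s) by nra. set (w := 1 - E ^ 2) in *. assert (55/64 <= w <= 1) by (unfold w; nra). assert (16/9 * w ^ 2 <= s ^ 2) by nra. replace (E ^ 2) with (1 - w) by (unfold w; ring). nra.
  - assert (H3 : (3 <= n)%nat) by lia. pose proof (sn_ratio n H3) as R.
    assert (3 <= INR n) by (apply (le_INR 3) in H3; simpl in H3; lra).
    assert (Sp : 0 < sinh (INR n * T)) by (apply sinh_pos; nra).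
    set (sn := sinh (INR n * T)) in *.
    (* With this ratio, s c / Sn T n = c k and s c rho_n = c k x, so only the bound k <= 4/11 from
       [sn_ratio] is needed. *)
    set (k := s * INR n / sn).
    assert (Hk : 0 < k <= 4 / 11).
    { unfold k; split; [apply Rdiv_lt_0_compat; nra|].
      apply (Rmult_le_reg_r sn); [lra|]. unfold Rdiv. rewrite Rmult_assoc, Rinv_l by lra. nra. }
    set (x := exp (- (INR n * T))).
    assert (Hx : 0 < x <= E).
    { split; [apply exp_pos|]. unfold x, E. destruct (Req_dec (INR n * T) T); [nra|].
      left; apply exp_increasing. nra. }
    assert (Er : s * c * rho T n = c * (k * x)) by (unfold rho, k; fold sn x; field; lra).
    assert (Ez : (s * c) ^ 2 * (z / Sn T n) ^ 2 = c ^ 2 * k ^ 2 * z ^ 2).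
    { unfold Sn, k; fold sn. field. split; lra. }
    apply (Fin (c * E - c * (k * x)) (c ^ 2 - 2 * (c * E - c * (k * x)) - c ^ 2 * k ^ 2)).
    + rewrite Er. field. lra.
    + rewrite Ez. ring.
    + assert (0 < c * (k * x)) by (apply Rmult_lt_0_compat; nra).
      assert (k ^ 2 <= 16 / 121) by (replace (16/121) with ((4/11)^2) by field; apply pow_incr; lra). assert (23127/10000 <= c ^ 2) by nra. assert (E ^ 2 <= 9/64) by nra. assert (c ^ 2 * k ^ 2 <= c ^ 2 * (16/121)) by (apply Rmult_le_compat_l; nra).
      lra.
    + assert (0 < c * (k * x)) by (apply Rmult_lt_0_compat; nra).
      assert (c * (k * x) <= c * E) by (apply Rmult_le_compat_l; nra).
      assert (k ^ 2 <= 16 / 121) by (replace (16/121) with ((4/11)^2) by field; apply pow_incr; lra). assert (23127/10000 <= c ^ 2) by nra. assert (E ^ 2 <= 9/64) by nra. assert (c ^ 2 * k ^ 2 <= c ^ 2 * (16/121)) by (apply Rmult_le_compat_l; nra).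
      assert ((c * E - c * (k * x)) ^ 2 <= (c * E) ^ 2) by (apply pow_incr; lra).
      assert ((c * E) ^ 2 <= 3253/10000) by (rewrite cE; nra). lra.
Qed.

(** Completion of the square of h against s c z / Sn T n, using n coth(n T) = n + rho T n. The
    factor s c is fixed by the extremal map: for n = 1, z = y and d = 0 the subtracted term is cosh
    T y = h, so the square vanishes. *)
Lemma mode_eq n z y d h : (1 <= n)%nat ->
  h = cosh (INR n * T) * y + Sn T n * d ->
  h ^ 2 = (h - s * c * z / Sn T n) ^ 2 + 2 * (s * c) * (z * d) + 2 * (s * c) * (INR n * (z * y))
    + (2 * (s * c) * rho T n * (z * y) - (s * c) ^ 2 * (z / Sn T n) ^ 2).
Proof.
  intros Hn ->. assert (1 <= INR n) by (apply (le_INR 1) in Hn; simpl in Hn; lra).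
  assert (Sp : 0 < sinh (INR n * T)) by (apply sinh_pos; nra).
  unfold Sn, rho. rewrite <- (cosh_m_sinh (INR n * T)). field. split; lra.
Qed.

Lemma mode_one z y :
  2 * (s * c) * rho T 1 * (z * y) - (s * c) ^ 2 * (z / Sn T 1) ^ 2 =
  2 * (s * c) * rho T 1 * (z * y) - c ^ 2 * z ^ 2.
Proof.
  destruct mode_facts as (E0 & sE & cE & s1 & cs & c0 & c1).
  unfold Sn. simpl INR. rewrite Rmult_1_l. fold s. field. lra.
Qed.
End Mode.

(** * The Poisson kernel *)

Lemma cosn_per k q : cos (INR k * (q + 2 * PI)) = cos (INR k * q).
Proof. replace (INR k * (q + 2 * PI)) with (INR k * q + 2 * INR k * PI) by ring. apply cos_period. Qed.
Lemma sinn_per k q : sin (INR k * (q + 2 * PI)) = sin (INR k * q).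
Proof. replace (INR k * (q + 2 * PI)) with (INR k * q + 2 * INR k * PI) by ring. apply sin_period. Qed.

Lemma mean_cos k : (0 < k)%nat -> mean (fun q => cos (INR k * q)) = 0.
Proof.
  intro H. assert (0 < INR k) by now apply lt_0_INR.
  apply (mean_derive0 (fun q => sin (INR k * q) / INR k)).
  - intro x. auto_derive; [trivial|]. field. lra.
  - auto 20 with cts.
  - intro x. now rewrite sinn_per.
Qed.
Lemma mean_cos0 : mean (fun q => cos (INR 0 * q)) = 1.
Proof. rewrite (mean_ext _ (fun _ => 1)); [apply mean_const|]. intro; simpl; now rewrite Rmult_0_l, cos_0. Qed.

Lemma cos_cos n m q : cos (INR n * q) * cos (INR m * q) =
  / 2 * cos (INR (dst n m) * q) + / 2 * cos (INR (n + m) * q).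
Proof.
  assert (E : cos (INR (dst n m) * q) = cos (INR n * q - INR m * q)).
  { destruct (Nat.le_ge_cases m n) as [L|L].
    - replace (dst n m) with (n - m)%nat by (unfold dst; lia). rewrite minus_INR by auto. f_equal; ring.
    - replace (dst n m) with (m - n)%nat by (unfold dst; lia). rewrite minus_INR by auto.
      rewrite <- cos_neg. f_equal; ring. }
  rewrite E, plus_INR, Rmult_plus_distr_r, cos_minus, cos_plus. field.
Qed.
Lemma sin_sin n m q : sin (INR n * q) * sin (INR m * q) =
  / 2 * cos (INR (dst n m) * q) - / 2 * cos (INR (n + m) * q).
Proof.
  assert (E : cos (INR (dst n m) * q) = cos (INR n * q - INR m * q)).
  { destruct (Nat.le_ge_cases m n) as [L|L].
    - replace (dst n m) with (n - m)%nat by (unfold dst; lia). rewrite minus_INR by auto. f_equal; ring.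
    - replace (dst n m) with (m - n)%nat by (unfold dst; lia). rewrite minus_INR by auto.
      rewrite <- cos_neg. f_equal; ring. }
  rewrite E, plus_INR, Rmult_plus_distr_r, cos_minus, cos_plus. field.
Qed.
(** The integrand is odd; the substitution q -> 2 PI - q changes its sign. *)
Lemma cos_even_mean_sin (w : R -> R) n m : cts w -> per w -> (forall q, w (- q) = w q) ->
  mean (fun q => w q * (cos (INR n * q) * sin (INR m * q))) = 0.
Proof.
  intros C P Ev. set (f := fun q => w q * (cos (INR n * q) * sin (INR m * q))).
  assert (Cf : cts f) by (unfold f; auto 20 with cts).
  assert (Pf : per f) by (intro x; unfold f; now rewrite P, cosn_per, sinn_per).
  assert (Od : forall q, f (- q) = - f q).
  { intro q; unfold f. rewrite Ev. replace (INR n * - q) with (- (INR n * q)) by ring.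
    replace (INR m * - q) with (- (INR m * q)) by ring. rewrite cos_neg, sin_neg; ring. }
  assert (S : mean (fun q => f (- q)) = mean f).
  { unfold mean; f_equal.
    pose proof (RInt_comp_lin f (-1) (2 * PI) 0 (2 * PI) (cts_ex_RInt _ _ _ Cf)) as L.
    replace (-1 * 0 + 2 * PI) with (2 * PI) in L by ring.
    replace (-1 * (2 * PI) + 2 * PI) with 0 in L by ring.
    rewrite <- (opp_RInt_swap f) in L by auto 20 with cts.
    unfold opp in L; simpl in L.
    rewrite (RInt_ext _ (fun q => - f (- q))) in L.
    2:{ intros q _. unfold scal; simpl; unfold mult; simpl.
        rewrite <- (Pf (- q)). replace (-1 * q + 2 * PI) with (- q + 2 * PI) by ring. ring. }
    rewrite (RInt_opp (fun q => f (- q))) in L.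
    2:{ apply cts_ex_RInt. apply (cts_comp (fun q => - q) f); auto 20 with cts. }
    unfold opp in L; simpl in L. lra. }
  rewrite (mean_ext _ (fun q => - f q)) in S by exact Od.
  rewrite mean_opp in S by auto. lra.
Qed.

Definition poisson (a q : R) : R := (1 - a ^ 2) / (1 - 2 * a * cos q + a ^ 2).

Section Poisson.
Variable a : R.
Hypothesis Ha : 0 <= a < 1.

Lemma Pden q : (1 - a) ^ 2 <= 1 - 2 * a * cos q + a ^ 2.
Proof. pose proof (COS_bound q). nra. Qed.
Lemma Pden_pos q : 0 < 1 - 2 * a * cos q + a ^ 2.
Proof. pose proof (Pden q). assert (0 < (1 - a) ^ 2) by nra. lra. Qed.
Lemma poisson_pos q : 0 < poisson a q.
Proof. apply Rdiv_lt_0_compat; [nra|apply Pden_pos]. Qed.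
Lemma poisson_cts : cts (poisson a).
Proof.
  unfold poisson. apply cts_div; auto 20 with cts. intro x. pose proof (Pden_pos x); lra.
Qed.
Lemma poisson_per : per (poisson a).
Proof.
  intro q. unfold poisson. pose proof (cosn_per 1 q) as H. simpl INR in H. rewrite !Rmult_1_l in H. now rewrite H.
Qed.
Lemma poisson_even q : poisson a (- q) = poisson a q.
Proof. unfold poisson. now rewrite cos_neg. Qed.
Lemma poisson_bound q : poisson a q <= (1 + a) / (1 - a).
Proof.
  unfold poisson. pose proof (Pden q). pose proof (Pden_pos q).
  apply (Rmult_le_reg_r (1 - 2 * a * cos q + a ^ 2)); [auto|].
  unfold Rdiv at 1. rewrite Rmult_assoc, Rinv_l, Rmult_1_r by lra.
  replace (1 - a ^ 2) with ((1 + a) / (1 - a) * (1 - a) ^ 2) by (field; lra).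
  apply Rmult_le_compat_l; auto. left; apply Rdiv_lt_0_compat; lra.
Qed.

(** The recurrence has characteristic roots a and 1/a. The combination D_k = x_{k+1} - a x_k
    isolates the growing root and is killed by boundedness; the relation at index 0 then excludes
    the decaying one. *)
Lemma bounded_rec (x : nat -> R) M : (forall k, Rabs (x k) <= M) ->
  (1 + a ^ 2) * x O = 2 * a * x 1%nat ->
  (forall k, (1 + a ^ 2) * x (S k) = a * (x (S (S k)) + x k)) -> forall k, x k = 0.
Proof.
  intros B H0 H.
  set (D := fun k => x (S k) - a * x k).
  assert (HD : forall k, D k = a * D (S k)) by (intro k; unfold D; pose proof (H k); lra).
  assert (HDm : forall m k, D k = a ^ m * D (k + m)%nat).
  { induction m as [|m IH]; intro k; [simpl; rewrite Nat.add_0_r; ring|].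
    rewrite (IH k), (HD (k + m)%nat). replace (S (k + m)) with (k + S m)%nat by lia. simpl. ring. }
  assert (BD : forall k, Rabs (D k) <= 2 * M).
  { intro k. unfold D. pose proof (B k) as B1. pose proof (B (S k)) as B2.
    apply Rabs_le_between in B1. apply Rabs_le_between in B2. apply Rabs_le. nra. }
  assert (D0 : D O = 0).
  { assert (M0 : 0 <= M) by (eapply Rle_trans; [apply Rabs_pos|apply (B O)]).
    destruct (Req_dec (D O) 0) as [|N]; auto. exfalso.
    assert (PD : 0 < Rabs (D O)) by now apply Rabs_pos_lt.
    destruct (pow_lt_1_zero a) with (y := Rabs (D O) / (2 * M + 1)) as [m Hm].
    - rewrite Rabs_pos_eq by lra; lra.
    - apply Rdiv_lt_0_compat; lra.
    - specialize (Hm m (le_n m)). rewrite (HDm m O) in PD, Hm at 1.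
      assert (Rabs (D O) = Rabs (a ^ m) * Rabs (D m)) by (rewrite (HDm m O) at 1; apply Rabs_mult).
      rewrite <- (HDm m O) in Hm.
      assert (Rabs (a ^ m) * (2 * M + 1) < Rabs (D O)).
      { apply (Rmult_lt_compat_r (2 * M + 1)) in Hm; [|lra].
        unfold Rdiv in Hm. rewrite Rmult_assoc, Rinv_l, Rmult_1_r in Hm by lra. exact Hm. }
      pose proof (BD m). pose proof (Rabs_pos (a ^ m)). nra. }
  assert (x0 : x O = 0).
  { unfold D in D0. assert (Q : (1 - a ^ 2) * x O = 0) by (replace (x 1%nat) with (a * x O) in H0 by lra; lra).
    apply Rmult_integral in Q. destruct Q; [nra|auto]. }
  assert (Hk : forall k, D k = 0).
  { induction k as [|k IH]; [auto|]. destruct (Req_dec a 0) as [Z|Z].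
    - rewrite HD, Z. ring.
    - rewrite HD in IH. apply Rmult_integral in IH. destruct IH; [contradiction|auto]. }
  induction k as [|k IH]; auto. pose proof (Hk k) as Q. unfold D in Q. rewrite IH in Q. lra.
Qed.

Lemma w_rec (w g : R -> R) k : cts w -> cts g ->
  (forall q, (1 - 2 * a * cos q + a ^ 2) * w q = g q) ->
  (1 + a ^ 2) * mean (fun q => w q * cos (INR (S k) * q)) -
  a * (mean (fun q => w q * cos (INR (S (S k)) * q)) + mean (fun q => w q * cos (INR k * q)))
  = mean (fun q => g q * cos (INR (S k) * q)).
Proof.
  intros Cw Cg Hw.
  rewrite <- mean_plus by auto 20 with cts. rewrite <- !mean_scal by auto 20 with cts.
  rewrite <- mean_minus by auto 20 with cts. apply mean_ext; intro q. rewrite <- Hw.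
  assert (E : cos (INR (S (S k)) * q) + cos (INR k * q) = 2 * (cos q * cos (INR (S k) * q))).
  { rewrite !S_INR. replace ((INR k + 1 + 1) * q) with ((INR k + 1) * q + q) by ring.
    replace (INR k * q) with ((INR k + 1) * q - q) by ring. rewrite cos_plus, cos_minus. ring. }
  nra.
Qed.
Lemma w_rec0 (w g : R -> R) : cts w -> cts g ->
  (forall q, (1 - 2 * a * cos q + a ^ 2) * w q = g q) ->
  (1 + a ^ 2) * mean (fun q => w q * cos (INR 0 * q)) -
  2 * a * mean (fun q => w q * cos (INR 1 * q)) = mean (fun q => g q * cos (INR 0 * q)).
Proof.
  intros Cw Cg Hw. rewrite <- !mean_scal by auto 20 with cts.
  rewrite <- mean_minus by auto 20 with cts. apply mean_ext; intro q. rewrite <- Hw.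
  simpl INR. rewrite Rmult_0_l, cos_0, Rmult_1_l. ring.
Qed.

(** Multiplication by the denominator of the Poisson kernel couples neighbouring cosine
    coefficients. Any bounded solution p of the resulting recurrence gives the coefficients, so no
    series has to be summed under the integral. *)
Lemma w_solve (w g : R -> R) (p : nat -> R) (M M' : R) : cts w -> cts g ->
  (forall q, (1 - 2 * a * cos q + a ^ 2) * w q = g q) ->
  (forall q, Rabs (w q) <= M) -> (forall k, Rabs (p k) <= M') ->
  (1 + a ^ 2) * p O - 2 * a * p 1%nat = mean (fun q => g q * cos (INR 0 * q)) ->
  (forall k, (1 + a ^ 2) * p (S k) - a * (p (S (S k)) + p k) = mean (fun q => g q * cos (INR (S k) * q))) ->
  forall k, mean (fun q => w q * cos (INR k * q)) = p k.
Proof.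
  intros Cw Cg Hw Bw Bp p0 pk k.
  apply Rminus_diag_uniq.
  apply (bounded_rec (fun k => mean (fun q => w q * cos (INR k * q)) - p k) (M + M')).
  - intro j. unfold Rminus. eapply Rle_trans; [apply Rabs_triang|]. rewrite Rabs_Ropp.
    apply Rplus_le_compat; [|apply Bp]. apply mean_bound; [auto 20 with cts|].
    intro q. rewrite Rabs_mult. rewrite <- (Rmult_1_r M).
    apply Rmult_le_compat; try apply Rabs_pos; [apply Bw|].
    apply Rabs_le, COS_bound.
  - pose proof (w_rec0 w g Cw Cg Hw). lra.
  - intro j. pose proof (w_rec w g j Cw Cg Hw). pose proof (pk j). lra.
Qed.

Lemma mean_poisson k : mean (fun q => poisson a q * cos (INR k * q)) = a ^ k.
Proof.
  apply (w_solve (poisson a) (fun _ => 1 - a ^ 2) (fun k => a ^ k) ((1 + a) / (1 - a)) 1).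
  - apply poisson_cts. - apply cts_const.
  - intro q. unfold poisson. field. pose proof (Pden_pos q); lra.
  - intro q. rewrite Rabs_pos_eq; [apply poisson_bound|left; apply poisson_pos].
  - intro j. rewrite Rabs_pos_eq by (apply pow_le; lra).
    rewrite <- (pow1 j). apply pow_incr; lra.
  - rewrite mean_scal by auto 20 with cts. rewrite mean_cos0. simpl. ring.
  - intro j. rewrite mean_scal by auto 20 with cts. rewrite mean_cos by lia. simpl. ring.
Qed.

(** k a^k is at most a^0 + ... + a^{k-1}, since a^k is below each term. *)
Lemma INR_pow_bound k : INR k * a ^ k <= / (1 - a).
Proof.
  assert (H : forall n, sm n (fun i => a ^ i) = (1 - a ^ n) / (1 - a)).
  { induction n as [|n IH]; [simpl; field; lra|]. simpl sm. rewrite IH. simpl. field. lra. }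
  assert (G : INR k * a ^ k <= sm k (fun i => a ^ i)).
  { assert (G1 : forall n, (n <= k)%nat -> INR n * a ^ k <= sm n (fun i => a ^ i)).
    { induction n as [|n IH]; intro L; [simpl; lra|]. rewrite S_INR. simpl sm.
      assert (a ^ k <= a ^ n).
      { replace k with (n + (k - n))%nat by lia. rewrite pow_add. rewrite <- (Rmult_1_r (a ^ n)) at 2.
        apply Rmult_le_compat_l; [apply pow_le; lra|]. rewrite <- (pow1 (k - n)). apply pow_incr; lra. }
      specialize (IH ltac:(lia)). lra. }
    apply G1, le_n. }
  rewrite H in G. eapply Rle_trans; [apply G|]. unfold Rdiv. rewrite <- (Rmult_1_l (/ (1 - a))) at 2.
  apply Rmult_le_compat_r; [left; apply Rinv_0_lt_compat; lra|].
  assert (0 <= a ^ k) by (apply pow_le; lra). lra.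
Qed.

Lemma vv_pos : 1 <= vv a.
Proof.
  unfold vv. assert (0 < 1 - a ^ 2) by nra.
  apply (Rmult_le_reg_r (1 - a ^ 2)); auto. unfold Rdiv. rewrite Rmult_assoc, Rinv_l; nra.
Qed.

(** Times the denominator, P^2 becomes (1 - a^2) P, whose coefficients are known. The resonance of
    the right side with the root a produces the factor linear in k. *)
Lemma mean_poisson2 k : mean (fun q => poisson a q ^ 2 * cos (INR k * q)) = a ^ k * (INR k + vv a).
Proof.
  assert (B0 : 0 <= (1 + a) / (1 - a)) by (left; apply Rdiv_lt_0_compat; lra).
  pose proof poisson_cts.
  apply (w_solve (fun q => poisson a q ^ 2) (fun q => (1 - a ^ 2) * poisson a q) (fun k => a ^ k * (INR k + vv a))
    (((1 + a) / (1 - a)) ^ 2) (/ (1 - a) + vv a)).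
  - auto 20 with cts. - auto 20 with cts.
  - intro q. unfold poisson. field. pose proof (Pden_pos q); lra.
  - intro q. rewrite Rabs_pos_eq by apply pow2_ge_0. apply pow_incr; split; [left; apply poisson_pos|apply poisson_bound].
  - intro j. pose proof vv_pos. pose proof (pos_INR j). assert (0 <= a ^ j) by (apply pow_le; lra).
    rewrite Rabs_pos_eq by nra. rewrite Rmult_plus_distr_l. apply Rplus_le_compat.
    + rewrite Rmult_comm. apply INR_pow_bound.
    + rewrite <- (Rmult_1_l (vv a)) at 2. apply Rmult_le_compat_r; [lra|].
      rewrite <- (pow1 j). apply pow_incr; lra.
  - rewrite (mean_ext _ (fun q => (1 - a ^ 2) * (poisson a q * cos (INR 0 * q)))) by (intro; ring).
    rewrite mean_scal by auto 20 with cts. rewrite mean_poisson. unfold vv. simpl. field. nra.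
  - intro j. rewrite (mean_ext _ (fun q => (1 - a ^ 2) * (poisson a q * cos (INR (S j) * q)))) by (intro; ring).
    rewrite mean_scal by auto 20 with cts. rewrite mean_poisson. unfold vv. rewrite !S_INR. simpl. field. nra.
Qed.
End Poisson.

(** * Trigonometric polynomials and the key inequality *)

Definition poly (N : nat) (X Y : nat -> R) (q : R) : R :=
  sm (S N) (fun n => X n * cos (INR n * q) + Y n * sin (INR n * q)).

Lemma sm_cts n (f : nat -> R -> R) : (forall i, cts (f i)) -> cts (fun q => sm n (fun i => f i q)).
Proof. intro H; induction n as [|n IH]; simpl; auto 20 with cts. Qed.
Lemma poly_cts N X Y : cts (poly N X Y).
Proof. apply (sm_cts (S N) (fun n q => X n * cos (INR n * q) + Y n * sin (INR n * q))); auto 20 with cts. Qed.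
Lemma poly_per N X Y : per (poly N X Y).
Proof. intro q; apply sm_ext; intros; now rewrite cosn_per, sinn_per. Qed.
#[export] Hint Resolve poly_cts sm_cts : cts.

Lemma mean_sm n (f : nat -> R -> R) : (forall i, cts (f i)) ->
  mean (fun q => sm n (fun i => f i q)) = sm n (fun i => mean (f i)).
Proof.
  intro H; induction n as [|n IH]; simpl; [apply mean_const|].
  rewrite mean_plus by auto 20 with cts. now rewrite IH.
Qed.

Lemma mean_poly f N X Y : cts f -> mean (fun q => f q * poly N X Y q) =
  sm (S N) (fun n => X n * mean (fun q => f q * cos (INR n * q)) + Y n * mean (fun q => f q * sin (INR n * q))).
Proof.
  intro C. unfold poly.
  rewrite (mean_ext _ (fun q => sm (S N) (fun n => X n * (f q * cos (INR n * q)) + Y n * (f q * sin (INR n * q))))).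
  2:{ intro q. rewrite <- sm_scal. apply sm_ext; intros; ring. }
  rewrite (mean_sm (S N) (fun n q => X n * (f q * cos (INR n * q)) + Y n * (f q * sin (INR n * q)))) by auto 20 with cts.
  apply sm_ext; intros n _. rewrite mean_plus, !mean_scal by auto 20 with cts. reflexivity.
Qed.

(** An even weight does not mix sines and cosines, so only X survives; the product formula leaves a
    difference and a sum of frequencies. *)
Lemma mean_wpoly_cos w N X Y k : cts w -> per w -> (forall q, w (- q) = w q) ->
  mean (fun q => w q * poly N X Y q * cos (INR k * q)) =
  sm (S N) (fun m => X m * (/ 2 * mean (fun q => w q * cos (INR (dst m k) * q)) + / 2 * mean (fun q => w q * cos (INR (m + k) * q)))).
Proof.
  intros C P E.
  rewrite (mean_ext _ (fun q => (w q * cos (INR k * q)) * poly N X Y q)) by (intro; ring).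
  rewrite mean_poly by auto 20 with cts. apply sm_ext; intros m _.
  rewrite (mean_ext (fun q => w q * cos (INR k * q) * sin (INR m * q)) (fun q => w q * (cos (INR k * q) * sin (INR m * q)))) by (intro; ring).
  rewrite cos_even_mean_sin by auto. rewrite Rmult_0_r, Rplus_0_r. f_equal.
  rewrite <- !mean_scal, <- mean_plus by auto 20 with cts. apply mean_ext; intro q.
  pose proof (cos_cos m k q). nra.
Qed.
Lemma mean_wpoly_sin w N X Y k : cts w -> per w -> (forall q, w (- q) = w q) ->
  mean (fun q => w q * poly N X Y q * sin (INR k * q)) =
  sm (S N) (fun m => Y m * (/ 2 * mean (fun q => w q * cos (INR (dst m k) * q)) - / 2 * mean (fun q => w q * cos (INR (m + k) * q)))).
Proof.
  intros C P E.
  rewrite (mean_ext _ (fun q => (w q * sin (INR k * q)) * poly N X Y q)) by (intro; ring).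
  rewrite mean_poly by auto 20 with cts. apply sm_ext; intros m _.
  rewrite (mean_ext (fun q => w q * sin (INR k * q) * cos (INR m * q)) (fun q => w q * (cos (INR m * q) * sin (INR k * q)))) by (intro; ring).
  rewrite cos_even_mean_sin by auto. rewrite Rmult_0_r, Rplus_0_l. f_equal.
  rewrite <- !mean_scal, <- mean_minus by auto 20 with cts. apply mean_ext; intro q.
  pose proof (sin_sin m k q). nra.
Qed.

Lemma mean_cosk k : mean (fun q => 1 * cos (INR k * q)) = if Nat.eqb k 0 then 1 else 0.
Proof.
  rewrite (mean_ext _ (fun q => cos (INR k * q))) by (intro; ring).
  destruct k; [apply mean_cos0|apply mean_cos; lia].
Qed.

Lemma sm_single N k (f : nat -> R) : (forall i, i <> k -> f i = 0) ->
  sm N f = if Nat.ltb k N then f k else 0.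
Proof.
  intro H; induction N as [|N IH]; [reflexivity|]. simpl sm. rewrite IH.
  destruct (Nat.ltb_spec k N), (Nat.ltb_spec k (S N)); try lia; try (rewrite (H N) by lia; ring).
  - replace N with k by lia. ring.
Qed.

Lemma coef_poly_cos N X Y k : (0 < k <= N)%nat -> mean (fun q => poly N X Y q * cos (INR k * q)) = X k / 2.
Proof.
  intro H. rewrite (mean_ext _ (fun q => 1 * poly N X Y q * cos (INR k * q))) by (intro; ring).
  rewrite (mean_wpoly_cos (fun _ => 1)); auto 20 with cts; [|intro; reflexivity].
  rewrite (sm_single (S N) k).
  - destruct (Nat.ltb_spec k (S N)); [|lia]. rewrite !mean_cosk.
    replace (dst k k) with O by (unfold dst; lia). destruct (Nat.eqb_spec (k + k) 0); [lia|]. simpl. field.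
  - intros i Hi. rewrite !mean_cosk.
    destruct (Nat.eqb_spec (i + k) 0), (Nat.eqb_spec (dst i k) 0); try (unfold dst in *; lia). ring.
Qed.
Lemma coef_poly_sin N X Y k : (0 < k <= N)%nat -> mean (fun q => poly N X Y q * sin (INR k * q)) = Y k / 2.
Proof.
  intro H. rewrite (mean_ext _ (fun q => 1 * poly N X Y q * sin (INR k * q))) by (intro; ring).
  rewrite (mean_wpoly_sin (fun _ => 1)); auto 20 with cts; [|intro; reflexivity].
  rewrite (sm_single (S N) k).
  - destruct (Nat.ltb_spec k (S N)); [|lia]. rewrite !mean_cosk.
    replace (dst k k) with O by (unfold dst; lia). destruct (Nat.eqb_spec (k + k) 0); [lia|]. simpl. field.
  - intros i Hi. rewrite !mean_cosk.
    destruct (Nat.eqb_spec (i + k) 0), (Nat.eqb_spec (dst i k) 0); try (unfold dst in *; lia). ring.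
Qed.
Lemma coef_poly_0 N X Y : mean (poly N X Y) = X O.
Proof.
  rewrite (mean_ext _ (fun q => 1 * poly N X Y q * cos (INR 0 * q))).
  2:{ intro q. simpl INR. rewrite Rmult_0_l, cos_0. ring. }
  rewrite (mean_wpoly_cos (fun _ => 1)); auto 20 with cts; [|intro; reflexivity].
  rewrite (sm_single (S N) 0).
  - rewrite !mean_cosk. simpl. field.
  - intros i Hi. rewrite !mean_cosk.
    destruct (Nat.eqb_spec (i + 0) 0), (Nat.eqb_spec (dst i 0) 0); try (unfold dst in *; lia). ring.
Qed.

Lemma mean_poly' f N X Y : cts f -> mean (fun q => f q * poly N X Y q) = X O * mean f +
  / 2 * sm N (fun i => X (S i) * (2 * mean (fun q => f q * cos (INR (S i) * q))) + Y (S i) * (2 * mean (fun q => f q * sin (INR (S i) * q)))).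
Proof.
  intro C. rewrite mean_poly by auto. rewrite sm_shift.
  rewrite (mean_ext (fun q => f q * cos (INR 0 * q)) f) by (intro; simpl INR; rewrite Rmult_0_l, cos_0; ring).
  rewrite (mean_ext (fun q => f q * sin (INR 0 * q)) (fun _ => 0)) by (intro; simpl INR; rewrite Rmult_0_l, sin_0; ring).
  rewrite mean_const, Rmult_0_r, Rplus_0_r. f_equal. rewrite <- sm_scal. apply sm_ext; intros; field.
Qed.

Lemma poly_energy N X Y : mean (fun q => poly N X Y q ^ 2) = X O ^ 2 + / 2 * sm N (fun i => X (S i) ^ 2 + Y (S i) ^ 2).
Proof.
  rewrite (mean_ext _ (fun q => poly N X Y q * poly N X Y q)) by (intro; ring).
  rewrite mean_poly' by auto 20 with cts. rewrite coef_poly_0. f_equal; [ring|]. f_equal.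
  apply sm_ext; intros i Hi. rewrite coef_poly_cos, coef_poly_sin by lia. field.
Qed.

(** Index 0 is normalised separately so that [poly N (fcos f) (fsin f)] is the partial Fourier sum
    without a factor 1/2. *)
Definition fcos (f : R -> R) (n : nat) : R := match n with O => mean f | S _ => 2 * mean (fun q => f q * cos (INR n * q)) end.
Definition fsin (f : R -> R) (n : nat) : R := 2 * mean (fun q => f q * sin (INR n * q)).

Lemma bessel f N : cts f -> fcos f O ^ 2 + / 2 * sm N (fun i => fcos f (S i) ^ 2 + fsin f (S i) ^ 2) <= mean (fun q => f q ^ 2).
Proof.
  intro C. set (p := poly N (fcos f) (fsin f)).
  assert (E1 : mean (fun q => f q * p q) = fcos f O ^ 2 + / 2 * sm N (fun i => fcos f (S i) ^ 2 + fsin f (S i) ^ 2)).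
  { unfold p. rewrite mean_poly' by auto. unfold fcos at 1, fsin at 2. f_equal; [simpl; ring|]. f_equal.
    apply sm_ext; intros; unfold fcos, fsin; ring. }
  assert (E2 : mean (fun q => p q ^ 2) = fcos f O ^ 2 + / 2 * sm N (fun i => fcos f (S i) ^ 2 + fsin f (S i) ^ 2)) by apply poly_energy.
  assert (Cp : cts p) by apply poly_cts.
  assert (G : 0 <= mean (fun q => (f q - p q) ^ 2)) by (apply mean_ge0; [auto 20 with cts|intro; apply pow2_ge_0]).
  rewrite (mean_ext _ (fun q => (f q ^ 2 + p q ^ 2) - 2 * (f q * p q))) in G by (intro; ring).
  rewrite mean_minus, mean_plus, mean_scal in G by auto 20 with cts. lra.
Qed.

(** * Completing squares against the Poisson multiplier *)

Section Key.
Variables (a : R) (N : nat) (X Y : nat -> R).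
Hypothesis Ha : 0 <= a < 1.
Hypothesis H0 : sm (S N) (fun n => X n * a ^ n) = 0.
Let u := poly N X Y.
Let P := poisson a.
Let zX n := fcos (fun q => P q * u q) n.
Let zY n := fsin (fun q => P q * u q) n.
Let m1 := mean (fun q => P q * u q ^ 2).
Let m2 := mean (fun q => P q ^ 2 * u q ^ 2).

Let CP : cts P := poisson_cts a Ha.
Let Cu : cts u := poly_cts N X Y.
Let PP : per P := poisson_per a.
Let EP : forall q, P (- q) = P q := poisson_even a.
(** A sine series has no term of index 0, so that coefficient is free; it is chosen to make a a root
    as well. *)
Let F n := match n with O => - sm N (fun i => Y (S i) * a ^ S i) | S _ => Y n end.

Lemma odd_root : sm (S N) (fun n => F n * a ^ n) = 0.
Proof. rewrite sm_shift. unfold F. change (a ^ 0) with 1. ring. Qed.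

(** The product formula gives a^|n-m| + a^{n+m}; the second part sums to a^n times the root
    condition. *)
Lemma zX_form n : (0 < n)%nat -> zX n = sm (S N) (fun m => X m * a ^ dst n m).
Proof.
  intro Hn. unfold zX, fcos. destruct n as [|n]; [lia|].
  unfold u. rewrite mean_wpoly_cos by auto. rewrite <- sm_scal.
  rewrite (sm_ext (S N) _ (fun m => X m * a ^ dst (S n) m + a ^ S n * (X m * a ^ m))).
  2:{ intros m _. unfold P. rewrite !mean_poisson by auto. rewrite pow_add.
      replace (dst m (S n)) with (dst (S n) m) by (unfold dst; lia). field. }
  rewrite sm_plus, sm_scal, H0. ring.
Qed.
(** The Poisson integral of u at the point a, where the extension of u vanishes. *)
Lemma zX0_form : mean (fun q => P q * u q) = 0.
Proof.
  rewrite (mean_ext _ (fun q => P q * u q * cos (INR 0 * q))).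
  2:{ intro; simpl INR; rewrite Rmult_0_l, cos_0; ring. }
  unfold u. rewrite mean_wpoly_cos by auto. rewrite <- H0. apply sm_ext; intros m _.
  unfold P; rewrite !mean_poisson by auto. replace (dst m 0) with m by (unfold dst; lia). rewrite Nat.add_0_r. field.
Qed.
Lemma zY_form n : (0 < n)%nat -> zY n = sm (S N) (fun m => F m * a ^ dst n m).
Proof.
  intro Hn. unfold zY, fsin. unfold u. rewrite mean_wpoly_sin by auto. rewrite <- sm_scal.
  rewrite !sm_shift. unfold F at 1. unfold P; rewrite !mean_poisson by auto.
  replace (dst 0 n) with n by (unfold dst; lia). replace (dst n 0) with n by (unfold dst; lia).
  replace (0 + n)%nat with n by lia.
  rewrite (sm_ext N (fun i => 2 * _) (fun i => F (S i) * a ^ dst n (S i) - a ^ n * (Y (S i) * a ^ S i))).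
  2:{ intros m _. rewrite !mean_poisson by auto. rewrite pow_add.
      replace (dst (S m) n) with (dst n (S m)) by (unfold dst; lia). unfold F. field. }
  rewrite sm_minus, sm_scal. ring.
Qed.

(** The term proportional to a^n does not vanish here, but it does once it is paired with X_n and
    summed, again by the root condition. For the sines in [zY2_form] the corresponding term changes
    sign. *)
Lemma zX2_form n : 2 * mean (fun q => P q ^ 2 * u q * cos (INR n * q)) =
  sm (S N) (fun m => X m * (a ^ dst n m * (INR (dst n m) + vv a))) + a ^ n * sm (S N) (fun m => X m * a ^ m * INR m).
Proof.
  unfold u. rewrite (mean_wpoly_cos (fun q => P q ^ 2)); auto 20 with cts.
  2:{ intro q; now rewrite PP. } 2:{ intro q; now rewrite EP. }
  rewrite <- sm_scal.
  rewrite (sm_ext (S N) _ (fun m => X m * (a ^ dst n m * (INR (dst n m) + vv a)) + a ^ n * (X m * a ^ m * INR m) + a ^ n * (INR n + vv a) * (X m * a ^ m))).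
  2:{ intros m _. unfold P. rewrite !mean_poisson2 by auto. rewrite pow_add, plus_INR.
      replace (dst m n) with (dst n m) by (unfold dst; lia). field. }
  rewrite !sm_plus, !sm_scal, H0. ring.
Qed.
Lemma zY2_form n : (0 < n)%nat -> 2 * mean (fun q => P q ^ 2 * u q * sin (INR n * q)) =
  sm (S N) (fun m => F m * (a ^ dst n m * (INR (dst n m) + vv a))) - a ^ n * sm (S N) (fun m => F m * a ^ m * INR m).
Proof.
  intro Hn. unfold u. rewrite (mean_wpoly_sin (fun q => P q ^ 2)); auto 20 with cts.
  2:{ intro q; now rewrite PP. } 2:{ intro q; now rewrite EP. }
  rewrite <- sm_scal. pose proof odd_root as R. rewrite sm_shift in R. change (a ^ 0) with 1 in R. rewrite Rmult_1_r in R.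
  rewrite !sm_shift. unfold P; rewrite !mean_poisson2 by auto.
  replace (dst 0 n) with n by (unfold dst; lia). replace (dst n 0) with n by (unfold dst; lia).
  replace (0 + n)%nat with n by lia.
  rewrite (sm_ext N (fun i => 2 * _) (fun i => F (S i) * (a ^ dst n (S i) * (INR (dst n (S i)) + vv a)) - a ^ n * (F (S i) * a ^ S i * INR (S i)) - a ^ n * (INR n + vv a) * (F (S i) * a ^ S i))).
  2:{ intros m _. rewrite !mean_poisson2 by auto. rewrite pow_add, plus_INR.
      replace (dst (S m) n) with (dst n (S m)) by (unfold dst; lia). unfold F. field. }
  rewrite !sm_minus, !sm_scal.
  replace (sm N (fun i => F (S i) * a ^ S i)) with (- F O) by lra. change (INR 0) with 0. ring.
Qed.

Lemma m1_form : m1 = / 2 * sm N (fun i => X (S i) * zX (S i) + Y (S i) * zY (S i)).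
Proof.
  unfold m1. rewrite (mean_ext _ (fun q => (P q * u q) * poly N X Y q)) by (intro; unfold u; ring).
  rewrite mean_poly' by auto 20 with cts. fold u. rewrite zX0_form. unfold zX, zY, fcos, fsin. ring.
Qed.

(** In the coefficients, the sum on the right, [m2] and [m1] are quadratic forms with kernel a^|n-m|
    times (n + m)/2, (|n - m| + v)/2 and 1/2 respectively, with v = [vv a], so the claim is
    [weighted_form] added up for cosines and sines. *)
Lemma L_form : 3 * m2 - vv a * m1 <= sm N (fun i => INR (S i) * (X (S i) * zX (S i) + Y (S i) * zY (S i))).
Proof.
  pose proof (weighted_form a N X Ha H0) as WX. pose proof (weighted_form a N F Ha odd_root) as WF.
  (* By symmetry of a^|n-m|, the weight (n + m)/2 may be replaced by n. *)
  assert (Dec : forall G, qf (S N) (fun n m => a ^ dst n m * ((INR n + INR m) / 2 - 3 / 2 * INR (dst n m) - vv a)) G =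
    sm (S N) (fun n => INR n * G n * sm (S N) (fun m => G m * a ^ dst n m))
    - 3 / 2 * sm (S N) (fun n => G n * sm (S N) (fun m => G m * (a ^ dst n m * (INR (dst n m) + vv a))))
    + vv a / 2 * sm (S N) (fun n => G n * sm (S N) (fun m => G m * a ^ dst n m))).
  { intro G.
    assert (Sy : sm (S N) (fun n => G n * sm (S N) (fun m => INR m * G m * a ^ dst n m)) =
                 sm (S N) (fun n => INR n * G n * sm (S N) (fun m => G m * a ^ dst n m))).
    { rewrite (sm_ext (S N) _ (fun n => sm (S N) (fun m => G n * (INR m * G m * a ^ dst n m)))).
      2:{ intros; now rewrite sm_scal. }
      rewrite sm_swap. apply sm_ext; intros m _. rewrite <- sm_scal. apply sm_ext; intros n _.
      replace (dst n m) with (dst m n) by (unfold dst; lia). ring. }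
    replace (sm (S N) (fun n => INR n * G n * sm (S N) (fun m => G m * a ^ dst n m))) with
      (/ 2 * sm (S N) (fun n => INR n * G n * sm (S N) (fun m => G m * a ^ dst n m)) + / 2 *
       sm (S N) (fun n => G n * sm (S N) (fun m => INR m * G m * a ^ dst n m))) by (rewrite Sy; field).
    unfold qf. rewrite <- !sm_scal, <- sm_plus, <- sm_minus, <- sm_plus. apply sm_ext; intros n _.
    rewrite <- !sm_scal, <- sm_plus, <- sm_minus, <- sm_plus. apply sm_ext; intros m _. field. }
  rewrite Dec in WX, WF. clear Dec.
  (* The sine coefficients, completed by [F 0], also vanish at [a], so both halves have the form bounded by [weighted_form]. *)
  assert (M2 : m2 = / 2 * sm (S N) (fun n => X n * sm (S N) (fun m => X m * (a ^ dst n m * (INR (dst n m) + vv a))))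
                  + / 2 * sm (S N) (fun n => F n * sm (S N) (fun m => F m * (a ^ dst n m * (INR (dst n m) + vv a))))).
  { unfold m2. rewrite (mean_ext _ (fun q => (P q ^ 2 * u q) * poly N X Y q)) by (intro; unfold u; ring).
    rewrite mean_poly by auto 20 with cts. fold u.
    rewrite sm_plus. f_equal.
    - rewrite <- sm_scal.
      rewrite (sm_ext (S N) _ (fun n => / 2 * (X n * sm (S N) (fun m => X m * (a ^ dst n m * (INR (dst n m) + vv a))))
         + / 2 * sm (S N) (fun m => X m * a ^ m * INR m) * (X n * a ^ n))).
      + rewrite sm_plus, (sm_scal (S N) (/ 2 * sm (S N) (fun m => X m * a ^ m * INR m))), H0. ring.
      + intros n _. pose proof (zX2_form n). nra.
    - set (S1 := sm (S N) (fun m => F m * a ^ m * INR m)).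
      rewrite !sm_shift.
      rewrite (mean_ext (fun q => P q ^ 2 * u q * sin (INR 0 * q)) (fun _ => 0)) by (intro; simpl INR; rewrite Rmult_0_l, sin_0; ring).
      rewrite mean_const, Rmult_0_r, Rplus_0_l.
      rewrite (sm_ext N (fun i => Y (S i) * _) (fun i => / 2 * (F (S i) * sm (S N) (fun m => F m * (a ^ dst (S i) m * (INR (dst (S i) m) + vv a)))) - / 2 * S1 * (F (S i) * a ^ S i))).
      2:{ intros i _. pose proof (zY2_form (S i) ltac:(lia)) as Z. fold S1 in Z.
          change (Y (S i)) with (F (S i)).
          replace (mean (fun q => P q ^ 2 * u q * sin (INR (S i) * q))) with (/ 2 * (2 * mean (fun q => P q ^ 2 * u q * sin (INR (S i) * q)))) by field.
          rewrite Z. ring. }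
      rewrite sm_minus, (sm_scal N (/ 2 * S1)), sm_scal.
      pose proof odd_root as R. rewrite sm_shift in R. change (a ^ 0) with 1 in R. rewrite Rmult_1_r in R.
      replace (sm N (fun i => F (S i) * a ^ S i)) with (- F O) by lra.
      assert (W0 : F O * (a ^ dst 0 0 * (INR (dst 0 0) + vv a)) + sm N (fun i => F (S i) * (a ^ dst 0 (S i) * (INR (dst 0 (S i)) + vv a))) = S1).
      { unfold S1. rewrite sm_shift. change (dst 0 0) with O. simpl INR at 1 3. simpl pow at 1 3.
        rewrite (sm_ext N _ (fun i => F (S i) * a ^ S i * INR (S i) + vv a * (F (S i) * a ^ S i))).
        2:{ intros i _. replace (dst 0 (S i)) with (S i) by (unfold dst; lia). ring. }
        rewrite sm_plus, sm_scal. replace (sm N (fun i => F (S i) * a ^ S i)) with (- F O) by lra. ring. }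
      rewrite W0. ring. }
  assert (M1 : m1 = / 2 * sm (S N) (fun n => X n * sm (S N) (fun m => X m * a ^ dst n m))
                  + / 2 * sm (S N) (fun n => F n * sm (S N) (fun m => F m * a ^ dst n m))).
  { rewrite m1_form. rewrite sm_plus, Rmult_plus_distr_l.
    rewrite (sm_shift N (fun n => X n * sm (S N) (fun m => X m * a ^ dst n m))).
    rewrite (sm_shift N (fun n => F n * sm (S N) (fun m => F m * a ^ dst n m))).
    assert (Z0 : forall G, sm (S N) (fun m => G m * a ^ dst 0 m) = sm (S N) (fun m => G m * a ^ m)).
    { intro G; apply sm_ext; intros m _. replace (dst 0 m) with m by (unfold dst; lia). reflexivity. }
    rewrite !Z0, H0, odd_root, !Rmult_0_r, !Rplus_0_l. f_equal; f_equal; apply sm_ext; intros i _.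
    - now rewrite zX_form by lia. - now rewrite zY_form by lia. }
  assert (LL : sm N (fun i => INR (S i) * (X (S i) * zX (S i) + Y (S i) * zY (S i))) =
     sm (S N) (fun n => INR n * X n * sm (S N) (fun m => X m * a ^ dst n m))
     + sm (S N) (fun n => INR n * F n * sm (S N) (fun m => F m * a ^ dst n m))).
  { rewrite (sm_shift N (fun n => INR n * X n * sm (S N) (fun m => X m * a ^ dst n m))).
    rewrite (sm_shift N (fun n => INR n * F n * sm (S N) (fun m => F m * a ^ dst n m))).
    simpl (INR 0). rewrite !Rmult_0_l, !Rplus_0_l, <- sm_plus. apply sm_ext; intros i _.
    rewrite zX_form, zY_form by lia. change (F (S i)) with (Y (S i)). ring. }
  rewrite LL, M1, M2. lra.
Qed.

Variable T : R.
Hypothesis HT : 0 < T.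
Hypothesis HE : exp (- T) <= 3 / 8.
Variables DX DY HX HY : nat -> R.
Hypothesis EX : forall n, (0 < n <= N)%nat -> HX n = cosh (INR n * T) * X n + Sn T n * DX n.
Hypothesis EY : forall n, (0 < n <= N)%nat -> HY n = cosh (INR n * T) * Y n + Sn T n * DY n.
Let mu := sinh T * cosh T.
Let m0 := mean (fun q => u q ^ 2).

(* What completing the squares gives away; its smallness determines the equality case. *)
Definition slack : R := HX O ^ 2 +
  / 2 * sm N (fun i => (HX (S i) - mu * zX (S i) / Sn T (S i)) ^ 2 + (HY (S i) - mu * zY (S i) / Sn T (S i)) ^ 2
     + match i with O => 0 | S _ => (zX (S i) ^ 2 + zY (S i) ^ 2) / 20 end).

(** [mode_eq] is summed over all modes, with [mode_one] for the first and [mode_ineq] for the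
    others. The sums over modes are then turned into means: [L_form] for the weight n, [m1_form] for
    the products with z, and Bessel for the two sums of squares that enter with a minus sign. *)
Lemma key_lemma :
  slack + 2 * mu * mean (fun q => P q * (u q * poly N DX DY q)) + mu * (3 * m2 - vv a * m1)
   + 2 * mu * rho T 1 * m1 - cosh T ^ 2 * m2 - (m2 - 2 * m1 + m0) / 2
  <= HX O ^ 2 + / 2 * sm N (fun i => HX (S i) ^ 2 + HY (S i) ^ 2).
Proof.
  assert (mu0 : 0 < mu).
  { unfold mu. pose proof (sinh_pos T HT). pose proof (cosh_ge1 T). nra. }
  assert (B2 : / 2 * sm N (fun i => zX (S i) ^ 2 + zY (S i) ^ 2) <= m2).
  { pose proof (bessel (fun q => P q * u q) N ltac:(auto 20 with cts)) as B.
    unfold m2. rewrite (mean_ext _ (fun q => (P q * u q) ^ 2)) by (intro; ring).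
    unfold zX, zY. pose proof (pow2_ge_0 (fcos (fun q => P q * u q) 0)). lra. }
  (* Bessel for (P - 1) u. *)
  assert (B3 : / 2 * sm N (fun i => (zX (S i) - X (S i)) ^ 2 + (zY (S i) - Y (S i)) ^ 2) <= m2 - 2 * m1 + m0).
  { pose proof (bessel (fun q => P q * u q - u q) N ltac:(auto 20 with cts)) as B. cbv beta in B.
    rewrite (mean_ext (fun q => (P q * u q - u q) ^ 2) (fun q => P q ^ 2 * u q ^ 2 - 2 * (P q * u q ^ 2) + u q ^ 2)) in B by (intro; ring).
    rewrite mean_plus, mean_minus, mean_scal in B by auto 20 with cts. fold m0 m1 m2 in B.
    rewrite (sm_ext N (fun i => fcos _ (S i) ^ 2 + _) (fun i => (zX (S i) - X (S i)) ^ 2 + (zY (S i) - Y (S i)) ^ 2)) in B.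
    - pose proof (pow2_ge_0 (fcos (fun q => P q * u q - u q) 0)). lra.
    - intros i Hi. f_equal; f_equal.
      + unfold zX, fcos. rewrite (mean_ext (fun q => (P q * u q - u q) * cos (INR (S i) * q)) (fun q => P q * u q * cos (INR (S i) * q) - u q * cos (INR (S i) * q))) by (intro; ring).
        rewrite mean_minus by auto 20 with cts. unfold u at 2. rewrite coef_poly_cos by lia. field.
      + unfold zY, fsin. rewrite (mean_ext (fun q => (P q * u q - u q) * sin (INR (S i) * q)) (fun q => P q * u q * sin (INR (S i) * q) - u q * sin (INR (S i) * q))) by (intro; ring).
        rewrite mean_minus by auto 20 with cts. unfold u at 2. rewrite coef_poly_sin by lia. field. }
  assert (B4 : mean (fun q => P q * (u q * poly N DX DY q)) = / 2 * sm N (fun i => DX (S i) * zX (S i) + DY (S i) * zY (S i))).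
  { rewrite (mean_ext _ (fun q => (P q * u q) * poly N DX DY q)) by (intro; ring).
    rewrite mean_poly' by auto 20 with cts. rewrite zX0_form. unfold zX, zY, fcos, fsin. ring. }
  pose proof L_form as BL. pose proof m1_form as B1.
  assert (Main : sm N (fun i => (HX (S i) - mu * zX (S i) / Sn T (S i)) ^ 2 + (HY (S i) - mu * zY (S i) / Sn T (S i)) ^ 2
     + match i with O => 0 | S _ => (zX (S i) ^ 2 + zY (S i) ^ 2) / 20 end)
     + 2 * mu * sm N (fun i => DX (S i) * zX (S i) + DY (S i) * zY (S i))
     + 2 * mu * sm N (fun i => INR (S i) * (X (S i) * zX (S i) + Y (S i) * zY (S i)))
     + 2 * mu * rho T 1 * sm N (fun i => X (S i) * zX (S i) + Y (S i) * zY (S i))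
     - cosh T ^ 2 * sm N (fun i => zX (S i) ^ 2 + zY (S i) ^ 2)
     - / 2 * sm N (fun i => (zX (S i) - X (S i)) ^ 2 + (zY (S i) - Y (S i)) ^ 2)
     <= sm N (fun i => HX (S i) ^ 2 + HY (S i) ^ 2)).
  { rewrite <- !sm_scal, <- !sm_plus, <- !sm_minus. apply sm_le; intros i Hi.
    assert (Hi1 : (0 < S i <= N)%nat) by lia.
    pose proof (mode_eq T HT (S i) (zX (S i)) (X (S i)) (DX (S i)) (HX (S i)) ltac:(lia) (EX (S i) Hi1)) as MX.
    pose proof (mode_eq T HT (S i) (zY (S i)) (Y (S i)) (DY (S i)) (HY (S i)) ltac:(lia) (EY (S i) Hi1)) as MY.
    fold mu in MX, MY. rewrite MX, MY.
    destruct i as [|i].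
    - pose proof (mode_one T HE (zX 1%nat) (X 1%nat)) as OX. pose proof (mode_one T HE (zY 1%nat) (Y 1%nat)) as OY.
      fold mu in OX, OY. rewrite OX, OY.
      pose proof (pow2_ge_0 (zX 1%nat - X 1%nat)). pose proof (pow2_ge_0 (zY 1%nat - Y 1%nat)). lra.
    - pose proof (mode_ineq T HT HE (S (S i)) (zX (S (S i))) (X (S (S i))) ltac:(lia)) as OX.
      pose proof (mode_ineq T HT HE (S (S i)) (zY (S (S i))) (Y (S (S i))) ltac:(lia)) as OY.
      fold mu in OX, OY. lra. }
  unfold slack. rewrite B4.
  assert (c0 : 0 <= cosh T ^ 2) by apply pow2_ge_0.
  assert (cosh T ^ 2 * (/ 2 * sm N (fun i => zX (S i) ^ 2 + zY (S i) ^ 2)) <= cosh T ^ 2 * m2) by (apply Rmult_le_compat_l; auto).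
  assert (mu * (3 * m2 - vv a * m1) <= mu * sm N (fun i => INR (S i) * (X (S i) * zX (S i) + Y (S i) * zY (S i)))) by (apply Rmult_le_compat_l; lra).
  rewrite B1 at 2. rewrite B1 in B3. lra.
Qed.
End Key.

(** * Functions without low modes are small *)

(** A crude Jordan inequality: PI <= 4 gives z^2 <= 4, and the Taylor bound of degree 7 is then at
    least z - 4 z/6. *)
Lemma sin_lower z : 0 <= z <= PI / 2 -> z <= 3 * sin z.
Proof.
  intros [H0 H1]. pose proof PI_4 as P4.
  assert (L : sin_lb z <= sin z) by (apply SIN; lra).
  assert (E : sin_lb z = z - z ^ 3 / 6 + z ^ 5 / 120 - z ^ 7 / 5040).
  { unfold sin_lb, sin_approx, sin_term. cbn [sum_f_R0]. rewrite !INR_IZR_INZ.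
    change (Z.of_nat (Factorial.fact (2 * 0 + 1))) with 1%Z. change (Z.of_nat (Factorial.fact (2 * 1 + 1))) with 6%Z.
    change (Z.of_nat (Factorial.fact (2 * 2 + 1))) with 120%Z. change (Z.of_nat (Factorial.fact (2 * 3 + 1))) with 5040%Z.
    cbn [Nat.mul Nat.add]. field. }
  rewrite E in L. assert (z ^ 2 <= 4) by nra.
  assert (0 <= z ^ 5 * (42 - z ^ 2)) by (apply Rmult_le_pos; [apply pow_le; lra|lra]).
  assert (z ^ 3 <= 4 * z) by (simpl in *; nra).
  assert (z ^ 7 = z ^ 5 * z ^ 2) by ring. lra.
Qed.

Lemma mean_le_in f g : cts f -> cts g -> (forall x, 0 < x < 2 * PI -> f x <= g x) -> mean f <= mean g.
Proof.
  intros F G L; unfold mean; apply Rmult_le_compat_r.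
  - pose proof PI2_pos; left; now apply Rinv_0_lt_compat.
  - apply RInt_le; auto with cts. pose proof PI2_pos; lra.
Qed.

Lemma half_shift x : cos ((x + 2 * PI) / 2) = - cos (x / 2) /\ sin ((x + 2 * PI) / 2) = - sin (x / 2).
Proof.
  replace ((x + 2 * PI) / 2) with (x / 2 + PI) by field. split; [apply neg_cos|apply neg_sin].
Qed.

Lemma cts_half : cts (fun x => x / 2).
Proof. unfold Rdiv; auto with cts. Qed.
#[export] Hint Resolve cts_half : cts.

(** The derivative of sin(x/2) cos(x/2)^{2n+1} has mean 0 over a period. *)
Lemma wallis_rec n : INR (S n) * mean (fun x => (cos (x / 2) ^ 2) ^ S n) = (INR n + / 2) * mean (fun x => (cos (x / 2) ^ 2) ^ n).
Proof.
  apply Rminus_diag_uniq. rewrite <- !mean_scal, <- mean_minus by auto 20 with cts.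
  apply (mean_derive0 (fun x => sin (x / 2) * (cos (x / 2) * (cos (x / 2) ^ 2) ^ n))).
  - intro x. set (F := fun x => sin (x / 2) * (cos (x / 2) * (cos (x / 2) ^ 2) ^ n)).
    assert (D1 : is_derive (fun x => (cos (x / 2) ^ 2) ^ n) x (INR n * (- sin (x / 2) * cos (x / 2)) * (cos (x / 2) ^ 2) ^ pred n)).
    { eapply der_eq; [apply (is_derive_pow (fun x => cos (x / 2) ^ 2) n x (- sin (x / 2) * cos (x / 2)))|reflexivity].
      auto_derive; [trivial|]. unfold Rdiv. field. }
    eapply der_eq.
    + apply (is_derive_mult (fun x => sin (x / 2)) (fun x => cos (x / 2) * (cos (x / 2) ^ 2) ^ n) x (/ 2 * cos (x / 2))
        (- / 2 * sin (x / 2) * (cos (x / 2) ^ 2) ^ n + cos (x / 2) * (INR n * (- sin (x / 2) * cos (x / 2)) * (cos (x / 2) ^ 2) ^ pred n))).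
      * auto_derive; [trivial|]. unfold Rdiv. ring.
      * apply (is_derive_mult (fun x => cos (x / 2)) (fun x => (cos (x / 2) ^ 2) ^ n) x (- / 2 * sin (x / 2))); [|exact D1|intros; apply Rmult_comm].
        auto_derive; [trivial|]. unfold Rdiv. ring.
      * intros; apply Rmult_comm.
    + rewrite S_INR. change ((cos (x / 2) ^ 2) ^ S n) with (cos (x / 2) ^ 2 * (cos (x / 2) ^ 2) ^ n).
      change (@plus _) with Rplus; change (@mult _) with Rmult; cbv beta.
      pose proof (sin2_cos2 (x / 2)) as SC. unfold Rsqr in SC.
      assert (K : INR n * (cos (x / 2) ^ 2) ^ pred n * cos (x / 2) ^ 2 = INR n * (cos (x / 2) ^ 2) ^ n).
      { destruct n as [|n0]; [change (INR 0) with 0; ring|]. change (pred (S n0)) with n0.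
        change ((cos (x / 2) ^ 2) ^ S n0) with (cos (x / 2) ^ 2 * (cos (x / 2) ^ 2) ^ n0). ring. }
      revert SC K. generalize (sin (x / 2)) (cos (x / 2)) (INR n).
      intros s c i. generalize ((c ^ 2) ^ n) ((c ^ 2) ^ pred n). intros k k' SC K.
      assert (Es : s * s = 1 - c * c) by lra.
      transitivity (/ 2 * c * (c * k) - / 2 * (s * s) * k - (s * s) * (i * k' * c ^ 2)); [ring|].
      rewrite K, Es. field.
  - auto 20 with cts.
  - intro x. destruct (half_shift x) as [-> ->]. replace ((- cos (x / 2)) ^ 2) with (cos (x / 2) ^ 2) by ring. ring.
Qed.

(** With I_k the mean of cos(x/2)^{2k}, the quantity 4 k I_k^2 equals 1 at k = 1 and does not
    decrease, because (k + 1/2)^2 >= k (k + 1). *)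
Lemma wallis_low n : 1 <= 4 * INR (S n) * mean (fun x => (cos (x / 2) ^ 2) ^ S n) ^ 2.
Proof.
  induction n as [|n IH].
  - pose proof (wallis_rec 0) as W. simpl INR in W.
    rewrite (mean_ext (fun x => (cos (x / 2) ^ 2) ^ 0) (fun _ => 1)) in W by (intro; reflexivity).
    rewrite mean_const in W. simpl INR. set (x := mean _) in *. nra.
  - pose proof (wallis_rec (S n)) as W. set (x := mean (fun x => (cos (x / 2) ^ 2) ^ S n)) in *.
    set (y := mean (fun x => (cos (x / 2) ^ 2) ^ S (S n))) in *.
    assert (P : 0 < INR (S n)) by (apply lt_0_INR; lia). rewrite (S_INR (S n)) in *.
    set (k := INR (S n)) in *.
    assert (E : (k + 1) ^ 2 * y ^ 2 = (k + / 2) ^ 2 * x ^ 2) by (rewrite <- !Rpow_mult_distr, W; reflexivity).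
    apply (Rmult_le_reg_r (k * (k + 1))); [nra|].
    replace (4 * (k + 1) * y ^ 2 * (k * (k + 1))) with (4 * k * ((k + 1) ^ 2 * y ^ 2)) by ring. rewrite E.
    replace (4 * k * ((k + / 2) ^ 2 * x ^ 2)) with ((k + / 2) ^ 2 * (4 * k * x ^ 2)) by ring. nra.
Qed.

(** The integral is elementary, 4/(2n + 1). It measures the concentration of the kernel, since
    sin(x/2) is comparable to the distance from x to 0 on the circle. *)
Lemma sin_kernel n : mean (fun x => sin (x / 2) * (cos (x / 2) ^ 2) ^ n) <= / INR (S n).
Proof.
  assert (E : RInt (fun x => sin (x / 2) * (cos (x / 2) ^ 2) ^ n) 0 (2 * PI) = 4 / (2 * INR n + 1)).
  { rewrite (is_RInt_unique _ 0 (2 * PI) (minus ((fun x => - 2 * cos (x / 2) ^ (2 * n + 1) / (2 * INR n + 1)) (2 * PI)) ((fun x => - 2 * cos (x / 2) ^ (2 * n + 1) / (2 * INR n + 1)) 0))).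
    - unfold minus, plus, opp; simpl plus. replace (2 * PI / 2) with PI by field. replace (0 / 2) with 0 by field.
      rewrite cos_PI, cos_0. replace (2 * n + 1)%nat with (S (2 * n)) by lia. rewrite <- !tech_pow_Rmult, !pow_mult.
      replace ((-1) ^ 2) with 1 by ring. replace (1 ^ 2) with 1 by ring. rewrite pow1. simpl. field. pose proof (pos_INR n); lra.
    - apply (is_RInt_derive (fun x => - 2 * cos (x / 2) ^ (2 * n + 1) / (2 * INR n + 1))).
      + intros x _. pose proof (pos_INR n).
        eapply der_eq.
        * apply (is_derive_ext (fun x => (- 2 / (2 * INR n + 1)) * cos (x / 2) ^ (2 * n + 1))).
          { intro y. unfold Rdiv. change (- 2 * / (2 * INR n + 1) * cos (y * / 2) ^ (2 * n + 1) = - 2 * cos (y * / 2) ^ (2 * n + 1) * / (2 * INR n + 1)). ring. }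
          apply is_derive_scal. apply (is_derive_pow (fun x => cos (x / 2)) (2 * n + 1) x (- / 2 * sin (x / 2))).
          auto_derive; [trivial|]. unfold Rdiv; ring.
        * replace (pred (2 * n + 1)) with (2 * n)%nat by lia. rewrite pow_mult, plus_INR, mult_INR. simpl INR. field. lra.
      + intros x _. assert (C : cts (fun x => sin (x / 2) * (cos (x / 2) ^ 2) ^ n)) by auto 20 with cts. apply C. }
  unfold mean. rewrite E. rewrite S_INR. pose proof (pos_INR n). pose proof PI2_pos. pose proof PI2_1.
  unfold Rdiv. rewrite Rmult_assoc, <- Rinv_mult.
  assert (0 < (2 * INR n + 1) * (2 * PI)) by nra.
  apply (Rmult_le_reg_r ((2 * INR n + 1) * (2 * PI) * (INR n + 1))); [nra|].
  replace (4 * / ((2 * INR n + 1) * (2 * PI)) * ((2 * INR n + 1) * (2 * PI) * (INR n + 1))) with (4 * (INR n + 1)) by (field; lra).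
  replace (/ (INR n + 1) * ((2 * INR n + 1) * (2 * PI) * (INR n + 1))) with ((2 * INR n + 1) * (2 * PI)) by (field; lra).
  nra.
Qed.

(** The m-th power of (1 + cos(x - y))/2 is a trigonometric polynomial of degree m. A free frequency
    and phase make the induction on m close. *)
Lemma kernel_orth r N y : cts r -> (forall n, (n <= N)%nat -> mean (fun x => r x * cos (INR n * x)) = 0) ->
  (forall n, (n <= N)%nat -> mean (fun x => r x * sin (INR n * x)) = 0) ->
  forall m n phi, (n + m <= N)%nat ->
  mean (fun x => r x * (((1 + cos (x - y)) / 2) ^ m * cos (INR n * x + phi))) = 0.
Proof.
  intros C Hc Hs. induction m as [|m IH]; intros n phi Hn.
  - rewrite (mean_ext _ (fun x => cos phi * (r x * cos (INR n * x)) - sin phi * (r x * sin (INR n * x)))).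
    2:{ intro x. rewrite cos_plus. simpl. ring. }
    rewrite mean_minus, !mean_scal by auto 20 with cts. rewrite Hc, Hs by lia. ring.
  - assert (K : exists n' phi', (n' + m <= N)%nat /\ forall x, cos (x - y) * cos (INR n * x + phi) =
       / 2 * cos (INR (S n) * x + (phi - y)) + / 2 * cos (INR n' * x + phi')).
    { assert (E : forall x, cos (x - y) * cos (INR n * x + phi) =
       / 2 * cos (INR (S n) * x + (phi - y)) + / 2 * cos (INR n * x + phi - (x - y))).
      { intro x. rewrite S_INR. replace ((INR n + 1) * x + (phi - y)) with (INR n * x + phi + (x - y)) by ring.
        generalize (INR n * x + phi) (x - y); intros p0 q0. rewrite cos_plus, cos_minus. field. }
      destruct n as [|n].
      - exists 1%nat, (- phi - y). split; [lia|]. intro x. rewrite E. f_equal. f_equal.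
        rewrite <- cos_neg. f_equal. simpl. ring.
      - exists n, (phi + y). split; [lia|]. intro x. rewrite E. f_equal. f_equal. f_equal. rewrite S_INR. ring. }
    destruct K as (n' & phi' & Hn' & K).
    assert (Ck : cts (fun x => (1 + cos (x - y)) / 2)) by (unfold Rdiv; auto 20 with cts).
    rewrite (mean_ext _ (fun x => / 2 * (r x * (((1 + cos (x - y)) / 2) ^ m * cos (INR n * x + phi)))
       + / 4 * (r x * (((1 + cos (x - y)) / 2) ^ m * cos (INR (S n) * x + (phi - y))))
       + / 4 * (r x * (((1 + cos (x - y)) / 2) ^ m * cos (INR n' * x + phi'))))).
    2:{ intro x. specialize (K x). rewrite <- tech_pow_Rmult. set (k := ((1 + cos (x - y)) / 2) ^ m).
        transitivity (r x * k * / 2 * (cos (INR n * x + phi) + cos (x - y) * cos (INR n * x + phi))); [field|]. rewrite K. field. }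
    rewrite !mean_plus, !mean_scal by auto 20 with cts. rewrite !IH by lia. ring.
Qed.

(** Averaging r around y with the kernel cos(x/2)^{2(N+1)} gives 0, as r has no low modes. So |r(y)|
    times the mean of the kernel is at most the mean of |r(y) - r(x + y)| times the kernel, of order
    B/N by [sin_kernel], while the mean of the kernel is at least of order 1/sqrt N by
    [wallis_low]. *)
Lemma low_modes_small r N B : cts r -> per r -> (forall x y, Rabs (r x - r y) <= B * Rabs (x - y)) ->
  (forall n, (n <= S N)%nat -> mean (fun x => r x * cos (INR n * x)) = 0) ->
  (forall n, (n <= S N)%nat -> mean (fun x => r x * sin (INR n * x)) = 0) ->
  forall y, Rabs (r y) <= 12 * B / sqrt (INR (S N)).
Proof.
  intros C P Lp Hc Hs y.
  assert (B0 : 0 <= B).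
  { specialize (Lp 1 0). pose proof (Rabs_pos (r 1 - r 0)). rewrite Rminus_0_r, Rabs_R1 in Lp. lra. }
  set (k := fun x => (cos (x / 2) ^ 2) ^ S N).
  assert (Ck : cts k) by (unfold k; auto 20 with cts).
  assert (Cr : cts (fun x => r (x + y))) by (apply (cts_comp (fun x => x + y) r); auto with cts).
  assert (Kx : forall x, (1 + cos x) / 2 = cos (x / 2) ^ 2).
  { intro x. replace x with (2 * (x / 2)) at 1 by field. rewrite cos_2a_cos. field. }
  assert (Z : mean (fun x => r (x + y) * k x) = 0).
  { pose proof (kernel_orth r (S N) y C Hc Hs (S N) 0 0 ltac:(lia)) as Q.
    rewrite (mean_ext _ (fun x => r x * k (x - y))) in Q.
    2:{ intro x. unfold k. simpl (INR 0). rewrite Rmult_0_l, Rplus_0_l, cos_0, Rmult_1_r, Kx. reflexivity. }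
    rewrite <- (mean_shift _ y) in Q.
    - rewrite <- Q. apply mean_ext; intro x. replace (x + y - y) with x by ring. reflexivity.
    - apply cts_mult; auto. apply (cts_comp (fun x => x - y) k); auto with cts.
    - intro x. rewrite P. f_equal. unfold k. replace (x + 2 * PI - y) with (x - y + 2 * PI) by ring.
      destruct (half_shift (x - y)) as [-> _]. f_equal. ring. }
  (* Distances are taken on the circle: beyond PI the point x - 2 PI is the nearer
     representative. *)
  assert (Dx : forall x, 0 < x < 2 * PI -> Rabs (r y - r (x + y)) <= 6 * B * sin (x / 2)).
  { intros x Hx. destruct (Rle_lt_dec x PI) as [L|L].
    - eapply Rle_trans; [apply Lp|]. replace (y - (x + y)) with (- x) by ring. rewrite Rabs_Ropp, Rabs_pos_eq by lra.
      pose proof (sin_lower (x / 2) ltac:(lra)). nra.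
    - replace (r (x + y)) with (r (x + y - 2 * PI)) by (rewrite <- (P (x + y - 2 * PI)); f_equal; ring).
      eapply Rle_trans; [apply Lp|]. replace (y - (x + y - 2 * PI)) with (2 * PI - x) by ring. rewrite Rabs_pos_eq by lra.
      pose proof (sin_lower ((2 * PI - x) / 2) ltac:(lra)) as S.
      replace ((2 * PI - x) / 2) with (PI - x / 2) in S by field. rewrite sin_PI_x in S. nra. }
  assert (K0 : forall x, 0 <= k x) by (intro; unfold k; apply pow_le, pow2_ge_0).
  assert (M : Rabs (r y * mean k) <= 6 * B * / INR (S (S N))).
  { assert (E : r y * mean k = mean (fun x => (r y - r (x + y)) * k x)).
    { rewrite <- mean_scal by auto. rewrite (mean_ext (fun x => (r y - r (x + y)) * k x) (fun x => r y * k x - r (x + y) * k x)) by (intro; ring).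
      rewrite mean_minus by auto 20 with cts. lra. }
    assert (Up : mean (fun x => 6 * B * (sin (x / 2) * k x)) <= 6 * B * / INR (S (S N))).
    { rewrite mean_scal by auto 20 with cts. apply Rmult_le_compat_l; [lra|]. apply sin_kernel. }
    rewrite E. apply Rabs_le. split.
    - apply Ropp_le_cancel. rewrite Ropp_involutive, <- mean_opp by auto 20 with cts.
      eapply Rle_trans; [|exact Up]. apply mean_le_in; auto 20 with cts. intros x Hx.
      pose proof (Dx x Hx) as D. apply Rabs_le_between in D. specialize (K0 x). nra.
    - eapply Rle_trans; [|exact Up]. apply mean_le_in; auto 20 with cts. intros x Hx.
      pose proof (Dx x Hx) as D. apply Rabs_le_between in D. specialize (K0 x). nra. }
  pose proof (wallis_low N) as W. fold k in W.
  assert (Mk : 0 <= mean k) by (apply mean_ge0; auto).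
  assert (n0 : 0 < INR (S N)) by (apply lt_0_INR; lia).
  assert (q0 : 0 < sqrt (INR (S N))) by now apply sqrt_lt_R0.
  assert (q2 : sqrt (INR (S N)) * sqrt (INR (S N)) = INR (S N)) by (apply sqrt_sqrt; lra).
  set (w := sqrt (INR (S N))) in *.
  assert (Lk : 1 <= 2 * w * mean k).
  { destruct (Rle_lt_dec 1 (2 * w * mean k)); auto. exfalso.
    assert (4 * INR (S N) * mean k ^ 2 = (2 * w * mean k) ^ 2) by (rewrite <- q2; ring).
    assert (0 <= 2 * w * mean k) by nra. nra. }
  rewrite Rabs_mult, (Rabs_pos_eq (mean k)) in M by auto.
  assert (I1 : / INR (S (S N)) <= / INR (S N)) by (apply Rinv_le_contravar; auto; apply le_INR; lia).
  assert (I2 : / INR (S N) = / w * / w) by (rewrite <- q2, Rinv_mult; reflexivity).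
  assert (iw : 0 < / w) by now apply Rinv_0_lt_compat.
  assert (A0 : Rabs (r y) <= 2 * w * (Rabs (r y) * mean k)) by (pose proof (Rabs_pos (r y)); nra).
  assert (A1 : Rabs (r y) * mean k <= 6 * B * (/ w * / w)).
  { eapply Rle_trans; [exact M|]. rewrite <- I2. apply Rmult_le_compat_l; lra. }
  assert (A2 : 2 * w * (Rabs (r y) * mean k) <= 2 * w * (6 * B * (/ w * / w))) by (apply Rmult_le_compat_l; lra).
  replace (2 * w * (6 * B * (/ w * / w))) with (12 * B / w) in A2 by (field; lra). lra.
Qed.

(** * The energy near the inner circle *)

Lemma exp_convex l x : 0 <= l <= 1 -> exp (l * x) <= 1 - l + l * exp x.
Proof.
  intro H. set (m := l * x).
  assert (T : forall y, exp m * (1 + (y - m)) <= exp y).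
  { intro y. replace y with (m + (y - m)) at 2 by ring. rewrite exp_plus.
    apply Rmult_le_compat_l; [left; apply exp_pos|]. apply exp_ineq1_le. }
  pose proof (T 0) as T0. pose proof (T x) as T1. rewrite exp_0 in T0.
  assert (E : exp m = (1 - l) * (exp m * (1 + (0 - m))) + l * (exp m * (1 + (x - m)))) by (unfold m; ring).
  rewrite E. nra.
Qed.

Section Energy.
Variables (b : R) (U V : jet).
Hypothesis HR : rmap b U V.
Let HU := r_U _ _ _ HR.
Let HV := r_V _ _ _ HR.

Definition energy (t : R) : R := mean (nsq U V t).
Definition energy1 (t : R) : R := mean (fun q => 2 * (j0 U t q * jt U t q + j0 V t q * jt V t q)).
Definition energy2 (t : R) : R := mean (fun q => 2 * (jt U t q * jt U t q + jt V t q * jt V t q + jq U t q * jq U t q + jq V t q * jq V t q)).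
Definition area (t : R) : R := mean (ang U V t).

Lemma energy_d1 t : 0 < t < b -> is_derive energy t (energy1 t).
Proof.
  intro Ht. apply (mean_Dt 0 b (nsq U V) (fun t q => 2 * (j0 U t q * jt U t q + j0 V t q * jt V t q))); auto.
  - apply Dt_nsq; auto. - apply C2_nsq; auto. - pose proof HU; pose proof HV; c2t.
Qed.

(** Harmonicity replaces h_tt by -h_qq, and an integration by parts in q, in the form of the zero
    mean of [gq], turns this into |h_q|^2. *)
Lemma energy_d2 t : 0 < t < b -> is_derive energy1 t (energy2 t).
Proof.
  intro Ht. pose proof HU as HU'; pose proof HV as HV'.
  set (f1 := fun t q => 2 * (j0 U t q * jt U t q + j0 V t q * jt V t q)).
  set (f2 := fun t q => 2 * (jt U t q * jt U t q + jt V t q * jt V t q + jq U t q * jq U t q + jq V t q * jq V t q)).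
  set (g := fun t q => 2 * (j0 U t q * jq U t q + j0 V t q * jq V t q)).
  set (gq := fun t q => 2 * (jq U t q * jq U t q + jq V t q * jq V t q + (j0 U t q * jqq U t q + j0 V t q * jqq V t q))).
  assert (Dg : Dq 0 b g gq).
  { eapply Dq_eq; [unfold g; eauto 20 with dt|]. intros; unfold gq; cbv beta; ring. }
  assert (D1 : Dt 0 b f1 (fun t q => f2 t q - gq t q)).
  { eapply Dt_eq; [unfold f1; eauto 20 with dt|]. intros s q H; unfold f2, gq; cbv beta.
    pose proof (h_lap _ _ _ HU s q H). pose proof (h_lap _ _ _ HV s q H).
    replace (jtt U s q) with (- jqq U s q) by lra. replace (jtt V s q) with (- jqq V s q) by lra. ring. }
  assert (C1 : C2 0 b f1) by (unfold f1; c2t). assert (C2' : C2 0 b f2) by (unfold f2; c2t).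
  assert (Cg : C2 0 b gq) by (unfold gq; c2t).
  assert (Z : mean (gq t) = 0).
  { apply (mean_Dq 0 b g); auto. intros s q. unfold g.
    now rewrite (h_p _ _ _ HU), (h_p _ _ _ HV), (h_pq _ _ _ HU), (h_pq _ _ _ HV). }
  eapply der_eq; [apply (mean_Dt 0 b f1 _ D1); auto; c2t|].
  cbv beta. rewrite mean_minus, Z by (eapply C2_slice; eauto). unfold energy2; fold (f2 t). apply Rminus_0_r.
Qed.

(** The area is the weighted winding for chi the identity, since then chi(|h|^2)/|h|^2 = 1. *)
Lemma area_d1 t : 0 < t < b -> is_derive area t (mean (fun q => 2 * jac U V t q)).
Proof.
  intro Ht.
  pose proof (wnd_derive 0 b U V HU HV (nsq_pos b U V HR) (fun y => y) (fun _ => 1) d_id (cts_const 1) t Ht) as W.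
  rewrite (mean_ext _ (fun q => 2 * jac U V t q)) in W by (intro; ring).
  apply (is_derive_ext_loc (wnd U V (fun y => y))); auto.
  generalize (loc_in 0 b t Ht); apply filter_imp. intros s Hs. unfold wnd, area. apply mean_ext; intro q.
  pose proof (nsq_pos b U V HR s q Hs). field. lra.
Qed.

Lemma nsq_cts t : 0 < t < b -> cts (nsq U V t).
Proof. apply C2_slice. apply C2_nsq; auto. Qed.

Lemma energy_ge1 t : 0 < t < b -> 1 <= energy t.
Proof.
  intro Ht. rewrite <- (mean_const 1). apply mean_le; auto with cts; [now apply nsq_cts|].
  intro q. left. now apply (r_gt _ _ _ HR).
Qed.

Lemma energy_lim e : 0 < e -> exists d, 0 < d /\ forall t, 0 < t < d -> t < b -> energy t <= 1 + e.
Proof.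
  intro He. destruct (r_lim _ _ _ HR e He) as (d & Hd & L). exists d; split; auto. intros t Ht Hb.
  rewrite <- (mean_const (1 + e)). apply mean_le; auto with cts; [apply nsq_cts; lra|].
  intro q. left. now apply L.
Qed.

(** The energy is convex, at least 1, and tends to 1 at t = 0. *)
Lemma energy1_ge0 t : 0 < t < b -> 0 <= energy1 t.
Proof.
  intro Ht. replace 0 with (- 0 * t) by ring.
  apply (slope_lower (fun t => energy t - 1) energy1 energy2 b 0); auto; try lra.
  - intros s Hs. eapply der_eq; [apply d_minus; [apply energy_d1; auto|apply d_const]|ring].
  - apply energy_d2.
  - intros s Hs. rewrite Ropp_0. pose proof HU as HU'; pose proof HV as HV'.
    apply mean_ge0.
    + apply (C2_slice 0 b (fun t q => 2 * (jt U t q * jt U t q + jt V t q * jt V t q + jq U t q * jq U t q + jq V t q * jq V t q))); auto. c2t.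
    + intro q. pose proof (Rle_0_sqr (jt U s q)). pose proof (Rle_0_sqr (jt V s q)).
      pose proof (Rle_0_sqr (jq U s q)). pose proof (Rle_0_sqr (jq V s q)). unfold Rsqr in *. lra.
  - intros s Hs. pose proof (energy_ge1 s Hs). lra.
  - intros e He. destruct (energy_lim (e / 2) ltac:(lra)) as (d & Hd & L). exists d; split; auto.
    intros s H1 H2. specialize (L s H1 H2). lra.
Qed.

Lemma energy_mono s t : 0 < s -> s <= t -> t < b -> energy s <= energy t.
Proof. apply (der_mono energy energy1 0 b); [apply energy_d1|apply energy1_ge0]. Qed.

Definition thn (t : R) : R := sinh t / cosh t.
Definition xi1 t q := jt U t q - thn t * j0 U t q.
Definition xi2 t q := jt V t q - thn t * j0 V t q.
Definition et1 t q := jq U t q + j0 V t q.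
Definition et2 t q := jq V t q - j0 U t q.
(* Vanishes exactly when [h_t = tanh t h] and [h_q = i h], the equations of the extremal map. *)
Definition defect (t : R) : R := mean (fun q => xi1 t q * xi1 t q + xi2 t q * xi2 t q + et1 t q * et1 t q + et2 t q * et2 t q).
(** The mean of Im (conj xi eta) for xi = h_t - tanh t h and eta = h_q - i h: what the Jacobian
    becomes when the extremal part is removed. It is bounded by half the defect. *)
Definition cross (t : R) : R := mean (fun q => xi1 t q * et2 t q - xi2 t q * et1 t q).

Lemma cosh_pos x : 0 < cosh x.
Proof. pose proof (cosh_ge1 x); lra. Qed.

Lemma defect_cts t : 0 < t < b -> cts (j0 U t) /\ cts (j0 V t) /\ cts (jt U t) /\ cts (jt V t) /\ cts (jq U t) /\ cts (jq V t).
Proof.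
  intro Ht. pose proof HU as []; pose proof HV as [].
  repeat split; eapply C2_slice; eauto.
Qed.

Lemma defect_ge0 t : 0 < t < b -> 0 <= defect t.
Proof.
  intro Ht. destruct (defect_cts t Ht) as (? & ? & ? & ? & ? & ?).
  apply mean_ge0; [unfold xi1, xi2, et1, et2; auto 20 with cts|].
  intro q. pose proof (Rle_0_sqr (xi1 t q)). pose proof (Rle_0_sqr (xi2 t q)).
  pose proof (Rle_0_sqr (et1 t q)). pose proof (Rle_0_sqr (et2 t q)). unfold Rsqr in *. lra.
Qed.

Lemma cross_ge t : 0 < t < b -> - defect t <= 2 * cross t.
Proof.
  intro Ht. destruct (defect_cts t Ht) as (? & ? & ? & ? & ? & ?).
  unfold defect, cross. rewrite <- mean_scal, <- mean_opp by (unfold xi1, xi2, et1, et2; auto 20 with cts).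
  apply mean_le; [unfold xi1, xi2, et1, et2; auto 20 with cts|unfold xi1, xi2, et1, et2; auto 20 with cts|].
  intro q. pose proof (Rle_0_sqr (xi1 t q + et2 t q)). pose proof (Rle_0_sqr (xi2 t q - et1 t q)). unfold Rsqr in *. lra.
Qed.

Lemma defect_eq t : 0 < t < b -> defect t = energy2 t / 2 - thn t * energy1 t + thn t ^ 2 * energy t - 2 * area t + energy t.
Proof.
  intro Ht. destruct (defect_cts t Ht) as (? & ? & ? & ? & ? & ?).
  assert (cs := nsq_cts t Ht). assert (ca : cts (ang U V t)) by (unfold ang; auto 20 with cts).
  unfold energy2, energy1, energy, area. unfold Rdiv. rewrite (Rmult_comm (mean _) (/ 2)). rewrite <- !mean_scal by auto 20 with cts.
  rewrite <- mean_minus, <- mean_plus, <- mean_minus, <- mean_plus by auto 20 with cts.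
  apply mean_ext; intro q. unfold xi1, xi2, et1, et2, nsq, ang. generalize (thn t); intro. field.
Qed.

Lemma cross_eq t : 0 < t < b -> 2 * cross t = mean (fun q => 2 * jac U V t q) - energy1 t - 2 * thn t * (area t - energy t).
Proof.
  intro Ht. destruct (defect_cts t Ht) as (? & ? & ? & ? & ? & ?).
  assert (cs := nsq_cts t Ht). assert (ca : cts (ang U V t)) by (unfold ang; auto 20 with cts).
  assert (cj : cts (jac U V t)) by (unfold jac; auto 20 with cts).
  unfold cross, energy1, energy, area. rewrite <- (mean_minus (ang U V t)), <- !mean_scal by (unfold xi1, xi2, et1, et2; auto 20 with cts).
  rewrite <- !mean_minus by auto 20 with cts.
  apply mean_ext; intro q. unfold xi1, xi2, et1, et2, nsq, ang, jac. generalize (thn t); intro. field.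
Qed.
End Energy.

Lemma cosh_sq x : cosh x * cosh x = 1 + sinh x * sinh x.
Proof. pose proof (cosh_sinh_sq x). nra. Qed.

Lemma thn_bounds x : 0 <= x -> 0 <= thn x <= x.
Proof.
  intro H. unfold thn. pose proof (cosh_pos x) as C.
  assert (M : forall g g' : R -> R, (forall y, is_derive g y (g' y)) -> (forall y, 0 <= y -> 0 <= g' y) -> g 0 <= g x).
  { intros g g' D G. destruct H as [H|<-]; [|lra].
    destruct (MVT_cor2 g g' 0 x H) as (c & E & Hc); [intros; now apply is_derive_Reals|].
    pose proof (G c ltac:(lra)). nra. }
  assert (S0 : 0 <= sinh x) by (destruct H as [H|<-]; [left; now apply sinh_pos|rewrite sinh_0; lra]).
  assert (L : sinh x <= x * cosh x).
  { pose proof (M (fun y => y * cosh y - sinh y) (fun y => y * sinh y)) as K. cbv beta in K.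
    rewrite sinh_0 in K. assert (0 * cosh 0 - 0 <= x * cosh x - sinh x); [|lra]. apply K.
    - intro y. eapply der_eq; [apply d_minus; [apply d_mult; [apply d_id|apply d_cosh]|apply d_sinh]|cbv beta; ring].
    - intros y Hy. apply Rmult_le_pos; auto. destruct Hy as [Hy|<-]; [left; now apply sinh_pos|rewrite sinh_0; lra]. }
  split.
  - apply Rmult_le_pos; auto. left; now apply Rinv_0_lt_compat.
  - apply (Rmult_le_reg_r (cosh x)); auto. unfold Rdiv. rewrite Rmult_assoc, Rinv_l by lra. lra.
Qed.
Lemma sinh_ge0 x : 0 <= x -> 0 <= sinh x.
Proof. intros [H|<-]; [left; now apply sinh_pos|rewrite sinh_0; lra]. Qed.

(** * The bound for t <= 1 by a differential inequality *)

Section Short.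
Variables (b : R) (U V : jet) (t : R).
Hypothesis HR : rmap b U V.
Hypothesis Ht : 0 < t < b.
Hypothesis Ht1 : t <= 1.

Let P (x : R) := sinh (t - x) / cosh x.
Let Q (x : R) := 2 * (sinh t * (t - x) - sinh x * sinh (t - x)).
Let ks (x : R) := / (cosh x * cosh x).
(** At x = t the functions [P] and [Q] vanish and this is energy / cosh t. As x -> 0 its lower limit
    is at least cosh t, because the energy tends to 1, its derivative is nonnegative and the area is
    at least 1. *)
Let Z (x : R) := cosh t * (energy U V x * ks x) + P x * (energy1 U V x - 2 * thn x * energy U V x) + Q x * ((area U V x - energy U V x) * ks x).
(* [P] and [Q] solve the ODEs that make every term of [Z'] cancel except those in [defect] and [cross]. *)
Let Z' (x : R) := 2 * P x * defect U V x + Q x * ks x * (2 * cross U V x).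

Lemma d_tm x : is_derive (fun y => t - y) x (-1).
Proof. eapply der_eq; [apply d_minus; [apply d_const|apply d_id]|ring]. Qed.

Lemma Z_derive x : 0 < x < b -> is_derive Z x (Z' x).
Proof.
  intro Hx. pose proof (cosh_pos x) as C0. pose proof (cosh_sq x) as CS.
  assert (Dk : is_derive ks x (- (sinh x * cosh x + cosh x * sinh x) / (cosh x * cosh x) ^ 2)).
  { apply (is_derive_inv (fun y => cosh y * cosh y)); [apply d_mult; apply d_cosh|nra]. }
  assert (Di : is_derive (fun y => / cosh y) x (- sinh x / cosh x ^ 2)).
  { apply (is_derive_inv cosh); [apply d_cosh|lra]. }
  assert (DP : is_derive P x (-1 * cosh (t - x) * / cosh x + sinh (t - x) * (- sinh x / cosh x ^ 2))).
  { apply (d_mult (fun y => sinh (t - y)) (fun y => / cosh y)); auto.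
    apply (d_comp (fun y => t - y) sinh); [apply d_sinh|apply d_tm]. }
  assert (Dth : is_derive thn x (cosh x * / cosh x + sinh x * (- sinh x / cosh x ^ 2))).
  { apply (d_mult sinh (fun y => / cosh y)); auto. apply d_sinh. }
  assert (DQ : is_derive Q x (2 * (sinh t * (-1) - (cosh x * sinh (t - x) + sinh x * (-1 * cosh (t - x)))))).
  { apply d_scal, d_minus.
    - apply (d_scal (fun y => t - y)), d_tm.
    - apply (d_mult sinh (fun y => sinh (t - y))); [apply d_sinh|].
      apply (d_comp (fun y => t - y) sinh); [apply d_sinh|apply d_tm]. }
  pose proof (energy_d1 b U V HR x Hx) as De. pose proof (energy_d2 b U V HR x Hx) as De1. pose proof (area_d1 b U V HR x Hx) as Da.
  eapply der_eq.
  - apply (d_plus (fun x => cosh t * (energy U V x * ks x) + P x * (energy1 U V x - 2 * thn x * energy U V x))).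
    + apply d_plus.
      * apply (d_scal (fun x => energy U V x * ks x)), d_mult; eauto.
      * apply d_mult; [exact DP|]. apply d_minus; eauto. apply (d_mult (fun y => 2 * thn y)); [apply d_scal|]; eauto.
    + apply d_mult; [exact DQ|]. apply d_mult; [apply d_minus; eauto|eauto].
  - unfold Z'. rewrite (defect_eq b U V HR x Hx), (cross_eq b U V HR x Hx). unfold P, Q, ks, thn.
    (* With t expanded around x, the identity is algebraic modulo cosh^2 x - sinh^2 x = 1. *)
    replace (cosh t) with (cosh x * cosh (t - x) + sinh x * sinh (t - x)) by (rewrite <- cosh_plus; f_equal; ring).
    replace (sinh t) with (sinh x * cosh (t - x) + cosh x * sinh (t - x)) by (rewrite <- sinh_plus; f_equal; ring).
    generalize dependent (cosh x). generalize (sinh x) (sinh (t - x)) (cosh (t - x)) (energy U V x) (energy1 U V x) (energy2 U V x) (area U V x) (mean (fun q => 2 * jac U V x q)).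
    intros s sg k e e1 e2 a j c C0 CS _ _ _ _ _.
    assert (N : c <> 0) by lra.
    assert (S2 : s * s = c * c - 1) by lra.
    field [S2]; auto.
Qed.

Lemma P_ge0 x : 0 < x <= t -> 0 <= P x.
Proof.
  intro H. unfold P. apply Rmult_le_pos; [apply sinh_ge0; lra|]. left. apply Rinv_0_lt_compat, cosh_pos.
Qed.
Lemma Q_ge0 x : 0 < x <= t -> 0 <= Q x.
Proof.
  intro H. unfold Q. replace (sinh t) with (sinh x * cosh (t - x) + cosh x * sinh (t - x)) by (rewrite <- sinh_plus; f_equal; ring).
  destruct (thn_bounds (t - x) ltac:(lra)) as [T0 T1]. unfold thn in T1.
  pose proof (cosh_pos (t - x)) as C. pose proof (cosh_pos x). pose proof (sinh_ge0 x ltac:(lra)). pose proof (sinh_ge0 (t - x) ltac:(lra)).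
  assert (sinh (t - x) <= (t - x) * cosh (t - x)).
  { apply (Rmult_le_reg_r (/ cosh (t - x))); [now apply Rinv_0_lt_compat|]. rewrite Rmult_assoc, Rinv_r, Rmult_1_r by lra. exact T1. }
  assert (0 <= cosh x * sinh (t - x) * (t - x)) by (apply Rmult_le_pos; [apply Rmult_le_pos; lra|lra]).
  nra.
Qed.

Lemma coef_form x : 2 * P x - Q x * ks x = ks x * exp t * (1 - exp (-2 * (t - x)) - (t - x) * (1 - exp (-2 * t))).
Proof.
  unfold P, Q, ks. pose proof (cosh_pos x) as C.
  assert (E1 : sinh (t - x) * (cosh x + sinh x) = exp t * (1 - exp (-2 * (t - x))) / 2).
  { replace (cosh x + sinh x) with (exp x) by (unfold cosh, sinh; field).
    unfold sinh. replace (exp t) with (exp (t - x) * exp x) by (rewrite <- exp_plus; f_equal; ring).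
    replace (-2 * (t - x)) with (- (t - x) + - (t - x)) by ring. rewrite exp_plus, !exp_Ropp.
    field. pose proof (exp_pos (t - x)); lra. }
  assert (E2 : sinh t = exp t * (1 - exp (-2 * t)) / 2).
  { unfold sinh. replace (-2 * t) with (- t + - t) by ring. rewrite exp_plus, !exp_Ropp.
    field. pose proof (exp_pos t); lra. }
  transitivity (/ (cosh x * cosh x) * 2 * (sinh (t - x) * (cosh x + sinh x) - sinh t * (t - x))); [field; lra|].
  rewrite E1, E2. field. lra.
Qed.

(** Convexity of exp gives 1 - e^{-2(t-x)} >= ((t - x)/t)(1 - e^{-2t}), and 1/t >= 1 does the rest.
    This is where t <= 1 is used. *)
Lemma coef_ge0 x : 0 < x <= t -> 0 <= 2 * P x - Q x * ks x.
Proof.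
  intro H. rewrite coef_form. pose proof (cosh_pos x) as C.
  assert (K : 0 < ks x) by (unfold ks; apply Rinv_0_lt_compat; nra).
  apply Rmult_le_pos; [pose proof (exp_pos t); nra|].
  pose proof (exp_convex ((t - x) / t) (-2 * t)) as X.
  replace ((t - x) / t * (-2 * t)) with (-2 * (t - x)) in X by (field; lra).
  assert (D : 0 <= (t - x) / t <= 1).
  { split; [apply Rmult_le_pos; [lra|left; apply Rinv_0_lt_compat; lra]|].
    apply (Rmult_le_reg_r t); [lra|]. replace ((t - x) / t * t) with (t - x) by (field; lra). lra. }
  specialize (X D). assert (E1 : exp (-2 * t) < 1) by (rewrite <- exp_0; apply exp_increasing; lra).
  assert (L : (t - x) * (1 - exp (-2 * t)) <= (t - x) / t * (1 - exp (-2 * t))).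
  { apply Rmult_le_compat_r; [lra|]. apply (Rmult_le_reg_r t); [lra|]. replace ((t - x) / t * t) with (t - x) by (field; lra). nra. }
  lra.
Qed.

(** Strict positivity at one interior circle is enough to read off the defect there in the equality
    case. *)
Lemma coef_mid : 0 < 2 * P (t / 2) - Q (t / 2) * ks (t / 2).
Proof.
  rewrite coef_form. pose proof (cosh_pos (t / 2)) as C.
  assert (K : 0 < ks (t / 2)) by (unfold ks; apply Rinv_0_lt_compat; nra).
  apply Rmult_lt_0_compat; [pose proof (exp_pos t); nra|].
  replace (t - t / 2) with (t / 2) by field. replace (-2 * (t / 2)) with (- t) by field.
  replace (-2 * t) with (- t + - t) by ring. rewrite exp_plus.
  assert (E1 : exp (- t) < 1) by (rewrite <- exp_0; apply exp_increasing; lra).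
  pose proof (exp_pos (- t)). set (e := exp (- t)) in *.
  replace (1 - e - t / 2 * (1 - e * e)) with ((1 - e) * (1 - t / 2 * (1 + e))) by ring.
  apply Rmult_lt_0_compat; [lra|]. nra.
Qed.

Lemma Z'_ge x : 0 < x <= t -> (2 * P x - Q x * ks x) * defect U V x <= Z' x.
Proof.
  intro H. assert (Hx : 0 < x < b) by lra. unfold Z'.
  pose proof (cross_ge b U V HR x Hx) as Cr. pose proof (Q_ge0 x H) as Q0. pose proof (cosh_pos x) as C.
  assert (K : 0 < ks x) by (unfold ks; apply Rinv_0_lt_compat; nra).
  assert (0 <= Q x * ks x) by (apply Rmult_le_pos; lra). nra.
Qed.

Lemma Z_mono x y : 0 < x -> x <= y -> y <= t -> Z x <= Z y.
Proof.
  intros X XY [YT| ->].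
  - apply (der_mono Z Z' 0 t); auto. + intros s Hs; apply Z_derive; lra.
    + intros s Hs. eapply Rle_trans; [|apply Z'_ge; lra]. apply Rmult_le_pos; [apply coef_ge0; lra|apply (defect_ge0 b); auto; lra].
  - destruct XY as [XT| ->]; [|lra].
    destruct (mvt_open Z Z' 0 b x t Z_derive) as (c & Hc & E); try lra.
    assert (0 <= Z' c).
    { eapply Rle_trans; [|apply Z'_ge; lra]. apply Rmult_le_pos; [apply coef_ge0; lra|apply (defect_ge0 b); auto; lra]. }
    nra.
Qed.

Lemma Z_end : Z t = cosh t * (energy U V t * ks t).
Proof. unfold Z, P, Q. replace (t - t) with 0 by ring. rewrite sinh_0. unfold Rdiv. ring. Qed.

(** [Z] is nondecreasing, so it suffices to evaluate it on a circle s close to 0, where all terms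
    are controlled up to a multiple of e. *)
Lemma Z_low x : 0 < x <= t -> cosh t <= Z x.
Proof.
  intro Hx. apply Rnot_lt_le. intro N.
  set (g := cosh t - Z x). assert (g0 : 0 < g) by (unfold g; lra).
  (* The three summands bound the losses in the three terms of [Z]: from 1/cosh^2 s >= 1 - e, from
     the slope term and from area minus energy. *)
  set (M := cosh t + 4 * sinh t + 2 * sinh t).
  assert (St : 0 < sinh t) by (apply sinh_pos; lra). pose proof (cosh_pos t) as Ct.
  assert (M0 : 0 < M) by (unfold M; lra).
  set (e := Rmin 1 (g / (2 * M))).
  assert (e0 : 0 < e) by (apply Rmin_pos; [lra|apply Rdiv_lt_0_compat; lra]).
  assert (e1 : e <= 1) by apply Rmin_l. assert (e2 : e <= g / (2 * M)) by apply Rmin_r.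
  destruct (energy_lim b U V HR e e0) as (d & Hd & L).
  set (s := Rmin (Rmin (d / 2) x) e).
  assert (s0 : 0 < s) by (repeat apply Rmin_pos; lra).
  assert (s1 : s <= Rmin (d / 2) x) by apply Rmin_l. assert (s2' : s <= e) by apply Rmin_r.
  pose proof (Rmin_l (d / 2) x). pose proof (Rmin_r (d / 2) x).
  assert (Hs : 0 < s < b) by lra.
  pose proof (Z_mono s x s0 ltac:(lra) ltac:(lra)) as Mn.
  specialize (L s ltac:(lra) ltac:(lra)).
  pose proof (energy_ge1 b U V HR s Hs) as En. pose proof (energy1_ge0 b U V HR s Hs) as En1. pose proof (area_ge1 b U V HR s Hs) as Ar.
  fold (area U V s) in Ar. destruct (thn_bounds s ltac:(lra)) as [Th0 Th1].
  pose proof (P_ge0 s ltac:(lra)) as P0. pose proof (Q_ge0 s ltac:(lra)) as Q0.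
  pose proof (cosh_ge1 s) as Cs.
  assert (Sts : sinh (t - s) <= sinh t).
  { left. unfold sinh. assert (exp (t - s) < exp t) by (apply exp_increasing; lra).
    assert (exp (- t) < exp (- (t - s))) by (apply exp_increasing; lra). lra. }
  pose proof (sinh_ge0 (t - s) ltac:(lra)) as Sts0.
  assert (P1 : P s <= sinh t).
  { unfold P. apply (Rmult_le_reg_r (cosh s)); [lra|]. unfold Rdiv. rewrite Rmult_assoc, Rinv_l by lra. nra. }
  assert (Q1 : Q s <= 2 * sinh t).
  { unfold Q. pose proof (sinh_ge0 s ltac:(lra)). nra. }
  assert (K : 1 - e <= ks s <= 1).
  { unfold ks. assert (T : / (cosh s * cosh s) = 1 - thn s ^ 2).
    { unfold thn. pose proof (cosh_sq s). field_simplify; try lra. replace (cosh s ^ 2 - sinh s ^ 2) with 1 by nra. reflexivity. }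
    rewrite T. split; nra. }
  assert (A1 : (1 - e) <= energy U V s * ks s) by nra.
  assert (A2 : - (4 * sinh t * e) <= P s * (energy1 U V s - 2 * thn s * energy U V s)).
  { assert (- (4 * e) <= energy1 U V s - 2 * thn s * energy U V s) by nra. nra. }
  assert (A3 : - (2 * sinh t * e) <= Q s * ((area U V s - energy U V s) * ks s)).
  { assert (- e <= (area U V s - energy U V s) * ks s) by nra. nra. }
  assert (B : cosh t - M * e <= Z s) by (unfold Z, M; nra).
  assert (M * e <= g / 2).
  { apply (Rmult_le_compat_l M) in e2; [|lra]. replace (M * (g / (2 * M))) with (g / 2) in e2 by (field; lra). lra. }
  unfold g in *. lra.
Qed.

Lemma short_bound : cosh t ^ 2 <= energy U V t.
Proof.
  pose proof (Z_low t ltac:(lra)) as L. rewrite Z_end in L. pose proof (cosh_ge1 t) as C.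
  unfold ks in L. set (c := cosh t) in *.
  apply (Rmult_le_compat_l c) in L; [|lra].
  replace (c * (c * (energy U V t * / (c * c)))) with (energy U V t) in L by (field; lra). simpl; lra.
Qed.

(** [Z] is squeezed between cosh t at both ends, hence constant, so its derivative at t/2
    vanishes. *)
Lemma short_equality : energy U V t = cosh t ^ 2 -> defect U V (t / 2) = 0.
Proof.
  intro E. pose proof (cosh_ge1 t) as C.
  assert (Zt : Z t = cosh t) by (rewrite Z_end, E; unfold ks; field; lra).
  assert (Zc : forall x, 0 < x < t -> Z x = cosh t).
  { intros x Hx. apply Rle_antisym; [rewrite <- Zt; apply Z_mono; lra|apply Z_low; lra]. }
  assert (H0 : Z' (t / 2) = 0).
  { assert (W0 : is_derive Z (t / 2) 0).
    { apply (is_derive_ext_loc (fun _ => cosh t)); [|apply d_const].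
      generalize (loc_in 0 t (t / 2) ltac:(lra)); apply filter_imp. intros y Hy. symmetry; now apply Zc. }
    apply is_derive_unique in W0. rewrite <- W0. symmetry. apply is_derive_unique, Z_derive. lra. }
  pose proof (Z'_ge (t / 2) ltac:(lra)) as G. pose proof coef_mid. pose proof (defect_ge0 b U V HR (t / 2) ltac:(lra)). nra.
Qed.
End Short.

(** * Modes of harmonic functions *)

Lemma exp_le_mono x y : x <= y -> exp x <= exp y.
Proof. intros [H| ->]; [left; now apply exp_increasing|right; reflexivity]. Qed.

Definition mode (a b : R) (n : nat) (x y : R -> R) : Prop :=
  (forall t, a < t < b -> is_derive x t (y t)) /\ (forall t, a < t < b -> is_derive y t (INR n ^ 2 * x t)).

(** Propagating the data at a variable time z to the fixed time t gives a quantity independent of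
    z. *)
Lemma mode_cosh n a b x y s t : (0 < n)%nat -> mode a b n x y -> a < s < b -> a < t < b ->
  x t = cosh (INR n * (t - s)) * x s + Sn (t - s) n * y s.
Proof.
  intros Hn [Dx Dy] Hs Ht. assert (n0 : 0 < INR n) by (apply lt_0_INR; lia).
  set (G := fun z => cosh (INR n * (t - z)) * x z + sinh (INR n * (t - z)) / INR n * y z).
  assert (E : G t = G s).
  { apply (der_const G a b); auto. intros z Hz.
    assert (L : is_derive (fun z => INR n * (t - z)) z (- INR n)).
    { eapply der_eq; [apply d_scal, d_minus; [apply d_const|apply d_id]|ring]. }
    eapply der_eq.
    - apply d_plus; apply d_mult; [|apply Dx, Hz| |apply Dy, Hz].
      + apply (d_comp (fun z => INR n * (t - z)) cosh); [apply d_cosh|exact L].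
      + apply (d_mult (fun z => sinh (INR n * (t - z))) (fun _ => / INR n)); [|apply d_const].
        apply (d_comp (fun z => INR n * (t - z)) sinh); [apply d_sinh|exact L].
    - cbv beta. field. lra. }
  unfold G in E. replace (t - t) with 0 in E by ring. rewrite Rmult_0_r, cosh_0, sinh_0 in E. unfold Sn. rewrite <- E. field. lra.
Qed.

Lemma mode_sinh n a b x y s t : (0 < n)%nat -> mode a b n x y -> a < s < b -> a < t < b ->
  y t = cosh (INR n * (t - s)) * y s + INR n * sinh (INR n * (t - s)) * x s.
Proof.
  intros Hn [Dx Dy] Hs Ht. assert (n0 : 0 < INR n) by (apply lt_0_INR; lia).
  set (G := fun z => cosh (INR n * (t - z)) * y z + INR n * sinh (INR n * (t - z)) * x z).
  assert (E : G t = G s).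
  { apply (der_const G a b); auto. intros z Hz.
    assert (L : is_derive (fun z => INR n * (t - z)) z (- INR n)).
    { eapply der_eq; [apply d_scal, d_minus; [apply d_const|apply d_id]|ring]. }
    eapply der_eq.
    - apply d_plus; apply d_mult; [|apply Dy, Hz| |apply Dx, Hz].
      + apply (d_comp (fun z => INR n * (t - z)) cosh); [apply d_cosh|exact L].
      + apply d_scal. apply (d_comp (fun z => INR n * (t - z)) sinh); [apply d_sinh|exact L].
    - cbv beta. ring. }
  unfold G in E. replace (t - t) with 0 in E by ring. rewrite Rmult_0_r, cosh_0, sinh_0 in E. lra.
Qed.

Lemma mode_zero a b x y s t : mode a b 0 x y -> a < s < b -> a < t < b -> y t = y s /\ x t = x s + (t - s) * y s.
Proof.
  intros [Dx Dy] Hs Ht.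
  assert (Y : y t = y s).
  { apply (der_const y a b); auto. intros z Hz. eapply der_eq; [apply Dy, Hz|]. simpl; ring. }
  split; auto.
  assert (E : x t + (t - t) * y t = x s + (t - s) * y s); [|lra].
  apply (der_const (fun z => x z + (t - z) * y z) a b); auto. intros z Hz.
  eapply der_eq; [apply d_plus; [apply Dx, Hz|apply d_mult; [apply d_minus; [apply d_const|apply d_id]|apply Dy, Hz]]|].
  simpl; ring.
Qed.

Lemma mode_vanish n a b x y s : mode a b n x y -> a < s < b -> x s = 0 -> y s = 0 -> forall t, a < t < b -> x t = 0.
Proof.
  intros M Hs X Y t Ht. destruct n as [|n].
  - destruct (mode_zero a b x y s t M Hs Ht) as [_ ->]. rewrite X, Y; ring.
  - rewrite (mode_cosh (S n) a b x y s t) by (auto; lia). rewrite X, Y; ring.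
Qed.

(** A mode that vanishes at t is [Sn] times its slope there, and sinh z >= z. In the equality case
    this transfers smallness near the inner circle to the slope at t. *)
Lemma mode_bvp n a b x y s t : mode a b n x y -> a < s < b -> a < t < b -> s < t ->  x t = 0 -> 
  Rabs (y t) * (t - s) <= Rabs (x s).
Proof.
  intros M Hs Ht L X. destruct n as [|n].
  - destruct (mode_zero a b x y t s M Ht Hs) as [_ ->]. rewrite X, Rplus_0_l, Rabs_mult, (Rabs_left (s - t)) by lra.
    rewrite Rmult_comm. lra.
  - rewrite (mode_cosh (S n) a b x y t s) by (auto; lia). rewrite X, Rmult_0_r, Rplus_0_l, Rabs_mult, Rmult_comm.
    apply Rmult_le_compat_r; [apply Rabs_pos|]. unfold Sn.
    assert (n0 : 0 < INR (S n)) by (apply lt_0_INR; lia).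
    replace (INR (S n) * (s - t)) with (- (INR (S n) * (t - s))) by ring.
    assert (E : sinh (- (INR (S n) * (t - s))) = - sinh (INR (S n) * (t - s))).
    { unfold sinh. rewrite Ropp_involutive. field. }
    rewrite E. unfold Rdiv. rewrite Ropp_mult_distr_l_reverse, Rabs_Ropp.
    assert (K : forall z, 0 < z -> z <= sinh z).
    { intros z Hz. destruct (MVT_cor2 sinh cosh 0 z Hz) as (c & E' & _).
      - intros; apply is_derive_Reals, d_sinh. - rewrite sinh_0 in E'. pose proof (cosh_ge1 c). nra. }
    pose proof (K (INR (S n) * (t - s)) ltac:(nra)) as K1.
    rewrite Rabs_pos_eq.
    + apply (Rmult_le_reg_r (INR (S n))); auto. rewrite Rmult_assoc, Rinv_l by lra. lra.
    + apply Rmult_le_pos; [nra|]. left; now apply Rinv_0_lt_compat.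
Qed.

Lemma sinh_opp z : sinh (- z) = - sinh z.
Proof. unfold sinh. rewrite Ropp_involutive. field. Qed.
Lemma cosh_opp z : cosh (- z) = cosh z.
Proof. unfold cosh. rewrite Ropp_involutive. field. Qed.

Lemma exp_INR n e : exp (- (INR n * e)) = exp (- e) ^ n.
Proof.
  induction n as [|n IH]; [simpl; rewrite Rmult_0_l, Ropp_0; apply exp_0|].
  rewrite S_INR. simpl. rewrite <- IH, <- exp_plus. f_equal. ring.
Qed.

(** From 2 cosh(n e) x(s) = x(s - e) + x(s + e). Interior circles thus have geometrically decaying
    coefficients, given only a uniform bound. *)
Lemma mode_decay n a b x y s e M : mode a b n x y -> 0 < e -> a < s - e -> s + e < b ->
  Rabs (x (s - e)) <= M -> Rabs (x (s + e)) <= M -> Rabs (x s) <= 2 * M * exp (- e) ^ n.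
Proof.
  intros H He A B M1 M2. assert (M0 : 0 <= M) by (pose proof (Rabs_pos (x (s - e))); lra).
  assert (Hs : a < s < b) by lra. destruct n as [|n].
  - destruct (mode_zero a b x y s (s - e) H) as [_ E1]; try lra.
    destruct (mode_zero a b x y s (s + e) H) as [_ E2]; try lra.
    apply Rabs_le_between in M1. apply Rabs_le_between in M2. simpl. apply Rabs_le; split; nra.
  - set (k := S n) in *. assert (k0 : (0 < k)%nat) by (unfold k; lia).
    pose proof (mode_cosh k a b x y s (s - e) k0 H Hs ltac:(lra)) as E1.
    pose proof (mode_cosh k a b x y s (s + e) k0 H Hs ltac:(lra)) as E2.
    replace (s - e - s) with (- e) in E1 by ring. replace (s + e - s) with e in E2 by ring.
    unfold Sn in E1, E2. replace (INR k * - e) with (- (INR k * e)) in E1 by ring. rewrite sinh_opp, cosh_opp in E1.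
    assert (E : 2 * cosh (INR k * e) * x s = x (s - e) + x (s + e)) by (rewrite E1, E2; unfold Rdiv; ring).
    assert (L : exp (INR k * e) <= 2 * cosh (INR k * e)).
    { unfold cosh. pose proof (exp_pos (- (INR k * e))). lra. }
    rewrite <- exp_INR. pose proof (exp_pos (INR k * e)) as P.
    assert (Q : exp (- (INR k * e)) * exp (INR k * e) = 1) by (rewrite <- exp_plus, <- exp_0; f_equal; ring).
    assert (A1 : exp (INR k * e) * Rabs (x s) <= 2 * M).
    { apply Rle_trans with (2 * cosh (INR k * e) * Rabs (x s)).
      - apply Rmult_le_compat_r; [apply Rabs_pos|exact L].
      - rewrite <- (Rabs_pos_eq (2 * cosh (INR k * e))) by lra. rewrite <- Rabs_mult, E.
        eapply Rle_trans; [apply Rabs_triang|]. lra. }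
    apply (Rmult_le_reg_l (exp (INR k * e))); auto. nra.
Qed.

(** From 2 sinh(n e) y(s) = n (x(s + e) - x(s - e)), which carries no information for n = 0. *)
Lemma mode_decay1 n a b x y s e M : mode a b n x y -> 0 < e -> a < s - e -> s + e < b ->
  Rabs (x (s - e)) <= M -> Rabs (x (s + e)) <= M -> (0 < n)%nat ->
  Rabs (y s) <= 2 * M / (1 - exp (- (2 * e))) * (INR n * exp (- e) ^ n).
Proof.
  intros H He A B M1 M2 k0. assert (M0 : 0 <= M) by (pose proof (Rabs_pos (x (s - e))); lra).
  assert (Hs : a < s < b) by lra.
  pose proof (mode_cosh n a b x y s (s - e) k0 H Hs ltac:(lra)) as E1.
  pose proof (mode_cosh n a b x y s (s + e) k0 H Hs ltac:(lra)) as E2.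
  replace (s - e - s) with (- e) in E1 by ring. replace (s + e - s) with e in E2 by ring.
  unfold Sn in E1, E2. replace (INR n * - e) with (- (INR n * e)) in E1 by ring. rewrite sinh_opp, cosh_opp in E1.
  assert (n0 : 1 <= INR n) by (replace 1 with (INR 1) by reflexivity; apply le_INR; lia).
  assert (E : 2 * sinh (INR n * e) * y s = INR n * (x (s + e) - x (s - e))) by (rewrite E1, E2; field; lra).
  assert (D0 : exp (- (2 * e)) < 1) by (rewrite <- exp_0; apply exp_increasing; lra).
  assert (L : exp (INR n * e) * (1 - exp (- (2 * e))) <= 2 * sinh (INR n * e)).
  { unfold sinh. assert (exp (- (INR n * e)) <= exp (INR n * e) * exp (- (2 * e))); [|lra].
    rewrite <- exp_plus. apply exp_le_mono. nra. }
  rewrite <- exp_INR. pose proof (exp_pos (INR n * e)) as P.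
  assert (Q : exp (- (INR n * e)) = / exp (INR n * e)) by apply exp_Ropp. rewrite Q.
  assert (A1 : exp (INR n * e) * (1 - exp (- (2 * e))) * Rabs (y s) <= INR n * (2 * M)).
  { apply Rle_trans with (2 * sinh (INR n * e) * Rabs (y s)).
    - apply Rmult_le_compat_r; [apply Rabs_pos|exact L].
    - assert (0 < sinh (INR n * e)) by (apply sinh_pos; nra).
      rewrite <- (Rabs_pos_eq (2 * sinh (INR n * e))) by lra. rewrite <- Rabs_mult, E, Rabs_mult, (Rabs_pos_eq (INR n)) by lra.
      apply Rmult_le_compat_l; [lra|]. apply Rabs_le_between in M1. apply Rabs_le_between in M2. apply Rabs_le; lra. }
  apply (Rmult_le_reg_l (exp (INR n * e) * (1 - exp (- (2 * e))))); [nra|].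
  replace (exp (INR n * e) * (1 - exp (- (2 * e))) * (2 * M / (1 - exp (- (2 * e))) * (INR n * / exp (INR n * e)))) with (INR n * (2 * M)) by (field; lra).
  exact A1.
Qed.

Definition kap (n : nat) : R := match n with O => 1 | S _ => 2 end.
Lemma fcos_kap f n : fcos f n = kap n * mean (fun q => f q * cos (INR n * q)).
Proof.
  destruct n as [|n]; [|reflexivity]. unfold fcos, kap. rewrite Rmult_1_l. apply mean_ext; intro q.
  simpl. rewrite Rmult_0_l, cos_0; ring.
Qed.

Lemma fs0 f : fsin f 0 = 0.
Proof.
  unfold fsin. rewrite (mean_ext _ (fun _ => 0)); [rewrite mean_const; ring|]. intro q. simpl. rewrite Rmult_0_l, sin_0; ring.
Qed.

Lemma fcos_ext f g n : (forall q, f q = g q) -> fcos f n = fcos g n.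
Proof. intro E. rewrite !fcos_kap. f_equal. apply mean_ext; intro; now rewrite E. Qed.
Lemma fsin_ext f g n : (forall q, f q = g q) -> fsin f n = fsin g n.
Proof. intro E. unfold fsin. f_equal. apply mean_ext; intro; now rewrite E. Qed.

Lemma dcosn n q : is_derive (fun q => cos (INR n * q)) q (- INR n * sin (INR n * q)).
Proof.
  eapply der_eq; [apply (d_comp (fun q => INR n * q) cos); [apply is_derive_cos|apply d_scal, d_id]|]. ring.
Qed.
Lemma dsinn n q : is_derive (fun q => sin (INR n * q)) q (INR n * cos (INR n * q)).
Proof.
  eapply der_eq; [apply (d_comp (fun q => INR n * q) sin); [apply is_derive_sin|apply d_scal, d_id]|]. ring.
Qed.

Lemma fcos_der f f' n : (forall q, is_derive f q (f' q)) -> cts f' -> per f -> fcos f' n = INR n * fsin f n.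
Proof.
  intros D C P. rewrite fcos_kap. unfold fsin.
  assert (Cf : cts f) by (intro x; apply (ex_derive_continuous f x); eexists; apply D).
  rewrite (mean_ext _ (fun q => cos (INR n * q) * f' q)) by (intro; ring).
  rewrite (mean_parts (fun q => cos (INR n * q)) f (fun q => - INR n * sin (INR n * q)) f'); auto 20 with cts.
  - rewrite (mean_ext _ (fun q => - INR n * (f q * sin (INR n * q)))) by (intro; ring).
    rewrite mean_scal by auto 20 with cts. destruct n; unfold kap; [simpl; ring|ring].
  - apply dcosn.
  - intro; apply cosn_per.
Qed.
Lemma fsin_der f f' n : (forall q, is_derive f q (f' q)) -> cts f' -> per f -> fsin f' n = - INR n * fcos f n.
Proof.
  intros D C P. rewrite fcos_kap. unfold fsin.
  assert (Cf : cts f) by (intro x; apply (ex_derive_continuous f x); eexists; apply D).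
  rewrite (mean_ext _ (fun q => sin (INR n * q) * f' q)) by (intro; ring).
  rewrite (mean_parts (fun q => sin (INR n * q)) f (fun q => INR n * cos (INR n * q)) f'); auto 20 with cts.
  - rewrite (mean_ext _ (fun q => INR n * (f q * cos (INR n * q)))) by (intro; ring).
    rewrite mean_scal by auto 20 with cts. destruct n; unfold kap; [simpl; ring|ring].
  - apply dsinn.
  - intro; apply sinn_per.
Qed.

Section Modes.
Variables (a b : R) (U : jet).
Hypothesis HU : harm a b U.

Lemma jet_cts t : a < t < b -> cts (j0 U t) /\ cts (jt U t) /\ cts (jq U t) /\ cts (jtt U t) /\ cts (jtq U t) /\ cts (jqq U t).
Proof. intro H. destruct HU. repeat split; eapply C2_slice; eauto. Qed.

Lemma mean_weight_mode e f ft : Dt a b f ft -> C2 a b f -> C2 a b ft -> cts e ->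
  forall t, a < t < b -> is_derive (fun t => mean (fun q => f t q * e q)) t (mean (fun q => ft t q * e q)).
Proof.
  intros D C C' Ce t Ht.
  assert (Ce' : C2 a b (fun _ q => e q)) by (now apply C2_snd).
  apply (mean_Dt a b (fun t q => f t q * e q) (fun t q => ft t q * e q)); auto; [|c2t|c2t].
  eapply Dt_eq; [apply Dt_mult; [exact D|apply Dt_snd]|]. intros; cbv beta; ring.
Qed.

Lemma tt_mode t : a < t < b -> forall n, fcos (jtt U t) n = INR n ^ 2 * fcos (j0 U t) n /\ fsin (jtt U t) n = INR n ^ 2 * fsin (j0 U t) n.
Proof.
  intros Ht n. destruct (jet_cts t Ht) as (? & ? & ? & ? & ? & ?).
  assert (E : forall q, jtt U t q = - jqq U t q) by (intro q; pose proof (h_lap _ _ _ HU t q Ht); lra).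
  assert (E1 : forall q, is_derive (j0 U t) q (jq U t q)) by (intro; apply (h_q _ _ _ HU); auto).
  assert (E2 : forall q, is_derive (jq U t) q (jqq U t q)) by (intro; apply (h_qq _ _ _ HU); auto).
  assert (P0' : per (j0 U t)) by (intro; apply (h_p _ _ _ HU)).
  assert (P1' : per (jq U t)) by (intro; apply (h_pq _ _ _ HU)).
  rewrite (fcos_ext _ (fun q => - jqq U t q)), (fsin_ext _ (fun q => - jqq U t q)) by auto.
  assert (N1 : fcos (fun q => - jqq U t q) n = - fcos (jqq U t) n).
  { rewrite !fcos_kap. rewrite (mean_ext _ (fun q => - (jqq U t q * cos (INR n * q)))) by (intro; ring).
    rewrite mean_opp by auto 20 with cts. ring. }
  assert (N2 : fsin (fun q => - jqq U t q) n = - fsin (jqq U t) n).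
  { unfold fsin. rewrite (mean_ext _ (fun q => - (jqq U t q * sin (INR n * q)))) by (intro; ring).
    rewrite mean_opp by auto 20 with cts. ring. }
  rewrite N1, N2, (fcos_der (jq U t) (jqq U t)), (fsin_der (jq U t) (jqq U t)), (fsin_der (j0 U t) (jq U t)), (fcos_der (j0 U t) (jq U t)) by auto.
  split; ring.
Qed.

Lemma fcos_mode n : mode a b n (fun t => fcos (j0 U t) n) (fun t => fcos (jt U t) n).
Proof.
  destruct HU. split; intros t Ht.
  - apply (is_derive_ext (fun t => kap n * mean (fun q => j0 U t q * cos (INR n * q)))); [intro; symmetry; apply fcos_kap|].
    rewrite fcos_kap. apply d_scal. apply (mean_weight_mode (fun q => cos (INR n * q)) (j0 U) (jt U)); auto 20 with cts.
  - rewrite <- (proj1 (tt_mode t Ht n)).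
    apply (is_derive_ext (fun t => kap n * mean (fun q => jt U t q * cos (INR n * q)))); [intro; symmetry; apply fcos_kap|].
    rewrite fcos_kap. apply d_scal. apply (mean_weight_mode (fun q => cos (INR n * q)) (jt U) (jtt U)); auto 20 with cts.
Qed.
Lemma fsin_mode n : mode a b n (fun t => fsin (j0 U t) n) (fun t => fsin (jt U t) n).
Proof.
  destruct HU. split; intros t Ht.
  - apply d_scal. apply (mean_weight_mode (fun q => sin (INR n * q)) (j0 U) (jt U)); auto 20 with cts.
  - rewrite <- (proj2 (tt_mode t Ht n)).
    apply d_scal. apply (mean_weight_mode (fun q => sin (INR n * q)) (jt U) (jtt U)); auto 20 with cts.
Qed.
End Modes.

Lemma coef_bound f n : cts f -> Rabs (fcos f n) <= 1 + mean (fun q => f q ^ 2) /\ Rabs (fsin f n) <= 1 + mean (fun q => f q ^ 2).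
Proof.
  intro C.
  assert (B : forall e, cts e -> (forall q, Rabs (e q) <= 1) -> Rabs (2 * mean (fun q => f q * e q)) <= 1 + mean (fun q => f q ^ 2)).
  { intros e Ce He. rewrite <- mean_scal by auto with cts.
    rewrite <- (mean_const 1) at 1. rewrite <- mean_plus by auto with cts. apply Rabs_le; split.
    - rewrite <- mean_opp by auto with cts. apply mean_le; auto 20 with cts. intro q. specialize (He q).
      apply Rabs_le_between in He. pose proof (pow2_ge_0 (f q + e q)). nra.
    - apply mean_le; auto 20 with cts. intro q. specialize (He q).
      apply Rabs_le_between in He. pose proof (pow2_ge_0 (f q - e q)). nra. }
  split.
  - rewrite fcos_kap. pose proof (B (fun q => cos (INR n * q)) ltac:(auto with cts)) as B1.
    assert (Rabs (2 * mean (fun q => f q * cos (INR n * q))) <= 1 + mean (fun q => f q ^ 2)).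
    { apply B1. intro q. apply Rabs_le. pose proof (COS_bound (INR n * q)). lra. }
    eapply Rle_trans; [|exact H]. rewrite !Rabs_mult. apply Rmult_le_compat_r; [apply Rabs_pos|].
    destruct n; unfold kap; rewrite !Rabs_pos_eq; lra.
  - apply B; auto with cts. intro q. apply Rabs_le. pose proof (SIN_bound (INR n * q)). lra.
Qed.

Lemma lip_of_der f f' B : (forall x, is_derive f x (f' x)) -> (forall x, Rabs (f' x) <= B) ->
  forall x y, Rabs (f x - f y) <= B * Rabs (x - y).
Proof.
  intros D H x y. destruct (MVT_gen f y x f') as (c & _ & E).
  - intros; apply D.
  - intros z _. apply continuity_pt_filterlim, (ex_derive_continuous f z). eexists; apply D.
  - rewrite E, Rabs_mult. apply Rmult_le_compat_r; [apply Rabs_pos|apply H].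
Qed.

Lemma poly_derive N X Y q : is_derive (poly N X Y) q (poly N (fun n => INR n * Y n) (fun n => - INR n * X n) q).
Proof.
  unfold poly. induction (S N) as [|m IH]; simpl sm; [apply d_const|].
  apply (d_plus (fun q => sm m (fun n => X n * cos (INR n * q) + Y n * sin (INR n * q))) (fun q => X m * cos (INR m * q) + Y m * sin (INR m * q))); auto.
  eapply der_eq; [apply d_plus; apply d_scal; [apply dcosn|apply dsinn]|]. ring.
Qed.

Lemma Rabs_trig X Y z : Rabs (X * cos z + Y * sin z) <= Rabs X + Rabs Y.
Proof.
  eapply Rle_trans; [apply Rabs_triang|]. rewrite !Rabs_mult.
  assert (Rabs (cos z) <= 1) by (apply Rabs_le; pose proof (COS_bound z); lra).
  assert (Rabs (sin z) <= 1) by (apply Rabs_le; pose proof (SIN_bound z); lra).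
  pose proof (Rabs_pos X). pose proof (Rabs_pos Y). pose proof (Rabs_pos (cos z)). pose proof (Rabs_pos (sin z)). nra.
Qed.

Lemma sm_abs n f : Rabs (sm n f) <= sm n (fun i => Rabs (f i)).
Proof. induction n as [|n IH]; simpl; [rewrite Rabs_R0; lra|]. eapply Rle_trans; [apply Rabs_triang|]. lra. Qed.

Lemma sm_geo n a : 0 <= a < 1 -> sm n (fun i => a ^ i) <= / (1 - a).
Proof.
  intro H. assert (E : (1 - a) * sm n (fun i => a ^ i) = 1 - a ^ n).
  { induction n as [|n IH]; simpl; [ring|]. rewrite Rmult_plus_distr_l, IH. ring. }
  apply (Rmult_le_reg_l (1 - a)); [lra|]. rewrite E, Rinv_r by lra. pose proof (pow_le a n ltac:(lra)). lra.
Qed.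

(** * Geometrically decaying coefficients and truncated Fourier series *)

Definition geo (C a : R) (X : nat -> R) : Prop := forall n, Rabs (X n) <= C * a ^ n.

(** Half of the decay pays for the factor n: a^n = (sqrt a)^n (sqrt a)^n and n (sqrt a)^n is
    bounded. *)
Lemma geo_INR C a X : 0 <= a < 1 -> 0 <= C -> geo C a X -> geo (C / (1 - sqrt a)) (sqrt a) (fun n => INR n * X n).
Proof.
  intros H HC G n. set (r := sqrt a). assert (r2 : r * r = a) by (apply sqrt_sqrt; lra).
  assert (r0 : 0 <= r) by apply sqrt_pos. assert (r1 : r < 1) by nra.
  rewrite Rabs_mult, (Rabs_pos_eq (INR n)) by apply pos_INR.
  eapply Rle_trans; [apply Rmult_le_compat_l; [apply pos_INR|apply G]|].
  rewrite <- r2, Rpow_mult_distr. unfold Rdiv.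
  pose proof (INR_pow_bound r ltac:(lra) n) as B. pose proof (pow_le r n r0).
  replace (INR n * (C * (r ^ n * r ^ n))) with (C * r ^ n * (INR n * r ^ n)) by ring.
  replace (C * / (1 - r) * r ^ n) with (C * r ^ n * / (1 - r)) by ring.
  apply Rmult_le_compat_l; auto. apply Rmult_le_pos; auto.
Qed.

Lemma poly_bound_geo N C a X Y q : 0 <= a < 1 -> 0 <= C -> geo C a X -> geo C a Y ->
  Rabs (poly N X Y q) <= 2 * C / (1 - a).
Proof.
  intros H HC GX GY. unfold poly. eapply Rle_trans; [apply sm_abs|].
  apply Rle_trans with (sm (S N) (fun i => 2 * C * a ^ i)).
  - apply sm_le; intros i _. eapply Rle_trans; [apply Rabs_trig|]. specialize (GX i). specialize (GY i). lra.
  - rewrite sm_scal. apply Rmult_le_compat_l; [lra|]. now apply sm_geo.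
Qed.

Lemma poly_tail_geo N k C a X Y q : 0 <= a < 1 -> 0 <= C -> geo C a X -> geo C a Y ->
  Rabs (poly (k + N) X Y q - poly N X Y q) <= 2 * C * a ^ S N / (1 - a).
Proof.
  intros H HC GX GY.
  assert (E : poly (k + N) X Y q - poly N X Y q = sm k (fun i => X (i + S N)%nat * cos (INR (i + S N) * q) + Y (i + S N)%nat * sin (INR (i + S N) * q))).
  { induction k as [|k IH]; [simpl; ring|]. simpl sm. rewrite <- IH. unfold poly.
    change (S (S k + N)) with (S (S (k + N))). change (sm (S (S (k + N))) ?f) with (sm (S (k + N)) f + f (S (k + N))).
    replace (k + S N)%nat with (S (k + N)) by lia. cbv beta. ring. }
  rewrite E. eapply Rle_trans; [apply sm_abs|].
  apply Rle_trans with (sm k (fun i => 2 * C * a ^ S N * a ^ i)).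
  - apply sm_le; intros i _. eapply Rle_trans; [apply Rabs_trig|]. specialize (GX (i + S N)%nat). specialize (GY (i + S N)%nat).
    rewrite pow_add in GX, GY. lra.
  - rewrite sm_scal. apply Rmult_le_compat_l; [|now apply sm_geo]. pose proof (pow_le a (S N) ltac:(lra)). nra.
Qed.

(** The remainder of a long partial sum has no low modes and a Lipschitz constant independent of the
    length, so [low_modes_small] sends it to 0; the distance between partial sums is a geometric
    tail. Convergence of the Fourier series to f comes out of this argument. *)
Lemma trunc_geo f f' C a : (forall x, is_derive f x (f' x)) -> cts f' -> per f -> per f' -> 0 <= a < 1 -> 0 <= C ->
  geo C a (fcos f) -> geo C a (fsin f) ->
  forall N q, Rabs (f q - poly N (fcos f) (fsin f) q) <= 2 * C * a ^ S N / (1 - a).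
Proof.
  intros D Cf' P P' Ha HC GX GY N q.
  assert (Cf : cts f) by (intro x; apply (ex_derive_continuous f x); eexists; apply D).
  destruct (per_max f' Cf' P') as (B & B0 & HB).
  set (K := 2 * (C / (1 - sqrt a)) / (1 - sqrt a)).
  assert (r2 : sqrt a * sqrt a = a) by (apply sqrt_sqrt; lra).
  assert (r0 : 0 <= sqrt a) by apply sqrt_pos. assert (r1 : sqrt a < 1) by nra.
  assert (C1 : 0 <= C / (1 - sqrt a)) by (apply Rmult_le_pos; auto; left; apply Rinv_0_lt_compat; lra).
  assert (K0 : 0 <= K) by (apply Rmult_le_pos; [lra|left; apply Rinv_0_lt_compat; lra]).
  assert (App : forall M, Rabs (f q - poly (S M) (fcos f) (fsin f) q) <= 12 * (B + K) / sqrt (INR (S M))).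
  { intro M. apply (low_modes_small (fun x => f x - poly (S M) (fcos f) (fsin f) x)).
    - auto 20 with cts.
    - intro x. rewrite P, poly_per. reflexivity.
    - apply (lip_of_der _ (fun x => f' x - poly (S M) (fun n => INR n * fsin f n) (fun n => - INR n * fcos f n) x)).
      + intro x. apply d_minus; auto. apply poly_derive.
      + intro x. unfold Rminus. eapply Rle_trans; [apply Rabs_triang|]. rewrite Rabs_Ropp.
        apply Rplus_le_compat; [apply HB|]. apply poly_bound_geo; [lra|exact C1| |].
        * apply geo_INR; auto.
        * intro n. rewrite Ropp_mult_distr_l_reverse, Rabs_Ropp. apply (geo_INR C a (fcos f)); auto.
    - intros n Hn. rewrite (mean_ext _ (fun x => f x * cos (INR n * x) - poly (S M) (fcos f) (fsin f) x * cos (INR n * x))) by (intro; ring).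
      rewrite mean_minus by auto 20 with cts. destruct n as [|n].
      + rewrite (mean_ext _ f) by (intro; simpl; rewrite Rmult_0_l, cos_0; ring).
        rewrite (mean_ext (fun x => poly _ _ _ x * _) (poly (S M) (fcos f) (fsin f))) by (intro; simpl INR; rewrite Rmult_0_l, cos_0; ring).
        rewrite coef_poly_0. simpl; ring.
      + rewrite coef_poly_cos by lia. unfold fcos. field.
    - intros n Hn. rewrite (mean_ext _ (fun x => f x * sin (INR n * x) - poly (S M) (fcos f) (fsin f) x * sin (INR n * x))) by (intro; ring).
      rewrite mean_minus by auto 20 with cts. destruct n as [|n].
      + rewrite (mean_ext _ (fun _ => 0)) by (intro; simpl; rewrite Rmult_0_l, sin_0; ring).
        rewrite (mean_ext (fun x => poly _ _ _ x * _) (fun _ => 0)) by (intro; simpl INR; rewrite Rmult_0_l, sin_0; ring). ring.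
      + rewrite coef_poly_sin by lia. unfold fsin. field. }
  apply Rnot_lt_le. intro L. set (T := 2 * C * a ^ S N / (1 - a)) in *.
  set (g := Rabs (f q - poly N (fcos f) (fsin f) q) - T). assert (g0 : 0 < g) by (unfold g; lra).
  (* A length for which the remainder of the long sum falls below the supposed excess g. *)
  destruct (nfloor_ex ((12 * (B + K) / g) ^ 2)) as (k & _ & Hk); [apply pow2_ge_0|].
  pose proof (App (k + N)%nat) as A. pose proof (poly_tail_geo N (S k) C a (fcos f) (fsin f) q Ha HC GX GY) as Tl.
  change (S k + N)%nat with (S (k + N)) in Tl. fold T in Tl.
  assert (sq : 12 * (B + K) / g < sqrt (INR (S (k + N)))).
  { assert (I : (12 * (B + K) / g) ^ 2 < INR (S (k + N))).
    { rewrite S_INR, plus_INR. pose proof (pos_INR N). lra. }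
    rewrite <- (sqrt_pow2 (12 * (B + K) / g)).
    - apply sqrt_lt_1; auto; [apply pow2_ge_0|apply pos_INR].
    - apply Rmult_le_pos; [lra|left; now apply Rinv_0_lt_compat]. }
  assert (s0 : 0 <= 12 * (B + K) / g) by (apply Rmult_le_pos; [lra|left; now apply Rinv_0_lt_compat]).
  set (w := sqrt (INR (S (k + N)))) in *.
  assert (12 * (B + K) / w < g).
  { apply (Rmult_lt_reg_r w); [lra|]. replace (12 * (B + K) / w * w) with (12 * (B + K)) by (field; lra).
    apply (Rmult_lt_compat_r g) in sq; auto. replace (12 * (B + K) / g * g) with (12 * (B + K)) in sq by (field; lra). lra. }
  assert (Rabs (f q - poly N (fcos f) (fsin f) q) <= Rabs (f q - poly (S (k + N)) (fcos f) (fsin f) q) + Rabs (poly (S (k + N)) (fcos f) (fsin f) q - poly N (fcos f) (fsin f) q)).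
  { replace (f q - poly N (fcos f) (fsin f) q) with ((f q - poly (S (k + N)) (fcos f) (fsin f) q) + (poly (S (k + N)) (fcos f) (fsin f) q - poly N (fcos f) (fsin f) q)) by ring. apply Rabs_triang. }
  unfold g in *. lra.
Qed.

Lemma fcos_shift f p n : cts f -> per f -> fcos (fun q => f (q + p)) n = fcos f n * cos (INR n * p) + fsin f n * sin (INR n * p).
Proof.
  intros C P. rewrite !fcos_kap.
  rewrite <- (mean_shift (fun q => f (q + p) * cos (INR n * q)) (- p)).
  - rewrite (mean_ext _ (fun q => cos (INR n * p) * (f q * cos (INR n * q)) + sin (INR n * p) * (f q * sin (INR n * q)))).
    + rewrite mean_plus, !mean_scal by auto 20 with cts. unfold fsin.
      destruct n; unfold kap; [simpl; rewrite Rmult_0_l, sin_0|]; ring.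
    + intro q. replace (q + - p + p) with q by ring. replace (INR n * (q + - p)) with (INR n * q - INR n * p) by ring.
      rewrite cos_minus. ring.
  - apply cts_mult; auto with cts. apply (cts_comp (fun q => q + p) f); auto with cts.
  - intro q. rewrite cosn_per. replace (q + 2 * PI + p) with (q + p + 2 * PI) by ring. now rewrite P.
Qed.
Lemma fsin_shift f p n : cts f -> per f -> fsin (fun q => f (q + p)) n = fsin f n * cos (INR n * p) - fcos f n * sin (INR n * p).
Proof.
  intros C P. rewrite !fcos_kap. unfold fsin.
  rewrite <- (mean_shift (fun q => f (q + p) * sin (INR n * q)) (- p)).
  - rewrite (mean_ext _ (fun q => cos (INR n * p) * (f q * sin (INR n * q)) - sin (INR n * p) * (f q * cos (INR n * q)))).
    + rewrite mean_minus, !mean_scal by auto 20 with cts.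
      destruct n; unfold kap; [simpl; rewrite Rmult_0_l, sin_0|]; ring.
    + intro q. replace (q + - p + p) with q by ring. replace (INR n * (q + - p)) with (INR n * q - INR n * p) by ring.
      rewrite sin_minus. ring.
  - apply cts_mult; auto with cts. apply (cts_comp (fun q => q + p) f); auto with cts.
  - intro q. rewrite sinn_per. replace (q + 2 * PI + p) with (q + p + 2 * PI) by ring. now rewrite P.
Qed.

(** * Zeros of the decaying extension *)

(* The harmonic extension into the disk of the Fourier data [X], [Y], at the point of polar radius [exp (- s)] and angle [q]. *)
Definition pe (N : nat) (X Y : nat -> R) (s q : R) : R :=
  sm (S N) (fun n => exp (- s) ^ n * (X n * cos (INR n * q) + Y n * sin (INR n * q))).

Lemma pe_ext N X Y X' Y' s q : (forall n, X n = X' n) -> (forall n, Y n = Y' n) -> pe N X Y s q = pe N X' Y' s q.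
Proof. intros EX EY. apply sm_ext; intros n _. now rewrite EX, EY. Qed.

Lemma d_expn n s : is_derive (fun s => exp (- s) ^ n) s (- INR n * exp (- s) ^ n).
Proof.
  apply (is_derive_ext (fun s => exp (- (INR n * s)))).
  - intro x. apply exp_INR.
  - rewrite <- exp_INR. eapply der_eq.
    + apply (d_comp (fun s => - (INR n * s)) exp); [apply is_derive_exp|].
      apply (d_opp (fun s => INR n * s)), d_scal, d_id.
    + ring.
Qed.

Lemma pe_Dt a b N X Y : Dt a b (pe N X Y) (pe N (fun n => - INR n * X n) (fun n => - INR n * Y n)).
Proof.
  intros s q _. unfold pe. induction (S N) as [|m IH]; simpl sm; [apply d_const|].
  apply (d_plus (fun s => sm m (fun n => exp (- s) ^ n * (X n * cos (INR n * q) + Y n * sin (INR n * q))))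
    (fun s => exp (- s) ^ m * (X m * cos (INR m * q) + Y m * sin (INR m * q)))); auto.
  eapply der_eq; [apply d_mult; [apply d_expn|apply d_const]|]. cbv beta; ring.
Qed.
Lemma pe_Dq a b N X Y : Dq a b (pe N X Y) (pe N (fun n => INR n * Y n) (fun n => - INR n * X n)).
Proof.
  intros s q _. unfold pe. induction (S N) as [|m IH]; simpl sm; [apply d_const|].
  apply (d_plus (fun q => sm m (fun n => exp (- s) ^ n * (X n * cos (INR n * q) + Y n * sin (INR n * q))))
    (fun q => exp (- s) ^ m * (X m * cos (INR m * q) + Y m * sin (INR m * q)))); auto.
  eapply der_eq; [apply d_scal, d_plus; apply d_scal; [apply dcosn|apply dsinn]|]. cbv beta; ring.
Qed.
Lemma pe_C2 a b N X Y : C2 a b (pe N X Y).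
Proof.
  unfold pe. induction (S N) as [|m IH]; simpl sm; [apply C2_const|]. apply C2_plus; auto.
  apply C2_mult.
  - apply (C2_fst a b (fun s => exp (- s) ^ m)). intro x.
    apply (ex_derive_continuous (fun s => exp (- s) ^ m) x); eexists; apply d_expn.
  - apply (C2_snd a b (fun q => X m * cos (INR m * q) + Y m * sin (INR m * q))). auto 20 with cts.
Qed.
Lemma pe_Per N X Y : Per (pe N X Y).
Proof. intros s q. apply sm_ext; intros n _. now rewrite cosn_per, sinn_per. Qed.

Definition pjet (N : nat) (X Y : nat -> R) : jet :=
  Jet (pe N X Y) (pe N (fun n => - INR n * X n) (fun n => - INR n * Y n))
    (pe N (fun n => INR n * Y n) (fun n => - INR n * X n))
    (pe N (fun n => INR n ^ 2 * X n) (fun n => INR n ^ 2 * Y n))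
    (pe N (fun n => - INR n ^ 2 * Y n) (fun n => INR n ^ 2 * X n))
    (pe N (fun n => - INR n ^ 2 * X n) (fun n => - INR n ^ 2 * Y n)).

Lemma pjet_harm a b N X Y : harm a b (pjet N X Y).
Proof.
  constructor; simpl; try apply pe_C2; try apply pe_Per.
  - apply pe_Dt.
  - apply pe_Dq.
  - eapply Dt_eq; [apply pe_Dt|]. intros; apply pe_ext; intro; ring.
  - eapply Dq_eq; [apply pe_Dq|]. intros; apply pe_ext; intro; ring.
  - eapply Dt_eq; [apply pe_Dt|]. intros; apply pe_ext; intro; ring.
  - eapply Dq_eq; [apply pe_Dq|]. intros; apply pe_ext; intro; ring.
  - intros t q _. unfold pe. rewrite <- sm_plus. rewrite (sm_ext _ _ (fun n => 0 * 0)); [rewrite sm_scal; ring|].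
    intros; ring.
Qed.

Lemma pe_0 N X Y q : pe N X Y 0 q = poly N X Y q.
Proof. apply sm_ext; intros n _. rewrite Ropp_0, exp_0, pow1. ring. Qed.

Lemma pe_tail N X Y s q : 0 <= s -> Rabs (pe N X Y s q - X O) <= exp (- s) * sm N (fun n => Rabs (X (S n)) + Rabs (Y (S n))).
Proof.
  intro Hs. assert (E0 : 0 < exp (- s) <= 1).
  { split; [apply exp_pos|]. rewrite <- exp_0. apply exp_le_mono; lra. }
  unfold pe. rewrite sm_shift. simpl (INR 0). rewrite Rmult_0_l, cos_0, sin_0. change (exp (- s) ^ 0) with 1.
  replace (1 * (X O * 1 + Y O * 0) + _ - X O) with (sm N (fun i => exp (- s) ^ S i * (X (S i) * cos (INR (S i) * q) + Y (S i) * sin (INR (S i) * q)))) by ring.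
  eapply Rle_trans; [apply sm_abs|]. rewrite <- sm_scal. apply sm_le; intros i _.
  rewrite Rabs_mult. pose proof (Rabs_trig (X (S i)) (Y (S i)) (INR (S i) * q)) as T.
  assert (P : 0 <= exp (- s) ^ S i <= exp (- s)).
  { split; [apply pow_le; lra|]. simpl. assert (exp (- s) ^ i <= 1) by (rewrite <- (pow1 i); apply pow_incr; lra). nra. }
  rewrite Rabs_pos_eq by lra. apply Rmult_le_compat; auto; [lra|apply Rabs_pos|lra].
Qed.

Section Zero.
Variables (N : nat) (X Y X' Y' : nat -> R) (d m : R).
Let U := pjet N X Y.
Let V := pjet N X' Y'.
Hypothesis Hd : 0 < d.
Hypothesis Hm : 0 < m.
Hypothesis Near : forall s q, - d < s < m -> 0 < nsq U V s q.
Hypothesis Wind : 0 < mean (fun q => ang U V 0 q / nsq U V 0 q).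

Lemma nsq_nonneg s q : 0 <= nsq U V s q.
Proof. unfold nsq. pose proof (Rle_0_sqr (j0 U s q)). pose proof (Rle_0_sqr (j0 V s q)). unfold Rsqr in *. lra. Qed.

(** Argument principle. Without a zero in the disk of radius e^{-m} the map would have no zero at
    all, its winding would be the same for all s >= 0, and it would tend to 0 as s -> oo, where the
    map approaches a nonzero constant. *)
Lemma zero_exists : exists a p, 0 <= a <= exp (- m) /\
  sm (S N) (fun n => (X n * cos (INR n * p) + Y n * sin (INR n * p)) * a ^ n) = 0 /\
  sm (S N) (fun n => (X' n * cos (INR n * p) + Y' n * sin (INR n * p)) * a ^ n) = 0.
Proof.
  apply Classical_Prop.NNPP. intro No.
  assert (Pos : forall s q, - d < s -> 0 < nsq U V s q).
  { intros s q Hs. destruct (Rlt_le_dec s m) as [L|L]; [apply Near; lra|].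
    destruct (nsq_nonneg s q) as [P|P]; auto. exfalso. apply No. exists (exp (- s)), q.
    split; [split; [left; apply exp_pos|apply exp_le_mono; lra]|].
    unfold nsq in P. assert (j0 U s q = 0 /\ j0 V s q = 0) as [Z1 Z2] by (split; nra).
    split; [rewrite <- Z1|rewrite <- Z2]; apply sm_ext; intros n _; ring. }
  (* The centre of the disk is not of the form e^{-s}; a zero there is the witness a = 0. *)
  assert (C0 : 0 < X O * X O + X' O * X' O).
  { destruct (Req_dec (X O) 0) as [E1|]; [|nra]. destruct (Req_dec (X' O) 0) as [E2|]; [|nra].
    exfalso. apply No. exists 0, 0. split; [split; [lra|left; apply exp_pos]|].
    assert (Z : forall A B : nat -> R, A O = 0 -> sm (S N) (fun n => (A n * cos (INR n * 0) + B n * sin (INR n * 0)) * 0 ^ n) = 0).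
    { intros A B HA. rewrite sm_shift, HA. rewrite Rmult_0_r, sin_0.
      rewrite (sm_ext N _ (fun n => 0 * 0)); [rewrite sm_scal; ring|]. intros n _. simpl; ring. }
    split; now apply Z. }
  set (M := X O * X O + X' O * X' O) in *.
  set (w := fun s => mean (fun q => ang U V s q / nsq U V s q)).
  assert (Const : forall s, 0 <= s -> w s = w 0).
  { intros s Hs. apply (der_const w (- d) (s + 1)); try lra. intros t Ht.
    pose proof (wnd_derive (- d) (s + 1) U V (pjet_harm _ _ N X Y) (pjet_harm _ _ N X' Y')
      (fun t q H => Pos t q (proj1 H)) (fun _ => 1) (fun _ => 0) (d_const 1) (cts_const 0) t Ht) as W.
    rewrite (mean_ext _ (fun _ => 0)) in W by (intro; ring). rewrite mean_const in W.
    apply (is_derive_ext (wnd U V (fun _ => 1))); auto. intro x. unfold wnd, w. apply mean_ext; intro q. unfold Rdiv; ring. }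
  set (K := sm N (fun n => Rabs (X (S n)) + Rabs (Y (S n))) + sm N (fun n => Rabs (X' (S n)) + Rabs (Y' (S n)))
     + sm N (fun n => Rabs (INR (S n) * Y (S n)) + Rabs (- INR (S n) * X (S n))) + sm N (fun n => Rabs (INR (S n) * Y' (S n)) + Rabs (- INR (S n) * X' (S n)))).
  assert (Ks : forall f g : nat -> R, 0 <= sm N (fun n => Rabs (f n) + Rabs (g n))).
  { intros f g. apply sm_ge0; intros. pose proof (Rabs_pos (f i)). pose proof (Rabs_pos (g i)). lra. }
  pose proof (Ks (fun n => X (S n)) (fun n => Y (S n))) as K1. pose proof (Ks (fun n => X' (S n)) (fun n => Y' (S n))) as K2.
  pose proof (Ks (fun n => INR (S n) * Y (S n)) (fun n => - INR (S n) * X (S n))) as K3.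
  pose proof (Ks (fun n => INR (S n) * Y' (S n)) (fun n => - INR (S n) * X' (S n))) as K4. cbv beta in K1, K2, K3, K4.
  assert (K0 : 0 <= K) by (unfold K; lra).
  assert (Tail : forall e, 0 < e -> exists s, 0 <= s /\ exp (- s) * K < e).
  { intros e He. exists (K / e). split; [apply Rmult_le_pos; auto; left; now apply Rinv_0_lt_compat|].
    assert (E : 1 + K / e <= exp (K / e)) by apply exp_ineq1_le. rewrite exp_Ropp.
    pose proof (exp_pos (K / e)). apply (Rmult_lt_reg_l (exp (K / e))); auto. rewrite <- Rmult_assoc, Rinv_r, Rmult_1_l by lra.
    assert (e * (1 + K / e) = e + K) by (field; lra). nra. }
  pose proof (Const 0) as _. fold (w 0) in Wind. set (w0 := w 0) in *.
  set (c := Rabs (X O) + Rabs (X' O) + 1).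
  assert (Hc : 1 <= c) by (unfold c; pose proof (Rabs_pos (X O)); pose proof (Rabs_pos (X' O)); lra).
  (* Deviation e from the limit constant keeps |map|^2 >= M/2, and bounds the angular term by 2 c e
     <= w0 M/4, hence the quotient by w0/2. *)
  set (e := Rmin 1 (Rmin (M / (8 * c)) (w0 * M / (8 * c)))).
  assert (e0 : 0 < e) by (unfold e; repeat apply Rmin_pos; [lra|apply Rdiv_lt_0_compat; lra|apply Rdiv_lt_0_compat; [nra|lra]]).
  assert (e1 : e <= 1) by apply Rmin_l.
  assert (e2 : e <= M / (8 * c)) by (unfold e; eapply Rle_trans; [apply Rmin_r|apply Rmin_l]).
  assert (e3 : e <= w0 * M / (8 * c)) by (unfold e; eapply Rle_trans; [apply Rmin_r|apply Rmin_r]).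
  apply (Rmult_le_compat_r (8 * c)) in e2; [|lra]. replace (M / (8 * c) * (8 * c)) with M in e2 by (field; lra).
  apply (Rmult_le_compat_r (8 * c)) in e3; [|lra]. replace (w0 * M / (8 * c) * (8 * c)) with (w0 * M) in e3 by (field; lra).
  destruct (Tail e e0) as (s & Hs & Es). pose proof (exp_pos (- s)) as Ep.
  assert (Est : forall q, Rabs (ang U V s q / nsq U V s q) <= w0 / 2).
  { intro q. pose proof (pe_tail N X Y s q Hs) as T1. pose proof (pe_tail N X' Y' s q Hs) as T2.
    pose proof (pe_tail N (fun n => INR n * Y n) (fun n => - INR n * X n) s q Hs) as T3.
    pose proof (pe_tail N (fun n => INR n * Y' n) (fun n => - INR n * X' n) s q Hs) as T4. cbv beta in T3, T4.
    simpl (INR 0) in T3, T4. rewrite Rmult_0_l, Rminus_0_r in T3, T4.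
    assert (B1 : Rabs (pe N X Y s q - X O) <= e) by (unfold K in Es; nra).
    assert (B2 : Rabs (pe N X' Y' s q - X' O) <= e) by (unfold K in Es; nra).
    assert (B3 : Rabs (pe N (fun n => INR n * Y n) (fun n => - INR n * X n) s q) <= e) by (unfold K in Es; nra).
    assert (B4 : Rabs (pe N (fun n => INR n * Y' n) (fun n => - INR n * X' n) s q) <= e) by (unfold K in Es; nra).
    clear T1 T2 T3 T4.
    assert (Q : M / 2 <= nsq U V s q).
    { unfold nsq, U, V; simpl j0. set (f := pe N X Y s q) in *. set (g := pe N X' Y' s q) in *.
      apply Rabs_le_between in B1. apply Rabs_le_between in B2.
      pose proof (Rle_abs (X O)). pose proof (Rle_abs (- X O)). pose proof (Rle_abs (X' O)). pose proof (Rle_abs (- X' O)). rewrite Rabs_Ropp in *.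
      assert (- (2 * (Rabs (X O) * e)) <= 2 * (X O * (f - X O))).
      { pose proof (Rabs_mult (X O) (f - X O)) as A. assert (Rabs (f - X O) <= e) by (apply Rabs_le; lra).
        pose proof (Rle_abs (- (X O * (f - X O)))) as A'. rewrite Rabs_Ropp, A in A'. pose proof (Rabs_pos (X O)). nra. }
      assert (- (2 * (Rabs (X' O) * e)) <= 2 * (X' O * (g - X' O))).
      { pose proof (Rabs_mult (X' O) (g - X' O)) as A. assert (Rabs (g - X' O) <= e) by (apply Rabs_le; lra).
        pose proof (Rle_abs (- (X' O * (g - X' O)))) as A'. rewrite Rabs_Ropp, A in A'. pose proof (Rabs_pos (X' O)). nra. }
      assert (f * f + g * g = M + 2 * (X O * (f - X O)) + 2 * (X' O * (g - X' O)) + (f - X O) ^ 2 + (g - X' O) ^ 2) by (unfold M; ring).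
      pose proof (pow2_ge_0 (f - X O)). pose proof (pow2_ge_0 (g - X' O)). unfold c in e2. nra. }
    assert (A : Rabs (ang U V s q) <= 2 * c * e).
    { unfold ang, U, V; simpl j0; simpl jq. unfold Rminus. eapply Rle_trans; [apply Rabs_triang|]. rewrite Rabs_Ropp, !Rabs_mult.
      set (f := pe N X Y s q) in *. set (g := pe N X' Y' s q) in *.
      assert (Rabs f <= c). { unfold c. replace f with ((f - X O) + X O) by ring. eapply Rle_trans; [apply Rabs_triang|]. pose proof (Rabs_pos (X' O)). lra. }
      assert (Rabs g <= c). { unfold c. replace g with ((g - X' O) + X' O) by ring. eapply Rle_trans; [apply Rabs_triang|]. pose proof (Rabs_pos (X O)). lra. }
      pose proof (Rabs_pos f). pose proof (Rabs_pos g).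
      pose proof (Rabs_pos (pe N (fun n => INR n * Y n) (fun n => - INR n * X n) s q)). pose proof (Rabs_pos (pe N (fun n => INR n * Y' n) (fun n => - INR n * X' n) s q)).
      nra. }
    unfold Rdiv. rewrite Rabs_mult, Rabs_inv, (Rabs_pos_eq (nsq U V s q)) by (apply nsq_nonneg).
    apply (Rmult_le_reg_r (nsq U V s q)); [lra|]. rewrite Rmult_assoc, Rinv_l, Rmult_1_r by lra. nra. }
  assert (Rabs (w s) <= w0 / 2).
  { apply mean_bound; auto. apply cts_div.
    - apply (C2_slice (- d) (s + 1) (ang U V)); [apply C2_ang; apply pjet_harm|lra].
    - apply (C2_slice (- d) (s + 1) (nsq U V)); [apply C2_nsq; apply pjet_harm|lra].
    - intro q. apply Rgt_not_eq, Pos. lra. }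
  rewrite (Const s Hs) in H. fold w0 in H. rewrite Rabs_pos_eq in H; lra.
Qed.
End Zero.

(** * The normal derivative of the squared norm *)

Definition poisson1 (a q : R) : R := - (1 - a ^ 2) * (2 * a * sin q) / (1 - 2 * a * cos q + a ^ 2) ^ 2.
Definition poisson2 (a q : R) : R := (1 - a ^ 2) * (8 * a ^ 2 * sin q ^ 2 / (1 - 2 * a * cos q + a ^ 2) ^ 3 - 2 * a * cos q / (1 - 2 * a * cos q + a ^ 2) ^ 2).

Section PkD.
Variable a : R.
Hypothesis Ha : 0 <= a < 1.

Lemma d_den q : is_derive (fun q => 1 - 2 * a * cos q + a ^ 2) q (2 * a * sin q).
Proof.
  eapply der_eq; [apply d_plus; [apply d_minus; [apply d_const|apply (d_scal cos), is_derive_cos]|apply d_const]|]. ring.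
Qed.
Lemma poisson_d1 q : is_derive (poisson a) q (poisson1 a q).
Proof.
  pose proof (Pden_pos a Ha q) as D. unfold poisson, poisson1.
  eapply der_eq; [apply d_mult; [apply d_const|apply (is_derive_inv (fun q => 1 - 2 * a * cos q + a ^ 2)); [apply d_den|lra]]|].
  cbv beta. field. lra.
Qed.
Lemma poisson_d2 q : is_derive (poisson1 a) q (poisson2 a q).
Proof.
  pose proof (Pden_pos a Ha q) as D. unfold poisson1, poisson2.
  eapply der_eq.
  - apply d_mult; [apply (d_scal (fun q => 2 * a * sin q)), (d_scal sin), is_derive_sin|].
    apply (is_derive_inv (fun q => (1 - 2 * a * cos q + a ^ 2) ^ 2)); [|apply pow_nonzero; lra].
    apply (is_derive_pow (fun q => 1 - 2 * a * cos q + a ^ 2) 2), d_den.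
  - cbv beta. replace (INR 2) with 2 by (simpl; ring). cbn [Init.Nat.pred Nat.pred]. field. lra.
Qed.
Lemma poisson1_cts : cts (poisson1 a).
Proof. intro q. apply (ex_derive_continuous (poisson1 a) q). eexists; apply poisson_d2. Qed.
Lemma poisson2_cts : cts (poisson2 a).
Proof.
  assert (N : forall n q, (1 - 2 * a * cos q + a ^ 2) ^ n <> 0) by (intros; apply pow_nonzero, Rgt_not_eq, Pden_pos, Ha).
  assert (C : forall n, cts (fun q => / (1 - 2 * a * cos q + a ^ 2) ^ n)) by (intro n; apply cts_inv; auto 20 with cts).
  unfold poisson2, Rdiv. auto 20 with cts.
Qed.
(** Crude, but uniform for all a <= r, as the zero a varies with t0 and N. *)
Lemma poisson2_bound r q : a <= r -> r < 1 -> Rabs (poisson2 a q) <= 10 / (1 - r) ^ 6.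
Proof.
  intros Hr Hr1. unfold poisson2. pose proof (Pden a Ha q) as D. set (w := 1 - 2 * a * cos q + a ^ 2) in *.
  set (d := (1 - r) ^ 2). assert (d0 : 0 < d) by (unfold d; apply pow_lt; lra). assert (d1 : d <= 1) by (unfold d; nra).
  assert (dw : d <= w) by (unfold d; nra).
  assert (I3 : 0 < / w ^ 3 <= / d ^ 3).
  { split; [apply Rinv_0_lt_compat, pow_lt; lra|]. apply Rinv_le_contravar; [now apply pow_lt|]. apply pow_incr; lra. }
  assert (I2 : 0 < / w ^ 2 <= / d ^ 3).
  { split; [apply Rinv_0_lt_compat, pow_lt; lra|]. apply Rinv_le_contravar; [now apply pow_lt|].
    apply Rle_trans with (d ^ 2); [simpl; nra|apply pow_incr; lra]. }
  replace ((1 - r) ^ 6) with (d ^ 3) by (unfold d; ring).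
  pose proof (COS_bound q) as Cq. pose proof (SIN_bound q) as Sq.
  assert (A1 : Rabs (8 * a ^ 2 * sin q ^ 2 / w ^ 3) <= 8 * / d ^ 3).
  { unfold Rdiv. rewrite Rabs_mult, (Rabs_pos_eq (/ w ^ 3)) by lra.
    apply Rmult_le_compat; [apply Rabs_pos|lra| |lra].
    assert (0 <= a ^ 2 <= 1) by nra. assert (0 <= sin q ^ 2 <= 1) by nra.
    rewrite Rabs_pos_eq by nra. nra. }
  assert (A2 : Rabs (2 * a * cos q / w ^ 2) <= 2 * / d ^ 3).
  { unfold Rdiv. rewrite Rabs_mult, (Rabs_pos_eq (/ w ^ 2)) by lra.
    apply Rmult_le_compat; [apply Rabs_pos|lra| |lra]. apply Rabs_le; nra. }
  rewrite Rabs_mult. rewrite (Rabs_pos_eq (1 - a ^ 2)) by nra.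
  assert (A : Rabs (8 * a ^ 2 * sin q ^ 2 / w ^ 3 - 2 * a * cos q / w ^ 2) <= 10 * / d ^ 3).
  { unfold Rminus. eapply Rle_trans; [apply Rabs_triang|]. rewrite Rabs_Ropp. lra. }
  assert (0 <= 1 - a ^ 2 <= 1) by nra. pose proof (Rabs_pos (8 * a ^ 2 * sin q ^ 2 / w ^ 3 - 2 * a * cos q / w ^ 2)).
  unfold Rdiv. nra.
Qed.
Lemma poisson1_per : per (poisson1 a).
Proof.
  intro q. unfold poisson1. rewrite sin_plus, cos_plus, sin_2PI, cos_2PI.
  replace (sin q * 1 + cos q * 0) with (sin q) by ring. replace (cos q * 1 - sin q * 0) with (cos q) by ring. reflexivity.
Qed.
Lemma mean_Pk_1 : mean (poisson a) = 1.
Proof.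
  rewrite (mean_ext _ (fun q => poisson a q * cos (INR 0 * q))) by (intro; simpl; rewrite Rmult_0_l, cos_0; ring).
  rewrite mean_poisson by auto. reflexivity.
Qed.
End PkD.

(** [slope_lower] for f(t) = mean P (|h|^2 - 1), which is nonnegative and tends to 0. Its second
    derivative is a nonnegative gradient term minus mean P'' (|h|^2 - 1), and the latter is at most
    of order e. *)
Lemma phi_slope b U V r a e t0 : rmap b U V -> 0 <= a <= r -> r < 1 -> 0 < t0 < b ->
  (forall t q, 0 < t < b -> nsq U V t q - 1 <= e) ->
  - (10 / (1 - r) ^ 6 * e * t0) <= 2 * mean (fun q => poisson a q * (j0 U t0 q * jt U t0 q + j0 V t0 q * jt V t0 q)).
Proof.
  intros HR Har Hr Ht0 He. assert (Ha : 0 <= a < 1) by lra.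
  pose proof (r_U _ _ _ HR) as HU; pose proof (r_V _ _ _ HR) as HV.
  set (f1 := fun t q => poisson a q * (2 * (j0 U t q * jt U t q + j0 V t q * jt V t q))).
  set (f2 := fun t q => 2 * (jt U t q * jt U t q + jt V t q * jt V t q + jq U t q * jq U t q + jq V t q * jq V t q)).
  set (g := fun t q => 2 * (j0 U t q * jq U t q + j0 V t q * jq V t q)).
  set (gq := fun t q => 2 * (jq U t q * jq U t q + jq V t q * jq V t q + (j0 U t q * jqq U t q + j0 V t q * jqq V t q))).
  assert (e0 : 0 <= e).
  { specialize (He t0 0 Ht0). pose proof (r_gt _ _ _ HR t0 0 Ht0). lra. }
  set (K := 10 / (1 - r) ^ 6).
  assert (K0 : 0 < K) by (apply Rdiv_lt_0_compat; [lra|apply pow_lt; lra]).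
  assert (Dg : Dq 0 b g gq).
  { eapply Dq_eq; [unfold g; eauto 20 with dt|]. intros; unfold gq; cbv beta; ring. }
  assert (CP : C2 0 b (fun _ q => poisson a q)) by (apply C2_snd, poisson_cts, Ha).
  assert (C2' : C2 0 b f2) by (unfold f2; c2t). assert (Cg : C2 0 b g) by (unfold g; c2t). assert (Cgq : C2 0 b gq) by (unfold gq; c2t).
  assert (Cs : C2 0 b (nsq U V)) by (apply C2_nsq; auto).
  set (f3 := fun t q => poisson a q * (f2 t q - gq t q)).
  assert (D0 : forall t, 0 < t < b -> is_derive (fun t => mean (fun q => poisson a q * (nsq U V t q - 1))) t (mean (f1 t))).
  { intros t Ht. apply (mean_Dt 0 b (fun t q => poisson a q * (nsq U V t q - 1)) f1); auto; [|c2t|unfold f1; c2t].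
    eapply Dt_eq; [apply Dt_mult; [apply Dt_snd|apply Dt_minus; [apply Dt_nsq; eauto|apply Dt_const]]|]. intros; unfold f1; cbv beta; ring. }
  assert (D1 : forall t, 0 < t < b -> is_derive (fun t => mean (f1 t)) t (mean (f3 t))).
  { intros t Ht. apply (mean_Dt 0 b f1 f3); auto; [|unfold f1; c2t|unfold f3; c2t].
    eapply Dt_eq; [apply Dt_mult; [apply Dt_snd|eauto 20 with dt]|]. intros s q H; unfold f3, f2, gq; cbv beta.
    pose proof (h_lap _ _ _ HU s q H). pose proof (h_lap _ _ _ HV s q H).
    replace (jtt U s q) with (- jqq U s q) by lra. replace (jtt V s q) with (- jqq V s q) by lra. ring. }
  assert (L : forall t, 0 < t < b -> - (K * e) <= mean (f3 t)).
  { intros t Ht.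
    assert (cg : cts (g t)) by (eapply C2_slice; eauto). assert (cgq : cts (gq t)) by (eapply C2_slice; eauto).
    assert (cs : cts (nsq U V t)) by (eapply C2_slice; eauto). assert (cf : cts (f2 t)) by (eapply C2_slice; eauto).
    pose proof (poisson_cts a Ha) as cP. pose proof (poisson1_cts a Ha) as cP1. pose proof (poisson2_cts a Ha) as cP2.
    (* Two integrations by parts move both q-derivatives from |h|^2 to the kernel, so that only the
       smallness of |h|^2 - 1 is needed. *)
    assert (E1 : mean (fun q => poisson a q * gq t q) = mean (fun q => poisson2 a q * (nsq U V t q - 1))).
    { rewrite (mean_parts (poisson a) (g t) (poisson1 a) (gq t)); auto.
      - rewrite (mean_parts (poisson1 a) (fun q => nsq U V t q - 1) (poisson2 a) (g t)); auto.
        + ring.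
        + apply poisson_d2, Ha.
        + intro x. eapply der_eq; [apply d_minus; [apply (Dq_nsq 0 b U V HU HV t x Ht)|apply d_const]|]. unfold g; ring.
        + apply poisson1_per.
        + intro x. now rewrite (Per_nsq 0 b U V HU HV).
      - apply poisson_d1, Ha.
      - apply poisson_per.
      - intro x. unfold g. now rewrite (h_p _ _ _ HU), (h_p _ _ _ HV), (h_pq _ _ _ HU), (h_pq _ _ _ HV). }
    assert (B : Rabs (mean (fun q => poisson2 a q * (nsq U V t q - 1))) <= K * e).
    { apply mean_bound; [auto with cts|]. intro q. rewrite Rabs_mult.
      pose proof (r_gt _ _ _ HR t q Ht). specialize (He t q Ht). rewrite (Rabs_pos_eq (nsq U V t q - 1)) by lra.
      apply Rmult_le_compat; [apply Rabs_pos|lra|apply poisson2_bound; lra|lra]. }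
    assert (Pf : 0 <= mean (fun q => poisson a q * f2 t q)).
    { apply mean_ge0; [auto with cts|]. intro q. apply Rmult_le_pos; [left; apply poisson_pos, Ha|].
      unfold f2. pose proof (Rle_0_sqr (jt U t q)). pose proof (Rle_0_sqr (jt V t q)).
      pose proof (Rle_0_sqr (jq U t q)). pose proof (Rle_0_sqr (jq V t q)). unfold Rsqr in *. lra. }
    rewrite (mean_ext (f3 t) (fun q => poisson a q * f2 t q - poisson a q * gq t q)) by (intro; unfold f3; ring).
    rewrite mean_minus, E1 by auto with cts. apply Rabs_le_between in B. lra. }
  assert (Fin : - (K * e) * t0 <= mean (f1 t0)).
  { apply (slope_lower (fun t => mean (fun q => poisson a q * (nsq U V t q - 1))) (fun t => mean (f1 t)) (fun t => mean (f3 t)) b (K * e)); auto.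
    - nra.
    - intros t Ht. pose proof (poisson_cts a Ha) as cP. assert (cs : cts (nsq U V t)) by (eapply C2_slice; eauto).
      apply mean_ge0; [auto with cts|]. intro q. pose proof (r_gt _ _ _ HR t q Ht). pose proof (poisson_pos a Ha q). nra.
    - intros h Hh. destruct (r_lim _ _ _ HR (h / 2) ltac:(lra)) as (d & Hd & Ld). exists d; split; auto. intros t Ht Hb.
      pose proof (poisson_cts a Ha) as cP. assert (cs : cts (nsq U V t)) by (apply (C2_slice 0 b); auto; lra).
      apply Rle_lt_trans with (mean (fun q => h / 2 * poisson a q)).
      + apply mean_le; auto with cts. intro q. specialize (Ld t q Ht Hb). pose proof (poisson_pos a Ha q). nra.
      + rewrite mean_scal, mean_Pk_1 by auto. lra. }
  rewrite <- mean_scal.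
  - rewrite (mean_ext _ (f1 t0)) by (intro; unfold f1; ring). lra.
  - pose proof (poisson_cts a Ha) as cP. assert (cu : C2 0 b (fun t q => j0 U t q * jt U t q + j0 V t q * jt V t q)) by c2t.
    apply cts_mult; auto. apply (C2_slice 0 b _ t0 cu Ht0).
Qed.

Lemma rmap_sub b b' U V : b' <= b -> rmap b U V -> rmap b' U V.
Proof.
  intros H [HU HV G L0 J]. constructor.
  - now apply (harm_sub 0 b). - now apply (harm_sub 0 b).
  - intros; apply G; lra.
  - intros e He. destruct (L0 e He) as (d & Hd & L). exists d; split; auto. intros; apply L; lra.
  - intros; apply J; lra.
Qed.

Lemma d_cosh_mono x y : 0 <= x -> x <= y -> cosh x <= cosh y.
Proof.
  intros H [L| ->]; [|lra]. destruct (MVT_cor2 cosh sinh x y L) as (c & E & Hc).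
  - intros; apply is_derive_Reals, d_cosh.
  - pose proof (sinh_pos c ltac:(lra)). nra.
Qed.
Lemma sinh_scal l z : 0 <= l <= 1 -> 0 <= z -> sinh (l * z) <= l * sinh z.
Proof.
  intros Hl [Hz|<-]; [|rewrite Rmult_0_r, sinh_0; lra].
  destruct (MVT_cor2 (fun z => l * sinh z - sinh (l * z)) (fun z => l * cosh z - l * cosh (l * z)) 0 z Hz) as (c & E & Hc).
  - intros x _. apply is_derive_Reals. apply d_minus; [apply d_scal, d_sinh|].
    eapply der_eq; [apply (d_comp (fun z => l * z) sinh); [apply d_sinh|apply d_scal, d_id]|ring].
  - cbv beta in E. rewrite Rmult_0_r, sinh_0 in E.
    destruct Hl as [l0 l1], Hc as [c0 c1].
    assert (0 <= l * c) by (apply Rmult_le_pos; lra).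
    assert (l * c <= c) by (rewrite <- (Rmult_1_l c) at 2; apply Rmult_le_compat_r; lra).
    assert (cosh (l * c) <= cosh c) by (apply d_cosh_mono; auto). assert (0 <= l * cosh c - l * cosh (l * c)) by nra. nra.
Qed.
Lemma sinh_abs z : Rabs (sinh z) = sinh (Rabs z).
Proof.
  destruct (Rle_lt_dec 0 z) as [[H|<-]|H].
  - rewrite (Rabs_pos_eq z) by lra. apply Rabs_pos_eq. left; now apply sinh_pos.
  - now rewrite sinh_0, Rabs_R0, sinh_0.
  - pose proof (sinh_pos (- z) ltac:(lra)) as P. rewrite sinh_opp in P.
    rewrite (Rabs_left z), (Rabs_left (sinh z)), sinh_opp by lra. reflexivity.
Qed.

(* The discrepancy between a mode and its decaying extension vanishes at [s], so it grows from there like [sinh]. *)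
Lemma mode_near n a b x y s s1 h M : mode a b n x y -> a < s < b -> 0 < s1 -> s + s1 < b -> a < s + h < b -> Rabs h <= s1 / 2 ->
  Rabs (x s) <= M -> Rabs (x (s + s1)) <= M ->
  Rabs (x (s + h) - exp (- h) ^ n * x s) <= 4 * M / s1 * Rabs h * exp (- (s1 / 2)) ^ n.
Proof.
  intros Hm Hs H1 B1 Hh Hd M1 M2. assert (M0 : 0 <= M) by (pose proof (Rabs_pos (x s)); lra).
  pose proof (Rabs_pos h) as A0.
  destruct n as [|n].
  - destruct (mode_zero a b x y s (s + s1) Hm Hs ltac:(lra)) as [_ E1].
    destruct (mode_zero a b x y s (s + h) Hm Hs Hh) as [_ E2].
    simpl. rewrite E2. replace (x s + (s + h - s) * y s - 1 * x s) with (h * y s) by ring.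
    assert (Rabs (s1 * y s) <= 2 * M).
    { replace (s1 * y s) with (x (s + s1) - x s) by (rewrite E1; ring).
      apply Rabs_le_between in M1. apply Rabs_le_between in M2. apply Rabs_le; lra. }
    rewrite Rabs_mult in *. rewrite (Rabs_pos_eq s1) in H by lra.
    apply (Rmult_le_reg_r s1); auto. replace (4 * M / s1 * Rabs h * 1 * s1) with (4 * M * Rabs h) by (field; lra). nra.
  - set (k := S n) in *. assert (k0 : (0 < k)%nat) by (unfold k; lia).
    assert (n0 : 0 < INR k) by (apply lt_0_INR; lia).
    pose proof (mode_cosh k a b x y s (s + s1) k0 Hm Hs ltac:(lra)) as E1.
    pose proof (mode_cosh k a b x y s (s + h) k0 Hm Hs Hh) as E2.
    replace (s + s1 - s) with s1 in E1 by ring. replace (s + h - s) with h in E2 by ring. unfold Sn in E1, E2.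
    set (w := x s + y s / INR k).
    assert (F1 : x (s + s1) - exp (- s1) ^ k * x s = sinh (INR k * s1) * w).
    { rewrite E1, <- exp_INR, <- cosh_m_sinh. unfold w. field. lra. }
    assert (F2 : x (s + h) - exp (- h) ^ k * x s = sinh (INR k * h) * w).
    { rewrite E2, <- exp_INR, <- cosh_m_sinh. unfold w. field. lra. }
    rewrite F2, <- exp_INR.
    assert (G1 : sinh (INR k * s1) * Rabs w <= 2 * M).
    { assert (P : 0 < sinh (INR k * s1)) by (apply sinh_pos; nra).
      rewrite <- (Rabs_pos_eq (sinh (INR k * s1))) by lra. rewrite <- Rabs_mult, <- F1.
      unfold Rminus. eapply Rle_trans; [apply Rabs_triang|]. rewrite Rabs_Ropp, Rabs_mult.
      assert (0 <= exp (- s1) ^ k <= 1).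
      { split; [apply pow_le; left; apply exp_pos|]. rewrite <- (pow1 k). apply pow_incr. split; [left; apply exp_pos|].
        rewrite <- exp_0. apply exp_le_mono. lra. }
      rewrite (Rabs_pos_eq (exp (- s1) ^ k)) by lra. pose proof (Rabs_pos (x s)). nra. }
    rewrite Rabs_mult, sinh_abs, Rabs_mult, (Rabs_pos_eq (INR k)) by lra.
    set (z := INR k * (s1 / 2)). assert (z0 : 0 < z) by (unfold z; nra).
    assert (L : sinh (INR k * Rabs h) <= 2 * Rabs h / s1 * sinh z).
    { replace (INR k * Rabs h) with (2 * Rabs h / s1 * z) by (unfold z; field; lra). apply sinh_scal; [|lra].
      split; [apply Rmult_le_pos; [lra|left; now apply Rinv_0_lt_compat]|].
      apply (Rmult_le_reg_r s1); auto. replace (2 * Rabs h / s1 * s1) with (2 * Rabs h) by (field; lra). lra. }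
    assert (D : sinh (INR k * s1) = 2 * sinh z * cosh z).
    { replace (INR k * s1) with (z + z) by (unfold z; field). rewrite sinh_plus. ring. }
    pose proof (sinh_pos z z0) as Sz. pose proof (exp_pos z) as Ez.
    assert (Ce : exp z <= 2 * cosh z) by (unfold cosh; pose proof (exp_pos (- z)); lra).
    pose proof (Rabs_pos w) as W0.
    assert (G2 : sinh z * Rabs w <= 2 * M * exp (- z)).
    { rewrite exp_Ropp. apply (Rmult_le_reg_r (exp z)); auto. rewrite (Rmult_assoc (2 * M)), Rinv_l, Rmult_1_r by lra.
      rewrite D in G1. assert (0 <= sinh z * Rabs w) by nra. nra. }
    assert (c0 : 0 <= 2 * Rabs h / s1) by (apply Rmult_le_pos; [lra|left; now apply Rinv_0_lt_compat]).
    apply Rle_trans with (2 * Rabs h / s1 * sinh z * Rabs w); [apply Rmult_le_compat_r; auto|].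
    replace (4 * M / s1 * Rabs h * exp (- z)) with (2 * Rabs h / s1 * (2 * M * exp (- z))) by (field; lra).
    rewrite Rmult_assoc. apply Rmult_le_compat_l; auto.
Qed.

(** * Uniform approximation by truncated series and by the decaying extension *)

Section Near.
Variables (a b : R) (U : jet) (M : R).
Hypothesis HU : harm a b U.
Hypothesis HM : forall t n, a < t < b -> Rabs (fcos (j0 U t) n) <= M /\ Rabs (fsin (j0 U t) n) <= M.

Lemma M_ge0 t : a < t < b -> 0 <= M.
Proof. intro Ht. destruct (HM t O Ht) as [H _]. pose proof (Rabs_pos (fcos (j0 U t) 0)). lra. Qed.

(** [mode_near] summed over the modes. The constant depends only on M and s1, neither on N nor on
    the circle s, which is what makes the zero radius uniform. *)
Lemma near_ext N s s1 h q : a < s < b -> 0 < s1 -> s + s1 < b -> a < s + h < b -> Rabs h <= s1 / 2 ->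
  Rabs (poly N (fcos (j0 U (s + h))) (fsin (j0 U (s + h))) q - pe N (fcos (j0 U s)) (fsin (j0 U s)) h q) <=
  8 * M / s1 / (1 - exp (- (s1 / 2))) * Rabs h.
Proof.
  intros Hs H1 B1 Hh Hd. unfold poly, pe. rewrite <- sm_minus.
  eapply Rle_trans; [apply sm_abs|].
  assert (E : 0 <= exp (- (s1 / 2)) < 1).
  { split; [left; apply exp_pos|]. rewrite <- exp_0. apply exp_increasing. lra. }
  assert (M0 : 0 <= M) by (apply (M_ge0 s Hs)).
  assert (c0 : 0 <= 8 * M / s1 * Rabs h).
  { apply Rmult_le_pos; [apply Rmult_le_pos; [lra|left; now apply Rinv_0_lt_compat]|apply Rabs_pos]. }
  apply Rle_trans with (sm (S N) (fun i => 8 * M / s1 * Rabs h * exp (- (s1 / 2)) ^ i)).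
  - apply sm_le; intros n _.
    replace (fcos (j0 U (s + h)) n * cos (INR n * q) + fsin (j0 U (s + h)) n * sin (INR n * q) - exp (- h) ^ n * (fcos (j0 U s) n * cos (INR n * q) + fsin (j0 U s) n * sin (INR n * q)))
     with ((fcos (j0 U (s + h)) n - exp (- h) ^ n * fcos (j0 U s) n) * cos (INR n * q) + (fsin (j0 U (s + h)) n - exp (- h) ^ n * fsin (j0 U s) n) * sin (INR n * q)) by ring.
    eapply Rle_trans; [apply Rabs_trig|].
    pose proof (mode_near n a b _ _ s s1 h M (fcos_mode a b U HU n) Hs H1 B1 Hh Hd (proj1 (HM s n Hs)) (proj1 (HM (s + s1) n ltac:(lra)))) as A1.
    pose proof (mode_near n a b _ _ s s1 h M (fsin_mode a b U HU n) Hs H1 B1 Hh Hd (proj2 (HM s n Hs)) (proj2 (HM (s + s1) n ltac:(lra)))) as A2.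
    cbv beta in A1, A2. eapply Rle_trans; [apply Rplus_le_compat; [exact A1|exact A2]|]. right; field. lra.
  - rewrite sm_scal. replace (8 * M / s1 / (1 - exp (- (s1 / 2))) * Rabs h) with (8 * M / s1 * Rabs h * / (1 - exp (- (s1 / 2)))) by (field; lra).
    apply Rmult_le_compat_l; auto. now apply sm_geo.
Qed.

Lemma geo_j0 t e : 0 < e -> a < t - e -> t + e < b -> geo (2 * M) (exp (- e)) (fcos (j0 U t)) /\ geo (2 * M) (exp (- e)) (fsin (j0 U t)).
Proof.
  intros He A B. split; intro n.
  - apply (mode_decay n a b (fun t => fcos (j0 U t) n) (fun t => fcos (jt U t) n) t e M); auto; [now apply fcos_mode|apply HM; lra|apply HM; lra].
  - apply (mode_decay n a b (fun t => fsin (j0 U t) n) (fun t => fsin (jt U t) n) t e M); auto; [now apply fsin_mode|apply HM; lra|apply HM; lra].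
Qed.

Lemma trunc_j0 t e N q : 0 < e -> a < t - e -> t + e < b ->
  Rabs (j0 U t q - poly N (fcos (j0 U t)) (fsin (j0 U t)) q) <= 4 * M * exp (- e) ^ S N / (1 - exp (- e)).
Proof.
  intros He A B. assert (Ht : a < t < b) by lra. destruct (geo_j0 t e He A B) as [G1 G2].
  destruct (jet_cts a b U HU t Ht) as (? & ? & ? & ? & ? & ?).
  assert (E : 0 <= exp (- e) < 1).
  { split; [left; apply exp_pos|]. rewrite <- exp_0. apply exp_increasing. lra. }
  pose proof (M_ge0 t Ht) as M0.
  replace (4 * M) with (2 * (2 * M)) by ring.
  apply (trunc_geo (j0 U t) (jq U t)); auto; try lra.
  - intro; apply (h_q _ _ _ HU); auto.
  - intro; apply (h_p _ _ _ HU).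
  - intro; apply (h_pq _ _ _ HU).
Qed.

Lemma pow_small e c : 0 <= e < 1 -> 0 < c -> forall C, exists N0, forall N, (N0 <= N)%nat -> C * e ^ S N <= c.
Proof.
  intros He Hc C. assert (H : Rabs e < 1) by (rewrite Rabs_pos_eq; lra).
  destruct (pow_lt_1_zero e H (c / (Rabs C + 1))) as [N0 L].
  { apply Rdiv_lt_0_compat; auto. pose proof (Rabs_pos C); lra. }
  exists N0. intros N HN. specialize (L (S N) ltac:(lia)). pose proof (Rabs_pos C) as C0.
  pose proof (Rle_abs (C * e ^ S N)) as A. rewrite Rabs_mult in A.
  apply (Rmult_lt_compat_r (Rabs C + 1)) in L; [|lra]. replace (c / (Rabs C + 1) * (Rabs C + 1)) with c in L by (field; lra).
  pose proof (Rabs_pos (e ^ S N)). nra.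
Qed.

Lemma geo_jt t : a < t < b -> exists C c, 0 <= C /\ 0 <= c < 1 /\ geo C c (fcos (jt U t)) /\ geo C c (fsin (jt U t)).
Proof.
  intro Ht. set (e := Rmin (t - a) (b - t) / 2).
  assert (e0 : 0 < e) by (unfold e; assert (0 < Rmin (t - a) (b - t)) by (apply Rmin_pos; lra); lra).
  pose proof (Rmin_l (t - a) (b - t)). pose proof (Rmin_r (t - a) (b - t)).
  assert (A : a < t - e) by (unfold e; lra). assert (B : t + e < b) by (unfold e; lra).
  pose proof (M_ge0 t Ht) as M0.
  assert (E : 0 < exp (- e) < 1).
  { split; [apply exp_pos|]. rewrite <- exp_0. apply exp_increasing. lra. }
  assert (E2 : exp (- (2 * e)) < 1) by (rewrite <- exp_0; apply exp_increasing; lra).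
  set (c := sqrt (exp (- e))). assert (c2 : c * c = exp (- e)) by (apply sqrt_sqrt; lra).
  assert (c0 : 0 <= c) by apply sqrt_pos. assert (c1 : c < 1) by nra.
  set (D := 2 * M / (1 - exp (- (2 * e)))). assert (D0 : 0 <= D) by (apply Rmult_le_pos; [lra|left; apply Rinv_0_lt_compat; lra]).
  (* The decay estimate for slopes starts at n = 1, so the coefficients of index 0 are added to the
     constant. *)
  set (C := D / (1 - c) + Rabs (fcos (jt U t) 0) + Rabs (fsin (jt U t) 0)).
  assert (DC : 0 <= D / (1 - c)) by (apply Rmult_le_pos; [auto|left; apply Rinv_0_lt_compat; lra]).
  pose proof (Rabs_pos (fcos (jt U t) 0)). pose proof (Rabs_pos (fsin (jt U t) 0)).
  assert (K : forall n, D * (INR n * exp (- e) ^ n) <= D / (1 - c) * c ^ n).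
  { intro n. rewrite <- c2, Rpow_mult_distr. pose proof (INR_pow_bound c ltac:(lra) n) as P. pose proof (pow_le c n c0).
    replace (D * (INR n * (c ^ n * c ^ n))) with (D * c ^ n * (INR n * c ^ n)) by ring.
    replace (D / (1 - c) * c ^ n) with (D * c ^ n * / (1 - c)) by (unfold Rdiv; ring).
    apply Rmult_le_compat_l; auto. now apply Rmult_le_pos. }
  exists C, c. split; [unfold C; lra|split; [lra|split]]; intros [|n]; try (change (c ^ 0) with 1; unfold C; lra).
  - pose proof (mode_decay1 (S n) a b (fun t => fcos (j0 U t) (S n)) (fun t => fcos (jt U t) (S n)) t e M (fcos_mode a b U HU (S n)) e0 A B
      (proj1 (HM (t - e) (S n) ltac:(lra))) (proj1 (HM (t + e) (S n) ltac:(lra))) ltac:(lia)) as P. cbv beta in P. fold D in P.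
    eapply Rle_trans; [exact P|]. eapply Rle_trans; [apply K|]. apply Rmult_le_compat_r; [now apply pow_le|unfold C; lra].
  - pose proof (mode_decay1 (S n) a b (fun t => fsin (j0 U t) (S n)) (fun t => fsin (jt U t) (S n)) t e M (fsin_mode a b U HU (S n)) e0 A B
      (proj2 (HM (t - e) (S n) ltac:(lra))) (proj2 (HM (t + e) (S n) ltac:(lra))) ltac:(lia)) as P. cbv beta in P. fold D in P.
    eapply Rle_trans; [exact P|]. eapply Rle_trans; [apply K|]. apply Rmult_le_compat_r; [now apply pow_le|unfold C; lra].
Qed.

Lemma geo_jq t : a < t < b -> exists C c, 0 <= C /\ 0 <= c < 1 /\ geo C c (fcos (jq U t)) /\ geo C c (fsin (jq U t)).
Proof.
  intro Ht. set (e := Rmin (t - a) (b - t) / 2).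
  assert (e0 : 0 < e) by (unfold e; assert (0 < Rmin (t - a) (b - t)) by (apply Rmin_pos; lra); lra).
  pose proof (Rmin_l (t - a) (b - t)). pose proof (Rmin_r (t - a) (b - t)).
  destruct (geo_j0 t e e0) as [G1 G2]; try (unfold e; lra).
  pose proof (M_ge0 t Ht) as M0.
  assert (E : 0 < exp (- e) < 1).
  { split; [apply exp_pos|]. rewrite <- exp_0. apply exp_increasing. lra. }
  destruct (jet_cts a b U HU t Ht) as (? & ? & ? & ? & ? & ?).
  assert (D : forall q, is_derive (j0 U t) q (jq U t q)) by (intro; apply (h_q _ _ _ HU); auto).
  assert (P : per (j0 U t)) by (intro; apply (h_p _ _ _ HU)).
  assert (c2 : sqrt (exp (- e)) * sqrt (exp (- e)) = exp (- e)) by (apply sqrt_sqrt; lra).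
  assert (c0 : 0 <= sqrt (exp (- e))) by apply sqrt_pos. assert (c1 : sqrt (exp (- e)) < 1) by nra.
  exists (2 * M / (1 - sqrt (exp (- e)))), (sqrt (exp (- e))). split; [|split; [lra|split]].
  - apply Rmult_le_pos; [lra|left; apply Rinv_0_lt_compat; lra].
  - intro n. rewrite (fcos_der (j0 U t) (jq U t)) by auto. apply (geo_INR (2 * M) (exp (- e)) (fsin (j0 U t))); auto; lra.
  - intro n. rewrite (fsin_der (j0 U t) (jq U t)) by auto. rewrite Ropp_mult_distr_l_reverse, Rabs_Ropp.
    apply (geo_INR (2 * M) (exp (- e)) (fcos (j0 U t))); auto; lra.
Qed.

Lemma trunc_all t d : a < t < b -> 0 < d -> exists N0, forall N, (N0 <= N)%nat -> forall q,
  Rabs (j0 U t q - poly N (fcos (j0 U t)) (fsin (j0 U t)) q) <= d /\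
  Rabs (jt U t q - poly N (fcos (jt U t)) (fsin (jt U t)) q) <= d /\
  Rabs (jq U t q - poly N (fcos (jq U t)) (fsin (jq U t)) q) <= d.
Proof.
  intros Ht Hd.
  destruct (jet_cts a b U HU t Ht) as (? & ? & ? & ? & ? & ?).
  assert (T : forall f f', (forall x, is_derive f x (f' x)) -> cts f' -> per f ->
     (exists C c, 0 <= C /\ 0 <= c < 1 /\ geo C c (fcos f) /\ geo C c (fsin f)) ->
     exists N0, forall N, (N0 <= N)%nat -> forall q, Rabs (f q - poly N (fcos f) (fsin f) q) <= d).
  { intros f f' D C P (K & c & K0 & Hc & G1 & G2).
    assert (P' : per f').
    { intro x. assert (is_derive f x (f' (x + 2 * PI))).
      { apply (der_ext (fun y => f (y + 2 * PI))); [intro; apply P|]. eapply der_eq; [apply (d_comp (fun y => y + 2 * PI) f)|].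
        - apply D. - apply d_plus; [apply d_id|apply d_const]. - ring. }
      apply is_derive_unique in H5. pose proof (D x) as Dx. apply is_derive_unique in Dx. congruence. }
    destruct (pow_small c d Hc Hd (2 * K / (1 - c))) as [N0 L].
    exists N0. intros N HN q. eapply Rle_trans; [apply (trunc_geo f f' K c); auto|].
    specialize (L N HN). unfold Rdiv in *. lra. }
  destruct (T (j0 U t) (jq U t)) as [N1 L1]; auto.
  { intro; apply (h_q _ _ _ HU); auto. } { intro; apply (h_p _ _ _ HU). }
  { set (e := Rmin (t - a) (b - t) / 2).
    assert (e0 : 0 < e) by (unfold e; assert (0 < Rmin (t - a) (b - t)) by (apply Rmin_pos; lra); lra).
    pose proof (Rmin_l (t - a) (b - t)). pose proof (Rmin_r (t - a) (b - t)).
    destruct (geo_j0 t e e0) as [G1 G2]; try (unfold e; lra). pose proof (M_ge0 t Ht).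
    exists (2 * M), (exp (- e)). repeat split; auto; [lra|left; apply exp_pos|rewrite <- exp_0; apply exp_increasing; lra]. }
  destruct (T (jt U t) (jtq U t)) as [N2 L2]; auto.
  { intro; apply (h_tq _ _ _ HU); auto. } { intro; apply (h_pt _ _ _ HU). } { now apply geo_jt. }
  destruct (T (jq U t) (jqq U t)) as [N3 L3]; auto.
  { intro; apply (h_qq _ _ _ HU); auto. } { intro; apply (h_pq _ _ _ HU). } { now apply geo_jq. }
  exists (Nat.max N1 (Nat.max N2 N3)). intros N HN q. repeat split; [apply L1|apply L2|apply L3]; lia.
Qed.
End Near.

Lemma prod_err x y x' y' B d : Rabs x <= B -> Rabs y <= B -> Rabs (x - x') <= d -> Rabs (y - y') <= d -> d <= 1 -> 1 <= B ->
  Rabs (x * y - x' * y') <= 3 * B * d.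
Proof.
  intros HX HY DX DY D1 B1.
  replace (x * y - x' * y') with (x * (y - y') + y * (x - x') - (x - x') * (y - y')) by ring.
  unfold Rminus at 1. eapply Rle_trans; [apply Rabs_triang|]. rewrite Rabs_Ropp.
  eapply Rle_trans; [apply Rplus_le_compat_r, Rabs_triang|]. rewrite !Rabs_mult.
  pose proof (Rabs_pos x). pose proof (Rabs_pos y). pose proof (Rabs_pos (x - x')). pose proof (Rabs_pos (y - y')). nra.
Qed.

Section Loc.
Variables (b : R) (U V : jet) (t : R).
Hypothesis HR : rmap b U V.
Hypothesis Ht : 0 < t < b.
Let M := 1 + energy U V t.

(** The energy is nondecreasing in the radius, so its value at t bounds the coefficients on all
    smaller circles at once. *)
Lemma modes_M s n : 0 < s < t -> (Rabs (fcos (j0 U s) n) <= M /\ Rabs (fsin (j0 U s) n) <= M) /\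
   (Rabs (fcos (j0 V s) n) <= M /\ Rabs (fsin (j0 V s) n) <= M).
Proof.
  intro Hs. pose proof (energy_mono b U V HR s t ltac:(lra) ltac:(lra) ltac:(lra)) as E.
  destruct (defect_cts b U V HR s ltac:(lra)) as (cu & cv & _).
  assert (A : mean (fun q => j0 U s q ^ 2) <= energy U V s).
  { apply mean_le; auto with cts. - apply (nsq_cts b U V HR); lra. - intro q. unfold nsq. pose proof (Rle_0_sqr (j0 V s q)). unfold Rsqr in *. simpl. lra. }
  assert (B : mean (fun q => j0 V s q ^ 2) <= energy U V s).
  { apply mean_le; auto with cts. - apply (nsq_cts b U V HR); lra. - intro q. unfold nsq. pose proof (Rle_0_sqr (j0 U s q)). unfold Rsqr in *. simpl. lra. }
  pose proof (coef_bound (j0 U s) n cu). pose proof (coef_bound (j0 V s) n cv). unfold M. repeat split; lra.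
Qed.

Let HU : harm 0 t U.
Proof. apply (harm_sub 0 b); [lra|lra|apply (r_U _ _ _ HR)]. Qed.
Let HV : harm 0 t V.
Proof. apply (harm_sub 0 b); [lra|lra|apply (r_V _ _ _ HR)]. Qed.
Let MU : forall s n, 0 < s < t -> Rabs (fcos (j0 U s) n) <= M /\ Rabs (fsin (j0 U s) n) <= M.
Proof. intros s n H; exact (proj1 (modes_M s n H)). Qed.
Let MV : forall s n, 0 < s < t -> Rabs (fcos (j0 V s) n) <= M /\ Rabs (fsin (j0 V s) n) <= M.
Proof. intros s n H; exact (proj2 (modes_M s n H)). Qed.

Lemma trunc_both s d : 0 < s < t -> 0 < d -> exists N0, forall N, (N0 <= N)%nat -> forall q,
  (Rabs (j0 U s q - poly N (fcos (j0 U s)) (fsin (j0 U s)) q) <= d /\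
   Rabs (jt U s q - poly N (fcos (jt U s)) (fsin (jt U s)) q) <= d /\
   Rabs (jq U s q - poly N (fcos (jq U s)) (fsin (jq U s)) q) <= d) /\
  (Rabs (j0 V s q - poly N (fcos (j0 V s)) (fsin (j0 V s)) q) <= d /\
   Rabs (jt V s q - poly N (fcos (jt V s)) (fsin (jt V s)) q) <= d /\
   Rabs (jq V s q - poly N (fcos (jq V s)) (fsin (jq V s)) q) <= d).
Proof.
  intros Hs Hd. destruct (trunc_all 0 t U M HU MU s d Hs Hd) as [N1 L1]. destruct (trunc_all 0 t V M HV MV s d Hs Hd) as [N2 L2].
  exists (Nat.max N1 N2). intros N HN q. split; [apply L1|apply L2]; lia.
Qed.

(** The order of quantifiers is the point: m does not depend on t0. At depth below m the extension
    is close to h on the circle t0 + h, where |h| > 1, so its zero lies at radius at most e^{-m},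
    uniformly away from the unit circle. *)
Lemma zero_loc : exists m, 0 < m /\ forall t0, 0 < t0 < t / 4 -> exists N0, forall N, (N0 <= N)%nat -> exists a p,
  0 <= a <= exp (- m) /\
  sm (S N) (fun n => fcos (j0 (shift p U) t0) n * a ^ n) = 0 /\ sm (S N) (fun n => fcos (j0 (shift p V) t0) n * a ^ n) = 0.
Proof.
  assert (M1 : 2 <= M) by (unfold M; pose proof (energy_ge1 b U V HR t Ht); lra).
  set (s1 := t / 2). set (C1 := 8 * M / s1 / (1 - exp (- (s1 / 2)))).
  assert (s10 : 0 < s1) by (unfold s1; lra).
  assert (E0 : exp (- (s1 / 2)) < 1) by (rewrite <- exp_0; apply exp_increasing; lra).
  assert (C10 : 0 < C1) by (unfold C1; apply Rdiv_lt_0_compat; [apply Rdiv_lt_0_compat; lra|lra]).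
  (* The extension then differs by at most 1/8 from the truncated series, and the truncation by 1/8
     from the map; an error 1/4 in each component cannot cancel a vector of length above 1. *)
  set (m := Rmin (t / 4) (/ (8 * C1))).
  assert (m0 : 0 < m) by (apply Rmin_pos; [lra|apply Rinv_0_lt_compat; lra]).
  assert (m1 : m <= t / 4) by apply Rmin_l. assert (m2 : m <= / (8 * C1)) by apply Rmin_r.
  exists m; split; auto. intros t0 Ht0. assert (Hs : 0 < t0 < t) by lra.
  set (e := t0 / 4).
  assert (Ee : 0 <= exp (- e) < 1).
  { split; [left; apply exp_pos|]. rewrite <- exp_0. apply exp_increasing. unfold e; lra. }
  destruct (pow_small (exp (- e)) (/ 8) Ee ltac:(lra) (4 * M / (1 - exp (- e)))) as [N1 L1].
  destruct (jet_cts 0 t U HU t0 Hs) as (cu & _ & cuq & _). destruct (jet_cts 0 t V HV t0 Hs) as (cv & _ & cvq & _).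
  assert (Pu : per (j0 U t0)) by (intro; apply (h_p _ _ _ HU)). assert (Pv : per (j0 V t0)) by (intro; apply (h_p _ _ _ HV)).
  assert (Puq : per (jq U t0)) by (intro; apply (h_pq _ _ _ HU)). assert (Pvq : per (jq V t0)) by (intro; apply (h_pq _ _ _ HV)).
  destruct (per_max _ cu Pu) as (B1 & b1 & HB1). destruct (per_max _ cv Pv) as (B2 & b2 & HB2).
  destruct (per_max _ cuq Puq) as (B3 & b3 & HB3). destruct (per_max _ cvq Pvq) as (B4 & b4 & HB4).
  set (B := 1 + B1 + B2 + B3 + B4). assert (HB : 1 <= B) by (unfold B; lra).
  (* Replacing the map by its truncation changes ang/|h|^2 by at most 12 d B + 24 d B^3 <= 36/200,
     so the winding, at least 1 before, remains positive. *)
  set (d := / (200 * B ^ 3)). assert (BB : 1 <= B ^ 3) by (replace 1 with (1 ^ 3) by ring; apply pow_incr; lra).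
  assert (d0 : 0 < d) by (apply Rinv_0_lt_compat; lra).
  assert (d1 : d * B ^ 3 = / 200) by (unfold d; field; lra).
  destruct (trunc_both t0 d Hs d0) as [N2 L2].
  exists (Nat.max N1 N2). intros N HN. specialize (L1 N ltac:(lia)). specialize (L2 N ltac:(lia)).
  set (X := fcos (j0 U t0)). set (Y := fsin (j0 U t0)). set (X' := fcos (j0 V t0)). set (Y' := fsin (j0 V t0)).
  destruct (zero_exists N X Y X' Y' (Rmin (t0 / 2) m) m) as (a & p & Ha & Z1 & Z2).
  - apply Rmin_pos; lra.
  - intros h q Hh. pose proof (Rmin_l (t0 / 2) m). pose proof (Rmin_r (t0 / 2) m).
    assert (Ah : Rabs h <= m) by (apply Rabs_le; lra).
    assert (Ht' : 0 < t0 + h < t) by lra.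
    assert (C1m : C1 * Rabs h <= / 8).
    { apply Rle_trans with (C1 * / (8 * C1)); [apply Rmult_le_compat_l; lra|right; field; lra]. }
    assert (Cl : forall W, harm 0 t W -> (forall s n, 0 < s < t -> Rabs (fcos (j0 W s) n) <= M /\ Rabs (fsin (j0 W s) n) <= M) ->
      Rabs (j0 W (t0 + h) q - pe N (fcos (j0 W t0)) (fsin (j0 W t0)) h q) <= / 4).
    { intros W HW MW.
      pose proof (near_ext 0 t W M HW MW N t0 s1 h q Hs s10 ltac:(unfold s1; lra) Ht' ltac:(unfold s1; lra)) as A1. fold C1 in A1.
      pose proof (trunc_j0 0 t W M HW MW (t0 + h) e N q ltac:(unfold e; lra) ltac:(unfold e; lra) ltac:(unfold e; lra)) as A2.
      assert (A3 : 4 * M * exp (- e) ^ S N / (1 - exp (- e)) <= / 8) by (unfold Rdiv in *; lra).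
      replace (j0 W (t0 + h) q - pe N (fcos (j0 W t0)) (fsin (j0 W t0)) h q) with
        ((j0 W (t0 + h) q - poly N (fcos (j0 W (t0 + h))) (fsin (j0 W (t0 + h))) q) + (poly N (fcos (j0 W (t0 + h))) (fsin (j0 W (t0 + h))) q - pe N (fcos (j0 W t0)) (fsin (j0 W t0)) h q)) by ring.
      eapply Rle_trans; [apply Rabs_triang|]. lra. }
    pose proof (Cl U HU MU) as D1. pose proof (Cl V HV MV) as D2.
    pose proof (r_gt _ _ _ HR (t0 + h) q ltac:(lra)) as G. unfold nsq in *. simpl j0.
    fold X Y in D1. fold X' Y' in D2. set (f := pe N X Y h q) in *. set (g := pe N X' Y' h q) in *.
    destruct (Req_dec f 0) as [F0|]; [|nra]. destruct (Req_dec g 0) as [G0|]; [|nra]. exfalso.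
    rewrite F0, Rminus_0_r in D1. rewrite G0, Rminus_0_r in D2. apply Rabs_le_between in D1. apply Rabs_le_between in D2. nra.
  - set (UN := pjet N X Y). set (VN := pjet N X' Y').
    pose proof (winding_ge1 b U V HR t0 ltac:(lra)) as W. unfold winding in W.
    assert (CD : d <= 1).
    { unfold d. rewrite <- Rinv_1. apply Rinv_le_contravar; lra. }
    assert (dB : d * B <= / 200).
    { rewrite <- d1. apply Rmult_le_compat_l; [lra|]. rewrite <- (pow_1 B) at 1. apply Rle_pow; [lra|lia]. }
    assert (Es : forall q, / 2 <= nsq UN VN 0 q /\ Rabs (ang U V t0 q / nsq U V t0 q - ang UN VN 0 q / nsq UN VN 0 q) <= / 2).
    { intro q. destruct (L2 q) as [(u1 & _ & u3) (v1 & _ & v3)].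
      assert (Q1 : j0 UN 0 q = poly N X Y q) by apply pe_0.
      assert (Q2 : j0 VN 0 q = poly N X' Y' q) by apply pe_0.
      assert (Dq1 : forall q, is_derive (j0 U t0) q (jq U t0 q)) by (intro; apply (h_q _ _ _ HU); auto).
      assert (Dq2 : forall q, is_derive (j0 V t0) q (jq V t0 q)) by (intro; apply (h_q _ _ _ HV); auto).
      assert (Q3 : jq UN 0 q = poly N (fcos (jq U t0)) (fsin (jq U t0)) q).
      { simpl. rewrite pe_0. apply sm_ext; intros n _. now rewrite (fcos_der (j0 U t0) (jq U t0)), (fsin_der (j0 U t0) (jq U t0)). }
      assert (Q4 : jq VN 0 q = poly N (fcos (jq V t0)) (fsin (jq V t0)) q).
      { simpl. rewrite pe_0. apply sm_ext; intros n _. now rewrite (fcos_der (j0 V t0) (jq V t0)), (fsin_der (j0 V t0) (jq V t0)). }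
      fold X Y in u1. fold X' Y' in v1.
      unfold ang, nsq. rewrite Q1, Q2, Q3, Q4. pose proof (r_gt _ _ _ HR t0 q ltac:(lra)) as G. unfold nsq in G.
      specialize (HB1 q). specialize (HB2 q). specialize (HB3 q). specialize (HB4 q).
      assert (K1 : Rabs (j0 U t0 q) <= B) by (unfold B; lra). assert (K2 : Rabs (j0 V t0 q) <= B) by (unfold B; lra).
      assert (K3 : Rabs (jq U t0 q) <= B) by (unfold B; lra). assert (K4 : Rabs (jq V t0 q) <= B) by (unfold B; lra).
      set (u := j0 U t0 q) in *. set (v := j0 V t0 q) in *. set (uq := jq U t0 q) in *. set (vq := jq V t0 q) in *.
      set (u' := poly N X Y q) in *. set (v' := poly N X' Y' q) in *.
      set (uq' := poly N (fcos (jq U t0)) (fsin (jq U t0)) q) in *. set (vq' := poly N (fcos (jq V t0)) (fsin (jq V t0)) q) in *.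
      pose proof (prod_err u u u' u' B d K1 K1 u1 u1 CD HB) as P1. pose proof (prod_err v v v' v' B d K2 K2 v1 v1 CD HB) as P2.
      pose proof (prod_err u vq u' vq' B d K1 K4 u1 v3 CD HB) as P3. pose proof (prod_err v uq v' uq' B d K2 K3 v1 u3 CD HB) as P4.
      assert (PA : Rabs (u * vq - v * uq) <= 2 * B ^ 2).
      { unfold Rminus. eapply Rle_trans; [apply Rabs_triang|]. rewrite Rabs_Ropp, !Rabs_mult.
        pose proof (Rabs_pos u). pose proof (Rabs_pos v). pose proof (Rabs_pos uq). pose proof (Rabs_pos vq). simpl. nra. }
      apply Rabs_le_between in P1. apply Rabs_le_between in P2. apply Rabs_le_between in P3. apply Rabs_le_between in P4.
      set (s := u * u + v * v) in *. set (s' := u' * u' + v' * v') in *. set (w := u * vq - v * uq) in *. set (w' := u' * vq' - v' * uq') in *.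
      assert (S1 : Rabs (s - s') <= 6 * (d * B)) by (unfold s, s'; apply Rabs_le; lra).
      assert (W1 : Rabs (w - w') <= 6 * (d * B)) by (unfold w, w'; apply Rabs_le; lra).
      assert (S2 : / 2 <= s') by (apply Rabs_le_between in S1; lra).
      split; auto.
      replace (w / s - w' / s') with (/ s' * (w - w') - / s * / s' * (w * (s - s'))) by (field; lra).
      assert (I1 : 0 < / s <= 1) by (split; [apply Rinv_0_lt_compat; lra|rewrite <- Rinv_1; apply Rinv_le_contravar; lra]).
      assert (I2 : 0 < / s' <= 2) by (split; [apply Rinv_0_lt_compat; lra|rewrite <- (Rinv_inv 2); apply Rinv_le_contravar; lra]).
      assert (T1 : Rabs (/ s' * (w - w')) <= 2 * (6 * (d * B))).
      { rewrite Rabs_mult, (Rabs_pos_eq (/ s')) by lra. apply Rmult_le_compat; try lra. apply Rabs_pos. }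
      assert (T2 : Rabs (/ s * / s' * (w * (s - s'))) <= 2 * (2 * B ^ 2 * (6 * (d * B)))).
      { rewrite Rabs_mult, (Rabs_pos_eq (/ s * / s')) by nra. apply Rmult_le_compat; [nra|apply Rabs_pos|nra|].
        rewrite Rabs_mult. apply Rmult_le_compat; try apply Rabs_pos; auto. }
      unfold Rminus at 1. eapply Rle_trans; [apply Rabs_triang|]. rewrite Rabs_Ropp.
      replace (2 * (2 * B ^ 2 * (6 * (d * B)))) with (24 * (d * B ^ 3)) in T2 by ring. lra. }
    assert (cw : cts (fun q => ang U V t0 q / nsq U V t0 q)).
    { apply cts_div.
      - apply (C2_slice 0 t (ang U V)); auto. now apply C2_ang.
      - apply (C2_slice 0 t (nsq U V)); auto. now apply C2_nsq.
      - intro q. pose proof (r_gt _ _ _ HR t0 q ltac:(lra)). lra. }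
    assert (cw' : cts (fun q => ang UN VN 0 q / nsq UN VN 0 q)).
    { apply cts_div.
      - apply (C2_slice (-1) 1 (ang UN VN)); [apply C2_ang; apply pjet_harm|lra].
      - apply (C2_slice (-1) 1 (nsq UN VN)); [apply C2_nsq; apply pjet_harm|lra].
      - intro q. destruct (Es q). lra. }
    assert (DM : Rabs (mean (fun q => ang U V t0 q / nsq U V t0 q) - mean (fun q => ang UN VN 0 q / nsq UN VN 0 q)) <= / 2).
    { rewrite <- mean_minus by auto. apply mean_bound; [auto with cts|]. intro q; apply Es. }
    apply Rabs_le_between in DM. fold UN VN. lra.
  (* Rotation by the polar angle p of the zero turns the coefficients into those of the shifted
     jet. *)
  - exists a, p. split; auto. split.
    + rewrite <- Z1. apply sm_ext; intros n _. f_equal. simpl. unfold shf. now apply fcos_shift.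
    + rewrite <- Z2. apply sm_ext; intros n _. f_equal. simpl. unfold shf. now apply fcos_shift.
Qed.
End Loc.

(** * The energy far from the inner circle *)

Section Main.
Variables (b : R) (U V : jet) (t0 t a eta : R) (N : nat).
Hypothesis HR : rmap b U V.
Hypothesis H0t : 0 < t0 < t.
Hypothesis Htb : t < b.
Hypothesis HE : exp (- (t - t0)) <= 3 / 8.
Hypothesis Ha : 0 <= a < 1.
Let T := t - t0.
Let X := fcos (j0 U t0). Let Y := fsin (j0 U t0). Let X' := fcos (j0 V t0). Let Y' := fsin (j0 V t0).
Let DX := fcos (jt U t0). Let DY := fsin (jt U t0). Let DX' := fcos (jt V t0). Let DY' := fsin (jt V t0).
Let HX := fcos (j0 U t). Let HY := fsin (j0 U t). Let HX' := fcos (j0 V t). Let HY' := fsin (j0 V t).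
Hypothesis ZU : sm (S N) (fun n => X n * a ^ n) = 0.
Hypothesis ZV : sm (S N) (fun n => X' n * a ^ n) = 0.
Hypothesis He : 0 <= eta.
Hypothesis H1 : forall q, Rabs (poly N X Y q ^ 2 + poly N X' Y' q ^ 2 - 1) <= eta.
Hypothesis H2 : - eta <= 2 * mean (fun q => poisson a q * (poly N X Y q * poly N DX DY q + poly N X' Y' q * poly N DX' DY' q)).

(** If |h(t0, .)| were exactly 1, the three means would be v, 1 and 1 with v = [vv a], and
    [key_lemma] would give c^2 + (v - 1)(2 s c - c^2 - 1/2), because s c + c E = c^2. The deviation
    eta costs at most 10 c^2 v eta, split as 1 + 4 + 2 + 1 + 2 over [A1] to [A5]. *)
Lemma main_ineq : slack a N X Y T HX HY + slack a N X' Y' T HX' HY' + cosh T ^ 2 + (vv a - 1) / 2 <=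
  energy U V t + 10 * cosh T ^ 2 * vv a * eta.
Proof.
  pose proof (r_U _ _ _ HR) as HU. pose proof (r_V _ _ _ HR) as HV.
  assert (HT : 0 < T) by (unfold T; lra). assert (HE' : exp (- T) <= 3 / 8) by exact HE.
  assert (R1 : 0 < t0 < b) by lra. assert (R2 : 0 < t < b) by lra.
  pose proof (key_lemma a N X Y Ha ZU T HT HE' DX DY HX HY
    (fun n Hn => mode_cosh n 0 b _ _ t0 t (proj1 Hn) (fcos_mode 0 b U HU n) R1 R2)
    (fun n Hn => mode_cosh n 0 b _ _ t0 t (proj1 Hn) (fsin_mode 0 b U HU n) R1 R2)) as KU.
  pose proof (key_lemma a N X' Y' Ha ZV T HT HE' DX' DY' HX' HY'
    (fun n Hn => mode_cosh n 0 b _ _ t0 t (proj1 Hn) (fcos_mode 0 b V HV n) R1 R2)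
    (fun n Hn => mode_cosh n 0 b _ _ t0 t (proj1 Hn) (fsin_mode 0 b V HV n) R1 R2)) as KV.
  destruct (defect_cts b U V HR t R2) as (cu & cv & _).
  pose proof (bessel (j0 U t) N cu) as BU. pose proof (bessel (j0 V t) N cv) as BV. fold HX HY in BU. fold HX' HY' in BV.
  assert (EE : energy U V t = mean (fun q => j0 U t q ^ 2) + mean (fun q => j0 V t q ^ 2)).
  { rewrite <- mean_plus by auto with cts. apply mean_ext; intro; unfold nsq; ring. }
  pose proof (poisson_cts a Ha) as cP.
  set (u := poly N X Y) in *. set (v := poly N X' Y') in *. set (ut := poly N DX DY) in *. set (vt := poly N DX' DY') in *.
  assert (c1 : cts u) by (unfold u; auto with cts). assert (c2 : cts v) by (unfold v; auto with cts).
  assert (c3 : cts ut) by (unfold ut; auto with cts). assert (c4 : cts vt) by (unfold vt; auto with cts).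
  assert (F1 : mean (fun q => poisson a q * (u q * ut q + v q * vt q)) = mean (fun q => poisson a q * (u q * ut q)) + mean (fun q => poisson a q * (v q * vt q))).
  { rewrite <- mean_plus by auto 20 with cts. apply mean_ext; intro; ring. }
  assert (Fi : forall w, cts w -> (forall q, 0 <= w q) -> mean w * (1 - eta) <= mean (fun q => w q * u q ^ 2) + mean (fun q => w q * v q ^ 2) <= mean w * (1 + eta)).
  { intros w cw wp. rewrite <- mean_plus by auto 20 with cts. rewrite !(Rmult_comm (mean w)), <- !mean_scal by auto.
    split; apply mean_le; auto 20 with cts; intro q; specialize (wp q); specialize (H1 q); apply Rabs_le_between in H1; fold u v in H1; nra. }
  assert (V2 : mean (fun q => poisson a q ^ 2) = vv a).
  { rewrite (mean_ext _ (fun q => poisson a q ^ 2 * cos (INR 0 * q))) by (intro; simpl INR; rewrite Rmult_0_l, cos_0; ring).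
    rewrite mean_poisson2 by auto. simpl; ring. }
  pose proof (Fi (fun q => poisson a q ^ 2) ltac:(auto with cts) (fun q => pow2_ge_0 _)) as M2. rewrite V2 in M2.
  pose proof (Fi (poisson a) cP (fun q => Rlt_le _ _ (poisson_pos a Ha q))) as M1. rewrite mean_Pk_1 in M1 by auto.
  pose proof (Fi (fun _ => 1) ltac:(auto with cts) (fun q => Rle_0_1)) as M0. rewrite mean_const in M0.
  rewrite (mean_ext (fun q => 1 * u q ^ 2) (fun q => u q ^ 2)), (mean_ext (fun q => 1 * v q ^ 2) (fun q => v q ^ 2)) in M0 by (intro; ring).
  fold u v ut vt in H2. rewrite F1 in H2.
  pose proof (vv_pos a Ha) as Vp.
  set (p2u := mean (fun q => poisson a q ^ 2 * u q ^ 2)) in *. set (p2v := mean (fun q => poisson a q ^ 2 * v q ^ 2)) in *.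
  set (p1u := mean (fun q => poisson a q * u q ^ 2)) in *. set (p1v := mean (fun q => poisson a q * v q ^ 2)) in *.
  set (p0u := mean (fun q => u q ^ 2)) in *. set (p0v := mean (fun q => v q ^ 2)) in *.
  set (du := mean (fun q => poisson a q * (u q * ut q))) in *. set (dv := mean (fun q => poisson a q * (v q * vt q))) in *.
  pose proof (cosh_m_sinh T) as CS. pose proof (sinh_pos T HT) as Sp. pose proof (cosh_ge1 T) as Cp. pose proof (cosh_sinh_sq T) as Sq.
  rewrite rho1 in KU, KV. set (c := cosh T) in *. set (s := sinh T) in *. set (E := exp (- T)) in *.
  assert (Ep : 0 < E) by apply exp_pos.
  assert (Rh : forall x, 2 * (s * c) * (E / s) * x = 2 * c * E * x) by (intro; field; lra).
  rewrite Rh in KU, KV. set (w := vv a) in *.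
  assert (Sc : c * E + s * E = 1) by (rewrite <- CS; nra).
  (* In terms of i = e^T this is i^2 - 2 - 3 E^2 >= 4, true from i >= 8/3 and E <= 3/8; it makes the
     coefficient of v - 1 at least 1/2. *)
  assert (G : 1 <= 2 * (s * c) - c ^ 2).
  { set (i := / E). assert (iE : i * E = 1) by (unfold i; field; lra).
    assert (Ei : 8 / 3 <= i).
    { replace (8 / 3) with (/ (3 / 8)) by field. apply Rinv_le_contravar; lra. }
    assert (Ec : c = (i + E) / 2).
    { apply (Rmult_eq_reg_r E); [|lra]. replace ((i + E) / 2 * E) with ((i * E + E * E) / 2) by field. rewrite iE. nra. }
    assert (Es : s = (i - E) / 2) by lra.
    replace (2 * (s * c) - c ^ 2) with ((i * i - 2 * (i * E) - 3 * (E * E)) / 4) by (rewrite Es, Ec; field).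
    rewrite iE. nra. }
  assert (Tot : slack a N X Y T HX HY + slack a N X' Y' T HX' HY' + (2 * (s * c)) * (du + dv) + s * c * (3 * (p2u + p2v) - w * (p1u + p1v))
     + 2 * c * E * (p1u + p1v) - c ^ 2 * (p2u + p2v) - ((p2u + p2v) - 2 * (p1u + p1v) + (p0u + p0v)) / 2 <= energy U V t).
  { rewrite EE. lra. }
  set (q2 := p2u + p2v) in *. set (q1 := p1u + p1v) in *. set (q0 := p0u + p0v) in *.
  assert (c21 : 1 <= c ^ 2) by (clear - Cp; nra).
  assert (sc : 0 < s * c) by (apply Rmult_lt_0_compat; lra). assert (scc : s * c <= c ^ 2) by (clear - Cp CS Ep; nra).
  assert (cE : 0 < c * E <= c ^ 2) by (clear - Cp CS Ep Sp; split; nra).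
  assert (A1 : - (c ^ 2 * w * eta) <= 2 * (s * c) * (du + dv)).
  { assert (s * c * (- eta) <= s * c * (2 * (du + dv))) by (apply Rmult_le_compat_l; lra).
    assert (c ^ 2 * 1 <= c ^ 2 * w) by (apply Rmult_le_compat_l; lra).
    assert (s * c * eta <= c ^ 2 * w * eta) by (apply Rmult_le_compat_r; lra). lra. }
  assert (A2 : s * c * (2 * w) - 4 * (c ^ 2 * w * eta) <= s * c * (3 * q2 - w * q1)).
  { assert (2 * w - 4 * w * eta <= 3 * q2 - w * q1) by (assert (w * q1 <= w * (1 * (1 + eta))) by (apply Rmult_le_compat_l; lra); lra).
    apply Rle_trans with (s * c * (2 * w - 4 * w * eta)); [|apply Rmult_le_compat_l; lra].
    assert (s * c * (w * eta) <= c ^ 2 * (w * eta)) by (apply Rmult_le_compat_r; [apply Rmult_le_pos; lra|auto]). lra. }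
  assert (A3 : 2 * (c * E) - 2 * (c ^ 2 * w * eta) <= 2 * c * E * q1).
  { assert (2 * (c * E) * (1 - eta) <= 2 * (c * E) * q1) by (apply Rmult_le_compat_l; lra).
    assert (c * E * eta <= c ^ 2 * eta) by (apply Rmult_le_compat_r; lra).
    assert (c ^ 2 * eta * 1 <= c ^ 2 * eta * w) by (apply Rmult_le_compat_l; [apply Rmult_le_pos; [apply pow2_ge_0|auto]|auto]). lra. }
  assert (A4 : c ^ 2 * q2 <= c ^ 2 * w + c ^ 2 * w * eta).
  { apply Rle_trans with (c ^ 2 * (w * (1 + eta))); [apply Rmult_le_compat_l; [apply pow2_ge_0|lra]|right; ring]. }
  assert (A5 : (q2 - 2 * q1 + q0) / 2 <= (w - 1) / 2 + 2 * (c ^ 2 * w * eta)).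
  { assert (q2 - 2 * q1 + q0 <= w - 1 + w * eta + 3 * eta) by lra.
    assert (eta <= w * eta) by (rewrite <- (Rmult_1_l eta) at 1; apply Rmult_le_compat_r; lra).
    assert (w * eta <= c ^ 2 * (w * eta)) by (rewrite <- (Rmult_1_l (w * eta)) at 1; apply Rmult_le_compat_r; lra). lra. }
  assert (A6 : (w - 1) * 1 <= (w - 1) * (2 * (s * c) - c ^ 2)) by (apply Rmult_le_compat_l; lra).
  assert (A7 : s * c + c * E = c ^ 2) by (rewrite <- CS; ring).
  lra.
Qed.
End Main.

Section Slack.
Variables (a : R) (N : nat) (X Y : nat -> R) (T : R) (HX HY : nat -> R).
Let zX n := fcos (fun q => poisson a q * poly N X Y q) n.
Let zY n := fsin (fun q => poisson a q * poly N X Y q) n.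
Let mu := sinh T * cosh T.
Let term i := (HX (S i) - mu * zX (S i) / Sn T (S i)) ^ 2 + (HY (S i) - mu * zY (S i) / Sn T (S i)) ^ 2
     + match i with O => 0 | S _ => (zX (S i) ^ 2 + zY (S i) ^ 2) / 20 end.

Lemma slack_term_ge0 i : 0 <= term i.
Proof.
  unfold term. pose proof (pow2_ge_0 (HX (S i) - mu * zX (S i) / Sn T (S i))). pose proof (pow2_ge_0 (HY (S i) - mu * zY (S i) / Sn T (S i))).
  destruct i; [lra|]. pose proof (pow2_ge_0 (zX (S (S i)))). pose proof (pow2_ge_0 (zY (S (S i)))). lra.
Qed.
Lemma slack_0 : HX O ^ 2 <= slack a N X Y T HX HY.
Proof.
  assert (0 <= sm N term) by (apply sm_ge0; intros; apply slack_term_ge0).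
  change (HX O ^ 2 <= HX O ^ 2 + / 2 * sm N term). lra.
Qed.
Lemma slack_ge0 : 0 <= slack a N X Y T HX HY.
Proof. pose proof slack_0. pose proof (pow2_ge_0 (HX O)). lra. Qed.
Lemma slack_n i : (i < N)%nat -> term i <= 2 * slack a N X Y T HX HY.
Proof.
  intro H. pose proof (sm_term N term i (fun i _ => slack_term_ge0 i) H).
  change (term i <= 2 * (HX O ^ 2 + / 2 * sm N term)). pose proof (pow2_ge_0 (HX O)). lra.
Qed.
End Slack.

Lemma poly_shift N f p q : cts f -> per f ->
  poly N (fcos (fun x => f (x + p))) (fsin (fun x => f (x + p))) q = poly N (fcos f) (fsin f) (q + p).
Proof.
  intros C P. apply sm_ext; intros n _. rewrite fcos_shift, fsin_shift by auto.
  replace (INR n * (q + p)) with (INR n * q + INR n * p) by ring. rewrite cos_plus, sin_plus. ring.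
Qed.

(** From e^T >= (1 + T/64)^64, evaluated by six squarings with rounding down. *)
Lemma exp_T T : 999 / 1000 <= T -> exp (- T) <= 3 / 8.
Proof.
  intro H. rewrite exp_Ropp. replace (3 / 8) with (/ (8 / 3)) by field. apply Rinv_le_contravar; [lra|].
  set (x := exp (T / 64)).
  assert (x0 : 10156 / 10000 <= x) by (unfold x; pose proof (exp_ineq1_le (T / 64)); lra).
  assert (E : exp T = ((((((x ^ 2) ^ 2) ^ 2) ^ 2) ^ 2) ^ 2)).
  { replace ((((((x ^ 2) ^ 2) ^ 2) ^ 2) ^ 2) ^ 2) with (x ^ 64) by ring. unfold x.
    pose proof (exp_INR 64 (- (T / 64))) as P. rewrite Ropp_involutive in P. rewrite <- P. f_equal.
    rewrite INR_IZR_INZ. change (Z.of_nat 64) with 64%Z. field. }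
  rewrite E.
  assert (x1 : 10314 / 10000 <= x ^ 2) by nra. set (y1 := x ^ 2) in *.
  assert (x2 : 10637 / 10000 <= y1 ^ 2) by nra. set (y2 := y1 ^ 2) in *.
  assert (x3 : 1131 / 1000 <= y2 ^ 2) by nra. set (y3 := y2 ^ 2) in *.
  assert (x4 : 1279 / 1000 <= y3 ^ 2) by nra. set (y4 := y3 ^ 2) in *.
  assert (x5 : 1635 / 1000 <= y4 ^ 2) by nra. set (y5 := y4 ^ 2) in *. nra.
Qed.

Lemma energy_shift b U V p t : rmap b U V -> 0 < t < b -> energy (shift p U) (shift p V) t = energy U V t.
Proof.
  intros HR Ht. unfold energy. change (nsq (shift p U) (shift p V) t) with (fun q => nsq U V t (q + p)).
  apply mean_shift; [now apply (nsq_cts b)|]. intro q. apply (Per_nsq 0 b U V (r_U _ _ _ HR) (r_V _ _ _ HR)).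
Qed.

Lemma vv_le a r : 0 <= a <= r -> r < 1 -> vv a <= 2 / (1 - r).
Proof.
  intros Ha Hr. unfold vv. assert (D : 1 - r <= 1 - a ^ 2) by nra. assert (D0 : 0 < 1 - r) by lra.
  unfold Rdiv. apply Rmult_le_compat.
  - pose proof (pow2_ge_0 a); lra.
  - left; apply Rinv_0_lt_compat; lra.
  - nra.
  - apply Rinv_le_contravar; auto.
Qed.

(** The parameters are chosen in the order m, tolerance h, boundary closeness e, circle t0,
    truncation order N and finally the zero a with its angle p. All constants before t0 depend only
    on t and m, as [zero_loc] permits. *)
Lemma limit_ineq b U V t : rmap b U V -> 1 <= t < b -> forall eta k, 0 < eta -> exists t0 a p N,
  0 < t0 < eta /\ t0 <= 1 / 1000 /\ (k <= N)%nat /\ 0 <= a < 1 /\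
  sm (S N) (fun n => fcos (j0 (shift p U) t0) n * a ^ n) = 0 /\ sm (S N) (fun n => fcos (j0 (shift p V) t0) n * a ^ n) = 0 /\
  (forall q, poly N (fcos (j0 (shift p U) t0)) (fsin (j0 (shift p U) t0)) q ^ 2 + poly N (fcos (j0 (shift p V) t0)) (fsin (j0 (shift p V) t0)) q ^ 2 <= 2) /\
  slack a N (fcos (j0 (shift p U) t0)) (fsin (j0 (shift p U) t0)) (t - t0) (fcos (j0 (shift p U) t)) (fsin (j0 (shift p U) t)) +
  slack a N (fcos (j0 (shift p V) t0)) (fsin (j0 (shift p V) t0)) (t - t0) (fcos (j0 (shift p V) t)) (fsin (j0 (shift p V) t)) +
  cosh (t - t0) ^ 2 + (vv a - 1) / 2 <= energy U V t + eta.
Proof.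
  intros HR Ht eta k He. assert (Ht' : 0 < t < b) by lra.
  destruct (zero_loc b U V t HR Ht') as (m & Hm & ZL).
  set (r := exp (- m)). assert (Hr : 0 < r < 1) by (split; [apply exp_pos|unfold r; rewrite <- exp_0; apply exp_increasing; lra]).
  set (Vm := 2 / (1 - r)). assert (V0 : 0 < Vm) by (apply Rdiv_lt_0_compat; lra).
  pose proof (cosh_ge1 t) as Ct. set (C := 10 * cosh t ^ 2 * Vm).
  assert (C0 : 0 < C) by (unfold C; apply Rmult_lt_0_compat; auto; nra).
  set (h := Rmin 1 (eta / C)). assert (h0 : 0 < h) by (apply Rmin_pos; [lra|apply Rdiv_lt_0_compat; lra]).
  assert (h1 : h <= 1) by apply Rmin_l. assert (h2 : h <= eta / C) by apply Rmin_r.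
  assert (Ch : C * h <= eta).
  { apply Rle_trans with (C * (eta / C)); [apply Rmult_le_compat_l; lra|right; field; lra]. }
  set (K := 10 / (1 - r) ^ 6). assert (K0 : 0 < K) by (apply Rdiv_lt_0_compat; [lra|apply pow_lt; lra]).
  (* The first bound is for |h|^2 - 1 itself, the second for the slope error K e t0. *)
  set (e := Rmin (h / 2) (h / (2 * K))). assert (e0 : 0 < e) by (apply Rmin_pos; apply Rdiv_lt_0_compat; lra).
  assert (e1 : e <= h / 2) by apply Rmin_l. assert (e2 : e <= h / (2 * K)) by apply Rmin_r.
  assert (Ke : K * e <= h / 2).
  { apply Rle_trans with (K * (h / (2 * K))); [apply Rmult_le_compat_l; lra|right; field; lra]. }
  destruct (r_lim _ _ _ HR e e0) as (d & Hd & Ld).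
  set (t0 := Rmin (Rmin (d / 2) (eta / 2)) (1 / 1000)).
  assert (T0 : 0 < t0) by (repeat apply Rmin_pos; lra).
  assert (T1 : t0 <= Rmin (d / 2) (eta / 2)) by apply Rmin_l. assert (T2 : t0 <= 1 / 1000) by apply Rmin_r.
  pose proof (Rmin_l (d / 2) (eta / 2)). pose proof (Rmin_r (d / 2) (eta / 2)).
  destruct (ZL t0 ltac:(lra)) as [N1 ZN]. clear ZL.
  assert (Ht0 : 0 < t0 < t) by lra.
  destruct (defect_cts b U V HR t0 ltac:(lra)) as (cu & cv & cut & cvt & _ & _).
  pose proof (r_U _ _ _ HR) as HU. pose proof (r_V _ _ _ HR) as HV.
  assert (pu : per (j0 U t0)) by (intro; apply (h_p _ _ _ HU)). assert (pv : per (j0 V t0)) by (intro; apply (h_p _ _ _ HV)).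
  assert (put : per (jt U t0)) by (intro; apply (h_pt _ _ _ HU)). assert (pvt : per (jt V t0)) by (intro; apply (h_pt _ _ _ HV)).
  destruct (per_max _ cu pu) as (B1 & b1 & HB1). destruct (per_max _ cv pv) as (B2 & b2 & HB2).
  destruct (per_max _ cut put) as (B3 & b3 & HB3). destruct (per_max _ cvt pvt) as (B4 & b4 & HB4).
  set (B := 1 + B1 + B2 + B3 + B4). assert (HB : 1 <= B) by (unfold B; lra).
  (* A product of two truncated factors is off by 3 B dl, so a sum of two such products by h/4. *)
  set (dl := h / (24 * B)). assert (d0 : 0 < dl) by (apply Rdiv_lt_0_compat; lra).
  assert (dB : dl * B = h / 24) by (unfold dl; field; lra). assert (d1 : dl <= 1) by nra.
  destruct (trunc_both b U V t HR Ht' t0 dl Ht0 d0) as [N2 L2].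
  set (N := Nat.max k (Nat.max N1 N2)). specialize (L2 N ltac:(lia)).
  destruct (ZN N ltac:(lia)) as (a & p & Ha & ZU & ZV). fold r in Ha. assert (Ha1 : 0 <= a < 1) by lra.
  exists t0, a, p, N. split; [lra|]. split; [lra|]. split; [unfold N; lia|]. split; [lra|]. split; [exact ZU|]. split; [exact ZV|].
  pose proof (rmap_shift b U V p HR) as HS.
  assert (PU : forall q, poly N (fcos (j0 (shift p U) t0)) (fsin (j0 (shift p U) t0)) q = poly N (fcos (j0 U t0)) (fsin (j0 U t0)) (q + p)) by (intro q; apply poly_shift; auto).
  assert (PV : forall q, poly N (fcos (j0 (shift p V) t0)) (fsin (j0 (shift p V) t0)) q = poly N (fcos (j0 V t0)) (fsin (j0 V t0)) (q + p)) by (intro q; apply poly_shift; auto).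
  assert (PUt : forall q, poly N (fcos (jt (shift p U) t0)) (fsin (jt (shift p U) t0)) q = poly N (fcos (jt U t0)) (fsin (jt U t0)) (q + p)) by (intro q; apply poly_shift; auto).
  assert (PVt : forall q, poly N (fcos (jt (shift p V) t0)) (fsin (jt (shift p V) t0)) q = poly N (fcos (jt V t0)) (fsin (jt V t0)) (q + p)) by (intro q; apply poly_shift; auto).
  assert (H1 : forall q, Rabs (poly N (fcos (j0 (shift p U) t0)) (fsin (j0 (shift p U) t0)) q ^ 2 + poly N (fcos (j0 (shift p V) t0)) (fsin (j0 (shift p V) t0)) q ^ 2 - 1) <= h).
  { intro q. rewrite PU, PV. destruct (L2 (q + p)) as [(u1 & _ & _) (v1 & _ & _)].
    specialize (HB1 (q + p)). specialize (HB2 (q + p)).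
    assert (K1 : Rabs (j0 U t0 (q + p)) <= B) by (unfold B; lra). assert (K2 : Rabs (j0 V t0 (q + p)) <= B) by (unfold B; lra).
    pose proof (prod_err _ _ _ _ B dl K1 K1 u1 u1 d1 HB) as P1. pose proof (prod_err _ _ _ _ B dl K2 K2 v1 v1 d1 HB) as P2.
    pose proof (r_gt _ _ _ HR t0 (q + p) ltac:(lra)) as G. pose proof (Ld t0 (q + p) ltac:(lra) ltac:(lra)) as G'. unfold nsq in G, G'.
    apply Rabs_le_between in P1. apply Rabs_le_between in P2. apply Rabs_le.
    set (x := poly N (fcos (j0 U t0)) (fsin (j0 U t0)) (q + p)) in *. set (y := poly N (fcos (j0 V t0)) (fsin (j0 V t0)) (q + p)) in *.
    replace (x ^ 2) with (x * x) by ring. replace (y ^ 2) with (y * y) by ring. lra. }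
  split.
  { intro q. pose proof (H1 q) as Q. apply Rabs_le_between in Q. lra. }
  (* [phi_slope] wants |h|^2 - 1 <= e on the whole strip; this holds for the strip of height 2 t0 <=
     d. *)
  assert (HS' : rmap (2 * t0) (shift p U) (shift p V)) by (apply (rmap_sub b); auto; lra).
  pose proof (phi_slope (2 * t0) (shift p U) (shift p V) r a e t0 HS' Ha ltac:(lra) ltac:(lra)) as PS.
  assert (PS' : - (K * e * t0) <= 2 * mean (fun q => poisson a q * (j0 (shift p U) t0 q * jt (shift p U) t0 q + j0 (shift p V) t0 q * jt (shift p V) t0 q))).
  { apply PS. intros s q Hs. pose proof (Ld s (q + p) ltac:(lra) ltac:(lra)). change (nsq (shift p U) (shift p V) s q) with (nsq U V s (q + p)). lra. }
  clear PS. pose proof (poisson_cts a Ha1) as cP.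
  destruct (defect_cts b (shift p U) (shift p V) HS t0 ltac:(lra)) as (su & sv & sut & svt & _ & _).
  assert (H2 : - h <= 2 * mean (fun q => poisson a q * (poly N (fcos (j0 (shift p U) t0)) (fsin (j0 (shift p U) t0)) q * poly N (fcos (jt (shift p U) t0)) (fsin (jt (shift p U) t0)) q
       + poly N (fcos (j0 (shift p V) t0)) (fsin (j0 (shift p V) t0)) q * poly N (fcos (jt (shift p V) t0)) (fsin (jt (shift p V) t0)) q))).
  { assert (Dm : Rabs (mean (fun q => poisson a q * (j0 (shift p U) t0 q * jt (shift p U) t0 q + j0 (shift p V) t0 q * jt (shift p V) t0 q)
      - poisson a q * (poly N (fcos (j0 (shift p U) t0)) (fsin (j0 (shift p U) t0)) q * poly N (fcos (jt (shift p U) t0)) (fsin (jt (shift p U) t0)) q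
       + poly N (fcos (j0 (shift p V) t0)) (fsin (j0 (shift p V) t0)) q * poly N (fcos (jt (shift p V) t0)) (fsin (jt (shift p V) t0)) q))) <= mean (fun q => 6 * (dl * B) * poisson a q)).
    { assert (Pt : forall q, Rabs (poisson a q * (j0 (shift p U) t0 q * jt (shift p U) t0 q + j0 (shift p V) t0 q * jt (shift p V) t0 q)
      - poisson a q * (poly N (fcos (j0 (shift p U) t0)) (fsin (j0 (shift p U) t0)) q * poly N (fcos (jt (shift p U) t0)) (fsin (jt (shift p U) t0)) q
       + poly N (fcos (j0 (shift p V) t0)) (fsin (j0 (shift p V) t0)) q * poly N (fcos (jt (shift p V) t0)) (fsin (jt (shift p V) t0)) q)) <= 6 * (dl * B) * poisson a q).
      { intro q. rewrite PU, PV, PUt, PVt. rewrite <- Rmult_minus_distr_l, Rabs_mult, (Rabs_pos_eq (poisson a q)) by (left; apply poisson_pos, Ha1).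
        rewrite (Rmult_comm (6 * (dl * B))). apply Rmult_le_compat_l; [left; apply poisson_pos, Ha1|].
        destruct (L2 (q + p)) as [(u1 & u2 & _) (v1 & v2 & _)].
        specialize (HB1 (q + p)). specialize (HB2 (q + p)). specialize (HB3 (q + p)). specialize (HB4 (q + p)).
        assert (K1 : Rabs (j0 U t0 (q + p)) <= B) by (unfold B; lra). assert (K2 : Rabs (j0 V t0 (q + p)) <= B) by (unfold B; lra).
        assert (K3 : Rabs (jt U t0 (q + p)) <= B) by (unfold B; lra). assert (K4 : Rabs (jt V t0 (q + p)) <= B) by (unfold B; lra).
        pose proof (prod_err _ _ _ _ B dl K1 K3 u1 u2 d1 HB) as P1. pose proof (prod_err _ _ _ _ B dl K2 K4 v1 v2 d1 HB) as P2.
        apply Rabs_le_between in P1. apply Rabs_le_between in P2. simpl j0. simpl jt. unfold shf. apply Rabs_le. lra. }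
      apply Rabs_le. split.
      - apply Ropp_le_cancel. rewrite Ropp_involutive, <- mean_opp by auto 20 with cts. apply mean_le; auto 20 with cts.
        intro q. specialize (Pt q). apply Rabs_le_between in Pt. lra.
      - apply mean_le; auto 20 with cts. intro q. specialize (Pt q). apply Rabs_le_between in Pt. lra. }
    rewrite mean_minus, mean_scal, mean_Pk_1 in Dm by auto 20 with cts. apply Rabs_le_between in Dm.
    assert (K * e * t0 <= h / 2 * 1) by (apply Rmult_le_compat; nra). lra. }
  assert (HE : exp (- (t - t0)) <= 3 / 8) by (apply exp_T; lra).
  pose proof (main_ineq b (shift p U) (shift p V) t0 t a h N HS Ht0 (proj2 Ht') HE Ha1 ZU ZV (Rlt_le _ _ h0) H1 H2) as MI.
  rewrite (energy_shift b) in MI by auto.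
  assert (Fin : 10 * cosh (t - t0) ^ 2 * vv a * h <= eta); [|lra].
  apply Rle_trans with (C * h); [|exact Ch]. apply Rmult_le_compat_r; [lra|]. unfold C.
  pose proof (d_cosh_mono (t - t0) t ltac:(lra) ltac:(lra)) as Cm. pose proof (cosh_ge1 (t - t0)).
  assert (cosh (t - t0) ^ 2 <= cosh t ^ 2) by (apply pow_incr; lra).
  pose proof (vv_le a r Ha ltac:(lra)) as Vl. fold Vm in Vl. pose proof (vv_pos a Ha1). pose proof (pow2_ge_0 (cosh (t - t0))).
  apply Rmult_le_compat; lra.
Qed.

Lemma cosh_cont_limit t : forall e, 0 < e -> exists d, 0 < d /\ forall t0, 0 < t0 < d -> cosh t ^ 2 - e < cosh (t - t0) ^ 2.
Proof.
  intros e He. assert (C : continuous (fun x => cosh (t - x) ^ 2) 0).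
  { apply (ex_derive_continuous (fun x => cosh (t - x) ^ 2)). eexists.
    apply (is_derive_pow (fun x => cosh (t - x)) 2), (d_comp (fun x => t - x) cosh); [apply d_cosh|]. apply d_minus; [apply d_const|apply d_id]. }
  specialize (C (fun y => cosh t ^ 2 - e < y)). cbv beta in C. rewrite Rminus_0_r in C.
  destruct C as [d Hd]; [apply open_gt; lra|].
  exists d. split; [apply cond_pos|]. intros t0 H0. apply Hd. unfold ball; simpl; unfold AbsRing_ball, abs, minus, plus, opp; simpl.
  rewrite Ropp_0, Rplus_0_r, Rabs_pos_eq; lra.
Qed.

Lemma long_bound b U V t : rmap b U V -> 1 <= t < b -> cosh t ^ 2 <= energy U V t.
Proof.
  intros HR Ht. apply Rnot_lt_le. intro L. set (g := cosh t ^ 2 - energy U V t). assert (g0 : 0 < g) by (unfold g; lra).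
  destruct (cosh_cont_limit t (g / 2) ltac:(lra)) as (d & Hd & Ld).
  destruct (limit_ineq b U V t HR Ht (Rmin d (g / 4)) O) as (t0 & a & p & N & H0 & _ & _ & Ha & _ & _ & _ & I).
  { apply Rmin_pos; lra. }
  pose proof (Rmin_l d (g / 4)). pose proof (Rmin_r d (g / 4)).
  specialize (Ld t0 ltac:(lra)). pose proof (vv_pos a Ha).
  pose proof (slack_ge0 a N (fcos (j0 (shift p U) t0)) (fsin (j0 (shift p U) t0)) (t - t0) (fcos (j0 (shift p U) t)) (fsin (j0 (shift p U) t))).
  pose proof (slack_ge0 a N (fcos (j0 (shift p V) t0)) (fsin (j0 (shift p V) t0)) (t - t0) (fcos (j0 (shift p V) t)) (fsin (j0 (shift p V) t))).
  unfold g in *. lra.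
Qed.

(** * The equality case *)

(** Cauchy data, on a single circle s, of a function cosh t (C cos q + D sin q). Both regimes
    produce this form, at different circles. *)
Definition rigid (b : R) (W : jet) : Prop := exists s, 0 < s < b /\
  (forall n, n <> 1%nat -> fcos (j0 W s) n = 0 /\ fsin (j0 W s) n = 0 /\ fcos (jt W s) n = 0 /\ fsin (jt W s) n = 0) /\
  cosh s * fcos (jt W s) 1 = sinh s * fcos (j0 W s) 1 /\ cosh s * fsin (jt W s) 1 = sinh s * fsin (j0 W s) 1.

Lemma Sn1 T : Sn T 1 = sinh T.
Proof. unfold Sn. simpl. rewrite Rmult_1_l. field. Qed.

Lemma rigid_mode b x y s t : mode 0 b 1 x y -> 0 < s < b -> 0 < t < b -> cosh s * y s = sinh s * x s ->
  x t = cosh t * (x s / cosh s).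
Proof.
  intros M Hs Ht E. rewrite (mode_cosh 1 0 b x y s t) by (auto; lia). rewrite Sn1. simpl INR. rewrite Rmult_1_l.
  pose proof (cosh_pos s). replace (cosh t) with (cosh (t - s) * cosh s + sinh (t - s) * sinh s) by (rewrite <- cosh_plus; f_equal; ring).
  replace (y s) with (sinh s * x s / cosh s) by (rewrite <- E; field; lra). field. lra.
Qed.

Lemma rigid_form b W : harm 0 b W -> rigid b W -> exists C D, forall t q, 0 < t < b -> j0 W t q = cosh t * (C * cos q + D * sin q).
Proof.
  intros HW (s & Hs & Z & E1 & E2).
  exists (fcos (j0 W s) 1 / cosh s), (fsin (j0 W s) 1 / cosh s). intros t q Ht.
  assert (X1 : fcos (j0 W t) 1 = cosh t * (fcos (j0 W s) 1 / cosh s)) by exact (rigid_mode b _ _ s t (fcos_mode 0 b W HW 1) Hs Ht E1).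
  assert (Y1 : fsin (j0 W t) 1 = cosh t * (fsin (j0 W s) 1 / cosh s)) by exact (rigid_mode b _ _ s t (fsin_mode 0 b W HW 1) Hs Ht E2).
  assert (Zx : forall n, n <> 1%nat -> fcos (j0 W t) n = 0).
  { intros n Hn. destruct (Z n Hn) as (A & _ & B & _). exact (mode_vanish n 0 b _ _ s (fcos_mode 0 b W HW n) Hs A B t Ht). }
  assert (Zy : forall n, n <> 1%nat -> fsin (j0 W t) n = 0).
  { intros n Hn. destruct (Z n Hn) as (_ & A & _ & B). exact (mode_vanish n 0 b _ _ s (fsin_mode 0 b W HW n) Hs A B t Ht). }
  rewrite Rmult_plus_distr_l, <- !Rmult_assoc, <- X1, <- Y1.
  set (x := fcos (j0 W t) 1) in *. set (y := fsin (j0 W t) 1) in *.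
  assert (Pl : forall N, poly (S N) (fcos (j0 W t)) (fsin (j0 W t)) q = x * cos q + y * sin q).
  { intro N. unfold poly. rewrite (sm_single (S (S N)) 1).
    - destruct (Nat.ltb_spec 1 (S (S N))); [|lia]. fold x y. simpl INR. now rewrite Rmult_1_l.
    - intros n Hn. rewrite Zx, Zy by auto. ring. }
  (* With the arbitrary ratio 1/2, this constant dominates the only nonzero coefficients, those of
     index 1. *)
  set (K := 2 * (Rabs x + Rabs y)). pose proof (Rabs_pos x). pose proof (Rabs_pos y). assert (K0 : 0 <= K) by (unfold K; lra).
  assert (Gx : geo K (/ 2) (fcos (j0 W t))).
  { intro n. destruct (Nat.eq_dec n 1) as [->|Hn]; [fold x; unfold K; simpl; lra|].
    rewrite Zx, Rabs_R0 by auto. apply Rmult_le_pos; auto. apply pow_le; lra. }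
  assert (Gy : geo K (/ 2) (fsin (j0 W t))).
  { intro n. destruct (Nat.eq_dec n 1) as [->|Hn]; [fold y; unfold K; simpl; lra|].
    rewrite Zy, Rabs_R0 by auto. apply Rmult_le_pos; auto. apply pow_le; lra. }
  destruct (jet_cts 0 b W HW t Ht) as (? & _ & ? & _).
  assert (Tr : forall N, Rabs (j0 W t q - (x * cos q + y * sin q)) <= 2 * K * (/ 2) ^ S (S N) / (1 - / 2)).
  { intro N. rewrite <- (Pl N). apply (trunc_geo (j0 W t) (jq W t)); auto; try lra.
    - intro; apply (h_q _ _ _ HW); auto. - intro; apply (h_p _ _ _ HW). - intro; apply (h_pq _ _ _ HW). }
  apply Rminus_diag_uniq. destruct (Req_dec (j0 W t q - (x * cos q + y * sin q)) 0) as [|Nz]; auto. exfalso.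
  apply Rabs_pos_lt in Nz.
  destruct (pow_small (/ 2) (Rabs (j0 W t q - (x * cos q + y * sin q)) / 2) ltac:(lra) ltac:(lra) (2 * K / (1 - / 2))) as [N L].
  specialize (L (S N) ltac:(lia)). specialize (Tr N). unfold Rdiv in *. lra.
Qed.

Lemma mean_ext_in f g : (forall x, 0 < x < 2 * PI -> f x = g x) -> mean f = mean g.
Proof.
  intro E; unfold mean; f_equal. apply RInt_ext. intros x Hx. pose proof PI2_pos.
  rewrite Rmin_left, Rmax_right in Hx by lra. now apply E.
Qed.
Lemma fcos_ext_in f g n : (forall x, 0 < x < 2 * PI -> f x = g x) -> fcos f n = fcos g n.
Proof. intro E. rewrite !fcos_kap. f_equal. apply mean_ext_in; intros; now rewrite E. Qed.
Lemma fsin_ext_in f g n : (forall x, 0 < x < 2 * PI -> f x = g x) -> fsin f n = fsin g n.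
Proof. intro E. unfold fsin. f_equal. apply mean_ext_in; intros; now rewrite E. Qed.
Lemma fcos_scal c f n : cts f -> fcos (fun q => c * f q) n = c * fcos f n.
Proof.
  intro C. rewrite !fcos_kap. rewrite (mean_ext _ (fun q => c * (f q * cos (INR n * q)))) by (intro; ring).
  rewrite mean_scal by auto 20 with cts. ring.
Qed.
Lemma fsin_scal c f n : cts f -> fsin (fun q => c * f q) n = c * fsin f n.
Proof.
  intro C. unfold fsin. rewrite (mean_ext _ (fun q => c * (f q * sin (INR n * q)))) by (intro; ring).
  rewrite mean_scal by auto 20 with cts. ring.
Qed.

(** On the circle t/2 the map satisfies h_t = tanh h and h_q = i h. The second equation links the
    coefficients of U and V so that each is multiplied by n^2 and returns to itself; only n = 1
    survives. The first equation gives the slopes. *)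
Lemma short_rigid b U V t : rmap b U V -> 0 < t < b -> t <= 1 -> energy U V t = cosh t ^ 2 -> rigid b U /\ rigid b V.
Proof.
  intros HR Ht Ht1 E. pose proof (short_equality b U V t HR Ht Ht1 E) as D.
  set (s := t / 2) in *. assert (Hs : 0 < s < b) by (unfold s; lra).
  pose proof (r_U _ _ _ HR) as HU. pose proof (r_V _ _ _ HR) as HV.
  destruct (defect_cts b U V HR s Hs) as (cu & cv & cut & cvt & cuq & cvq).
  pose proof (mean_zero_fun (fun q => xi1 U s q * xi1 U s q + xi2 V s q * xi2 V s q + et1 U V s q * et1 U V s q + et2 U V s q * et2 U V s q)) as Z.
  assert (Z' : forall q, 0 < q < 2 * PI -> xi1 U s q = 0 /\ xi2 V s q = 0 /\ et1 U V s q = 0 /\ et2 U V s q = 0).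
  { intros q Hq. assert (Zq : xi1 U s q * xi1 U s q + xi2 V s q * xi2 V s q + et1 U V s q * et1 U V s q + et2 U V s q * et2 U V s q = 0).
    { apply Z; auto. - unfold xi1, xi2, et1, et2; auto 20 with cts.
      - intro x. pose proof (Rle_0_sqr (xi1 U s x)). pose proof (Rle_0_sqr (xi2 V s x)). pose proof (Rle_0_sqr (et1 U V s x)). pose proof (Rle_0_sqr (et2 U V s x)). unfold Rsqr in *. lra. }
    pose proof (Rle_0_sqr (xi1 U s q)) as q1. pose proof (Rle_0_sqr (xi2 V s q)) as q2. pose proof (Rle_0_sqr (et1 U V s q)) as q3. pose proof (Rle_0_sqr (et2 U V s q)) as q4. unfold Rsqr in *.
    repeat split; apply Rsqr_0_uniq; unfold Rsqr; lra. }
  clear Z.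
  assert (Du : forall q, is_derive (j0 U s) q (jq U s q)) by (intro; apply (h_q _ _ _ HU); auto).
  assert (Dv : forall q, is_derive (j0 V s) q (jq V s q)) by (intro; apply (h_q _ _ _ HV); auto).
  assert (Pu : per (j0 U s)) by (intro; apply (h_p _ _ _ HU)). assert (Pv : per (j0 V s)) by (intro; apply (h_p _ _ _ HV)).
  assert (A1 : forall n, INR n * fsin (j0 U s) n = - fcos (j0 V s) n).
  { intro n. rewrite <- (fcos_der (j0 U s) (jq U s)) by auto. replace (- fcos (j0 V s) n) with (-1 * fcos (j0 V s) n) by ring.
    rewrite <- fcos_scal by auto. apply fcos_ext_in. intros q Hq. destruct (Z' q Hq) as (_ & _ & e & _). unfold et1 in e. lra. }
  assert (A2 : forall n, - INR n * fcos (j0 U s) n = - fsin (j0 V s) n).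
  { intro n. rewrite <- (fsin_der (j0 U s) (jq U s)) by auto. replace (- fsin (j0 V s) n) with (-1 * fsin (j0 V s) n) by ring.
    rewrite <- fsin_scal by auto. apply fsin_ext_in. intros q Hq. destruct (Z' q Hq) as (_ & _ & e & _). unfold et1 in e. lra. }
  assert (A3 : forall n, INR n * fsin (j0 V s) n = fcos (j0 U s) n).
  { intro n. rewrite <- (fcos_der (j0 V s) (jq V s)) by auto. apply fcos_ext_in. intros q Hq. destruct (Z' q Hq) as (_ & _ & _ & e). unfold et2 in e. lra. }
  assert (A4 : forall n, - INR n * fcos (j0 V s) n = fsin (j0 U s) n).
  { intro n. rewrite <- (fsin_der (j0 V s) (jq V s)) by auto. apply fsin_ext_in. intros q Hq. destruct (Z' q Hq) as (_ & _ & _ & e). unfold et2 in e. lra. }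
  assert (T1 : forall n, fcos (jt U s) n = thn s * fcos (j0 U s) n).
  { intro n. rewrite <- fcos_scal by auto. apply fcos_ext_in. intros q Hq. destruct (Z' q Hq) as (e & _). unfold xi1 in e. lra. }
  assert (T2 : forall n, fsin (jt U s) n = thn s * fsin (j0 U s) n).
  { intro n. rewrite <- fsin_scal by auto. apply fsin_ext_in. intros q Hq. destruct (Z' q Hq) as (e & _). unfold xi1 in e. lra. }
  assert (T3 : forall n, fcos (jt V s) n = thn s * fcos (j0 V s) n).
  { intro n. rewrite <- fcos_scal by auto. apply fcos_ext_in. intros q Hq. destruct (Z' q Hq) as (_ & e & _). unfold xi2 in e. lra. }
  assert (T4 : forall n, fsin (jt V s) n = thn s * fsin (j0 V s) n).
  { intro n. rewrite <- fsin_scal by auto. apply fsin_ext_in. intros q Hq. destruct (Z' q Hq) as (_ & e & _). unfold xi2 in e. lra. }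
  (* Eliminating V from the four relations leaves (n^2 - 1) times each coefficient of U equal to
     0. *)
  assert (Zn : forall n, n <> 1%nat -> fcos (j0 U s) n = 0 /\ fsin (j0 U s) n = 0 /\ fcos (j0 V s) n = 0 /\ fsin (j0 V s) n = 0).
  { intros n Hn. specialize (A1 n). specialize (A2 n). specialize (A3 n). specialize (A4 n).
    assert (I : INR n * INR n - 1 <> 0).
    { destruct n as [|[|n]]; [simpl; lra|lia|]. rewrite !S_INR. pose proof (pos_INR n). nra. }
    assert (Q1 : (INR n * INR n - 1) * fcos (j0 U s) n = 0) by nra.
    assert (Q2 : (INR n * INR n - 1) * fsin (j0 U s) n = 0) by nra.
    apply Rmult_integral in Q1; destruct Q1 as [Q1|Q1]; [contradiction|].
    apply Rmult_integral in Q2; destruct Q2 as [Q2|Q2]; [contradiction|].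
    rewrite Q1 in *. rewrite Q2 in *. repeat split; lra. }
  assert (Th : forall x, cosh s * (thn s * x) = sinh s * x).
  { intro x. unfold thn. pose proof (cosh_pos s). field. lra. }
  split; exists s; (split; [exact Hs|]); rewrite ?T1, ?T2, ?T3, ?T4, ?Th; (split; [|split; reflexivity]);
  intros n Hn; rewrite ?T1, ?T2, ?T3, ?T4; destruct (Zn n Hn) as (e1 & e2 & e3 & e4); rewrite ?e1, ?e2, ?e3, ?e4; repeat split; ring.
Qed.

Lemma coef_sup f n B : cts f -> (forall q, Rabs (f q) <= B) -> Rabs (fcos f n) <= 2 * B /\ Rabs (fsin f n) <= 2 * B.
Proof.
  intros C H. assert (B0 : 0 <= B) by (pose proof (H 0); pose proof (Rabs_pos (f 0)); lra).
  assert (K : forall e, cts e -> (forall q, Rabs (e q) <= 1) -> Rabs (mean (fun q => f q * e q)) <= B).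
  { intros e Ce He. apply mean_bound; auto with cts. intro q. rewrite Rabs_mult, <- (Rmult_1_r B).
    apply Rmult_le_compat; try apply Rabs_pos; auto. }
  split.
  - rewrite fcos_kap, Rabs_mult. apply Rmult_le_compat; try apply Rabs_pos.
    + destruct n; unfold kap; rewrite Rabs_pos_eq; lra.
    + apply K; auto with cts. intro q. apply Rabs_le. pose proof (COS_bound (INR n * q)). lra.
  - unfold fsin. rewrite Rabs_mult, (Rabs_pos_eq 2) by lra. apply Rmult_le_compat_l; [lra|].
    apply K; auto with cts. intro q. apply Rabs_le. pose proof (SIN_bound (INR n * q)). lra.
Qed.

Lemma poisson_near1 a e q : 0 <= a -> a <= e -> e <= 1 / 4 -> Rabs (poisson a q - 1) <= 5 * e.
Proof.
  intros Ha Hae He. assert (Ha1 : 0 <= a < 1) by lra. pose proof (Pden a Ha1 q) as D. pose proof (Pden_pos a Ha1 q) as Dp.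
  unfold poisson. replace ((1 - a ^ 2) / (1 - 2 * a * cos q + a ^ 2) - 1) with ((2 * a * cos q - 2 * a ^ 2) * / (1 - 2 * a * cos q + a ^ 2)) by (field; lra).
  rewrite Rabs_mult, (Rabs_pos_eq (/ _)) by (left; now apply Rinv_0_lt_compat).
  apply (Rmult_le_reg_r (1 - 2 * a * cos q + a ^ 2)); auto. rewrite Rmult_assoc, Rinv_l, Rmult_1_r by lra.
  apply Rle_trans with (5 * a * (1 - a) ^ 2).
  - pose proof (COS_bound q). apply Rabs_le. assert (- a <= a * cos q <= a) by nra. assert (1 / 2 <= (1 - a) ^ 2) by nra.
    assert (a * (1 / 2) <= a * (1 - a) ^ 2) by (apply Rmult_le_compat_l; lra). assert (0 <= a ^ 2 <= a * (1 / 4)) by nra. split; lra.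
  - apply Rmult_le_compat; try lra. apply pow2_ge_0.
Qed.

Lemma poly_fcos N X Y n : (n <= N)%nat -> fcos (poly N X Y) n = X n.
Proof. intro H. destruct n; [apply coef_poly_0|]. unfold fcos. rewrite coef_poly_cos by lia. field. Qed.
Lemma poly_fsin N X Y n : (0 < n <= N)%nat -> fsin (poly N X Y) n = Y n.
Proof. intro H. unfold fsin. rewrite coef_poly_sin by lia. field. Qed.

Lemma rot_bound x y X Y p n G : X = x * cos (INR n * p) + y * sin (INR n * p) -> Y = y * cos (INR n * p) - x * sin (INR n * p) ->
  Rabs X <= G -> Rabs Y <= G -> Rabs x <= 2 * G /\ Rabs y <= 2 * G.
Proof.
  intros -> -> HX HY. pose proof (sin2_cos2 (INR n * p)) as S. unfold Rsqr in S.
  set (c := cos _) in *. set (s := sin _) in *.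
  assert (Rabs c <= 1) by (apply Rabs_le; apply COS_bound). assert (Rabs s <= 1) by (apply Rabs_le; apply SIN_bound).
  assert (Ex : x = (x * c + y * s) * c - (y * c - x * s) * s) by (transitivity (x * (s * s + c * c)); [rewrite S; ring|ring]).
  assert (Ey : y = (x * c + y * s) * s + (y * c - x * s) * c) by (transitivity (y * (s * s + c * c)); [rewrite S; ring|ring]).
  pose proof (Rabs_pos c). pose proof (Rabs_pos s). pose proof (Rabs_pos (x * c + y * s)). pose proof (Rabs_pos (y * c - x * s)).
  split; [rewrite Ex|rewrite Ey].
  - unfold Rminus at 1. eapply Rle_trans; [apply Rabs_triang|]. rewrite Rabs_Ropp, !(Rabs_mult (_ + _)), !(Rabs_mult (_ - _)).
    assert (Rabs (x * c + y * s) * Rabs c <= G * 1) by (apply Rmult_le_compat; auto).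
    assert (Rabs (y * c - x * s) * Rabs s <= G * 1) by (apply Rmult_le_compat; auto). lra.
  - eapply Rle_trans; [apply Rabs_triang|]. rewrite !(Rabs_mult (_ + _)), !(Rabs_mult (_ - _)).
    assert (Rabs (x * c + y * s) * Rabs s <= G * 1) by (apply Rmult_le_compat; auto).
    assert (Rabs (y * c - x * s) * Rabs c <= G * 1) by (apply Rmult_le_compat; auto). lra.
Qed.

Lemma sinh_ge z : 0 <= z -> z <= sinh z.
Proof.
  intros [Hz|<-]; [|rewrite sinh_0; lra]. destruct (MVT_cor2 sinh cosh 0 z Hz) as (c & E & _).
  - intros; apply is_derive_Reals, d_sinh. - rewrite sinh_0 in E. pose proof (cosh_ge1 c). nra.
Qed.

Lemma abs_of_sq x e : 0 <= e -> x ^ 2 <= e ^ 2 -> Rabs x <= e.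
Proof. intros He H. apply Rabs_le. split; nra. Qed.

(** * Small slack leaves only the first mode *)

Section Collapse.
Variables (t a e : R) (N : nat) (X Y DX DY HX HY : nat -> R) (T : R).
Hypothesis HT : 1 / 2 <= T <= t.
Hypothesis He : 0 < e <= 1 / 4.
Hypothesis Ha : 0 <= a <= e.
Hypothesis Hz : sm (S N) (fun n => X n * a ^ n) = 0.
Hypothesis Hp : forall q, Rabs (poly N X Y q) <= 2.
Hypothesis Hs : slack a N X Y T HX HY <= e ^ 2.
Hypothesis EX : HX 1%nat = cosh T * X 1%nat + sinh T * DX 1%nat.
Hypothesis EY : HY 1%nat = cosh T * Y 1%nat + sinh T * DY 1%nat.

(** One generous bound for all estimates of the section; the largest is 2 (2 e + 20 cosh t e), from
    the slope of the first mode, with 2 coming from sinh T >= 1/2. *)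
Let G := 100 * cosh t ^ 2 * e.
Let zX n := fcos (fun q => poisson a q * poly N X Y q) n.
Let zY n := fsin (fun q => poisson a q * poly N X Y q) n.
Let Ha1 : 0 <= a < 1.
Proof. lra. Qed.

(** A zero near the centre makes the Poisson kernel close to 1, so multiplying by it hardly changes
    the coefficients. *)
Lemma z_near n : (n <= N)%nat -> Rabs (zX n - X n) <= 20 * e /\ ((0 < n)%nat -> Rabs (zY n - Y n) <= 20 * e).
Proof.
  intro Hn. pose proof (poisson_cts a Ha1) as cP.
  assert (B : forall q, Rabs ((poisson a q - 1) * poly N X Y q) <= 10 * e).
  { intro q. rewrite Rabs_mult. replace (10 * e) with (5 * e * 2) by ring.
    apply Rmult_le_compat; try apply Rabs_pos; auto. apply poisson_near1; lra. }
  destruct (coef_sup (fun q => (poisson a q - 1) * poly N X Y q) n (10 * e)) as [B1 B2]; auto with cts.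
  split; [|intro H0].
  - replace (zX n - X n) with (fcos (fun q => (poisson a q - 1) * poly N X Y q) n); [lra|].
    unfold zX. rewrite <- (poly_fcos N X Y n Hn), !fcos_kap, <- Rmult_minus_distr_l, <- mean_minus by auto 20 with cts.
    f_equal. apply mean_ext; intro; ring.
  - replace (zY n - Y n) with (fsin (fun q => (poisson a q - 1) * poly N X Y q) n); [lra|].
    unfold zY. rewrite <- (poly_fsin N X Y n) by lia. unfold fsin. rewrite <- Rmult_minus_distr_l, <- mean_minus by auto 20 with cts.
    f_equal. apply mean_ext; intro; ring.
Qed.

Lemma G_big : 100 * e <= G /\ 100 * (cosh t * e) <= G.
Proof.
  unfold G. pose proof (cosh_ge1 t). assert (cosh t <= cosh t ^ 2) by nra. split.
  - apply Rmult_le_compat_r; nra. - replace (100 * (cosh t * e)) with (100 * cosh t * e) by ring. apply Rmult_le_compat_r; lra.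
Qed.

Lemma cT : cosh T <= cosh t.
Proof. apply d_cosh_mono; lra. Qed.

Lemma collapse_0 : Rabs (HX O) <= G /\ Rabs (X O) <= G.
Proof.
  destruct G_big as [G1 _]. split.
  - pose proof (slack_0 a N X Y T HX HY). assert (Rabs (HX O) <= e) by (apply abs_of_sq; lra). lra.
  - destruct (z_near 0 ltac:(lia)) as [B _]. assert (Z0 : zX 0 = 0) by (apply (zX0_form a N X Y Ha1 Hz)).
    rewrite Z0 in B. replace (X O) with (- (0 - X O)) by ring. rewrite Rabs_Ropp. lra.
Qed.

Lemma mu_ratio n : (0 < n)%nat -> 0 <= sinh T * cosh T / Sn T n <= cosh t ^ 2.
Proof.
  intro Hn. assert (n0 : 1 <= INR n) by (replace 1 with (INR 1) by reflexivity; apply le_INR; lia).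
  pose proof (sinh_pos T ltac:(lra)) as Sp. pose proof (cosh_ge1 T) as C1. pose proof cT as CT.
  (* [sinh] is convex, so [n sinh T <= sinh (n T)] *)
  assert (L : sinh T <= Sn T n).
  { unfold Sn. apply (Rmult_le_reg_l (INR n)); [lra|]. replace (INR n * (sinh (INR n * T) / INR n)) with (sinh (INR n * T)) by (field; lra).
    pose proof (sinh_scal (/ INR n) (INR n * T)) as Q. replace (/ INR n * (INR n * T)) with T in Q by (field; lra).
    assert (sinh T <= / INR n * sinh (INR n * T)).
    { apply Q; [|nra]. split; [left; apply Rinv_0_lt_compat; lra|]. rewrite <- Rinv_1. apply Rinv_le_contravar; lra. }
    apply (Rmult_le_compat_l (INR n)) in H; [|lra]. rewrite <- Rmult_assoc, Rinv_r, Rmult_1_l in H by lra. exact H. }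
  assert (Ssn : 0 < Sn T n) by lra. split.
  - apply Rmult_le_pos; [nra|left; now apply Rinv_0_lt_compat].
  - apply (Rmult_le_reg_r (Sn T n)); auto. replace (sinh T * cosh T / Sn T n * Sn T n) with (sinh T * cosh T) by (field; lra).
    assert (cosh T <= cosh t ^ 2) by nra. rewrite Rmult_comm. apply Rmult_le_compat; lra.
Qed.

Lemma collapse_n n : (2 <= n <= N)%nat -> Rabs (HX n) <= G /\ Rabs (HY n) <= G /\ Rabs (X n) <= G /\ Rabs (Y n) <= G.
Proof.
  intro Hn. destruct n as [|[|n]]; try lia. set (k := S (S n)) in *.
  pose proof (slack_n a N X Y T HX HY (S n) ltac:(lia)) as Sl. cbv zeta beta in Sl. fold k in Sl.
  change (fcos (fun q => poisson a q * poly N X Y q) k) with (zX k) in Sl. change (fsin (fun q => poisson a q * poly N X Y q) k) with (zY k) in Sl.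
  destruct (z_near k ltac:(lia)) as [B1 B2]. specialize (B2 ltac:(lia)).
  destruct (mu_ratio k ltac:(lia)) as [M0 M1]. set (m := sinh T * cosh T / Sn T k) in *.
  assert (F : forall z, sinh T * cosh T * z / Sn T k = m * z) by (intro; unfold m, Rdiv; ring). rewrite !F in Sl.
  pose proof (pow2_ge_0 (HX k - m * zX k)). pose proof (pow2_ge_0 (HY k - m * zY k)). pose proof (pow2_ge_0 (zX k)). pose proof (pow2_ge_0 (zY k)).
  (* Each summand of the slack is at most 2 e^2; the part z^2/20 then gives z^2 <= 40 e^2 <= (7
     e)^2. *)
  assert (A1 : Rabs (HX k - m * zX k) <= 2 * e) by (apply abs_of_sq; nra).
  assert (A2 : Rabs (HY k - m * zY k) <= 2 * e) by (apply abs_of_sq; nra).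
  assert (A3 : Rabs (zX k) <= 7 * e) by (apply abs_of_sq; nra).
  assert (A4 : Rabs (zY k) <= 7 * e) by (apply abs_of_sq; nra).
  pose proof (cosh_ge1 t) as Ct. assert (Q : 1 <= cosh t ^ 2) by nra. assert (Qe : e <= cosh t ^ 2 * e) by nra.
  assert (W : forall h z, Rabs (h - m * z) <= 2 * e -> Rabs z <= 7 * e -> Rabs h <= G).
  { intros h z W1 W2. replace h with ((h - m * z) + m * z) by ring. eapply Rle_trans; [apply Rabs_triang|].
    rewrite (Rabs_mult m), (Rabs_pos_eq m) by auto.
    assert (m * Rabs z <= cosh t ^ 2 * (7 * e)) by (apply Rmult_le_compat; auto; apply Rabs_pos). unfold G. lra. }
  assert (W' : forall x z, Rabs (z - x) <= 20 * e -> Rabs z <= 7 * e -> Rabs x <= G).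
  { intros x z W1 W2. replace x with (z + - (z - x)) by ring. eapply Rle_trans; [apply Rabs_triang|]. rewrite Rabs_Ropp. unfold G. lra. }
  repeat split; eauto.
Qed.

(** The slack gives h close to cosh T z and [z_near] gives z close to x; in h = cosh T x + sinh T d
    this leaves nothing but a small d. *)
Lemma collapse_1 : (1 <= N)%nat -> Rabs (DX 1%nat) <= G /\ Rabs (DY 1%nat) <= G.
Proof.
  intro Hn. pose proof (slack_n a N X Y T HX HY 0 ltac:(lia)) as Sl. cbv zeta beta in Sl.
  change (fcos (fun q => poisson a q * poly N X Y q) 1) with (zX 1) in Sl. change (fsin (fun q => poisson a q * poly N X Y q) 1) with (zY 1) in Sl.
  destruct (z_near 1 ltac:(lia)) as [B1 B2]. specialize (B2 ltac:(lia)). rewrite Sn1 in Sl.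
  pose proof (sinh_ge T ltac:(lra)) as ST. pose proof cT as CT. pose proof (cosh_ge1 T) as C1.
  assert (F : forall z, sinh T * cosh T * z / sinh T = cosh T * z) by (intro; field; lra). rewrite !F in Sl.
  pose proof (pow2_ge_0 (HX 1%nat - cosh T * zX 1)). pose proof (pow2_ge_0 (HY 1%nat - cosh T * zY 1)).
  assert (A1 : Rabs (HX 1%nat - cosh T * zX 1) <= 2 * e) by (apply abs_of_sq; nra).
  assert (A2 : Rabs (HY 1%nat - cosh T * zY 1) <= 2 * e) by (apply abs_of_sq; nra).
  assert (W : forall h z x d, Rabs (h - cosh T * z) <= 2 * e -> Rabs (z - x) <= 20 * e -> h = cosh T * x + sinh T * d -> Rabs d <= G).
  { intros h z x d W1 W2 W3.
    assert (E : sinh T * d = (h - cosh T * z) + cosh T * (z - x)) by (rewrite W3; ring).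
    assert (Q : sinh T * Rabs d <= 2 * e + cosh t * (20 * e)).
    { rewrite <- (Rabs_pos_eq (sinh T)) by lra. rewrite <- Rabs_mult, E. eapply Rle_trans; [apply Rabs_triang|].
      rewrite Rabs_mult, (Rabs_pos_eq (cosh T)) by lra. apply Rplus_le_compat; auto. apply Rmult_le_compat; auto; [lra|apply Rabs_pos]. }
    destruct G_big as [G1 G2]. pose proof (Rabs_pos d). assert (/ 2 * Rabs d <= sinh T * Rabs d) by (apply Rmult_le_compat_r; lra). lra. }
  split; eauto.
Qed.
End Collapse.

Lemma zero_of_small x K : 0 <= K -> (forall e, 0 < e <= 1 / 4 -> Rabs x <= K * e) -> x = 0.
Proof.
  intros HK H. destruct (Req_dec x 0) as [|N]; auto. exfalso. apply Rabs_pos_lt in N.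
  set (e := Rmin (1 / 4) (Rabs x / (2 * (K + 1)))).
  assert (e0 : 0 < e) by (apply Rmin_pos; [lra|apply Rdiv_lt_0_compat; lra]).
  assert (e1 : e <= 1 / 4) by apply Rmin_l. assert (e2 : e <= Rabs x / (2 * (K + 1))) by apply Rmin_r.
  specialize (H e ltac:(lra)). apply (Rmult_le_compat_l (K + 1)) in e2; [|lra].
  replace ((K + 1) * (Rabs x / (2 * (K + 1)))) with (Rabs x / 2) in e2 by (field; lra). nra.
Qed.

Section LongJet.
Variables (b t : R) (W : jet).
Hypothesis HW : harm 0 b W.
Hypothesis Ht : 1 <= t < b.
(** Twice the previous constant: the estimates hold for the rotated jet, and undoing the rotation
    costs a factor 2 in [rot_bound]. *)
Let K := 200 * cosh t ^ 2.

Definition collapsed (e : R) (k : nat) (t0 : R) : Prop :=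
  (forall n, (n <= k)%nat -> n <> 1%nat -> (Rabs (fcos (j0 W t) n) <= K * e /\ Rabs (fsin (j0 W t) n) <= K * e) /\
     (Rabs (fcos (j0 W t0) n) <= K * e /\ Rabs (fsin (j0 W t0) n) <= K * e)) /\
  Rabs (fcos (jt W t0) 1) <= K * e /\ Rabs (fsin (jt W t0) 1) <= K * e.

Lemma collapse_jet e k t0 a p N : 0 < e <= 1 / 4 -> 0 < t0 <= 1 / 1000 -> (S k <= N)%nat -> 0 <= a <= e ->
  sm (S N) (fun n => fcos (j0 (shift p W) t0) n * a ^ n) = 0 ->
  (forall q, Rabs (poly N (fcos (j0 (shift p W) t0)) (fsin (j0 (shift p W) t0)) q) <= 2) ->
  slack a N (fcos (j0 (shift p W) t0)) (fsin (j0 (shift p W) t0)) (t - t0) (fcos (j0 (shift p W) t)) (fsin (j0 (shift p W) t)) <= e ^ 2 ->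
  collapsed e k t0.
Proof.
  intros He Ht0 HN Ha Hz Hp Hs. assert (T1 : 0 < t0 < b) by lra. assert (T2 : 0 < t < b) by lra.
  assert (HT : 1 / 2 <= t - t0 <= t) by lra.
  set (G := 100 * cosh t ^ 2 * e) in *. assert (KG : K * e = 2 * G) by (unfold K, G; ring). unfold collapsed. rewrite KG.
  assert (G0 : 0 <= G) by (unfold G; pose proof (pow2_ge_0 (cosh t)); nra).
  pose proof (harm_shift 0 b p W HW) as HS.
  destruct (jet_cts 0 b W HW t T2) as (c1 & c2 & _). destruct (jet_cts 0 b W HW t0 T1) as (c3 & c4 & _).
  assert (p1 : per (j0 W t)) by (intro; apply (h_p _ _ _ HW)). assert (p2 : per (j0 W t0)) by (intro; apply (h_p _ _ _ HW)).
  assert (p3 : per (jt W t0)) by (intro; apply (h_pt _ _ _ HW)).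
  split.
  - intros n Hn Hn1. destruct n as [|n].
    + destruct (collapse_0 t a e N _ _ _ _ _ He Ha Hz Hp Hs) as [A B]. fold G in A, B.
      rewrite !fs0, Rabs_R0.
      assert (S0 : forall f, cts f -> per f -> fcos (fun q => f (q + p)) 0 = fcos f 0).
      { intros f cf pf. rewrite fcos_shift by auto. simpl INR. rewrite Rmult_0_l, cos_0, sin_0. ring. }
      change (j0 (shift p W) t) with (fun q => j0 W t (q + p)) in A. change (j0 (shift p W) t0) with (fun q => j0 W t0 (q + p)) in B.
      rewrite S0 in A, B by auto. repeat split; lra.
    + destruct (collapse_n t a e N _ _ _ _ _ HT He Ha Hp Hs (S n) ltac:(lia)) as (A1 & A2 & A3 & A4). fold G in A1, A2, A3, A4.
      split.
      * apply (rot_bound _ _ _ _ p (S n) G (fcos_shift _ p (S n) c1 p1) (fsin_shift _ p (S n) c1 p1)); assumption.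
      * apply (rot_bound _ _ _ _ p (S n) G (fcos_shift _ p (S n) c3 p2) (fsin_shift _ p (S n) c3 p2)); assumption.
  - assert (EX : forall x y, mode 0 b 1 x y -> x t = cosh (t - t0) * x t0 + sinh (t - t0) * y t0).
    { intros x y M. rewrite (mode_cosh 1 0 b x y t0 t) by (auto; lia). rewrite Sn1. simpl INR. now rewrite Rmult_1_l. }
    destruct (collapse_1 t a e N _ _ (fcos (jt (shift p W) t0)) (fsin (jt (shift p W) t0)) _ _ _ HT He Ha Hp Hs
      (EX _ _ (fcos_mode 0 b _ HS 1)) (EX _ _ (fsin_mode 0 b _ HS 1)) ltac:(lia)) as [A1 A2]. fold G in A1, A2.
    apply (rot_bound _ _ _ _ p 1 G (fcos_shift _ p 1 c4 p3) (fsin_shift _ p 1 c4 p3)); assumption.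
Qed.

Lemma cosh_lip t0 : 0 < t0 < t -> Rabs (cosh (t - t0) - cosh t) <= cosh t * t0 /\ Rabs (sinh (t - t0) - sinh t) <= cosh t * t0.
Proof.
  intro H. split.
  - destruct (MVT_cor2 cosh sinh (t - t0) t ltac:(lra)) as (c & E & Hc); [intros; apply is_derive_Reals, d_cosh|].
    replace (t - (t - t0)) with t0 in E by ring. pose proof (sinh_ge0 c ltac:(lra)).
    assert (sinh c <= cosh c) by (pose proof (cosh_m_sinh c); pose proof (exp_pos (- c)); lra).
    pose proof (d_cosh_mono c t ltac:(lra) ltac:(lra)). apply Rabs_le. nra.
  - destruct (MVT_cor2 sinh cosh (t - t0) t ltac:(lra)) as (c & E & Hc); [intros; apply is_derive_Reals, d_sinh|].
    replace (t - (t - t0)) with t0 in E by ring. pose proof (cosh_ge1 c).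
    pose proof (d_cosh_mono c t ltac:(lra) ltac:(lra)). apply Rabs_le. nra.
Qed.

(** As e -> 0, a mode other than the first vanishes at t and tends to 0 along circles t0 -> 0, so
    its slope at t vanishes by [mode_bvp]. The slope of the first mode tends to 0 along the same
    circles, which singles out the solution proportional to cosh. *)
Lemma collapsed_rigid : (forall e k, 0 < e <= 1 / 4 -> exists t0, 0 < t0 < e /\ t0 <= 1 / 1000 /\ collapsed e k t0) -> rigid b W.
Proof.
  intro H. assert (T2 : 0 < t < b) by lra. exists t. split; [exact T2|].
  assert (K0 : 0 <= K) by (unfold K; pose proof (pow2_ge_0 (cosh t)); lra).
  assert (Gen : forall n x y, n <> 1%nat -> mode 0 b n x y ->
     (forall e, 0 < e <= 1 / 4 -> exists t0, 0 < t0 < e /\ t0 <= 1 / 1000 /\ Rabs (x t) <= K * e /\ Rabs (x t0) <= K * e) -> x t = 0 /\ y t = 0).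
  { intros n x y Hn M B.
    assert (X0 : x t = 0).
    { apply (zero_of_small _ K K0). intros e He. destruct (B e He) as (t0 & _ & _ & Q & _). exact Q. }
    split; auto. apply (zero_of_small _ (2 * K)); [lra|]. intros e He. destruct (B e He) as (t0 & H0 & H1 & _ & Q).
    pose proof (mode_bvp n 0 b x y t0 t M ltac:(lra) T2 ltac:(lra) X0) as V. pose proof (Rabs_pos (y t)). nra. }
  assert (Gen1 : forall x y, mode 0 b 1 x y -> (forall e, 0 < e <= 1 / 4 -> exists t0, 0 < t0 < e /\ t0 <= 1 / 1000 /\ Rabs (y t0) <= K * e) -> cosh t * y t = sinh t * x t).
  { intros x y M B. apply Rminus_diag_uniq. pose proof (cosh_ge1 t) as Ct. pose proof (Rabs_pos (x t)) as Px. pose proof (Rabs_pos (y t)) as Py.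
    apply (zero_of_small _ (K + cosh t * (Rabs (x t) + Rabs (y t)))); [nra|]. intros e He. destruct (B e He) as (t0 & H0 & H1 & Q).
    (* Run backwards from t, the slope at t0 is cosh(t - t0) y(t) - sinh(t - t0) x(t), close to the
       quantity to be shown zero. *)
    pose proof (mode_sinh 1 0 b x y t t0 ltac:(lia) M T2 ltac:(lra)) as E. simpl INR in E. rewrite !Rmult_1_l in E.
    replace (t0 - t) with (- (t - t0)) in E by ring. rewrite cosh_opp, sinh_opp in E.
    destruct (cosh_lip t0 ltac:(lra)) as [L1 L2].
    replace (cosh t * y t - sinh t * x t) with (y t0 + (- ((cosh (t - t0) - cosh t) * y t) + (sinh (t - t0) - sinh t) * x t)) by (rewrite E; ring).
    eapply Rle_trans; [apply Rabs_triang|]. eapply Rle_trans; [apply Rplus_le_compat_l, Rabs_triang|]. rewrite Rabs_Ropp, !Rabs_mult.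
    assert (C0 : cosh t * t0 <= cosh t * e) by (apply Rmult_le_compat_l; lra).
    assert (Rabs (cosh (t - t0) - cosh t) * Rabs (y t) <= cosh t * e * Rabs (y t)) by (apply Rmult_le_compat_r; lra).
    assert (Rabs (sinh (t - t0) - sinh t) * Rabs (x t) <= cosh t * e * Rabs (x t)) by (apply Rmult_le_compat_r; lra). lra. }
  split; [|split].
  - intros n Hn.
    destruct (Gen n _ _ Hn (fcos_mode 0 b W HW n)) as [A1 A2].
    { intros e He. destruct (H e n He) as (t0 & H0 & H1 & C & _). exists t0. destruct (C n ltac:(lia) Hn) as [[B1 B2] [B3 B4]]. auto. }
    destruct (Gen n _ _ Hn (fsin_mode 0 b W HW n)) as [A3 A4].
    { intros e He. destruct (H e n He) as (t0 & H0 & H1 & C & _). exists t0. destruct (C n ltac:(lia) Hn) as [[B1 B2] [B3 B4]]. auto. }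
    auto.
  - apply (Gen1 _ _ (fcos_mode 0 b W HW 1)). intros e He. destruct (H e 0%nat He) as (t0 & H0 & H1 & _ & C & _). eauto.
  - apply (Gen1 _ _ (fsin_mode 0 b W HW 1)). intros e He. destruct (H e 0%nat He) as (t0 & H0 & H1 & _ & _ & C). eauto.
Qed.
End LongJet.

Lemma long_rigid b U V t : rmap b U V -> 1 <= t < b -> energy U V t = cosh t ^ 2 -> rigid b U /\ rigid b V.
Proof.
  intros HR Ht E. pose proof (r_U _ _ _ HR) as HU. pose proof (r_V _ _ _ HR) as HV.
  assert (Both : forall e k, 0 < e <= 1 / 4 -> exists t0, (0 < t0 < e /\ t0 <= 1 / 1000 /\ collapsed t U e k t0) /\ (0 < t0 < e /\ t0 <= 1 / 1000 /\ collapsed t V e k t0)).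
  { intros e k He. assert (e2 : 0 < e ^ 2) by (apply pow_lt; lra).
    destruct (cosh_cont_limit t (e ^ 2 / 2) ltac:(lra)) as (d & Hd & Ld).
    assert (m0 : 0 < Rmin d (e ^ 2 / 2)) by (apply Rmin_pos; lra).
    destruct (limit_ineq b U V t HR Ht (Rmin d (e ^ 2 / 2)) (S k) m0) as (t0 & a & p & N & H0 & H1 & HN & Ha & ZU & ZV & HP & I).
    pose proof (Rmin_l d (e ^ 2 / 2)). pose proof (Rmin_r d (e ^ 2 / 2)).
    specialize (Ld t0 ltac:(lra)). pose proof (vv_pos a Ha) as Vp.
    pose proof (slack_ge0 a N (fcos (j0 (shift p U) t0)) (fsin (j0 (shift p U) t0)) (t - t0) (fcos (j0 (shift p U) t)) (fsin (j0 (shift p U) t))) as S1.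
    pose proof (slack_ge0 a N (fcos (j0 (shift p V) t0)) (fsin (j0 (shift p V) t0)) (t - t0) (fcos (j0 (shift p V) t)) (fsin (j0 (shift p V) t))) as S2.
    assert (Sm : slack a N (fcos (j0 (shift p U) t0)) (fsin (j0 (shift p U) t0)) (t - t0) (fcos (j0 (shift p U) t)) (fsin (j0 (shift p U) t)) <= e ^ 2) by lra.
    assert (Sm' : slack a N (fcos (j0 (shift p V) t0)) (fsin (j0 (shift p V) t0)) (t - t0) (fcos (j0 (shift p V) t)) (fsin (j0 (shift p V) t)) <= e ^ 2) by lra.
    (* Since v - 1 = 2 a^2/(1 - a^2) >= 2 a^2 for v = [vv a], the surplus term forces a <= e. *)
    assert (Vs : vv a - 1 <= 2 * e ^ 2) by lra.
    assert (Ae : 0 <= a <= e).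
    { split; [lra|]. apply Rnot_lt_le; intro L. assert (Va : vv a - 1 = 2 * (a ^ 2 / (1 - a ^ 2))) by (unfold vv; field; nra).
      assert (a2 : 0 < a ^ 2 < 1) by nra. assert (a ^ 2 <= a ^ 2 / (1 - a ^ 2)).
      { apply (Rmult_le_reg_r (1 - a ^ 2)); [lra|]. replace (a ^ 2 / (1 - a ^ 2) * (1 - a ^ 2)) with (a ^ 2) by (field; lra). nra. }
      nra. }
    assert (e3 : e ^ 2 <= e) by nra.
    exists t0. split; (split; [lra|split; [lra|]]).
    - apply (collapse_jet b t U HU Ht e k t0 a p N); auto; try lra.
      intro q. specialize (HP q). apply abs_of_sq; [lra|]. pose proof (pow2_ge_0 (poly N (fcos (j0 (shift p V) t0)) (fsin (j0 (shift p V) t0)) q)). lra.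
    - apply (collapse_jet b t V HV Ht e k t0 a p N); auto; try lra.
      intro q. specialize (HP q). apply abs_of_sq; [lra|]. pose proof (pow2_ge_0 (poly N (fcos (j0 (shift p U) t0)) (fsin (j0 (shift p U) t0)) q)). lra. }
  split.
  - apply (collapsed_rigid b t U HU Ht). intros e k He. destruct (Both e k He) as (t0 & A & _). eauto.
  - apply (collapsed_rigid b t V HV Ht). intros e k He. destruct (Both e k He) as (t0 & _ & A). eauto.
Qed.

(** * From the annulus to the strip *)

Section Transfer.
Variables (r R0 : R).
Hypothesis Hr : 0 < r.
Hypothesis HrR : r < R0.
Let A := annulus r R0.
Let b := ln (R0 / r).

Lemma annulus_sq x y : A (x, y) <-> r ^ 2 < x ^ 2 + y ^ 2 < R0 ^ 2.
Proof.
  unfold A, annulus, cnorm; simpl fst; simpl snd. set (n := x ^ 2 + y ^ 2).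
  assert (n0 : 0 <= n) by (unfold n; pose proof (pow2_ge_0 x); pose proof (pow2_ge_0 y); lra).
  pose proof (sqrt_pos n) as S0. assert (S2 : sqrt n * sqrt n = n) by now apply sqrt_sqrt.
  split; intros [H1 H2]; split; nra.
Qed.

Lemma annulus_nbhd x y : A (x, y) -> exists d, 0 < d /\ forall u v, Rabs (u - x) < d -> Rabs (v - y) < d -> A (u, v).
Proof.
  intro H. apply annulus_sq in H.
  assert (C : continuity_2d_pt (fun u v => u ^ 2 + v ^ 2) x y).
  { apply (continuity_2d_pt_ext (fun u v => u * u + v * v)); [intros; ring|].
    apply continuity_2d_pt_plus; apply continuity_2d_pt_mult; first [apply continuity_2d_pt_id1|apply continuity_2d_pt_id2]. }
  assert (E : 0 < Rmin (x ^ 2 + y ^ 2 - r ^ 2) (R0 ^ 2 - (x ^ 2 + y ^ 2))) by (apply Rmin_pos; lra).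
  destruct (C (mkposreal _ E)) as [d Hd]. exists d. split; [apply cond_pos|]. intros u v Hu Hv.
  specialize (Hd u v Hu Hv). cbv beta in Hd. change (pos (mkposreal _ E)) with (Rmin (x ^ 2 + y ^ 2 - r ^ 2) (R0 ^ 2 - (x ^ 2 + y ^ 2))) in Hd. apply Rabs_def2 in Hd.
  pose proof (Rmin_l (x ^ 2 + y ^ 2 - r ^ 2) (R0 ^ 2 - (x ^ 2 + y ^ 2))). pose proof (Rmin_r (x ^ 2 + y ^ 2 - r ^ 2) (R0 ^ 2 - (x ^ 2 + y ^ 2))).
  apply annulus_sq. lra.
Qed.

Lemma cdist_lt u v x y d : Rabs (u - x) < d / 2 -> Rabs (v - y) < d / 2 -> cdist (u, v) (x, y) < d.
Proof.
  intros H1 H2. unfold cdist, cnorm; simpl fst; simpl snd. apply Rabs_def2 in H1. apply Rabs_def2 in H2.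
  assert (0 < d) by lra. rewrite <- (sqrt_pow2 d) by lra. apply sqrt_lt_1.
  - pose proof (pow2_ge_0 (u - x)); pose proof (pow2_ge_0 (v - y)); lra.
  - apply pow2_ge_0.
  - nra.
Qed.

Definition cur (g : pt -> R) (x y : R) : R := g (x, y).

Lemma cur_c2 g x y : cont_on A g -> A (x, y) -> continuity_2d_pt (cur g) x y.
Proof.
  intros C H e. destruct (C (x, y) H e (cond_pos e)) as (d & Hd & L). destruct (annulus_nbhd x y H) as (d' & Hd' & N).
  assert (E : 0 < Rmin (d / 2) d') by (apply Rmin_pos; lra).
  exists (mkposreal _ E). simpl. intros u v Hu Hv. apply L.
  - apply N; eapply Rlt_le_trans; eauto; apply Rmin_r.
  - apply cdist_lt; eapply Rlt_le_trans; eauto; apply Rmin_l.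
Qed.

Lemma cur_diff g gx gy x y : has_partials A g gx gy -> cont_on A gx -> A (x, y) ->
  differentiable_pt_lim (cur g) x y (gx (x, y)) (gy (x, y)).
Proof.
  intros P C H. apply filterdiff_differentiable_pt_lim.
  apply (filterdiff_ext_lin _ (fun u : R * R => plus (scal (fst u) (cur gx x y)) (scal (snd u) (gy (x, y))))); [|intro; reflexivity].
  apply (is_derive_filterdiff (cur g) x y (cur gx) (gy (x, y))).
  - apply (locally_2d_locally (fun u v => is_derive (fun z => cur g z v) u (cur gx u v))). destruct (annulus_nbhd x y H) as (d & Hd & N). exists (mkposreal d Hd).
    intros u v Hu Hv. apply is_derive_Reals. apply (P (u, v)). now apply N.
  - apply is_derive_Reals. apply (P (x, y) H).
  - apply continuity_2d_pt_filterlim. now apply cur_c2.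
Qed.

Lemma cur_chain g gx gy (f1 f2 : R -> R) s d1 d2 : has_partials A g gx gy -> cont_on A gx -> A (f1 s, f2 s) ->
  is_derive f1 s d1 -> is_derive f2 s d2 -> is_derive (fun s => g (f1 s, f2 s)) s (gx (f1 s, f2 s) * d1 + gy (f1 s, f2 s) * d2).
Proof.
  intros P C H D1 D2. apply is_derive_Reals. apply (derivable_pt_lim_comp_2d (cur g)).
  - now apply cur_diff. - now apply is_derive_Reals. - now apply is_derive_Reals.
Qed.

(** Schwarz's theorem; [harmonic_on] supplies the two mixed derivatives as separate functions,
    whereas a jet has only one. *)
Lemma mixed_eq f fx fy fxx fxy fyx fyy x y : has_partials A f fx fy -> has_partials A fx fxx fxy -> has_partials A fy fyx fyy ->
  cont_on A fxy -> cont_on A fyx -> A (x, y) -> fxy (x, y) = fyx (x, y).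
Proof.
  intros P Px Py Cxy Cyx H.
  assert (L : forall Q : R -> R -> Prop, (forall u v, A (u, v) -> Q u v) -> forall u v, A (u, v) -> locally_2d Q u v).
  { intros Q HQ u v Huv. destruct (annulus_nbhd u v Huv) as (d & Hd & N). exists (mkposreal d Hd). intros; apply HQ, N; auto. }
  assert (L1 : forall Q : R -> Prop, forall u v, A (u, v) -> (forall s, A (s, v) -> Q s) -> locally u Q).
  { intros Q u v Huv HQ. destruct (annulus_nbhd u v Huv) as (d & Hd & N). exists (mkposreal d Hd). intros s Hs. apply HQ, N; [exact Hs|].
    unfold Rminus; rewrite Rplus_opp_r, Rabs_R0; auto. }
  assert (L2 : forall Q : R -> Prop, forall u v, A (u, v) -> (forall s, A (u, s) -> Q s) -> locally v Q).
  { intros Q u v Huv HQ. destruct (annulus_nbhd u v Huv) as (d & Hd & N). exists (mkposreal d Hd). intros s Hs. apply HQ, N; [|exact Hs].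
    unfold Rminus; rewrite Rplus_opp_r, Rabs_R0; auto. }
  assert (D : forall g gx gy u v, has_partials A g gx gy -> A (u, v) -> is_derive (fun z => cur g z v) u (gx (u, v)) /\ is_derive (fun z => cur g u z) v (gy (u, v))).
  { intros g gx gy u v Pg Huv. destruct (Pg (u, v) Huv). split; now apply is_derive_Reals. }
  assert (E1 : forall u v, A (u, v) -> is_derive (fun z => Derive (fun t => cur f z t) v) u (fyx (u, v))).
  { intros u v Huv. apply (is_derive_ext_loc (fun z => cur fy z v)); [|apply (D fy fyx fyy u v Py Huv)].
    apply (L1 _ u v Huv). intros s Hs. symmetry. apply is_derive_unique. apply (D f fx fy s v P Hs). }
  assert (E2 : forall u v, A (u, v) -> is_derive (fun z => Derive (fun t => cur f t z) u) v (fxy (u, v))).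
  { intros u v Huv. apply (is_derive_ext_loc (fun z => cur fx u z)); [|apply (D fx fxx fxy u v Px Huv)].
    apply (L2 _ u v Huv). intros s Hs. symmetry. apply is_derive_unique. apply (D f fx fy u s P Hs). }
  transitivity (Derive (fun z : R => Derive (fun t : R => cur f t z) x) y); [symmetry; exact (is_derive_unique _ _ _ (E2 x y H))|].
  transitivity (Derive (fun z : R => Derive (fun t : R => cur f z t) y) x); [|exact (is_derive_unique _ _ _ (E1 x y H))].
  symmetry. apply Schwarz.
  - apply L; auto. intros u v Huv. destruct (D f fx fy u v P Huv) as [D1 D2].
    repeat split; eexists; [exact D1|exact D2|exact (E1 u v Huv)|exact (E2 u v Huv)].
  - apply (continuity_2d_pt_ext_loc (cur fyx)); [|now apply cur_c2].
    apply L; auto. intros u v Huv. symmetry. exact (is_derive_unique _ _ _ (E1 u v Huv)).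
  - apply (continuity_2d_pt_ext_loc (cur fxy)); [|now apply cur_c2].
    apply L; auto. intros u v Huv. symmetry. exact (is_derive_unique _ _ _ (E2 u v Huv)).
Qed.

Definition px (t q : R) : R := r * exp t * cos q.
Definition py (t q : R) : R := r * exp t * sin q.
Definition lp (g : pt -> R) (t q : R) : R := g (px t q, py t q).

Lemma polar_sq t q : px t q ^ 2 + py t q ^ 2 = (r * exp t) ^ 2.
Proof.
  unfold px, py. pose proof (sin2_cos2 q) as S. unfold Rsqr in S.
  transitivity ((r * exp t) ^ 2 * (sin q * sin q + cos q * cos q)); [ring|rewrite S; ring].
Qed.

Lemma b_bounds t : 0 < t < b <-> r < r * exp t < R0.
Proof.
  assert (Q : 0 < R0 / r) by (apply Rdiv_lt_0_compat; lra).
  assert (E : r * exp b = R0) by (unfold b; rewrite exp_ln by auto; field; lra).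
  split.
  - intros [H1 H2]. rewrite <- E. apply exp_increasing in H1. apply exp_increasing in H2. rewrite exp_0 in H1. split; nra.
  - intros [H1 H2]. rewrite <- E in H2. split.
    + apply exp_lt_inv. rewrite exp_0. nra.
    + apply exp_lt_inv. nra.
Qed.

Lemma polar_A t q : 0 < t < b -> A (px t q, py t q).
Proof.
  intro H. apply b_bounds in H. apply annulus_sq. rewrite polar_sq. split; nra.
Qed.

Lemma px_t q t : is_derive (fun t => px t q) t (px t q).
Proof. unfold px. eapply der_eq; [apply (d_mult (fun t => r * exp t)); [apply d_scal, is_derive_exp|apply d_const]|]. cbv beta; ring. Qed.
Lemma py_t q t : is_derive (fun t => py t q) t (py t q).
Proof. unfold py. eapply der_eq; [apply (d_mult (fun t => r * exp t)); [apply d_scal, is_derive_exp|apply d_const]|]. cbv beta; ring. Qed.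
Lemma px_q t q : is_derive (px t) q (- py t q).
Proof. unfold px, py. eapply der_eq; [apply d_scal, is_derive_cos|]. ring. Qed.
Lemma py_q t q : is_derive (py t) q (px t q).
Proof. unfold px, py. eapply der_eq; [apply d_scal, is_derive_sin|]. ring. Qed.

Lemma exp_cts : cts exp.
Proof. intro x. apply (ex_derive_continuous exp x). eexists; apply is_derive_exp. Qed.
Lemma C2_px : C2 0 b px.
Proof.
  unfold px. apply C2_mult; [apply (C2_fst 0 b (fun t => r * exp t)); pose proof exp_cts; auto with cts|apply (C2_snd 0 b cos); intro; apply continuous_cos].
Qed.
Lemma C2_py : C2 0 b py.
Proof.
  unfold py. apply C2_mult; [apply (C2_fst 0 b (fun t => r * exp t)); pose proof exp_cts; auto with cts|apply (C2_snd 0 b sin); intro; apply continuous_sin].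
Qed.

Lemma C2_lp g : cont_on A g -> C2 0 b (lp g).
Proof.
  intros C t q Ht e. destruct (cur_c2 g _ _ C (polar_A t q Ht) e) as [d Hd].
  destruct (C2_px t q Ht d) as [d1 H1]. destruct (C2_py t q Ht d) as [d2 H2].
  assert (E : 0 < Rmin d1 d2) by (apply Rmin_pos; apply cond_pos).
  exists (mkposreal _ E). simpl. intros u v Hu Hv. apply Hd.
  - apply H1; eapply Rlt_le_trans; eauto; apply Rmin_l.
  - apply H2; eapply Rlt_le_trans; eauto; apply Rmin_r.
Qed.

Lemma Dt_lp g gx gy : has_partials A g gx gy -> cont_on A gx -> Dt 0 b (lp g) (fun t q => lp gx t q * px t q + lp gy t q * py t q).
Proof.
  intros P C t q Ht. unfold lp. apply (cur_chain g gx gy (fun t => px t q) (fun t => py t q)); auto.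
  - now apply polar_A. - apply px_t. - apply py_t.
Qed.
Lemma Dq_lp g gx gy : has_partials A g gx gy -> cont_on A gx -> Dq 0 b (lp g) (fun t q => lp gy t q * px t q - lp gx t q * py t q).
Proof.
  intros P C t q Ht. unfold lp. eapply der_eq.
  - apply (cur_chain g gx gy (px t) (py t)); eauto; [now apply polar_A|apply px_q|apply py_q].
  - cbv beta. ring.
Qed.
Lemma Dt_px : Dt 0 b px px.
Proof. intros t q _. apply px_t. Qed.
Lemma Dt_py : Dt 0 b py py.
Proof. intros t q _. apply py_t. Qed.
Lemma Dq_px : Dq 0 b px (fun t q => - py t q).
Proof. intros t q _. apply px_q. Qed.
Lemma Dq_py : Dq 0 b py px.
Proof. intros t q _. apply py_q. Qed.
Lemma Per_polar t q : px t (q + 2 * PI) = px t q /\ py t (q + 2 * PI) = py t q.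
Proof. unfold px, py. rewrite cos_plus, sin_plus, cos_2PI, sin_2PI. split; ring. Qed.
Lemma Per_lp g : Per (lp g).
Proof. intros t q. unfold lp. destruct (Per_polar t q) as [-> ->]. reflexivity. Qed.

(** Polar coordinates z = r e^{t + i q} are conformal, hence preserve harmonicity. The factor k
    normalises the inner radius of the image to 1. *)
Lemma harmonic_jet f fx fy k : harmonic_on A f fx fy -> exists j, harm 0 b j /\
  (forall t q, j0 j t q = k * lp f t q) /\
  (forall t q, jt j t q = k * (lp fx t q * px t q + lp fy t q * py t q)) /\
  (forall t q, jq j t q = k * (lp fy t q * px t q - lp fx t q * py t q)).
Proof.
  intros (C & P & Cx & Cy & fxx & fxy & fyx & fyy & Px & Py & Cxx & Cxy & Cyx & Cyy & L).
  pose proof (C2_lp _ C) as K. pose proof (C2_lp _ Cx) as Kx. pose proof (C2_lp _ Cy) as Ky.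
  pose proof (C2_lp _ Cxx) as Kxx. pose proof (C2_lp _ Cxy) as Kxy. pose proof (C2_lp _ Cyx) as Kyx. pose proof (C2_lp _ Cyy) as Kyy.
  pose proof C2_px as Kpx. pose proof C2_py as Kpy.
  pose proof (Dt_lp f fx fy P Cx) as Tf. pose proof (Dt_lp fx fxx fxy Px Cxx) as Tx. pose proof (Dt_lp fy fyx fyy Py Cyx) as Ty.
  pose proof (Dq_lp f fx fy P Cx) as Qf. pose proof (Dq_lp fx fxx fxy Px Cxx) as Qx. pose proof (Dq_lp fy fyx fyy Py Cyx) as Qy.
  assert (Mx : forall t q, 0 < t < b -> lp fxy t q = lp fyx t q).
  { intros t q Ht. apply (mixed_eq f fx fy fxx fxy fyx fyy); auto. now apply polar_A. }
  pose proof Dt_px as Tpx. pose proof Dt_py as Tpy. pose proof Dq_px as Qpx. pose proof Dq_py as Qpy.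
  assert (Sc : forall g gt, Dt 0 b g gt -> Dt 0 b (fun t q => k * g t q) (fun t q => k * gt t q)).
  { intros g gt D t q Ht. apply (d_scal (fun t => g t q)), D, Ht. }
  assert (Sq : forall g gt, Dq 0 b g gt -> Dq 0 b (fun t q => k * g t q) (fun t q => k * gt t q)).
  { intros g gt D t q Ht. apply (d_scal (g t)), D, Ht. }
  exists (Jet (fun t q => k * lp f t q) (fun t q => k * (lp fx t q * px t q + lp fy t q * py t q))
    (fun t q => k * (lp fy t q * px t q - lp fx t q * py t q))
    (fun t q => k * (lp fxx t q * px t q ^ 2 + (lp fxy t q + lp fyx t q) * px t q * py t q + lp fyy t q * py t q ^ 2 + lp fx t q * px t q + lp fy t q * py t q))
    (fun t q => k * ((lp fyy t q - lp fxx t q) * px t q * py t q + lp fxy t q * (px t q ^ 2 - py t q ^ 2) + lp fy t q * px t q - lp fx t q * py t q))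
    (fun t q => k * (lp fxx t q * py t q ^ 2 - (lp fxy t q + lp fyx t q) * px t q * py t q + lp fyy t q * px t q ^ 2 - lp fx t q * px t q - lp fy t q * py t q))).
  split; [|repeat split].
  constructor; simpl; try (now c2t).
  - now apply Sc.
  - now apply Sq.
  - apply Sc. eapply Dt_eq; [apply Dt_plus; apply Dt_mult; eassumption|]. intros t q Ht; cbv beta. ring.
  - apply Sq. eapply Dq_eq; [apply Dq_plus; apply Dq_mult; eassumption|]. intros t q Ht; cbv beta. rewrite (Mx t q Ht). ring.
  - apply Sc. eapply Dt_eq; [apply Dt_minus; apply Dt_mult; eassumption|]. intros t q Ht; cbv beta. rewrite (Mx t q Ht). ring.
  - apply Sq. eapply Dq_eq; [apply Dq_minus; apply Dq_mult; eassumption|]. intros t q Ht; cbv beta. ring.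
  (* The first-order and mixed terms cancel and the sum is k |z|^2 (f_xx + f_yy). *)
  - intros t q Ht. pose proof (L _ (polar_A t q Ht)) as E. change (lp fxx t q + lp fyy t q = 0) in E.
    replace (lp fyy t q) with (- lp fxx t q) by lra. ring.
  - intros t q. cbv beta. now rewrite Per_lp.
  - intros t q. cbv beta. rewrite !Per_lp. destruct (Per_polar t q) as [-> ->]. reflexivity.
  - intros t q. cbv beta. rewrite !Per_lp. destruct (Per_polar t q) as [-> ->]. reflexivity.
Qed.
End Transfer.

Lemma energy_bound b U V t : rmap b U V -> 0 < t < b -> cosh t ^ 2 <= energy U V t.
Proof.
  intros HR Ht. destruct (Rle_lt_dec 1 t).
  - apply (long_bound b); auto; lra.
  - apply (short_bound b); auto; lra.
Qed.

Lemma energy_rigid b U V t : rmap b U V -> 0 < t < b -> energy U V t = cosh t ^ 2 -> rigid b U /\ rigid b V.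
Proof.
  intros HR Ht E. destruct (Rle_lt_dec 1 t).
  - apply (long_rigid b U V t); auto; lra.
  - apply (short_rigid b U V t); auto; lra.
Qed.

Lemma unit_angle c s : c * c + s * s = 1 -> exists al, 0 <= al < 2 * PI /\ cos al = c /\ sin al = s.
Proof.
  intro E. assert (Hc : -1 <= c <= 1) by nra. pose proof (acos_bound c) as B. pose proof PI_RGT_0 as P.
  assert (Sa : sin (acos c) = sqrt (1 - c ^ 2)).
  { rewrite sin_acos by auto. f_equal. unfold Rsqr. ring. }
  assert (Q : sqrt (1 - c ^ 2) = Rabs s).
  { replace (1 - c ^ 2) with (Rsqr s) by (unfold Rsqr; lra). apply sqrt_Rsqr_abs. }
  destruct (Rle_lt_dec 0 s) as [L|L].
  - exists (acos c). split; [lra|]. rewrite cos_acos, Sa, Q, Rabs_pos_eq by auto. auto.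
  - exists (2 * PI - acos c). assert (N : acos c <> 0).
    { intro Z. pose proof (cos_acos c Hc) as C. rewrite Z, cos_0 in C. nra. }
    split; [lra|]. rewrite cos_minus, sin_minus, cos_2PI, sin_2PI, cos_acos, Sa, Q, Rabs_left by auto. split; ring.
Qed.

(** Here |h|^2 = cosh^2 t n(q), and t -> 0 forces n = 1: a larger value contradicts the limit of
    |h|, a smaller one contradicts |h| > 1. So the matrix with columns (C, C') and (D, D') is
    orthogonal, and the positive Jacobian makes it a rotation. *)
Lemma rigid_pair b U V : 0 < b -> rmap b U V -> rigid b U -> rigid b V ->
  exists al, 0 <= al < 2 * PI /\ forall t q, 0 < t < b -> j0 U t q = cosh t * cos (q + al) /\ j0 V t q = cosh t * sin (q + al).
Proof.
  intros Hb HR RU RV. pose proof (r_U _ _ _ HR) as HU. pose proof (r_V _ _ _ HR) as HV.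
  destruct (rigid_form b U HU RU) as (C & D & FU). destruct (rigid_form b V HV RV) as (C' & D' & FV).
  set (n := fun q => (C * cos q + D * sin q) ^ 2 + (C' * cos q + D' * sin q) ^ 2).
  assert (S : forall t q, 0 < t < b -> nsq U V t q = cosh t ^ 2 * n q).
  { intros t q Ht. unfold nsq, n. rewrite FU, FV by auto. ring. }
  assert (N1 : forall q, n q = 1).
  { intro q. assert (n0 : 0 <= n q) by (unfold n; pose proof (pow2_ge_0 (C * cos q + D * sin q)); pose proof (pow2_ge_0 (C' * cos q + D' * sin q)); lra).
    apply Rle_antisym.
    - apply Rnot_lt_le. intro L. destruct (r_lim _ _ _ HR (n q - 1) ltac:(lra)) as (d & Hd & Ld).
      set (t := Rmin (d / 2) (b / 2)). assert (0 < t) by (apply Rmin_pos; lra).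
      assert (t <= d / 2) by apply Rmin_l. assert (t <= b / 2) by apply Rmin_r.
      specialize (Ld t q ltac:(lra) ltac:(lra)). rewrite S in Ld by lra. pose proof (cosh_ge1 t). assert (1 <= cosh t ^ 2) by nra. nra.
    - apply Rnot_lt_le. intro L.
      assert (Cc : continuous (fun x => cosh x ^ 2 * n q) 0).
      { apply (ex_derive_continuous (fun x => cosh x ^ 2 * n q)). eexists.
        apply (d_mult (fun x => cosh x ^ 2) (fun _ => n q)); [|apply d_const]. apply (is_derive_pow cosh 2), d_cosh. }
      specialize (Cc (fun y => y < 1)). cbv beta in Cc. rewrite cosh_0 in Cc.
      destruct Cc as [d Hd]; [apply open_lt; lra|].
      set (t := Rmin (d / 2) (b / 2)). pose proof (cond_pos d) as Pd. assert (0 < t) by (apply Rmin_pos; lra).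
      assert (t <= d / 2) by apply Rmin_l. assert (t <= b / 2) by apply Rmin_r.
      pose proof (r_gt _ _ _ HR t q ltac:(lra)) as G. rewrite S in G by lra.
      assert (cosh t ^ 2 * n q < 1); [|lra]. apply Hd. unfold ball; simpl; unfold AbsRing_ball, abs, minus, plus, opp; simpl.
      rewrite Ropp_0, Rplus_0_r, Rabs_pos_eq; lra. }
  assert (O1 : C * C + C' * C' = 1) by (pose proof (N1 0) as Q; unfold n in Q; rewrite cos_0, sin_0 in Q; lra).
  assert (O2 : D * D + D' * D' = 1) by (pose proof (N1 (PI / 2)) as Q; unfold n in Q; rewrite cos_PI2, sin_PI2 in Q; lra).
  assert (O3 : C * D + C' * D' = 0).
  (* At PI/4 both trigonometric values agree, so the mixed term becomes visible once [O1] and [O2]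
     are known. *)
  { pose proof (N1 (PI / 4)) as Q. unfold n in Q. rewrite cos_PI4, sin_PI4 in Q. set (k := 1 / sqrt 2) in *.
    assert (K : k * k = / 2).
    { unfold k. pose proof (sqrt_sqrt 2 ltac:(lra)) as E. pose proof (sqrt_lt_R0 2 ltac:(lra)).
      replace (1 / sqrt 2 * (1 / sqrt 2)) with (/ (sqrt 2 * sqrt 2)) by (field; lra). now rewrite E. }
    assert (Q' : k * k * ((C * C + C' * C') + (D * D + D' * D') + 2 * (C * D + C' * D')) = 1) by (rewrite <- Q; ring).
    rewrite K, O1, O2 in Q'. lra. }
  assert (O4 : 0 < C * D' - D * C').
  { set (t := b / 2). assert (Ht : 0 < t < b) by (unfold t; lra). pose proof (r_jac _ _ _ HR t 0 Ht) as J. unfold jac in J.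
    assert (Tt : forall W E F, harm 0 b W -> (forall t q, 0 < t < b -> j0 W t q = cosh t * (E * cos q + F * sin q)) ->
       jt W t 0 = sinh t * E /\ jq W t 0 = cosh t * F).
    { intros W E F HW FW. split.
      - pose proof (h_t _ _ _ HW t 0 Ht) as D1. apply is_derive_unique in D1. rewrite <- D1. apply is_derive_unique.
        apply (is_derive_ext_loc (fun s => cosh s * E)).
        + generalize (loc_in 0 b t Ht); apply filter_imp. intros s Hs. rewrite FW, cos_0, sin_0 by auto. change (cosh s * E = cosh s * (E * 1 + F * 0)). ring.
        + eapply der_eq; [apply d_mult; [apply d_cosh|apply d_const]|]. cbv beta; ring.
      - pose proof (h_q _ _ _ HW t 0 Ht) as D1. apply is_derive_unique in D1. rewrite <- D1. apply is_derive_unique.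
        apply (der_ext (fun q => cosh t * (E * cos q + F * sin q))); [intro; rewrite FW by auto; reflexivity|].
        eapply der_eq; [apply d_scal, d_plus; apply d_scal; [apply is_derive_cos|apply is_derive_sin]|]. rewrite cos_0, sin_0. ring. }
    destruct (Tt U C D HU FU) as [e1 e2]. destruct (Tt V C' D' HV FV) as [e3 e4]. rewrite e1, e2, e3, e4 in J.
    pose proof (sinh_pos t ltac:(lra)). pose proof (cosh_ge1 t).
    assert (0 < sinh t * cosh t) by nra. assert (0 < sinh t * cosh t * (C * D' - D * C')) by lra. nra. }
  assert (O5 : C * D' - D * C' = 1).
  { assert ((C * D' - D * C') * (C * D' - D * C') = 1).
    { replace ((C * D' - D * C') * (C * D' - D * C')) with ((C * C + C' * C') * (D * D + D' * D') - (C * D + C' * D') * (C * D + C' * D')) by ring.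
      rewrite O1, O2, O3. ring. }
    nra. }
  assert (O6 : D = - C' /\ D' = C).
  { assert ((D + C') * (D + C') + (D' - C) * (D' - C) = 0).
    { replace ((D + C') * (D + C') + (D' - C) * (D' - C)) with ((C * C + C' * C') + (D * D + D' * D') - 2 * (C * D' - D * C')) by ring.
      rewrite O1, O2, O5. ring. }
    pose proof (Rle_0_sqr (D + C')). pose proof (Rle_0_sqr (D' - C)). unfold Rsqr in *.
    assert (D + C' = 0) by (apply Rsqr_0_uniq; unfold Rsqr; lra).
    assert (D' - C = 0) by (apply Rsqr_0_uniq; unfold Rsqr; lra). split; lra. }
  destruct O6 as [-> ->]. destruct (unit_angle C C' O1) as (al & Hal & Ec & Es).
  exists al. split; auto. intros t q Ht. rewrite FU, FV, cos_plus, sin_plus, Ec, Es by auto. split; ring.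
Qed.

Section Final.
Variables (r R0 rs : R) (Astar : pt -> Prop) (h : pt -> pt) (ux uy vx vy : pt -> R).
Hypothesis Hr : 0 < r.
Hypothesis HrR : r < R0.
Hypothesis Hrs : 0 < rs.
Hypothesis Hdisk : forall p, cnorm p <= rs -> ~ Astar p.
Hypothesis Hu : harmonic_on (annulus r R0) (fun z => fst (h z)) ux uy.
Hypothesis Hv : harmonic_on (annulus r R0) (fun z => snd (h z)) vx vy.
Hypothesis Hsense : forall z, annulus r R0 z -> ux z * vy z - uy z * vx z > 0.
Hypothesis Hinto : forall z, annulus r R0 z -> Astar (h z).
Hypothesis Horder : forall eps, 0 < eps -> exists d, 0 < d /\
     forall z, annulus r R0 z -> cnorm z < r + d -> Rabs (cnorm (h z) - rs) < eps.

Lemma cnorm_sq p : cnorm p * cnorm p = fst p ^ 2 + snd p ^ 2.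
Proof. unfold cnorm. apply sqrt_sqrt. pose proof (pow2_ge_0 (fst p)). pose proof (pow2_ge_0 (snd p)). lra. Qed.
Lemma cnorm_ge0 p : 0 <= cnorm p.
Proof. apply sqrt_pos. Qed.

Lemma cnorm_polar t q : cnorm (px r t q, py r t q) = r * exp t.
Proof. unfold cnorm; simpl fst; simpl snd. rewrite polar_sq. apply sqrt_pow2. pose proof (exp_pos t). nra. Qed.

(** The disk |w| <= rs lies outside the target domain, so the image avoids it and the normalised
    modulus exceeds 1; the boundary limit and the sign of the Jacobian are carried over by the
    conformal change of variables. *)
Lemma log_polar_rmap : exists U V, rmap (ln (R0 / r)) U V /\
  (forall t q, nsq U V t q = (cnorm (h (px r t q, py r t q)) / rs) ^ 2) /\
  (forall t q, h (px r t q, py r t q) = (rs * j0 U t q, rs * j0 V t q)).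
Proof.
  destruct (harmonic_jet r R0 Hr HrR _ ux uy (/ rs) Hu) as (U & HU & U0 & U1 & U2).
  destruct (harmonic_jet r R0 Hr HrR _ vx vy (/ rs) Hv) as (V & HV & V0 & V1 & V2).
  assert (S : forall t q, nsq U V t q = (cnorm (h (px r t q, py r t q)) / rs) ^ 2).
  { intros t q. unfold nsq. rewrite U0, V0. unfold lp.
    replace ((cnorm (h (px r t q, py r t q)) / rs) ^ 2) with (cnorm (h (px r t q, py r t q)) * cnorm (h (px r t q, py r t q)) / rs ^ 2) by (field; lra).
    rewrite cnorm_sq. field. lra. }
  exists U, V. split; [|split; [exact S|]].
  - constructor; auto.
    + intros t q Ht. rewrite S. pose proof (polar_A r R0 Hr HrR t q Ht) as P.
      assert (L : rs < cnorm (h (px r t q, py r t q))).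
      { apply Rnot_le_lt. intro L. apply (Hdisk _ L). now apply Hinto. }
      assert (1 < cnorm (h (px r t q, py r t q)) / rs).
      { apply (Rmult_lt_reg_r rs); auto. unfold Rdiv. rewrite Rmult_assoc, Rinv_l by lra. lra. }
      nra.
    (* Chosen so that (1 + x)^2 < 1 + e. *)
    + intros e He. set (x := Rmin 1 e / 4). assert (x0 : 0 < x) by (unfold x; assert (0 < Rmin 1 e) by (apply Rmin_pos; lra); lra).
      assert (x1 : 4 * x <= 1) by (unfold x; pose proof (Rmin_l 1 e); lra). assert (x2 : 4 * x <= e) by (unfold x; pose proof (Rmin_r 1 e); lra).
      destruct (Horder (rs * x)) as (d & Hd & L); [nra|].
      assert (Q : 1 < 1 + d / r) by (assert (0 < d / r) by (now apply Rdiv_lt_0_compat); lra).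
      (* Exactly the t for which r e^t = r + d. *)
      exists (ln (1 + d / r)). split; [rewrite <- ln_1; apply ln_increasing; lra|].
      intros t q Ht Hb. rewrite S. specialize (L (px r t q, py r t q) (polar_A r R0 Hr HrR t q ltac:(lra))).
      rewrite cnorm_polar in L.
      assert (E : r * exp t < r + d).
      { destruct Ht as [_ Ht]. apply exp_increasing in Ht. rewrite exp_ln in Ht by lra.
        apply (Rmult_lt_compat_l r) in Ht; auto. replace (r * (1 + d / r)) with (r + d) in Ht by (field; lra). exact Ht. }
      specialize (L E). apply Rabs_def2 in L. pose proof (cnorm_ge0 (h (px r t q, py r t q))) as G.
      set (w := cnorm (h (px r t q, py r t q))) in *. set (y := w / rs).
      assert (y0 : 0 <= y) by (apply Rmult_le_pos; auto; left; now apply Rinv_0_lt_compat).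
      assert (Y : w = rs * y) by (unfold y; field; lra).
      assert (y < 1 + x) by (apply (Rmult_lt_reg_l rs); lra). nra.
    + intros t q Ht. pose proof (polar_A r R0 Hr HrR t q Ht) as P. specialize (Hsense _ P).
      unfold jac. rewrite U1, U2, V1, V2. unfold lp. pose proof (polar_sq r t q) as PS.
      set (X := px r t q) in *. set (Y := py r t q) in *. pose proof (exp_pos t).
      match goal with |- 0 < ?L => replace L with (/ rs * / rs * ((ux (X, Y) * vy (X, Y) - uy (X, Y) * vx (X, Y)) * (X ^ 2 + Y ^ 2))) by ring end.
      rewrite PS. pose proof (Rinv_0_lt_compat rs Hrs).
      apply Rmult_lt_0_compat; [nra|]. apply Rmult_lt_0_compat; [lra|]. apply pow_lt. nra.
  - intros t q. rewrite U0, V0. unfold lp. destruct (h (px r t q, py r t q)) as [a c]. simpl. f_equal; field; lra.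
Qed.

(** With sigma = r e^t the right-hand side of the theorem is rs cosh t, and the arclength density
    sigma cancels in the mean. *)
Lemma circle_mean U V : rmap (ln (R0 / r)) U V -> (forall t q, nsq U V t q = (cnorm (h (px r t q, py r t q)) / rs) ^ 2) ->
  forall sigma, r < sigma < R0 -> exists t, 0 < t < ln (R0 / r) /\ sigma = r * exp t /\
  / 2 * (sigma / r + r / sigma) * rs = rs * cosh t /\
  forall pr : Riemann_integrable (circ_integrand h sigma) 0 (2 * PI), sqrt (RiemannInt pr / (2 * PI * sigma)) = rs * sqrt (energy U V t).
Proof.
  intros HR S sigma Hs. set (t := ln (sigma / r)).
  assert (Q : 0 < sigma / r) by (apply Rdiv_lt_0_compat; lra).
  assert (E : sigma = r * exp t) by (unfold t; rewrite exp_ln by auto; field; lra).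
  assert (Ht : 0 < t < ln (R0 / r)) by (apply (b_bounds r R0 Hr HrR); lra).
  exists t. split; [exact Ht|]. split; [exact E|]. split.
  - rewrite E. unfold cosh. rewrite exp_Ropp. pose proof (exp_pos t). field. lra.
  - intro pr. rewrite <- RInt_Reals. pose proof PI2_pos as P2.
    pose proof (nsq_cts (ln (R0 / r)) U V HR t Ht) as cs.
    assert (I : RInt (circ_integrand h sigma) 0 (2 * PI) = rs ^ 2 * sigma * RInt (nsq U V t) 0 (2 * PI)).
    { transitivity (RInt (fun q => rs ^ 2 * sigma * nsq U V t q) 0 (2 * PI)).
      - apply RInt_ext. intros q _. unfold circ_integrand. rewrite S, E. unfold px, py.
        change (cnorm (h (r * exp t * cos q, r * exp t * sin q)) ^ 2 * (r * exp t) =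
          rs ^ 2 * (r * exp t) * (cnorm (h (r * exp t * cos q, r * exp t * sin q)) / rs) ^ 2). field. lra.
      - apply (RInt_scal (nsq U V t) 0 (2 * PI) (rs ^ 2 * sigma)). auto with cts. }
    rewrite I. unfold energy, mean.
    replace (rs ^ 2 * sigma * RInt (nsq U V t) 0 (2 * PI) / (2 * PI * sigma)) with (rs ^ 2 * (RInt (nsq U V t) 0 (2 * PI) / (2 * PI))) by (field; lra).
    rewrite sqrt_mult_alt by apply pow2_ge_0. rewrite sqrt_pow2 by lra. reflexivity.
Qed.

Lemma final_bound : forall sigma, r < sigma < R0 ->
     forall pr : Riemann_integrable (circ_integrand h sigma) 0 (2 * PI),
       sqrt (RiemannInt pr / (2 * PI * sigma)) >= / 2 * (sigma / r + r / sigma) * rs.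
Proof.
  intros sigma Hs pr. destruct log_polar_rmap as (U & V & HR & S & _).
  destruct (circle_mean U V HR S sigma Hs) as (t & Ht & _ & E & I). rewrite I, E. apply Rle_ge.
  apply Rmult_le_compat_l; [lra|]. pose proof (cosh_ge1 t).
  rewrite <- (sqrt_pow2 (cosh t)) by lra. apply sqrt_le_1_alt. now apply (energy_bound (ln (R0 / r))).
Qed.

Lemma final_equality : (exists sigma, r < sigma < R0 /\
      exists pr : Riemann_integrable (circ_integrand h sigma) 0 (2 * PI),
        sqrt (RiemannInt pr / (2 * PI * sigma)) = / 2 * (sigma / r + r / sigma) * rs) ->
   (forall sigma, r < sigma < R0 ->
      forall pr : Riemann_integrable (circ_integrand h sigma) 0 (2 * PI),
        sqrt (RiemannInt pr / (2 * PI * sigma)) = / 2 * (sigma / r + r / sigma) * rs)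
   /\
   exists alpha, 0 <= alpha < 2 * PI /\
     forall z, annulus r R0 z -> h z = extremal_map r rs alpha z.
Proof.
  intros (s0 & Hs0 & pr0 & Eq). destruct log_polar_rmap as (U & V & HR & S & Hh).
  assert (Hb : 0 < ln (R0 / r)) by (destruct (circle_mean U V HR S s0 Hs0) as (t & Ht & _); lra).
  assert (RG : rigid (ln (R0 / r)) U /\ rigid (ln (R0 / r)) V).
  { destruct (circle_mean U V HR S s0 Hs0) as (t & Ht & _ & E & I). rewrite I, E in Eq.
    apply Rmult_eq_reg_l in Eq; [|lra]. apply (energy_rigid _ U V t HR Ht).
    pose proof (energy_ge1 _ U V HR t Ht). rewrite <- Eq. replace (sqrt (energy U V t) ^ 2) with (sqrt (energy U V t) * sqrt (energy U V t)) by ring.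
    symmetry. apply sqrt_sqrt. lra. }
  destruct (rigid_pair _ U V Hb HR (proj1 RG) (proj2 RG)) as (al & Hal & F).
  split.
  - intros sigma Hs pr. destruct (circle_mean U V HR S sigma Hs) as (t & Ht & _ & E & I). rewrite I, E. f_equal.
    pose proof (cosh_ge1 t). rewrite <- (sqrt_pow2 (cosh t)) by lra. f_equal. unfold energy.
    rewrite (mean_ext _ (fun _ => cosh t ^ 2)); [apply mean_const|]. intro q. unfold nsq. destruct (F t q Ht) as [-> ->].
    pose proof (sin2_cos2 (q + al)) as SC. unfold Rsqr in SC. transitivity (cosh t ^ 2 * (sin (q + al) * sin (q + al) + cos (q + al) * cos (q + al))); [ring|rewrite SC; ring].
  - exists al. split; auto. intros z Hz. pose proof Hz as [Z1 Z2].
    set (rho := cnorm z) in *. assert (rp : 0 < rho) by lra.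
    pose proof (cnorm_sq z) as Nz. fold rho in Nz. destruct z as [x y]. simpl fst in Nz. simpl snd in Nz.
    (* The polar angle of z, needed because the formula for h is known only in polar coordinates. *)
    destruct (unit_angle (x / rho) (y / rho)) as (q & _ & Ec & Es).
    { apply (Rmult_eq_reg_r (rho * rho)); [|nra]. replace ((x / rho * (x / rho) + y / rho * (y / rho)) * (rho * rho)) with (x ^ 2 + y ^ 2) by (field; lra). lra. }
    destruct (circle_mean U V HR S rho (conj Z1 Z2)) as (t & Ht & E & EC & _).
    assert (X : x = px r t q) by (unfold px; rewrite <- E, Ec; field; lra).
    assert (Y : y = py r t q) by (unfold py; rewrite <- E, Es; field; lra).
    rewrite X, Y at 1. rewrite Hh. destruct (F t q Ht) as [-> ->].
    unfold extremal_map; simpl fst; simpl snd. rewrite <- Nz. rewrite cos_plus, sin_plus, Ec, Es.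
    rewrite <- !Rmult_assoc, <- EC. f_equal; field; lra.
Qed.
End Final.

Theorem theorem1p5
  (r R0 rs : R) (Astar : pt -> Prop) (h : pt -> pt)
  (ux uy vx vy : pt -> R)
  (Hr : 0 < r) (HrR : r < R0) (Hrs : 0 < rs)
  (HA : doubly_connected_inner_circle Astar rs)
  (Hu : harmonic_on (annulus r R0) (fun z => fst (h z)) ux uy)
  (Hv : harmonic_on (annulus r R0) (fun z => snd (h z)) vx vy)
  (Hsense : forall z, annulus r R0 z -> ux z * vy z - uy z * vx z > 0)
  (Hhomeo : homeo_onto (annulus r R0) Astar h)
  (Horder : forall eps, 0 < eps -> exists d, 0 < d /\
     forall z, annulus r R0 z -> cnorm z < r + d -> Rabs (cnorm (h z) - rs) < eps) :
  (forall sigma, r < sigma < R0 ->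
     forall pr : Riemann_integrable (circ_integrand h sigma) 0 (2 * PI),
       sqrt (RiemannInt pr / (2 * PI * sigma)) >= / 2 * (sigma / r + r / sigma) * rs)
  /\
  ((exists sigma, r < sigma < R0 /\
      exists pr : Riemann_integrable (circ_integrand h sigma) 0 (2 * PI),
        sqrt (RiemannInt pr / (2 * PI * sigma)) = / 2 * (sigma / r + r / sigma) * rs) ->
   (forall sigma, r < sigma < R0 ->
      forall pr : Riemann_integrable (circ_integrand h sigma) 0 (2 * PI),
        sqrt (RiemannInt pr / (2 * PI * sigma)) = / 2 * (sigma / r + r / sigma) * rs)
   /\
   exists alpha, 0 <= alpha < 2 * PI /\
     forall z, annulus r R0 z -> h z = extremal_map r rs alpha z).
Proof.
  destruct HA as (_ & (Hdisk & _) & _). destruct Hhomeo as (Hinto & _).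
  split.
  - exact (final_bound r R0 rs Astar h ux uy vx vy Hr HrR Hrs Hdisk Hu Hv Hsense Hinto Horder).
  - exact (final_equality r R0 rs Astar h ux uy vx vy Hr HrR Hrs Hdisk Hu Hv Hsense Hinto Horder).
Qed.
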